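(* Let $k\ge1$ be an integer. Assume that the exact solution of the Einstein--scalar system described in the context satisfies $$u\in L^\infty(0,T;W^{k+1,\infty}(0,b))\quad\text{and}\quad u_t\in L^\infty(0,T;H^{k+1}(0,b)),$$ and let $u_h$ be the semidiscrete HDG solution on $[0,T]$ with boundary datum $U_b$ and initial data $u_h(0)=\Pi u(0)$. Then there exist $h_0>0$ and $C>0$, independent of $h$, such that for all $0<h\le h_0$, $$\sup_{0\le t\le T}\|u(t)-u_h(t)\|_{\mathcal T_h}\le Ch^{k+1}.$$
   Context: Exact system. Let $b>0$, $T>0$. The exact solution $(u,w,g,z)$ on $[0,T]\times[0,b]$ satisfies $$u_t-\bigl(\tfrac12\tilde g\,u\bigr)_r=-\tfrac12\tilde g_r\,\tilde u,\qquad w_r=u,\qquad g_r=\tfrac1r\,g\,(u-\tilde u)^2,\qquad z_r=g,$$ with $\tilde u=w/r$, $\tilde g=z/r$ for $r>0$, center conditions $w(t,0)=0$, $z(t,0)=0$, and outer conditions $u(t,b)=U_b(t)$, $g(t,b)=1$. Equivalently $\tilde u(r)=\frac1r\int_0^ru\,ds$, $\tilde g(r)=\frac1r\int_0^rg\,ds$, $g(r)=\exp(-\int_r^b\frac1s(u-\tilde u)^2ds)$. Mesh and spaces. Let $0=r_0<r_1<\dots<r_N=b$ be a partition of $[0,b]$, $I_i=(r_{i-1},r_i)$, $h_i=r_i-r_{i-1}$, $h=\max_ih_i$, $\mathcal T_h=\{I_i\}_{i=1}^N$. $P^k(I_i)$ denotes polynomials of degree at most $k$ on $I_i$ and $V_h^k=\{v\in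 L^2(0,b):v|_{I_i}\in P^k(I_i),\ i=1,\dots,N\}$. The value $v|_{I_i}(r_j)$, $j\in\{i-1,i\}$, is taken from within $I_i$. Write $(v_1,v_2)_{I_i}=\int_{I_i}v_1v_2\,dr$, $\|v\|_{\mathcal T_h}^2=\sum_i(v,v)_{I_i}$, $\langle\psi,\eta\,n\rangle_{\partial I_i}=\psi(r_i)\eta(r_i)-\psi(r_{i-1})\eta(r_{i-1})$ with values from within $I_i$. $r$-derivatives of broken functions are taken elementwise. Projection. On each $I_i$, $\Pi u\in P^k(I_i)$ is the Gauss--Radau projection defined by $(\Pi u-u,v)_{I_i}=0$ for all $v\in P^{k-1}(I_i)$ and $(\Pi u)(r_{i-1})=u(r_{i-1})$. Semidiscrete HDG scheme with boundary datum $U_b$: find $u_h\in C^1([0,T];V_h^k)$ with the prescribed initial value and, for each $t$, trace values $\widehat u_h,\widehat g_h$ at $r_1,\dots,r_N$ and $\widehat w_h,\widehat z_h$ at $r_0,\dots,r_{N-1}$, such that at each $t$: (1) on each $I_i$, $w_h(r)=\widehat w_h(r_{i-1})+\int_{r_{i-1}}^ru_h\,ds$, $g_h(r)=\widehat g_h(r_i)\exp(-\int_r^{r_i}\frac1s(u_h-\tilde u_h)^2ds)$, $z_h(r)=\widehat z_h(r_{i-1})+\int_{r_{i-1}}^rg_h\,ds$, where $\tilde u_h=w_h/r$, $\tilde g_h=z_h/r$ for $r>0$, $\tilde u_h(0):=u_h(0)$, $\tilde g_h(0):=g_h(0)$; (2) for all $i$ and all $\phi_u\in P^k(I_i)$,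 $$\bigl((u_h)_t,\phi_u\bigr)_{I_i}+\bigl(\tfrac12\tilde g_hu_h,(\phi_u)_r\bigr)_{I_i}-\langle\widehat{\mathcal F}_{u,h},\phi_u\,n\rangle_{\partial I_i}+\bigl(\tfrac12(\tilde g_h)_r\tilde u_h,\phi_u\bigr)_{I_i}=0,$$ with flux on $I_i$: $\widehat{\mathcal F}_{u,h}(r_i)=\tfrac12\tilde g_h(r_i)\widehat u_h(r_i)$, $\widehat{\mathcal F}_{u,h}(r_{i-1})=\tfrac12\tilde g_h(r_{i-1})u_h(r_{i-1})$ (from within $I_i$); (3) for $i=1,\dots,N-1$, each of $\widehat{\mathcal F}_{u,h},w_h,z_h,g_h$ takes the same value at $r_i$ from $I_i$ and from $I_{i+1}$; (4) $\widehat u_h(t,b)=U_b(t)$, $\widehat g_h(t,b)=1$, $\widehat w_h(t,0)=0$, $\widehat z_h(t,0)=0$. (This scheme has a unique solution on $[0,T]$ for continuous $U_b$.) *)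

(* Defs.v *)
From HB Require Import structures.
From mathcomp Require Import all_boot all_order all_algebra.
From mathcomp Require Import all_classical all_reals all_analysis.
Set Implicit Arguments.
Unset Strict Implicit.
Unset Printing Implicit Defensive.
Import Order.TTheory GRing.Theory Num.Theory.
Import numFieldNormedType.Exports.
Local Open Scope classical_set_scope.
Local Open Scope ring_scope.

Notation leb R := (@lebesgue_measure R).

(* The space C^1_c(]a, b[), the usual test functions for weak derivatives in
   dimension one; C^oo_c gives the same weak derivatives. *)
Definition test_function (R : realType) (a b : R) (phi : R -> R) : Prop :=
  [/\ forall x, derivable phi x 1,
      continuous (derive1 phi) &
      exists c d, [/\ a < c, d < b & forall x, x \notin `[c, d] -> phi x = 0]].

Definition weak_derivative (R : realType) (a b : R) (f f' : R -> R) : Prop :=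
  forall phi, test_function a b phi ->
    \int[leb R]_(x in `]a, b[) (f x * derive1 phi x) =
    - \int[leb R]_(x in `]a, b[) (f' x * phi x).

Definition Lp_norm (R : realType) (a b : R) (p : \bar R) (f : R -> R) : \bar R :=
  Lnorm (leb R) p (EFin \o (f \_ `]a, b[)).

(* D j is the j-th weak derivative of f, for j <= m.  Each D j is asked to be
   in L^p, so that the integrals in [weak_derivative] are meaningful. *)
Definition weak_derivatives (R : realType) (a b : R) (m : nat) (p : \bar R)
    (f : R -> R) (D : nat -> R -> R) : Prop :=
  [/\ D 0%N = f,
      forall j, (j <= m)%N ->
        measurable_fun `]a, b[ (D j) /\ (Lp_norm a b p (D j) < +oo)%E &
      forall j, (j < m)%N -> weak_derivative a b (D j) (D j.+1)].

(* The norm of W^{m,p}(]a, b[), equal to +oo outside of this space.  Weak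
   derivatives are unique almost everywhere, so the infimum is over a set with
   at most one element. *)
Definition W_norm (R : realType) (a b : R) (m : nat) (p : \bar R)
    (f : R -> R) : \bar R :=
  ereal_inf [set (\sum_(j < m.+1) Lp_norm a b p (D j))%E |
             D in [set D | weak_derivatives a b m p f D]].

Definition simple_function (R : realType) (nrm : (R -> R) -> \bar R)
    (s : R -> R -> R) : Prop :=
  exists (m : nat) (A : 'I_m -> set R) (f : 'I_m -> R -> R),
    [/\ forall i, measurable (A i),
        forall i, (nrm (f i) < +oo)%E &
        forall t x, s t x = \sum_(i < m) \1_(A i) t * f i x].

Definition strongly_measurable (R : realType) (T : R)
    (nrm : (R -> R) -> \bar R) (v : R -> R -> R) : Prop :=
  exists s : nat -> R -> R -> R,
    (forall n, simple_function nrm (s n)) /\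
    {ae leb R, forall t, t \in `]0, T[ ->
       (fun n => nrm (v t \- s n t)) @ \oo --> 0%E}.

(* v belongs to L^oo(0, T; X), where X is the space of functions of finite
   [nrm]. *)
Definition Linfty_Bochner (R : realType) (T : R)
    (nrm : (R -> R) -> \bar R) (v : R -> R -> R) : Prop :=
  strongly_measurable T nrm v /\
  (Lnorm (leb R) +oo%E ((fun t => nrm (v t)) \_ `]0%R, T[) < +oo)%E.

(* The arguments of the unknowns are the time, then the radius. *)
Definition time_derivative (R : realType) (u : R -> R -> R) (t x : R) : R :=
  derive1 (fun s => u s x) t.

(* Classical solutions: the unknowns are continuous up to the boundary, and
   the equations hold at interior points. *)
Record exact_solution (R : realType) (b T : R) (Ub : R -> R)
    (u w g z : R -> R -> R) : Prop := {
  exact_u_cont :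
    {within `[0, T] `*` `[0, b], continuous (fun q : R * R => u q.1 q.2)};
  exact_wgz_cont : forall t, t \in `[0, T] ->
    [/\ {within `[0, b], continuous (w t)},
        {within `[0, b], continuous (g t)} &
        {within `[0, b], continuous (z t)}];
  exact_u_t : forall t x, t \in `]0, T[ -> x \in `]0, b[ ->
    derivable (fun s => u s x) t 1;
  exact_gu_r : forall t x, t \in `]0, T[ -> x \in `]0, b[ ->
    derivable (fun y => 2^-1 * (z t y / y) * u t y) x 1;
  exact_evolution : forall t x, t \in `]0, T[ -> x \in `]0, b[ ->
    time_derivative u t x
      - derive1 (fun y => 2^-1 * (z t y / y) * u t y) x
    = - (2^-1 * derive1 (fun y => z t y / y) x * (w t x / x));
  exact_w_r : forall t x, t \in `[0, T] -> x \in `]0, b[ ->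
    is_derive x 1 (w t) (u t x);
  exact_g_r : forall t x, t \in `[0, T] -> x \in `]0, b[ ->
    is_derive x 1 (g t) (x^-1 * g t x * (u t x - w t x / x) ^+ 2);
  exact_z_r : forall t x, t \in `[0, T] -> x \in `]0, b[ ->
    is_derive x 1 (z t) (g t x);
  exact_center : forall t, t \in `[0, T] -> w t 0 = 0 /\ z t 0 = 0;
  exact_outer : forall t, t \in `[0, T] -> u t b = Ub t /\ g t b = 1
}.

(* The elements are numbered from 0: the i-th one is ]r i, r i.+1[, i < N. *)
Definition is_mesh (R : realType) (b : R) (N : nat) (r : nat -> R) : Prop :=
  [/\ r 0%N = 0, r N = b & forall i, (i < N)%N -> r i < r i.+1].

Definition mesh_size (R : realType) (N : nat) (r : nat -> R) : R :=
  \big[Num.max/0]_(i < N) (r i.+1 - r i).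

(* An element of V_h^k is given by its polynomial on each element. *)
Definition broken_poly (R : realType) (k N : nat) (p : nat -> {poly R}) : Prop :=
  forall i, (i < N)%N -> (size (p i) <= k.+1)%N.

Definition broken_error (R : realType) (N : nat) (r : nat -> R)
    (f : R -> R) (p : nat -> {poly R}) : R :=
  Num.sqrt (\sum_(i < N)
    \int[leb R]_(x in `]r i, r i.+1[) (f x - (p i).[x]) ^+ 2).

Definition Gauss_Radau (R : realType) (k : nat) (a c : R) (f : R -> R)
    (q : {poly R}) : Prop :=
  [/\ (size q <= k.+1)%N,
      forall v : {poly R}, (size v <= k)%N ->
        \int[leb R]_(x in `]a, c[) ((q.[x] - f x) * v.[x]) = 0 &
      q.[a] = f a].

(* p is in C^1([0, T]; V_h^k), with time derivative dp.  At t = 0 and t = T the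
   one-sided derivatives are obtained from the continuity of dp. *)
Record C1_broken_poly (R : realType) (T : R) (k N : nat)
    (p dp : R -> nat -> {poly R}) : Prop := {
  C1_poly : forall t, t \in `[0, T] ->
    broken_poly k N (p t) /\ broken_poly k N (dp t);
  C1_cont : forall i j, (i < N)%N ->
    {within `[0, T], continuous (fun t => (p t i)`_j)} /\
    {within `[0, T], continuous (fun t => (dp t i)`_j)};
  C1_derive : forall i j t, (i < N)%N -> t \in `]0, T[ ->
    is_derive t 1 (fun s => (p s i)`_j) (dp t i)`_j
}.

(* Trace values at one time, indexed by the node.  The values of [u_hat] and
   [g_hat] at node 0, of [w_hat] and [z_hat] at node N, and of all of them
   beyond N, are never used. *)
Record traces (R : realType) := Traces {
  u_hat : nat -> R;
  w_hat : nat -> R;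
  g_hat : nat -> R;
  z_hat : nat -> R
}.

(* F / x, with value f 0 at the center. *)
Definition tilde (R : realType) (F f : R -> R) (x : R) : R :=
  if x == 0 then f 0 else F x / x.

(* In the following definitions the index i is that of the element on which
   the field is considered; at a node, this gives the value from within it. *)
Definition w_h (R : realType) (r : nat -> R) (p : nat -> {poly R})
    (tr : traces R) (i : nat) (x : R) : R :=
  w_hat tr i + \int[leb R]_(s in `[r i, x]) (p i).[s].

Definition ut_h (R : realType) (r : nat -> R) (p : nat -> {poly R})
    (tr : traces R) (i : nat) : R -> R :=
  tilde (w_h r p tr i) (fun x => (p i).[x]).

Definition g_h (R : realType) (r : nat -> R) (p : nat -> {poly R})
    (tr : traces R) (i : nat) (x : R) : R :=
  g_hat tr i.+1 *
  expR (- \int[leb R]_(s in `[x, r i.+1])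
            (s^-1 * ((p i).[s] - ut_h r p tr i s) ^+ 2)).

Definition z_h (R : realType) (r : nat -> R) (p : nat -> {poly R})
    (tr : traces R) (i : nat) (x : R) : R :=
  z_hat tr i + \int[leb R]_(s in `[r i, x]) g_h r p tr i s.

Definition gt_h (R : realType) (r : nat -> R) (p : nat -> {poly R})
    (tr : traces R) (i : nat) : R -> R :=
  tilde (z_h r p tr i) (g_h r p tr i).

Definition flux_right (R : realType) (r : nat -> R) (p : nat -> {poly R})
    (tr : traces R) (i : nat) : R :=
  2^-1 * gt_h r p tr i (r i.+1) * u_hat tr i.+1.

Definition flux_left (R : realType) (r : nat -> R) (p : nat -> {poly R})
    (tr : traces R) (i : nat) : R :=
  2^-1 * gt_h r p tr i (r i) * (p i).[r i].

Definition local_equation (R : realType) (k : nat) (r : nat -> R)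
    (p dp : nat -> {poly R}) (tr : traces R) (i : nat) : Prop :=
  forall phi : {poly R}, (size phi <= k.+1)%N ->
    \int[leb R]_(x in `]r i, r i.+1[) ((dp i).[x] * phi.[x])
    + \int[leb R]_(x in `]r i, r i.+1[)
        (2^-1 * gt_h r p tr i x * (p i).[x] * (deriv phi).[x])
    - (flux_right r p tr i * phi.[r i.+1] - flux_left r p tr i * phi.[r i])
    + \int[leb R]_(x in `]r i, r i.+1[)
        (2^-1 * derive1 (gt_h r p tr i) x * ut_h r p tr i x * phi.[x])
    = 0.

(* Transmission conditions at the node r i.+1, between elements i and i.+1. *)
Definition transmission (R : realType) (r : nat -> R)
    (p : nat -> {poly R}) (tr : traces R) (i : nat) : Prop :=
  [/\ flux_right r p tr i = flux_left r p tr i.+1,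
      w_h r p tr i (r i.+1) = w_h r p tr i.+1 (r i.+1),
      z_h r p tr i (r i.+1) = z_h r p tr i.+1 (r i.+1) &
      g_h r p tr i (r i.+1) = g_h r p tr i.+1 (r i.+1)].

Definition hdg_solution (R : realType) (k : nat) (T : R) (Ub : R -> R)
    (N : nat) (r : nat -> R) (u_h : R -> nat -> {poly R})
    (tr : R -> traces R) : Prop :=
  exists du_h : R -> nat -> {poly R},
    C1_broken_poly T k N u_h du_h /\
    forall t, t \in `[0, T] ->
      [/\ forall i, (i < N)%N -> local_equation k r (u_h t) (du_h t) (tr t) i,
          forall i, (i.+1 < N)%N -> transmission r (u_h t) (tr t) i,
          u_hat (tr t) N = Ub t /\ g_hat (tr t) N = 1 &
          w_hat (tr t) 0%N = 0 /\ z_hat (tr t) 0%N = 0].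

(* Main.v *)
Require Import Defs.
From HB Require Import structures.
From mathcomp Require Import all_boot all_order all_algebra.
From mathcomp Require Import all_classical all_reals all_analysis.
From mathcomp Require Import measurable_realfun ring lra.
Import Order.TTheory GRing.Theory Num.Theory.
Import numFieldNormedType.Exports.
Set Implicit Arguments.
Unset Strict Implicit.
Unset Printing Implicit Defensive.
Local Open Scope classical_set_scope.
Local Open Scope ring_scope.

(* Let p = u_h, let q be the Gauss-Radau projection of u and d = p - q.  Since
   the discrete g~ is nondecreasing in r, the upwind form of the scheme is
   dissipative, and integrating by parts against the projection error gives
   (d/dt)|d|^2 <= C |d|^2 + C h^(k+1) |d| as long as a broken energy norm
   |||d||| (derivatives, and jumps divided by the mesh step) is at most 1, which
   bounds the nonlinear coefficients.  As the mesh is arbitrary, that bound does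
   not follow from |d| by an inverse inequality.  It is obtained by estimating
   the difference quotients of d in time, again by an energy argument, which
   gives |d_t| = O(sqrt h); testing the scheme on each cell with
   (r_i - r) d_r and with 1 bounds |||d||| by |d_t| + |d| + O(sqrt h), hence by
   1/2 for small h, and a continuity argument concludes.  The estimate on d_t
   uses 1/2-Hoelder bounds for u_r and u_t, which follow from the Sobolev
   regularity of u and u_t. *)

(** What makes the two solutions comparable is that the traces can be eliminated: [w_h], [g_h] and
    [z_h] are functionals of one glued function [P], the same ones that give the exact [w], [g] and
    [z] from [u]. The nonlinear error is then a difference of values of these functionals, and the
    singular factor 1/r is absorbed by Hardy's inequality: |||d||| bounds (d - d~)/r in L2,
    uniformly over all meshes. Two small parameters have to be kept apart. The projection errors of
    u and u_t, of size h^(k+1), are the only data of the estimate on d. The derivatives of the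
    projection error, and the increments of projection errors in time, are only O(sqrt h); they
    serve to close the bound |||d||| <= 1 and never reach the final rate. As u_h is only C^1 in
    time, the scheme cannot be differentiated, whence the difference quotients; their step may
    depend on the mesh. Their equation contains |||d|||, which is in turn bounded by |d_t|, so this
    loop has to close inside Gronwall's inequality. *)

(* Irrelevant hypotheses slow [lra] down. *)
Ltac slim_lra :=
  intros;
  repeat match goal with
  | H : is_true _ |- _ => revert H
  | H : _ = _ |- _ => revert H
  end;
  clear; intros; lra.

Ltac lran :=
  repeat match goal with
  | H : context [Num.norm _] |- _ => revert H
  end;
  repeat match goal with
  | |- context [Num.norm ?x] => case: (ger0P x) => ?
  end; intros; lra.

(** * Integrals and derivatives *)

(* [itg], [nn] and [GG] are locked so that conversion never unfolds them. *)
Definition itg {R : realType} : R -> R -> (R -> R) -> R :=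
  locked (fun a c f => \int[leb R]_(x in `[a, c]) f x).

Definition ig {R : realType} (a c : R) (f : R -> R) : Prop :=
  (leb R).-integrable `[a, c] (EFin \o f).

(** The working class of integrands: closed under products, unlike integrability alone, and large
    enough for broken functions and for quotients by the radius. *)
Definition bm {R : realType} (a c : R) (f : R -> R) : Prop :=
  measurable_fun `[a, c] f /\ exists M : R, forall x : R, a <= x <= c -> `|f x| <= M.

Definition lip {R : realType} (a c : R) (f : R -> R) : Prop :=
  exists2 L : R, 0 <= L & forall x y : R, a <= x <= c -> a <= y <= c ->
    `|f x - f y| <= L * `|x - y|.

(** * Bounded measurable functions and Lipschitz functions on an interval *)

Section BoundedMeasurable.
Context {R : realType}.
Implicit Types (a c : R) (f g : R -> R).

Lemma bm_cst a c k : bm a c (fun=> k : R).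
Proof. by split; [exact: measurable_cst|exists `|k|]. Qed.

Lemma bm_id a c : bm a c (fun x : R => x).
Proof.
split; first exact: measurable_id.
by exists (`|a| + `|c|) => x /andP[ax xc]; lran.
Qed.

Lemma bmD a c f g : bm a c f -> bm a c g -> bm a c (fun x => f x + g x).
Proof.
move=> [mf [M fM]] [mg [M' gM]]; split; first exact: measurable_funD.
exists (M + M') => x xI; apply: le_trans (ler_normD _ _) _.
exact: lerD (fM _ xI) (gM _ xI).
Qed.

Lemma bmM a c f g : bm a c f -> bm a c g -> bm a c (fun x => f x * g x).
Proof.
move=> [mf [M fM]] [mg [M' gM]]; split; first exact: measurable_funM.
exists (M * M') => x xI; rewrite normrM.
exact: ler_pM (normr_ge0 _) (normr_ge0 _) (fM _ xI) (gM _ xI).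
Qed.

Lemma bmN a c f : bm a c f -> bm a c (fun x => - f x).
Proof.
move=> [mf [M fM]]; split; first exact: measurable_funN.
by exists M => x xI; rewrite normrN fM.
Qed.

Lemma bmB a c f g : bm a c f -> bm a c g -> bm a c (fun x => f x - g x).
Proof. by move=> bf bg; exact: bmD bf (bmN bg). Qed.

Lemma bmX a c f n : bm a c f -> bm a c (fun x => f x ^+ n).
Proof.
move=> bf; elim: n => [|n ih]; first exact: bm_cst.
by under eq_fun do rewrite exprS; exact: bmM.
Qed.

Lemma bm_norm a c f : bm a c f -> bm a c (fun x => `|f x|).
Proof.
move=> [mf [M fM]]; split; first exact: measurableT_comp mf.
by exists M => x xI; rewrite normr_id fM.
Qed.

Lemma bm_eq a c f g : (forall x, a <= x <= c -> f x = g x) ->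
  bm a c f -> bm a c g.
Proof.
move=> fg [mf [M fM]]; split.
  apply: eq_measurable_fun mf => x; rewrite inE/= in_itv/= => xI; exact: fg.
by exists M => x xI; rewrite -fg// fM.
Qed.

Lemma bm_sub a c a' c' f : a <= a' -> c' <= c -> bm a c f -> bm a' c' f.
Proof.
move=> aa cc [mf [M fM]]; split.
  apply: measurable_funS mf => // x; rewrite /= !in_itv/=; lra.
by exists M => x xI; apply: fM; lra.
Qed.

Lemma bm_sum a c (I : Type) (s : seq I) (P : pred I) (F : I -> R -> R) :
  (forall i, bm a c (F i)) -> bm a c (fun x => \sum_(i <- s | P i) F i x).
Proof.
move=> bF; elim: s => [|i s ih].
  by under eq_fun do rewrite big_nil; exact: bm_cst.
under eq_fun do rewrite big_cons.
case: (P i) => //; exact: bmD.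
Qed.

Lemma lip_cont a c f : lip a c f -> {within `[a, c], continuous f}.
Proof.
move=> [L L0 fL]; apply/subspace_continuousP => x; rewrite /= in_itv/= => xI.
apply/cvgrPdist_le => e e0; rewrite near_withinE.
have L1 : 0 < L + 1 by lra.
near=> y => yI; apply: le_trans (fL _ _ xI _) _; first by move: yI; rewrite /= in_itv.
have : `|x - y| <= e / (L + 1).
  near: y; apply: (@cvgr_dist_le _ R) => //; exact: divr_gt0.
rewrite ler_pdivlMr// => h; have := normr_ge0 (x - y); nra.
Unshelve. all: by end_near. Qed.

Lemma bm_cont a c f : {within `[a, c], continuous f} -> bm a c f.
Proof.
move=> cf; split; first exact: subspace_continuous_measurable_fun.
case: (leP a c) => [ac|ca]; last by exists 0 => x; lra.
have [u _ fu] := EVT_max ac cf; have [v _ fv] := EVT_min ac cf.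
exists (`|f u| + `|f v|) => x xI.
have xI' : x \in `[a, c] by rewrite in_itv.
by have := fu _ xI'; have := fv _ xI'; lran.
Qed.

Lemma bm_lip a c f : lip a c f -> bm a c f.
Proof. by move/lip_cont/bm_cont. Qed.

Lemma bm_ig a c f : bm a c f -> ig a c f.
Proof.
move=> [mf [M fM]]; apply: measurable_bounded_integrable => //.
- by rewrite /= lebesgue_measure_itv/=; case: ifP; rewrite ?ltry// -EFinB ltry.
- exists M; split; first exact: num_real.
  move=> M' MM' x; rewrite /= in_itv/= => /fM; lra.
Qed.

Lemma lip_sub a c a' c' f : a <= a' -> c' <= c -> lip a c f -> lip a' c' f.
Proof. by move=> aa cc [L L0 fL]; exists L => // x y xI yI; apply: fL; lra. Qed.

Lemma lip_cst a c k : lip a c (fun=> k : R).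
Proof. by exists 0 => // x y _ _; rewrite subrr normr0 mul0r. Qed.

Lemma lip_id a c : lip a c (fun x : R => x).
Proof. by exists 1 => // x y _ _; rewrite mul1r. Qed.

Lemma lipD a c f g : lip a c f -> lip a c g -> lip a c (fun x => f x + g x).
Proof.
move=> [L L0 fL] [L' L0' gL]; exists (L + L'); first lra.
move=> x y xI yI; have := fL _ _ xI yI; have := gL _ _ xI yI.
rewrite (_ : f x + g x - (f y + g y) = (f x - f y) + (g x - g y)); last by ring.
have := ler_normD (f x - f y) (g x - g y); rewrite mulrDl; lra.
Qed.

Lemma lipN a c f : lip a c f -> lip a c (fun x => - f x).
Proof.
move=> [L L0 fL]; exists L => // x y xI yI; have := fL _ _ xI yI.
by rewrite -opprD normrN.
Qed.

Lemma lipB a c f g : lip a c f -> lip a c g -> lip a c (fun x => f x - g x).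
Proof. by move=> lf lg; exact: lipD lf (lipN lg). Qed.

Lemma lipM a c f g : lip a c f -> lip a c g -> lip a c (fun x => f x * g x).
Proof.
move=> lf lg; have [_ [M fM]] := bm_lip lf; have [_ [M' gM]] := bm_lip lg.
case: lf lg => [L L0 fL] [L' L0' gL]; exists (`|M| * L' + `|M'| * L).
  by rewrite addr_ge0// mulr_ge0.
move=> x y xI yI.
rewrite (_ : _ - _ = f x * (g x - g y) + g y * (f x - f y)); last by ring.
apply: le_trans (ler_normD _ _) _; rewrite !normrM mulrDl -!mulrA.
apply: lerD; apply: ler_pM => //; [|exact: gL| |exact: fL].
- exact: le_trans (fM _ xI) (ler_norm _).
- exact: le_trans (gM _ yI) (ler_norm _).
Qed.

Lemma lipX a c f n : lip a c f -> lip a c (fun x => f x ^+ n).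
Proof.
move=> bf; elim: n => [|n ih]; first exact: lip_cst.
by under eq_fun do rewrite exprS; exact: lipM.
Qed.

Lemma lip_sum a c (I : Type) (s : seq I) (P : pred I) (F : I -> R -> R) :
  (forall i, lip a c (F i)) -> lip a c (fun x => \sum_(i <- s | P i) F i x).
Proof.
move=> bF; elim: s => [|i s ih].
  by under eq_fun do rewrite big_nil; exact: lip_cst.
under eq_fun do rewrite big_cons.
case: (P i) => //; exact: lipD.
Qed.

Lemma lip_poly a c (p : {poly R}) : lip a c (fun x => p.[x]).
Proof.
under eq_fun do rewrite horner_coef.
by apply: lip_sum => i; apply: lipM; [exact: lip_cst|exact/lipX/lip_id].
Qed.

Lemma bm_poly a c (p : {poly R}) : bm a c (fun x => p.[x]).
Proof. exact/bm_lip/lip_poly. Qed.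

Lemma bm_inv a c : measurable_fun `[a, c] (fun x : R => x^-1).
Proof.
apply: (@measurable_funS _ _ _ _ setT) => //.
pose D : set R := [set 0].
have mD : measurable D by exact: measurable_set1.
rewrite -(setvU D); apply/measurable_funU => //; first exact: measurableC.
split.
  apply: open_continuous_measurable_fun.
    by rewrite openC; exact: closed_eq.
  by move=> x; rewrite inE => /= x0; apply: inv_continuous; apply/eqP.
apply: (@eq_measurable_fun _ _ R R D (fun=> 0)); last exact: measurable_cst.
by move=> x; rewrite inE /= => ->; rewrite invr0.
Qed.

End BoundedMeasurable.

(** * The integral over a closed interval *)

Section Integral.
Context {R : realType}.
Implicit Types (a c : R) (f g : R -> R).

Lemma itgE a c f : itg a c f = \int[leb R]_(x in `[a, c]) f x.
Proof. by rewrite /itg -lock. Qed.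

Lemma ig_sub a c a' c' f : a <= a' -> c' <= c -> ig a c f -> ig a' c' f.
Proof.
move=> aa cc; apply: integrableS => // x; rewrite /= !in_itv/=; lra.
Qed.

Lemma ig_eq a c f g : (forall x, a <= x <= c -> f x = g x) ->
  ig a c f -> ig a c g.
Proof.
move=> fg; apply: eq_integrable => // x; rewrite inE/= in_itv/= => xI.
by rewrite /= fg.
Qed.

Lemma igD a c f g : ig a c f -> ig a c g -> ig a c (fun x => f x + g x).
Proof. 
move=> h1 h2; rewrite /ig.
have mI : measurable (`[a, c]%classic : set (measurableTypeR R)) by exact: measurable_itv.
have := integrableD mI h1 h2; apply: eq_integrable => //.
 Qed.

Lemma igB a c f g : ig a c f -> ig a c g -> ig a c (fun x => f x - g x).
Proof. 
move=> h1 h2; rewrite /ig.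
have mI : measurable (`[a, c]%classic : set (measurableTypeR R)) by exact: measurable_itv.
have := integrableB mI h1 h2; apply: eq_integrable => //.
 Qed.

Lemma igZ a c (k : R) f : ig a c f -> ig a c (fun x => k * f x).
Proof. 
move=> h1; rewrite /ig.
have mI : measurable (`[a, c]%classic : set (measurableTypeR R)) by exact: measurable_itv.
have := integrableZl mI k h1; apply: eq_integrable => //.
 Qed.

Lemma ig_norm a c f : ig a c f -> ig a c (fun x => `|f x|).
Proof. by move=> h1; apply: (integrable_norm h1). Qed.

Lemma eq_itg a c f g : (forall x, a <= x <= c -> f x = g x) ->
  itg a c f = itg a c g.
Proof.
by move=> fg; rewrite !itgE; apply: eq_Rintegral => x; rewrite inE/= in_itv/=; exact: fg.
Qed.

Lemma itgD a c f g : ig a c f -> ig a c g ->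
  itg a c (fun x => f x + g x) = itg a c f + itg a c g.
Proof. by move=> h1 h2; rewrite !itgE; exact: RintegralD. Qed.

Lemma itgB a c f g : ig a c f -> ig a c g ->
  itg a c (fun x => f x - g x) = itg a c f - itg a c g.
Proof. by move=> h1 h2; rewrite !itgE; exact: RintegralB. Qed.

Lemma itgZ a c (k : R) f : ig a c f ->
  itg a c (fun x => k * f x) = k * itg a c f.
Proof. by move=> h1; rewrite !itgE; exact: RintegralZl. Qed.

Lemma itgN a c f : ig a c f -> itg a c (fun x => - f x) = - itg a c f.
Proof.
move=> h1; rewrite -mulN1r -itgZ//; apply: eq_itg => x _; by rewrite mulN1r.
Qed.

Lemma itg_cst a c (k : R) : a <= c -> itg a c (fun=> k) = k * (c - a).
Proof.
move=> ac; rewrite !itgE Rintegral_cst//= lebesgue_measure_itv/= lte_fin.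
by case: ltP => [//|ca]; have -> : c - a = 0 by lra.
Qed.

Lemma itg_gt a c f : c < a -> itg a c f = 0.
Proof. by move=> ca; rewrite !itgE set_itv_ge ?Rintegral_set0// bnd_simp -ltNge. Qed.

Lemma itgxx a f : itg a a f = 0.
Proof. by rewrite !itgE set_itv1 Rintegral_set1. Qed.

Lemma itg_le a c f g : ig a c f -> ig a c g ->
  (forall x, a <= x <= c -> f x <= g x) -> itg a c f <= itg a c g.
Proof.
by move=> h1 h2 fg; rewrite !itgE; apply: le_Rintegral => // x; rewrite /= in_itv/=; exact: fg.
Qed.

Lemma itg_ge0 a c f : (forall x, a <= x <= c -> 0 <= f x) -> 0 <= itg a c f.
Proof.
by move=> f0; rewrite itgE; apply: Rintegral_ge0 => x; rewrite /= in_itv/=; exact: f0.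
Qed.

Lemma itg_norm a c f : ig a c f -> `|itg a c f| <= itg a c (fun x => `|f x|).
Proof. by move=> h; rewrite !itgE; exact: le_normr_Rintegral. Qed.

Lemma itg_split a m c f : a <= m -> m <= c -> ig a c f ->
  itg a c f = itg a m f + itg m c f.
Proof.
move=> am mc h.
have := @Rintegral_itvB R f (BLeft a) (BRight c) m h.
rewrite !bnd_simp => /(_ am mc) h2.
rewrite !itgE -(@Rintegral_itv_obnd_cbnd R m (BRight c) f); first by rewrite -h2 addrC subrK.
apply: integrableS h => // x; rewrite /= !in_itv/=; lra.
Qed.

Lemma itg_bound a c f M : a <= c -> ig a c f ->
  (forall x, a <= x <= c -> `|f x| <= M) -> `|itg a c f| <= M * (c - a).
Proof.
move=> ac h fM; apply: le_trans (itg_norm h) _; rewrite -itg_cst//.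
apply: itg_le => //; [exact: ig_norm|exact/bm_ig/bm_cst].
Qed.

Lemma itg_oo a c f : ig a c f -> \int[leb R]_(x in `]a, c[) f x = itg a c f.
Proof.
move=> h; case: (ltP a c) => ac; last first.
  rewrite set_itv_ge ?bnd_simp -?leNgt// Rintegral_set0.
  move: ac; rewrite le_eqVlt => /orP[/eqP->|/itg_gt->//]; by rewrite itgxx.
rewrite itgE Rintegral_itv_bndo_bndc ?Rintegral_itv_obnd_cbnd//.
  apply: integrableS h => // x; rewrite /= !in_itv/=; lra.
apply: integrableS h => // x; rewrite /= !in_itv/=; lra.
Qed.

Lemma eq_itg_oo a c f g : ig a c f -> ig a c g ->
  (forall x, a < x < c -> f x = g x) -> itg a c f = itg a c g.
Proof.
move=> h1 h2 fg; rewrite -!itg_oo//; apply: eq_Rintegral => x.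
by rewrite inE/= in_itv/=; exact: fg.
Qed.

Lemma itg_le_oo a c f g : ig a c f -> ig a c g ->
  (forall x, a < x < c -> f x <= g x) -> itg a c f <= itg a c g.
Proof.
move=> h1 h2 fg; rewrite -!itg_oo//; apply: le_Rintegral => //.
- apply: integrableS h1 => // x; rewrite /= !in_itv/=; lra.
- apply: integrableS h2 => // x; rewrite /= !in_itv/=; lra.
Qed.

Lemma ig_sum a c (I : Type) (s : seq I) (P : pred I) (F : I -> R -> R) :
  (forall i, ig a c (F i)) -> ig a c (fun x => \sum_(i <- s | P i) F i x).
Proof.
move=> bF; elim: s => [|i s ih].
  by under eq_fun do rewrite big_nil; exact/bm_ig/bm_cst.
under eq_fun do rewrite big_cons.
case: (P i) => //; exact: igD.
Qed.

Lemma itg_sum a c (I : Type) (s : seq I) (P : pred I) (F : I -> R -> R) :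
  (forall i, ig a c (F i)) ->
  itg a c (fun x => \sum_(i <- s | P i) F i x) = \sum_(i <- s | P i) itg a c (F i).
Proof.
move=> bF; elim: s => [|i s ih].
  rewrite big_nil; under eq_itg => x _ do rewrite big_nil.
  by rewrite !itgE Rintegral_cst// mul0r.
rewrite big_cons; under eq_itg => x _ do rewrite big_cons.
case: (P i) => //; rewrite itgD ?ih//; exact: ig_sum.
Qed.

(* The discriminant of [l -> itg ((f - l g)^2)] is nonpositive. *)
Lemma itg_CS a c f g : ig a c (fun x => f x ^+ 2) -> ig a c (fun x => g x ^+ 2) ->
  ig a c (fun x => f x * g x) ->
  itg a c (fun x => f x * g x) ^+ 2 <=
  itg a c (fun x => f x ^+ 2) * itg a c (fun x => g x ^+ 2).
Proof.
move=> hf hg hfg; set A := itg a c (fun x => f x ^+ 2).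
set B := itg a c (fun x => g x ^+ 2); set C := itg a c _.
have B0 : 0 <= B by apply: itg_ge0 => x _; exact: sqr_ge0.
have A0 : 0 <= A by apply: itg_ge0 => x _; exact: sqr_ge0.
have key s t : 0 <= s ^+ 2 * A - 2 * s * t * C + t ^+ 2 * B.
  have : 0 <= itg a c (fun x => (s * f x - t * g x) ^+ 2).
    by apply: itg_ge0 => x _; exact: sqr_ge0.
  rewrite (_ : itg _ _ _ = itg a c (fun x => s ^+ 2 * f x ^+ 2 -
      2 * s * t * (f x * g x) + t ^+ 2 * g x ^+ 2)); last first.
    by apply: eq_itg => x _; ring.
  rewrite itgD ?itgB ?itgZ//; try exact: igZ.
  by apply: igB; exact: igZ.
have := key B C.
case: (eqVneq B 0) => [B00|B1] _.
  rewrite B00 mulr0 real_exprn_even_le0 ?num_real//=; apply: contraT => C0.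
  have := key 1 ((A + 1) / (2 * C)).
  rewrite (_ : 2 * 1 * _ * C = A + 1); last by field.
  by rewrite B00; lra.
have B2 : 0 < B by rewrite lt_neqAle eq_sym B1.
have := key B C; rewrite (_ : _ + _ = B * (A * B - C ^+ 2)); last by ring.
rewrite pmulr_rge0//; lra.
Qed.

Lemma lip_itg a c f : bm a c f -> lip a c (fun x => itg a x f).
Proof.
move=> bf; have [_ [M fM]] := bf; exists `|M| => // x y.
wlog xy : x y / x <= y => [hw|].
  move=> xI yI; case: (leP x y) => [|/ltW] xy; first exact: hw.
  by rewrite distrC [`|x - y|]distrC; exact: hw.
move=> xI yI; rewrite (@itg_split a x y)//; [|lra..|]; last first.
  by apply/bm_ig; apply: bm_sub bf; lra.
rewrite opprD addNKr normrN distrC (ger0_norm (_ : 0 <= y - x)); last lra.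
apply: itg_bound => //; first by apply/bm_ig; apply: bm_sub bf; lra.
move=> z zI; apply: le_trans (ler_norm _); apply: fM; lra.
Qed.

Lemma lip_itgr a c f : bm a c f -> lip a c (fun x => itg x c f).
Proof.
move=> bf; case: (leP a c) => ac; last by exists 0 => // x y; lra.
have h : lip a c (fun x => itg a c f - itg a x f).
  by apply: lipB (lip_itg bf); exact: lip_cst.
case: h => L L0 h; exists L => // x y xI yI.
have e z : a <= z <= c -> itg z c f = itg a c f - itg a z f.
  move=> zI; rewrite (@itg_split a z c)//; [|lra..|exact: bm_ig].
  by rewrite addrAC subrr add0r.
by rewrite (e x)// (e y)//; exact: h.
Qed.

Lemma derive_itg a c f x : a < x < c -> ig a c f -> {for x, continuous f} ->
  is_derive x 1 (fun y => itg a y f) (f x).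
Proof.
move=> /andP[ax xc] h cf.
have [h1 h2] := continuous_FTC1_closed xc h ax cf.
have -> : (fun y => itg a y f) = (fun y => \int[leb R]_(t in `[a, y]) f t).
  by apply/funext => y; exact: itgE.
by apply: DeriveDef; [exact: h1|rewrite -derive1E].
Qed.

Lemma derive_itgr a c f x : a < x < c -> ig a c f -> {for x, continuous f} ->
  is_derive x 1 (fun y => itg y c f) (- f x).
Proof.
move=> xI h cf.
have h1 : is_derive x 1 (fun y => itg a c f - itg a y f) (- f x).
  have h2 := derive_itg xI h cf.
  by rewrite -[- f x]sub0r; apply: is_deriveB.
apply: (near_eq_is_derive _ h1).
near=> y.
have yI : a < y < c.
  by apply/andP; split; near: y; [apply: lt_nbhsr|apply: lt_nbhsl]; lra.
rewrite (@itg_split a y c)//; [|lra..].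
by rewrite addrAC subrr add0r.
Unshelve. all: by end_near. Qed.

(* The derivative is only asked to be continuous inside, so the usual
   statement is applied on [a + e, c - e]. *)
Lemma FTC_lip a c F f : a <= c -> lip a c F -> bm a c f ->
  (forall x, a < x < c -> {for x, continuous f}) ->
  (forall x, a < x < c -> is_derive x 1 F (f x)) ->
  itg a c f = F c - F a.
Proof.
rewrite le_eqVlt => /orP[/eqP<- *|ac]; first by rewrite itgxx subrr.
move=> lF bf cf dF.
have [_ [M fM]] := bf; have [L L0 FL] := lF.
apply/eqP; rewrite -subr_eq0 -normr_le0; apply/ler_addgt0Pl => /= e e0.
rewrite addr0.
have M0 : 0 <= M by apply: le_trans (fM a _); rewrite // lexx ltW.
(* The two end layers of width [d] cost at most [2 (M + L) d]: [M] bounds the integrand there and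
   [L] the increments of [F]. *)
pose d := Num.min ((c - a) / 4) (e / (2 * (M + L + 1))).
have d0 : 0 < d.
  rewrite lt_min; apply/andP; split; first slim_lra.
  by apply: divr_gt0 => //; slim_lra.
have d1 : d <= (c - a) / 4 by rewrite ge_min lexx.
have d2 : 2 * (M + L) * d <= e.
  have : d <= e / (2 * (M + L + 1)) by rewrite ge_min lexx orbT.
  rewrite ler_pdivlMr; [nra|slim_lra].
have ig1 := bm_ig bf.
have -> : itg a c f = itg a (a + d) f + itg (a + d) (c - d) f + itg (c - d) c f.
  rewrite (@itg_split a (c - d) c)//; [|slim_lra..].
  rewrite (@itg_split a (a + d) (c - d))//; [slim_lra|slim_lra|].
  by apply: ig_sub ig1; slim_lra.
have mid : itg (a + d) (c - d) f = F (c - d) - F (a + d).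
  have := @continuous_FTC2 R f F (a + d) (c - d).
  rewrite itgE /Rintegral => ->//; first slim_lra.
  - apply: continuous_in_subspaceT => x; rewrite inE/= in_itv/= => xI.
    by apply: cf; slim_lra.
  - split.
    + move=> x; rewrite in_itv/= => xI.
      by have [] : is_derive x 1 F (f x) by apply: dF; slim_lra.
    + have := lip_cont lF => cF.
      apply: cvg_at_right_filter; apply: differentiable_continuous.
      apply/derivable1_diffP.
      by have [] : is_derive (a + d) 1 F (f (a + d)) by apply: dF; slim_lra.
    + apply: cvg_at_left_filter; apply: differentiable_continuous.
      apply/derivable1_diffP.
      by have [] : is_derive (c - d) 1 F (f (c - d)) by apply: dF; slim_lra.
  - move=> x; rewrite in_itv/= => xI; rewrite derive1E.
    by have [_ ->] : is_derive x 1 F (f x) by apply: dF; slim_lra.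
have i1 : `|itg a (a + d) f| <= M * d.
  have -> : M * d = M * (a + d - a) by ring.
  apply: itg_bound; [slim_lra|by apply: ig_sub ig1; slim_lra|].
  by move=> x xI; apply: fM; slim_lra.
have i2 : `|itg (c - d) c f| <= M * d.
  have -> : M * d = M * (c - (c - d)) by ring.
  apply: itg_bound; [slim_lra|by apply: ig_sub ig1; slim_lra|].
  by move=> x xI; apply: fM; slim_lra.
have i3 : `|F (a + d) - F a| <= L * d.
  have := FL (a + d) a; rewrite (_ : a + d - a = d) 1?(gtr0_norm d0); last by ring.
  apply; slim_lra.
have i4 : `|F c - F (c - d)| <= L * d.
  have := FL c (c - d); rewrite (_ : c - (c - d) = d) 1?(gtr0_norm d0); last by ring.
  apply; slim_lra.
rewrite mid; move: i1 i2 i3 i4; rewrite !ler_norml; nra.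
Qed.

End Integral.

Section Continuity.
Context {R : realType}.
Implicit Types (f g : R -> R) (x : R).

Lemma ctsB f g x : {for x, continuous f} -> {for x, continuous g} ->
  {for x, continuous (fun y => f y - g y)}.
Proof. by move=> hf hg; exact: continuousB. Qed.

Lemma ctsM f g x : {for x, continuous f} -> {for x, continuous g} ->
  {for x, continuous (fun y => f y * g y)}.
Proof. by move=> hf hg; exact: continuousM. Qed.

Lemma cts_cst x (k : R) : {for x, continuous (fun=> k : R)}.
Proof. by move=> A; exact: cvg_cst. Qed.

Lemma cts_id x : {for x, continuous (fun y : R => y)}.
Proof. by move=> A. Qed.

Lemma ctsX f x n : {for x, continuous f} -> {for x, continuous (fun y => f y ^+ n)}.
Proof.
move=> hf; elim: n => [|n ih]; first exact: cts_cst.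
have -> : (fun y => f y ^+ n.+1) = (fun y => f y * f y ^+ n).
  by apply/funext => y; rewrite exprS.
exact: ctsM.
Qed.

Lemma ctsV x : x != 0 -> {for x, continuous (fun y : R => y^-1)}.
Proof. by move=> x0; exact: inv_continuous. Qed.

Lemma cts_comp f g x : {for x, continuous g} -> {for g x, continuous f} ->
  {for x, continuous (fun y => f (g y))}.
Proof. by move=> hg hf; exact: continuous_comp. Qed.

Lemma cts_within f (a c x : R) : a < x < c -> {within `[a, c], continuous f} ->
  {for x, continuous f}.
Proof.
move=> xI cf; have ac : a < c by lra.
by have [+ _ _] := (continuous_within_itvP _ ac).1 cf; apply; rewrite in_itv/=.
Qed.

End Continuity.

Section Derivatives.
Context {R : realType}.
Implicit Types (f g : R -> R) (x : R).

Lemma drvD f g x (a c : R) : is_derive x 1 f a -> is_derive x 1 g c ->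
  is_derive x 1 (fun y => f y + g y) (a + c).
Proof. by move=> h1 h2; exact: is_deriveD. Qed.

Lemma drvN f x (a : R) : is_derive x 1 f a -> is_derive x 1 (fun y => - f y) (- a).
Proof. by move=> h1; exact: is_deriveN. Qed.

Lemma drvB f g x (a c : R) : is_derive x 1 f a -> is_derive x 1 g c ->
  is_derive x 1 (fun y => f y - g y) (a - c).
Proof. by move=> h1 h2; exact: is_deriveB. Qed.

Lemma drv_eq f x (a c : R) : is_derive x 1 f a -> a = c -> is_derive x 1 f c.
Proof. by move=> h <-. Qed.

Lemma drvM f g x (a c : R) : is_derive x 1 f a -> is_derive x 1 g c ->
  is_derive x 1 (fun y => f y * g y) (a * g x + f x * c).
Proof.
move=> h1 h2; have h := @is_deriveM _ _ _ _ _ _ _ _ h1 h2.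
by apply: (drv_eq h); rewrite /GRing.scale/= addrC mulrC.
Qed.

Lemma drv_cst x (k : R) : is_derive x 1 (fun=> k) 0.
Proof. exact: is_derive_cst. Qed.

Lemma drv_id x : is_derive x 1 (fun y : R => y) 1.
Proof. exact: is_derive_id. Qed.

Lemma drvZ f x (a k : R) : is_derive x 1 f a -> is_derive x 1 (fun y => k * f y) (k * a).
Proof. by move=> h; have := drvM (drv_cst x k) h; rewrite mul0r add0r. Qed.

Lemma drv_comp f g x (a c : R) : is_derive x 1 g c -> is_derive (g x) 1 f a ->
  is_derive x 1 (fun y => f (g y)) (a * c).
Proof. by move=> h1 h2; exact: is_derive1_comp. Qed.

Lemma drvV x : x != 0 -> is_derive x 1 (fun y : R => y^-1) (- x ^- 2).
Proof.
move=> x0; have h := @is_deriveV R (fun y : R => y) x 1 1 x0 (drv_id x).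
by apply: (drv_eq h); rewrite /GRing.scale/= mulr1.
Qed.

Lemma drv_exp f x (a : R) : is_derive x 1 f a ->
  is_derive x 1 (fun y => expR (f y)) (expR (f x) * a).
Proof. by move=> h; apply: drv_comp h _; exact: is_derive_expR. Qed.

Lemma drv_sum x (I : Type) (s : seq I) (P : pred I) (F : I -> R -> R) (dF : I -> R) :
  (forall i, is_derive x 1 (F i) (dF i)) ->
  is_derive x 1 (fun y => \sum_(i <- s | P i) F i y) (\sum_(i <- s | P i) dF i).
Proof.
move=> h; elim: s => [|i s ih].
  by under eq_fun do rewrite big_nil; rewrite big_nil; exact: drv_cst.
under eq_fun do rewrite big_cons; rewrite big_cons.
by case: (P i) => //; exact: drvD.
Qed.

Lemma drv_poly x (p : {poly R}) : is_derive x 1 (fun y => p.[y]) (deriv p).[x].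
Proof. exact: is_derive_poly. Qed.

Lemma drv_near f g x (a : R) : (\forall y \near x, f y = g y) ->
  is_derive x 1 f a -> is_derive x 1 g a.
Proof. exact: near_eq_is_derive. Qed.

Lemma drv_cts f x (a : R) : is_derive x 1 f a -> {for x, continuous f}.
Proof.
by move=> [h _]; apply: differentiable_continuous; apply/derivable1_diffP.
Qed.

Lemma cts_poly x (p : {poly R}) : {for x, continuous (fun y => p.[y])}.
Proof. exact: drv_cts (drv_poly x p). Qed.

Lemma near_in_oo (a c x : R) : a < x < c -> \forall y \near x, a < y < c.
Proof.
move=> xI; near=> y; apply/andP; split; near: y; [apply: lt_nbhsr|apply: lt_nbhsl]; lra.
Unshelve. all: by end_near. Qed.

Lemma MVT_bound (a c M : R) f (df : R -> R) : a <= c -> {within `[a, c], continuous f} ->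
  (forall x, a < x < c -> is_derive x 1 f (df x)) ->
  (forall x, a < x < c -> `|df x| <= M) -> `|f c - f a| <= M * (c - a).
Proof.
rewrite le_eqVlt => /orP[/eqP<- *|ac cf df' M'].
  by rewrite !subrr normr0 mulr0.
have df2 x : x \in `]a, c[ -> is_derive x 1 f (df x) by rewrite in_itv/=; exact: df'.
have [x + ->] := MVT ac df2 cf.
rewrite in_itv/= => xI; rewrite normrM (ger0_norm (_ : 0 <= c - a)); last lra.
by apply: ler_wpM2r; [lra|exact: M'].
Qed.

End Derivatives.

(** A primitive in the integrated sense: no pointwise derivative is asked for, so the notion
    tolerates discontinuous [f], includes the end points and restricts to subintervals. *)
Definition prim {R : realType} (a c : R) (F f : R -> R) : Prop :=
  bm a c f /\ forall x y, a <= x -> x <= y -> y <= c -> F y - F x = itg x y f.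

Definition nn {R : realType} : R -> R -> (R -> R) -> R :=
  locked (fun a c f => Num.sqrt (itg a c (fun x => f x ^+ 2))).

(** * Primitives of bounded functions and the product rule *)

Section Primitives.
Context {R : realType}.
Implicit Types (a c : R) (f g F H : R -> R).

Lemma prim_lip a c F f : prim a c F f -> lip a c F.
Proof.
move=> [bf e]; case: (leP a c) => ac; last by exists 0 => // x y; lra.
have [L L0 h] := lip_itg bf; exists L => // x y xI yI.
have E z : a <= z <= c -> F z = F a + itg a z f.
  by move=> zI; rewrite -e; [ring|lra..].
rewrite (E x)// (E y)//; rewrite (_ : _ - _ = itg a x f - itg a y f); last by ring.
exact: h.
Qed.

Lemma prim_itg a c f : bm a c f -> prim a c (fun x => itg a x f) f.
Proof.
move=> bf; split=> // x y ax xy yc; rewrite (@itg_split _ a x y)//; first by ring.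
by apply/bm_ig; apply: bm_sub bf.
Qed.

Lemma prim_sub a c a' c' F f : a <= a' -> c' <= c -> prim a c F f -> prim a' c' F f.
Proof.
move=> aa cc [bf e]; split; first exact: bm_sub bf.
by move=> x y ax xy yc; apply: e; lra.
Qed.

Lemma prim_FTC a c F f : lip a c F -> bm a c f ->
  (forall x, a < x < c -> {for x, continuous f}) ->
  (forall x, a < x < c -> is_derive x 1 F (f x)) -> prim a c F f.
Proof.
move=> lF bf cf dF; split=> // x y ax xy yc; apply/esym; apply: FTC_lip => //.
- by apply: lip_sub lF.
- by apply: bm_sub bf.
- by move=> z zI; apply: cf; lra.
- by move=> z zI; apply: dF; lra.
Qed.

Lemma primD a c F f H h : prim a c F f -> prim a c H h ->
  prim a c (fun x => F x + H x) (fun x => f x + h x).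
Proof.
move=> [bf eF] [bh eH]; split; first exact: bmD.
move=> x y ax xy yc; rewrite itgD; last 2 first.
- by apply/bm_ig; apply: bm_sub bf.
- by apply/bm_ig; apply: bm_sub bh.
by rewrite -eF// -eH//; ring.
Qed.

Lemma primN a c F f : prim a c F f -> prim a c (fun x => - F x) (fun x => - f x).
Proof.
move=> [bf eF]; split; first exact: bmN.
move=> x y ax xy yc; rewrite itgN; last by apply/bm_ig; apply: bm_sub bf.
by rewrite -eF//; ring.
Qed.

Lemma primB a c F f H h : prim a c F f -> prim a c H h ->
  prim a c (fun x => F x - H x) (fun x => f x - h x).
Proof. by move=> h1 h2; exact: primD h1 (primN h2). Qed.

(** Cutting the interval into [n + 1] equal pieces bounds the total increment by
    [C (y - x)^2 / (n + 1)], for every [n]. *)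
Lemma quadratic_increments_cst a c C (D : R -> R) : 0 <= C ->
  (forall x y, a <= x -> x <= y -> y <= c -> `|D y - D x| <= C * (y - x) ^+ 2) ->
  forall x y, a <= x -> x <= y -> y <= c -> D x = D y.
Proof.
move=> C0 h x y ax xy yc.
have step n : `|D y - D x| <= C * (y - x) ^+ 2 / n.+1%:R.
  pose d := (y - x) / n.+1%:R.
  have n0 : 0 < n.+1%:R :> R by rewrite ltr0n.
  have d0 : 0 <= d by rewrite divr_ge0// ?ler0n//; lra.
  have dn : d * n.+1%:R = y - x by rewrite /d mulfVK// gt_eqF.
  have ind j : (j <= n.+1)%N -> `|D (x + d * j%:R) - D x| <= j%:R * (C * d ^+ 2).
    elim: j => [|j ih] jn; first by rewrite mulr0 addr0 subrr normr0 mul0r.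
    have jn' : j.+1%:R <= n.+1%:R :> R by rewrite ler_nat.
    have j0 : 0 <= j%:R :> R by rewrite ler0n.
    have e : j.+1%:R = j%:R + 1 :> R by rewrite -natr1.
    rewrite e in jn' *.
    have := h (x + d * j%:R) (x + d * (j%:R + 1)).
    rewrite (_ : x + d * (j%:R + 1) - (x + d * j%:R) = d); last by ring.
    move=> /(_ _ _ _)hh.
    have {}hh : `|D (x + d * (j%:R + 1)) - D (x + d * j%:R)| <= C * d ^+ 2.
      by apply: hh; nra.
    have := ih (ltnW jn) => {}ih.
    have := ler_normD (D (x + d * (j%:R + 1)) - D (x + d * j%:R)) (D (x + d * j%:R) - D x).
    rewrite (_ : _ + (D (x + d * j%:R) - D x) = D (x + d * (j%:R + 1)) - D x); last by ring.
    by move: ih hh; set A := C * d ^+ 2; nra.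
  have := ind n.+1 (leqnn _); rewrite dn (_ : x + (y - x) = y); last by ring.
  move/le_trans; apply; rewrite -dn le_eqVlt; apply/orP; left; apply/eqP.
  by field; rewrite gt_eqF.
apply/eqP; rewrite eq_sym -subr_eq0 -normr_le0; apply/ler_addgt0Pl => e e0.
rewrite addr0.
pose B := C * (y - x) ^+ 2.
have B0 : 0 <= B by rewrite mulr_ge0// sqr_ge0.
pose n := Num.truncn (B / e).
apply: le_trans (step n) _; rewrite ler_pdivrMr ?ltr0n// -ler_pdivrMl//.
by rewrite mulrC ltW// -/B; apply: truncnS_gt.
Qed.

(** The densities are merely bounded, so the product cannot be differentiated pointwise. Instead,
    [F H] minus the integral of the candidate density has quadratically small increments, since [F]
    and [H] are Lipschitz, and is therefore constant. *)
Lemma primM a c F f H h : prim a c F f -> prim a c H h ->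
  prim a c (fun x => F x * H x) (fun x => f x * H x + F x * h x).
Proof.
move=> pF pH; have lF := prim_lip pF; have lH := prim_lip pH.
have bF := bm_lip lF; have bH := bm_lip lH.
have [bf eF] := pF; have [bh eH] := pH.
have bk : bm a c (fun x => f x * H x + F x * h x) by apply: bmD; apply: bmM.
split=> // x0 y0 ax0 xy0 yc0.
have [L L0 FL] := lF; have [L' L0' HL] := lH.
have [_ [M fM]] := bf; have [_ [M' hM]] := bh.
pose D x := F x * H x - itg a x (fun x => f x * H x + F x * h x).
suff : D x0 = D y0.
  rewrite /D (@itg_split _ a x0 y0)//; first by move=> e; lra.
  by apply/bm_ig; apply: bm_sub bk.
apply: (@quadratic_increments_cst a c (`|M| * L' + `|M'| * L)) => //.
  by rewrite addr_ge0// mulr_ge0.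
move=> x y ax xy yc.
have igs k : bm a c k -> ig x y k by move=> bk'; apply/bm_ig; apply: bm_sub bk'.
rewrite /D (@itg_split _ a x y)//; last by apply/bm_ig; apply: bm_sub bk.
rewrite (_ : _ - _ = H y * itg x y f + F x * itg x y h -
   itg x y (fun x => f x * H x + F x * h x)); last by rewrite -eF// -eH//; ring.
rewrite -!itgZ; [|exact: igs..].
rewrite -itgD; [|exact/igZ/igs|exact/igZ/igs].
rewrite -itgB; [|by apply: igD; apply/igZ/igs|exact: igs].
rewrite expr2 mulrA; apply: itg_bound => //.
  apply: igB; first by apply: igD; apply/igZ/igs.
  exact: igs.
move=> z zI.
rewrite (_ : _ - _ = f z * (H y - H z) + h z * (F x - F z)); last by ring.
apply: le_trans (ler_normD _ _) _; rewrite !normrM [leRHS]mulrDl -!mulrA.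
have zc : a <= z <= c by lra.
apply: lerD; apply: ler_pM => //.
- exact: le_trans (fM _ zc) (ler_norm _).
- apply: le_trans (HL _ _ _ zc) _; first lra.
  by apply: ler_wpM2l => //; rewrite ger0_norm; lra.
- exact: le_trans (hM _ zc) (ler_norm _).
- apply: le_trans (FL _ _ _ zc) _; first lra.
  by apply: ler_wpM2l => //; rewrite ler0_norm; lra.
Qed.

Lemma prim_eq a c F G f g : (forall x, a <= x <= c -> F x = G x) ->
  (forall x, a <= x <= c -> f x = g x) -> prim a c F f -> prim a c G g.
Proof.
move=> FG fg [bf e]; split; first exact: bm_eq bf.
move=> x y ax xy yc; rewrite -!FG; [|lra..]; rewrite e//.
by apply: eq_itg => z zI; apply: fg; lra.
Qed.

End Primitives.

(** * The L2 norm on an interval *)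

Section L2norm.
Context {R : realType}.
Implicit Types (a c : R) (f g : R -> R).

Lemma nnE a c f : nn a c f = Num.sqrt (itg a c (fun x => f x ^+ 2)).
Proof. by rewrite /nn -lock. Qed.

Lemma nn_ge0 a c f : 0 <= nn a c f.
Proof. by rewrite nnE sqrtr_ge0. Qed.

Lemma nn_sqr a c f : nn a c f ^+ 2 = itg a c (fun x => f x ^+ 2).
Proof. by rewrite nnE sqr_sqrtr// itg_ge0// => x _; exact: sqr_ge0. Qed.

Lemma eq_nn a c f g : (forall x, a <= x <= c -> f x = g x) -> nn a c f = nn a c g.
Proof. by move=> fg; rewrite !nnE; congr Num.sqrt; apply: eq_itg => x xI; rewrite fg. Qed.

Lemma nnN a c f : nn a c (fun x => - f x) = nn a c f.
Proof. by rewrite !nnE; congr Num.sqrt; apply: eq_itg => x xI; rewrite sqrrN. Qed.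

Lemma nn_le a c f g : bm a c f -> bm a c g ->
  (forall x, a < x < c -> `|f x| <= `|g x|) -> nn a c f <= nn a c g.
Proof.
move=> bf bg fg; rewrite !nnE; apply: ler_wsqrtr; apply: itg_le_oo; [exact/bm_ig/bmX|exact/bm_ig/bmX|].
by move=> x xI; rewrite -[f x ^+ 2]real_normK ?num_real// -[g x ^+ 2]real_normK ?num_real// ler_sqr ?nnegrE// fg.
Qed.

Lemma nn_CS a c f g : bm a c f -> bm a c g ->
  `|itg a c (fun x => f x * g x)| <= nn a c f * nn a c g.
Proof.
move=> bf bg; rewrite -ler_sqr ?nnegrE ?mulr_ge0 ?nn_ge0//.
rewrite real_normK ?num_real// exprMn !nn_sqr.
by apply: itg_CS; apply: bm_ig; [exact: bmX|exact: bmX|exact: bmM].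
Qed.

Lemma nnZ a c (k : R) f : bm a c f -> nn a c (fun x => k * f x) = `|k| * nn a c f.
Proof.
move=> bf; rewrite !nnE (_ : itg _ _ _ = k ^+ 2 * itg a c (fun x => f x ^+ 2)).
  by rewrite sqrtrM ?sqr_ge0// sqrtr_sqr.
by rewrite -itgZ; [apply: eq_itg => x _; exact: exprMn|exact/bm_ig/bmX].
Qed.

Lemma nnD a c f g : bm a c f -> bm a c g ->
  nn a c (fun x => f x + g x) <= nn a c f + nn a c g.
Proof.
move=> bf bg; rewrite -ler_sqr ?nnegrE ?addr_ge0 ?nn_ge0// sqrrD !nn_sqr.
rewrite (_ : itg _ _ _ = itg a c (fun x => f x ^+ 2) + 2 * itg a c (fun x => f x * g x) +
   itg a c (fun x => g x ^+ 2)); last first.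
  rewrite -itgZ; last exact/bm_ig/bmM.
  have h1 : ig a c (fun x => f x ^+ 2) by exact/bm_ig/bmX.
  have h2 : ig a c (fun x => g x ^+ 2) by exact/bm_ig/bmX.
  have h3 : ig a c (fun x => 2 * (f x * g x)) by exact/igZ/bm_ig/bmM.
  rewrite -(itgD h1 h3) -(itgD (igD h1 h3) h2).
  by apply: eq_itg => x _; ring.
have := nn_CS bf bg; rewrite ler_norml => /andP[_ h]; rewrite mulr2n; lra.
Qed.

Lemma nnB a c f g : bm a c f -> bm a c g ->
  nn a c (fun x => f x - g x) <= nn a c f + nn a c g.
Proof. by move=> bf bg; rewrite -(nnN a c g); apply: nnD => //; exact: bmN. Qed.

Lemma nn_sup a c f M : a <= c -> bm a c f -> 0 <= M ->
  (forall x, a < x < c -> `|f x| <= M) -> nn a c f <= M * Num.sqrt (c - a).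
Proof.
move=> ac bf M0 fM; rewrite nnE -[X in X * _](ger0_norm M0) -sqrtr_sqr -sqrtrM ?sqr_ge0//.
apply: ler_wsqrtr; rewrite -itg_cst//; apply: itg_le_oo.
- exact/bm_ig/bmX.
- exact/bm_ig/bm_cst.
by move=> x xI; rewrite -[f x ^+ 2]real_normK ?num_real// ler_sqr ?nnegrE// fM.
Qed.

Lemma nn_cst a c (M : R) : a <= c -> nn a c (fun=> M) = `|M| * Num.sqrt (c - a).
Proof.
move=> ac; have -> : nn a c (fun=> M) = Num.sqrt (M ^+ 2 * (c - a)) by rewrite nnE -itg_cst.
by rewrite sqrtrM ?sqr_ge0// sqrtr_sqr.
Qed.

End L2norm.

(** * Averages and the metric coefficient *)

(* For [f = u], [av f] is u~, [aa f] is (u - u~)/r, [GG f] is g, [gt f] is g~,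
   [sg f] is g - g~ and [AA f] is the r-derivative of g~. *)
Definition av {R : realType} (f : R -> R) (x : R) : R := itg 0 x f / x.

Definition aa {R : realType} (f : R -> R) (x : R) : R := (f x - av f x) / x.

Definition avz {R : realType} (f : R -> R) (x : R) : R :=
  if x == 0 then f 0 else av f x.

(** The exponent of [g]: the density [(f - f~)^2 / s] is written [s (aa f)^2], which is bounded as
    soon as [aa f] is. *)
Definition XX {R : realType} (b : R) (f : R -> R) (x : R) : R :=
  itg x b (fun s => s * aa f s ^+ 2).

Definition GG {R : realType} : R -> (R -> R) -> R -> R :=
  locked (fun b f x => expR (- XX b f x)).

Definition gt {R : realType} (b : R) (f : R -> R) : R -> R := avz (GG b f).

Definition sg {R : realType} (b : R) (f : R -> R) (x : R) : R :=
  GG b f x - gt b f x.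

Definition AA {R : realType} (b : R) (f : R -> R) (x : R) : R := sg b f x / x.

(** The class on which all the functionals behave well; the bound on [aa f] is a condition at the
    center, where [f - f~] is divided by the radius. *)
Definition adm {R : realType} (b : R) (f : R -> R) : Prop :=
  bm 0 b f /\ bm 0 b (aa f).

Lemma GGE {R : realType} (b : R) f x : GG b f x = expR (- XX b f x).
Proof. by rewrite /GG -lock. Qed.

Section Averages.
Context {R : realType} (b : R) (hb : 0 < b).
Implicit Types (f g : R -> R).

Lemma av_bound f M x : bm 0 b f -> 0 < x <= b ->
  (forall y, 0 <= y <= x -> `|f y| <= M) -> `|av f x| <= M.
Proof.
move=> bf xI fM; rewrite normrM normfV (gtr0_norm (_ : 0 < x)); last lra.
rewrite ler_pdivrMr; last lra.
rewrite -[X in M * X]subr0; apply: itg_bound => //; first lra.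
by apply/bm_ig; apply: bm_sub bf; lra.
Qed.

Lemma bm_av f : bm 0 b f -> bm 0 b (av f).
Proof.
move=> bf; split.
  apply: measurable_funM; last exact: bm_inv.
  by have [] := bm_lip (lip_itg bf).
have [_ [M fM]] := bf; exists `|M| => x xI.
have [->|x0] := eqVneq x 0; first by rewrite /av invr0 mulr0 normr0.
apply: av_bound => //; first by rewrite lt_neqAle eq_sym x0.
by move=> y yI; apply: le_trans (ler_norm _); apply: fM; lra.
Qed.

Lemma avB f g x : bm 0 b f -> bm 0 b g -> 0 <= x <= b ->
  av (fun y => f y - g y) x = av f x - av g x.
Proof.
move=> bf bg xI; rewrite /av itgB ?mulrBl//.
- by apply/bm_ig; apply: bm_sub bf; lra.
- by apply/bm_ig; apply: bm_sub bg; lra.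
Qed.

Lemma aaB f g x : bm 0 b f -> bm 0 b g -> 0 <= x <= b ->
  aa (fun y => f y - g y) x = aa f x - aa g x.
Proof. by move=> bf bg xI; rewrite /aa avB//; ring. Qed.

Lemma admB f g : adm b f -> adm b g -> adm b (fun x => f x - g x).
Proof.
move=> [bf af] [bg ag]; split; first exact: bmB.
apply: (@bm_eq _ _ _ (fun x => aa f x - aa g x)); last exact: bmB.
by move=> x xI; rewrite aaB.
Qed.

Lemma avzB f g x : bm 0 b f -> bm 0 b g -> 0 <= x <= b ->
  avz (fun y => f y - g y) x = avz f x - avz g x.
Proof. by move=> bf bg xI; rewrite /avz; case: ifP => // _; exact: avB. Qed.

Lemma avz_bound f M x : bm 0 b f -> 0 <= x <= b ->
  (forall y, 0 <= y <= b -> `|f y| <= M) -> `|avz f x| <= M.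
Proof.
move=> bf xI fM; rewrite /avz; case: eqP => [_|/eqP x0]; first by apply: fM; lra.
apply: av_bound => //; first by rewrite lt_neqAle eq_sym x0.
by move=> y yI; apply: fM; lra.
Qed.

Lemma lip_inv (e c : R) : 0 < e -> lip e c (fun x : R => x^-1).
Proof.
move=> e0; exists (e ^- 2); first by rewrite invr_ge0 sqr_ge0.
move=> x y xI yI; rewrite (_ : _ - _ = (y - x) / (x * y)); last first.
  by field; apply/andP; split; apply/eqP; lra.
rewrite normrM distrC mulrC; apply: ler_wpM2r => //.
rewrite ger0_norm ?invr_ge0 ?mulr_ge0; [|lra..].
by rewrite lef_pV2 ?posrE; nra.
Qed.

(* Integrate [(F^2 / x)' = 2 (F / x) f - (F / x)^2], where [F = \int_0 f]. *)
Lemma hardy f : bm 0 b f -> nn 0 b (av f) <= 2 * nn 0 b f.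
Proof.
move=> bf; have bav := bm_av bf; have [_ [M0 fM0]] := bf.
pose M := `|M0| + 1; have M1 : 0 < M by rewrite ltr_wpDl.
have fM x : 0 <= x <= b -> `|f x| <= M.
  by move=> /fM0 h; apply: le_trans h _; rewrite /M; have := ler_norm M0; slim_lra.
have aM x : 0 < x <= b -> `|av f x| <= M.
  by move=> xI; apply: av_bound => // y yI; apply: fM; slim_lra.
pose k x := 2 * (av f x * f x) - av f x ^+ 2.
have bk : bm 0 b k by apply: bmB; [apply: bmM; [exact: bm_cst|exact: bmM]|exact: bmX].
(* Away from the center the primitive of [k] is [F^2 / x]; its value at [b] is nonnegative and its
   value at [e] is at most [M^2 e], which disappears as [e] tends to 0. *)
have key e : 0 < e < b -> 0 <= itg e b k + M ^+ 2 * e.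
  move=> eI.
  have pF : prim e b (fun x => itg 0 x f) f by apply: prim_sub (prim_itg bf); slim_lra.
  have pI : prim e b (fun x => x^-1) (fun x => - x ^- 2).
    have cI x : e <= x <= b -> {for x, continuous (fun x : R => - x ^- 2)}.
      move=> xI; apply: continuousN; apply: continuousV.
        by rewrite expf_neq0//; apply/eqP; slim_lra.
      exact: exprn_continuous.
    apply: prim_FTC.
    - by apply: lip_inv; slim_lra.
    - apply: bm_cont; apply: continuous_in_subspaceT => x; rewrite inE/= in_itv/=.
      exact: cI.
    - by move=> x xI; apply: cI; slim_lra.
    - move=> x xI.
      have x0 : x != 0 by apply/eqP; slim_lra.
      exact: drvV.
  have [bp /(_ e b (lexx e) _ (lexx b))] := primM (primM pF pF) pI.
  rewrite (_ : itg e b _ = itg e b k); last first.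
    apply: eq_itg => x xI; rewrite /k /av /=; field; apply/eqP; slim_lra.
  move=> <-; last slim_lra.
  have h1 : `|itg 0 e f| <= M * e.
    rewrite -[X in M * X]subr0; apply: itg_bound => //; first slim_lra.
    - by apply: ig_sub (bm_ig bf); slim_lra.
    - by move=> y yI; apply: fM; slim_lra.
  have : itg 0 e f * itg 0 e f / e <= M ^+ 2 * e.
    rewrite ler_pdivrMr; last slim_lra.
    by move: h1; rewrite ler_norml; nra.
  have : 0 <= itg 0 b f * itg 0 b f / b by rewrite divr_ge0 ?sqr_ge0// -?expr2 ?sqr_ge0//; slim_lra.
  slim_lra.
have k0 : 0 <= itg 0 b k.
  have [_ [K kK]] := bk; have K0 : 0 <= K by apply: le_trans (normr_ge0 _) (kK 0 _); rewrite lexx ltW.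
  apply/ler_addgt0Pr => d d0.
  pose e := Num.min (b / 2) (d / (K + M ^+ 2)).
  have KM : 0 < K + M ^+ 2 by rewrite ltr_wpDl// exprn_gt0.
  have e0 : 0 < e by rewrite lt_min divr_gt0//= divr_gt0.
  have e1 : e <= b / 2 by rewrite ge_min lexx.
  have e2 : e * (K + M ^+ 2) <= d.
    by rewrite -ler_pdivlMr// ge_min lexx orbT.
  have := key e; rewrite (@itg_split _ 0 e b); [|slim_lra|slim_lra|exact: bm_ig].
  have : `|itg 0 e k| <= K * (e - 0).
    apply: itg_bound; [slim_lra|by apply: ig_sub (bm_ig bk); slim_lra|].
    by move=> x xI; apply: kK; slim_lra.
  rewrite ler_norml => /andP[h _] /(_ _); rewrite subr0 in h; nra.
have : nn 0 b (av f) ^+ 2 <= 2 * (nn 0 b (av f) * nn 0 b f).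
  rewrite nn_sqr; move: k0; rewrite /k itgB; last 2 first.
  - by apply: igZ; exact/bm_ig/bmM.
  - exact/bm_ig/bmX.
  rewrite itgZ; last exact/bm_ig/bmM.
  by have := nn_CS bav bf; rewrite ler_norml; slim_lra.
have := nn_ge0 0 b (av f); have := nn_ge0 0 b f; nra.
Qed.

(** Away from 0, [x * aa f x] is [f x - av f x], so 3 is 1 plus the Hardy constant 2. *)
Lemma nn_x_aa f : adm b f -> nn 0 b (fun x => x * aa f x) <= 3 * nn 0 b f.
Proof.
move=> [bf ba]; have bav := bm_av bf.
apply: (@le_trans _ _ (nn 0 b (fun x => f x - av f x))).
  apply: nn_le; [by apply: bmM => //; exact: bm_id|exact: bmB|].
  by move=> x xI; rewrite /aa mulrCA mulfV ?mulr1// gt_eqF//; lra.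
apply: le_trans (nnB bf bav) _; have := hardy bf; lra.
Qed.

Section Functional.
Context (f : R -> R) (af : adm b f).

Let bma : bm 0 b (fun s => s * aa f s ^+ 2).
Proof. by case: af => _ ba; apply: bmM; [exact: bm_id|exact: bmX]. Qed.

Lemma XX_ge0 x : 0 <= x <= b -> 0 <= XX b f x.
Proof.
by move=> xI; apply: itg_ge0 => y yI; apply: mulr_ge0; rewrite ?sqr_ge0//; lra.
Qed.

Lemma lip_XX : lip 0 b (XX b f).
Proof. exact: lip_itgr. Qed.

Lemma XX_diff x y : 0 <= x -> x <= y -> y <= b ->
  XX b f x - XX b f y = itg x y (fun s => s * aa f s ^+ 2).
Proof.
move=> x0 xy yb; rewrite /XX (@itg_split _ x y b)//; first by ring.
by apply/bm_ig; apply: bm_sub bma; lra.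
Qed.

Lemma XX_mono x y : 0 <= x -> x <= y -> y <= b -> XX b f y <= XX b f x.
Proof.
move=> x0 xy yb; rewrite -subr_ge0 XX_diff//; apply: itg_ge0 => z zI.
by apply: mulr_ge0; rewrite ?sqr_ge0//; lra.
Qed.

Lemma GG_gt0 x : 0 < GG b f x.
Proof. by rewrite GGE expR_gt0. Qed.

Lemma GG_le1 x : 0 <= x <= b -> GG b f x <= 1.
Proof. by move=> xI; rewrite GGE -expR0 ler_expR oppr_le0 XX_ge0. Qed.

Lemma XX_le x : 0 <= x <= b -> XX b f x <= b * nn 0 b (aa f) ^+ 2.
Proof.
move=> xI; case: af => bf ba; apply: (@le_trans _ _ (XX b f 0)).
  by apply: XX_mono; lra.
rewrite nn_sqr -itgZ; last exact/bm_ig/bmX.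
apply: itg_le; [exact: bm_ig|exact/igZ/bm_ig/bmX|].
by move=> y yI; apply: ler_wpM2r; rewrite ?sqr_ge0//; lra.
Qed.

Lemma GG_ge x : 0 <= x <= b -> expR (- (b * nn 0 b (aa f) ^+ 2)) <= GG b f x.
Proof. by move=> xI; rewrite GGE ler_expR lerN2 XX_le. Qed.

End Functional.

Lemma expRN_diff (x y : R) : 0 <= x -> 0 <= y -> `|expR (- x) - expR (- y)| <= `|x - y|.
Proof.
wlog xy : x y / x <= y => [hw|].
  move=> x0 y0; case: (leP x y) => [|/ltW] xy; first exact: hw.
  by rewrite distrC [`|x - y|]distrC; exact: hw.
move=> x0 y0.
have h1 : expR (- y) <= expR (- x) by rewrite ler_expR; lra.
rewrite ger0_norm ?subr_ge0// ler0_norm; last lra.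
have -> : expR (- y) = expR (- x) * expR (- (y - x)) by rewrite -expRD; congr expR; ring.
have h2 := expR_ge1Dx (- (y - x)).
have h3 : expR (- x) <= 1 by rewrite -expR0 ler_expR; lra.
have := expR_gt0 (- x); nra.
Qed.

(* Mean value theorem along the segments from [x2] to [x1] and from [x4] to [x3]. *)
Lemma expRN_diff2 (x1 x2 x3 x4 : R) : 0 <= x1 -> 0 <= x2 -> 0 <= x3 -> 0 <= x4 ->
  `|expR (- x1) - expR (- x2) - (expR (- x3) - expR (- x4))| <=
  `|x1 - x2 - (x3 - x4)| + `|x3 - x4| * (`|x1 - x3| + `|x2 - x4|).
Proof.
move=> p1 p2 p3 p4.
pose u s := x2 + s * (x1 - x2); pose v s := x4 + s * (x3 - x4).
pose F s := expR (- u s) - expR (- v s).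
pose f s := - (x1 - x2) * expR (- u s) + (x3 - x4) * expR (- v s).
have dF s : is_derive s (1 : R) F (f s).
  have d1 : is_derive s 1 (fun s => - u s) (- (x1 - x2)).
    apply: (drv_eq (drvN (drvD (drv_cst s x2) (drvM (drv_id s) (drv_cst s (x1 - x2)))))).
    ring.
  have d2 : is_derive s 1 (fun s => - v s) (- (x3 - x4)).
    apply: (drv_eq (drvN (drvD (drv_cst s x4) (drvM (drv_id s) (drv_cst s (x3 - x4)))))).
    ring.
  by apply: (drv_eq (drvB (drv_exp d1) (drv_exp d2))); rewrite /f; ring.
have cF : {within `[0, 1], continuous F}.
  by apply: continuous_subspaceT => x; exact: drv_cts (dF x).
have [s sI e] := MVT ltr01 (fun x _ => dF x) cF.
have -> : expR (- x1) - expR (- x2) - (expR (- x3) - expR (- x4)) = F 1 - F 0.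
  rewrite /F /u /v !mul1r !mul0r !addr0 !subrKC; ring.
rewrite e subr0 mulr1; move: sI; rewrite in_itv/= => sI.
have u0 : 0 <= u s by rewrite /u; nra.
have v0 : 0 <= v s by rewrite /v; nra.
have -> : f s = - (x1 - x2 - (x3 - x4)) * expR (- u s) - (x3 - x4) * (expR (- u s) - expR (- v s)).
  by rewrite /f; ring.
apply: le_trans (ler_normB _ _) _; rewrite !normrM normrN; apply: lerD.
  rewrite [`|expR _|]ger0_norm ?expR_ge0// -[leRHS]mulr1; apply: ler_wpM2l => //.
  by rewrite -expR0 ler_expR; lra.
apply: ler_wpM2l => //; apply: le_trans (expRN_diff u0 v0) _.
have -> : u s - v s = (1 - s) * (x2 - x4) + s * (x1 - x3) by rewrite /u /v; ring.
apply: le_trans (ler_normD _ _) _; rewrite !normrM.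
rewrite [`|1 - s|]ger0_norm ?[`|s|]ger0_norm; [|lra..].
have := normr_ge0 (x2 - x4); have := normr_ge0 (x1 - x3); nra.
Qed.

Section FunctionalDifference.
Context (f g : R -> R) (af : adm b f) (ag : adm b g).

(** A difference of squares, arranged so that the factor carrying [f - g] is [s * aa (f - g) s]: its
    L2 norm is controlled by that of [f - g] itself, without any derivative. Only the sum
    [aa f + aa g] calls for the energy norm. *)
Lemma XX_sub x : 0 <= x <= b -> XX b f x - XX b g x =
  itg x b (fun s => (s * aa (fun y => f y - g y) s) * (aa f s + aa g s)).
Proof.
move=> xI; rewrite /XX -itgB.
- apply: eq_itg => s sI; rewrite aaB; [ring|by case: af|by case: ag|lra].
- case: af => _ h; apply/bm_ig; apply: (@bm_sub _ 0 b) => //; first lra.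
  by apply: bmM; [exact: bm_id|exact: bmX].
- case: ag => _ h; apply/bm_ig; apply: (@bm_sub _ 0 b) => //; first lra.
  by apply: bmM; [exact: bm_id|exact: bmX].
Qed.

End FunctionalDifference.

Lemma nn_sub a c f : 0 <= a -> a <= c -> c <= b -> bm 0 b f -> nn a c f <= nn 0 b f.
Proof.
move=> a0 ac cb bf; rewrite -ler_sqr ?nnegrE ?nn_ge0// !nn_sqr.
have ig2 : ig 0 b (fun x => f x ^+ 2) by exact/bm_ig/bmX.
rewrite (@itg_split _ 0 a b)//; last lra.
rewrite (@itg_split _ a c b)//; last by apply: ig_sub ig2; lra.
have := @itg_ge0 _ 0 a (fun x => f x ^+ 2) (fun x _ => sqr_ge0 _).
have := @itg_ge0 _ c b (fun x => f x ^+ 2) (fun x _ => sqr_ge0 _).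
lra.
Qed.

Lemma itg_mul_le f g x : bm 0 b f -> bm 0 b g -> 0 <= x <= b ->
  `|itg x b (fun s => f s * g s)| <= nn 0 b f * nn 0 b g.
Proof.
move=> bf bg xI; apply: le_trans (nn_CS _ _) _.
- by apply: bm_sub bf; lra.
- by apply: bm_sub bg; lra.
by apply: ler_pM; rewrite ?nn_ge0//; apply: nn_sub => //; lra.
Qed.

Lemma XX_sub_le f g x : adm b f -> adm b g -> 0 <= x <= b ->
  `|XX b f x - XX b g x| <=
  3 * nn 0 b (fun y => f y - g y) * (nn 0 b (aa f) + nn 0 b (aa g)).
Proof.
move=> af ag xI; rewrite XX_sub//; have [_ aa1] := af; have [_ aa2] := ag.
have ad := admB af ag; apply: le_trans (itg_mul_le _ _ xI) _.
- by apply: bmM; [exact: bm_id|case: ad].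
- exact: bmD.
by apply: ler_pM; rewrite ?nn_ge0//; [exact: nn_x_aa|exact: nnD].
Qed.

Lemma GG_sub_le f g x : adm b f -> adm b g -> 0 <= x <= b ->
  `|GG b f x - GG b g x| <=
  3 * nn 0 b (fun y => f y - g y) * (nn 0 b (aa f) + nn 0 b (aa g)).
Proof.
move=> af ag xI; apply: le_trans (XX_sub_le af ag xI); rewrite !GGE.
by apply: expRN_diff; exact: XX_ge0.
Qed.

Lemma lip_GG f : adm b f -> lip 0 b (GG b f).
Proof.
move=> af; have [L L0 h] := lip_XX af; exists L => // x y xI yI; rewrite !GGE.
by apply: le_trans (expRN_diff _ _) (h _ _ xI yI); exact: XX_ge0.
Qed.

Lemma bm_GG f : adm b f -> bm 0 b (GG b f).
Proof. by move/lip_GG/bm_lip. Qed.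

Lemma cts_GG f x : adm b f -> 0 < x < b -> {for x, continuous (GG b f)}.
Proof.
move=> af xI; have := lip_cont (lip_GG af).
move/(continuous_within_itvP _ hb) => [+ _ _]; apply; rewrite in_itv/=; lra.
Qed.

Lemma prim_W f x : bm 0 b f -> 0 < x < b -> {for x, continuous f} ->
  is_derive x 1 (av f) ((f x - av f x) / x).
Proof.
move=> bf xI cf; have x0 : x != 0 by apply/eqP; lra.
apply: (drv_eq (drvM (derive_itg xI (bm_ig bf) cf) (drvV x0))).
by rewrite /av; field.
Qed.

(** * Monotonicity and bounds of the metric coefficient [g~] *)

Section MetricCoefficient.
Context (f : R -> R) (af : adm b f).
Let K := nn 0 b (aa f).

(** The exponent is monotone, and its density is at most [x (aa f)^2] on [[s, x]]. The factor [x]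
    gained here compensates the division by the radius in [AA]. *)
Lemma GG_incr s x : 0 <= s <= x -> x <= b ->
  0 <= GG b f x - GG b f s <= x * K ^+ 2.
Proof.
move=> sI xI; have m := XX_mono af (_ : 0 <= s) (_ : s <= x) (_ : x <= b).
apply/andP; split.
  by rewrite subr_ge0 !GGE ler_expR lerN2; apply: m; lra.
apply: le_trans (ler_norm _) _; rewrite !GGE; apply: le_trans (expRN_diff _ _) _.
- by apply: XX_ge0; lra.
- by apply: XX_ge0; lra.
rewrite distrC XX_diff; [|exact: af|lra..].
have [_ ba] := af.
have ba2 : bm 0 b (fun s => aa f s ^+ 2) by exact: bmX.
rewrite ger0_norm; last first.
  by apply: itg_ge0 => y yI; apply: mulr_ge0; rewrite ?sqr_ge0//; lra.
apply: (@le_trans _ _ (itg s x (fun y => x * aa f y ^+ 2))).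
  apply: itg_le.
  - apply/bm_ig; apply: (@bm_sub _ 0 b); [lra|lra|].
    by apply: bmM => //; exact: bm_id.
  - by apply: igZ; apply: ig_sub (bm_ig ba2); lra.
  - by move=> y yI; apply: ler_wpM2r; rewrite ?sqr_ge0//; lra.
rewrite itgZ; last by apply: ig_sub (bm_ig ba2); lra.
apply: ler_wpM2l; first lra.
rewrite -nn_sqr ler_sqr ?nnegrE ?nn_ge0//; apply: nn_sub => //; lra.
Qed.

(** [g - g~] at [x] is the mean over [[0, x]] of [g x - g s], and each of these increments lies
    between 0 and [K^2 x]. After division by [x] this says that [g~] is nondecreasing with bounded
    slope. *)
Lemma sg_bound x : 0 < x <= b -> 0 <= sg b f x <= K ^+ 2 * x.
Proof.
move=> xI; have bG := bm_GG af.
have x0 : x != 0 by apply/eqP; lra.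
have igG : ig 0 x (GG b f) by apply: ig_sub (bm_ig bG); lra.
have e : sg b f x = itg 0 x (fun s => GG b f x - GG b f s) / x.
  have x0' : 0 <= x by lra.
  rewrite (itgB (bm_ig (bm_cst 0 x (GG b f x))) igG) (itg_cst _ x0').
  by rewrite /sg /gt /avz (negbTE x0) /av; field.
have igD' : ig 0 x (fun s => GG b f x - GG b f s).
  by apply: igB; [exact/bm_ig/bm_cst|exact: igG].
have Gd s : 0 <= s <= x -> 0 <= GG b f x - GG b f s <= x * K ^+ 2.
  by move=> sI; apply: GG_incr; lra.
rewrite e; apply/andP; split.
  apply: divr_ge0; last lra.
  by apply: itg_ge0 => s /Gd/andP[].
rewrite ler_pdivrMr; last lra.
have := @itg_bound _ 0 x (fun s => GG b f x - GG b f s) (x * K ^+ 2) (_ : 0 <= x) igD' _.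
move=> h; apply: le_trans (ler_norm _) _.
rewrite [leRHS](_ : _ = x * K ^+ 2 * (x - 0)); last by ring.
apply: h; first lra.
by move=> s sI; have := Gd s sI => /andP[h1 h2]; rewrite ger0_norm.
Qed.

Lemma AA_bound x : 0 <= x <= b -> 0 <= AA b f x <= K ^+ 2.
Proof.
move=> xI; have [->|x0] := eqVneq x 0; first by rewrite /AA invr0 mulr0 lexx sqr_ge0.
have xp : 0 < x by rewrite lt_neqAle eq_sym x0; lra.
have := sg_bound (_ : 0 < x <= b); rewrite xp => /(_ _)/andP[|h1 h2]; first lra.
by rewrite /AA divr_ge0 ?ler_pdivrMr//; lra.
Qed.

Lemma gt_le1 x : 0 <= x <= b -> gt b f x <= 1.
Proof.
move=> xI; apply: le_trans (ler_norm _) _.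
apply: avz_bound => //; first exact: bm_GG.
by move=> y yI; rewrite ger0_norm ?(ltW (GG_gt0 _ _))//; exact: GG_le1.
Qed.

Lemma gt_lower x : 0 <= x <= b -> expR (- (b * K ^+ 2)) <= gt b f x.
Proof.
move=> xI; rewrite /gt /avz; case: eqP => [_|/eqP x0].
  by apply: GG_ge => //; lra.
have xp : 0 < x by rewrite lt_neqAle eq_sym x0; lra.
rewrite /av ler_pdivlMr// -[X in _ * X]subr0 -itg_cst; last lra.
apply: itg_le; [exact/bm_ig/bm_cst|by apply: ig_sub (bm_ig (bm_GG af)); lra|].
by move=> y yI; apply: GG_ge => //; lra.
Qed.

Lemma gt_derive x : 0 < x < b -> is_derive x 1 (gt b f) (AA b f x).
Proof.
move=> xI; have x0 : x != 0 by apply/eqP; lra.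
have h := prim_W (bm_GG af) xI (cts_GG af xI).
have e : (GG b f x - av (GG b f) x) / x = AA b f x.
  by rewrite /AA /sg /gt /avz (negbTE x0).
rewrite e in h; apply: drv_near h; near=> y; rewrite /gt /avz ifF//.
apply/negbTE; have : 0 < y < b by near: y; exact: near_in_oo.
by move=> yI; apply/eqP; lra.
Unshelve. all: by end_near. Qed.

Lemma gt0E : gt b f 0 = GG b f 0.
Proof. by rewrite /gt /avz eqxx. Qed.

Lemma gt_lip x y : 0 <= x -> x <= y -> y <= b ->
  0 <= gt b f y - gt b f x <= K ^+ 2 * (y - x).
Proof.
move=> x0; rewrite le_eqVlt => /orP[/eqP<- _|xy yb].
  by rewrite !subrr mulr0 lexx.
have bG := bm_GG af.
(* At the center [gt] is given by a separate value rather than by the quotient, so an increment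
   starting at 0 is computed as a mean of increments of [g]; elsewhere the mean value theorem
   applies. *)
move: x0; rewrite le_eqVlt => /orP[/eqP x0|x0].
  rewrite -x0 in xy *.
  have y0 : y != 0 by apply/eqP; lra.
  have -> : gt b f y - gt b f 0 = itg 0 y (fun s => GG b f s - GG b f 0) / y.
    have y0' : 0 <= y by lra.
    have iG : ig 0 y (GG b f) by apply: ig_sub (bm_ig bG).
    rewrite (itgB iG (bm_ig (bm_cst 0 y (GG b f 0)))) (itg_cst _ y0').
    by rewrite gt0E /gt /avz (negbTE y0) /av; field.
  have Gd s : 0 <= s <= y -> 0 <= GG b f s - GG b f 0 <= y * K ^+ 2.
    move=> sI; have s0 : (0 : R) <= 0 <= s by lra.
    have sb : s <= b by lra.
    have /andP[-> h2] := GG_incr s0 sb; apply: le_trans h2 _.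
    by apply: ler_wpM2r; rewrite ?sqr_ge0//; lra.
  rewrite subr0 ler_pdivrMr// divr_ge0/=; [| |lra]; last first.
    by apply: itg_ge0 => s /Gd/andP[].
  have -> : K ^+ 2 * y * y = itg 0 y (fun=> y * K ^+ 2) by rewrite itg_cst; [ring|lra].
  apply: itg_le; [|exact/bm_ig/bm_cst|by move=> s /Gd/andP[]].
  by apply: igB; [by apply: ig_sub (bm_ig bG); lra|exact/bm_ig/bm_cst].
have cg : {within `[x, y], continuous (gt b f)}.
  have l : lip x y (fun z => itg 0 z (GG b f) * z^-1).
    by apply: lipM; [apply: lip_sub (lip_itg bG); lra|exact: lip_inv].
  apply: lip_cont; case: l => L L0 l; exists L => // u v uI vI.
  rewrite /gt /avz !ifF; [exact: l| |]; by apply/negbTE/eqP; lra.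
have dg z : z \in `]x, y[ -> is_derive z 1 (gt b f) (AA b f z).
  by rewrite in_itv/= => zI; apply: gt_derive; lra.
have [z + ->] := MVT xy dg cg; rewrite in_itv/= => zI.
have := AA_bound (_ : 0 <= z <= b); rewrite -/K => /(_ _)/andP[|h1 h2]; first lra.
by apply/andP; split; nra.
Qed.

Lemma lip_gt : lip 0 b (gt b f).
Proof.
exists (K ^+ 2); first exact: sqr_ge0.
move=> x y xI yI; case: (leP x y) => xy.
  have := @gt_lip x y; rewrite distrC [`|x - y|]distrC => /(_ _ _ _)/andP[|||h1 h2]; [lra..|].
  rewrite ger0_norm// ger0_norm//; lra.
have := @gt_lip y x => /(_ _ _ _)/andP[|||h1 h2]; [lra..|].
rewrite ger0_norm// ger0_norm//; lra.
Qed.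

Lemma bm_gt : bm 0 b (gt b f).
Proof. exact: bm_lip lip_gt. Qed.

Lemma bm_AA : bm 0 b (AA b f).
Proof.
split.
  apply: measurable_funM; last exact: bm_inv.
  by have [] := bmB (bm_GG af) bm_gt.
exists (K ^+ 2) => x xI; have /andP[h1 h2] := AA_bound xI.
by rewrite ger0_norm.
Qed.

Lemma cts_AA x : 0 < x < b -> {for x, continuous (AA b f)}.
Proof.
move=> xI; apply: continuousM.
  apply: continuousB; first exact: cts_GG.
  exact: drv_cts (gt_derive xI).
by apply: inv_continuous; apply/eqP; lra.
Qed.

Lemma prim_gt : prim 0 b (gt b f) (AA b f).
Proof.
apply: prim_FTC; [exact: lip_gt|exact: bm_AA| |].
  by move=> x; exact: cts_AA.
by move=> x; exact: gt_derive.
Qed.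

End MetricCoefficient.

End Averages.

(** * Polynomials on an interval, Gauss-Radau projection *)

Definition jp {R : realType} (a c : R) (p : {poly R}) : R := itg a c (fun x => p.[x]).

Definition gram {R : realType} (n : nat) (w : {poly R}) : 'M[R]_n :=
  \matrix_(i, j) jp 0 1 (w * 'X^i * 'X^j).

(** The basis dual to the monomials for the inner product of weight [w] on [[0, 1]]: pairing with it
    reads off a coefficient. *)
Definition dualb {R : realType} (n : nat) (w : {poly R}) (j : 'I_n) : {poly R} :=
  \sum_(i < n) invmx (gram n w) i j *: 'X^i.

Section PolyIntegral.
Context {R : realType}.
Implicit Types (a c : R) (p q w : {poly R}).

Lemma jpD a c p q : jp a c (p + q) = jp a c p + jp a c q.
Proof.
rewrite /jp -itgD; [|exact/bm_ig/bm_poly|exact/bm_ig/bm_poly].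
by apply: eq_itg => x _; rewrite hornerD.
Qed.

Lemma jpZ a c k p : jp a c (k *: p) = k * jp a c p.
Proof.
rewrite /jp -itgZ; last exact/bm_ig/bm_poly.
by apply: eq_itg => x _; rewrite hornerZ.
Qed.

Lemma jp0 a c : jp a c 0 = 0.
Proof. by rewrite -[0](scale0r 0) jpZ mul0r. Qed.

Lemma jp_sum a c (I : Type) (s : seq I) (P : pred I) (F : I -> {poly R}) :
  jp a c (\sum_(i <- s | P i) F i) = \sum_(i <- s | P i) jp a c (F i).
Proof.
elim: s => [|i s ih]; first by rewrite !big_nil jp0.
by rewrite !big_cons; case: (P i); rewrite ?jpD ih.
Qed.

Lemma poly_coefE n p : (size p <= n)%N -> p = \sum_(i < n) p`_i *: 'X^i.
Proof.
move=> sp; rewrite -{1}[p]coefK poly_def.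
rewrite (big_ord_widen_cond n xpredT (fun i => p`_i *: 'X^i) sp) /= [RHS](bigID (fun i : 'I_n => (i < size p)%N)) /=.
rewrite [X in _ + X]big1 ?addr0// => i; rewrite -leqNgt => h.
by rewrite nth_default// scale0r.
Qed.

Lemma poly0_oo a c p : a < c -> (forall x, a < x < c -> p.[x] = 0) -> p = 0.
Proof.
move=> ac h; apply/eqP; apply: contraT => p0.
pose rs := [seq a + (c - a) / (i.+2)%:R | i <- iota 0 (size p)].
have := @max_poly_roots _ p rs p0; rewrite size_map size_iota ltnn; apply.
  apply/allP => x /mapP[i _ ->]; apply/rootP; apply: h.
  have i0 : 1 < i.+2%:R :> R by rewrite ltr1n.
  have : 0 < (c - a) / i.+2%:R by rewrite divr_gt0//; lra.
  have : (c - a) / i.+2%:R < c - a.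
    by rewrite ltr_pdivrMr; [rewrite ltr_pMr//; lra|lra].
  by set d := _ / _ => d1 d2; lra.
rewrite map_inj_uniq ?iota_uniq// => i j /addrI.
have ca : c - a != 0 by apply/eqP; lra.
by move/(mulfI ca)/invr_inj/eqP; rewrite eqr_nat => /eqP[].
Qed.

(** By positivity the integral over [[a, y]] vanishes for every [y], hence so does its derivative,
    which is [p]. *)
Lemma jp_eq0 a c p : a < c -> (forall x, a <= x <= c -> 0 <= p.[x]) ->
  jp a c p = 0 -> p = 0.
Proof.
move=> ac p0 j0; apply: (poly0_oo ac) => x xI.
have bp : bm a c (fun x => p.[x]) by exact: bm_poly.
have F0 y : a <= y <= c -> itg a y (fun x => p.[x]) = 0.
  move=> yI; move: j0; rewrite /jp (@itg_split _ a y c)//; [|lra|lra|exact: bm_ig].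
  have : 0 <= itg a y (fun x => p.[x]) by apply: itg_ge0 => z zI; apply: p0; lra.
  have : 0 <= itg y c (fun x => p.[x]) by apply: itg_ge0 => z zI; apply: p0; lra.
  lra.
have cp : {for x, continuous (fun x => p.[x])} by exact: drv_cts (drv_poly x p).
have [_ d1] := derive_itg xI (bm_ig bp) cp.
have d0 : is_derive x 1 (fun y => itg a y (fun x => p.[x])) 0.
  apply: drv_near (drv_cst x 0).
  near=> y; rewrite F0//; have : a < y < c by near: y; exact: near_in_oo.
  lra.
by case: d0 => _ d0; rewrite -d1 d0.
Unshelve. all: by end_near. Qed.

Section Gram.
Context (n : nat) (w : {poly R}).
Hypothesis w0 : w != 0.
Hypothesis wge0 : forall x, 0 <= x <= 1 -> 0 <= w.[x].

Lemma gramE p q : (size p <= n)%N -> (size q <= n)%N ->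
  jp 0 1 (w * p * q) = \sum_(i < n) \sum_(j < n) p`_i * gram n w i j * q`_j.
Proof.
move=> sp sq; rewrite {1}(poly_coefE sp) {1}(poly_coefE sq).
rewrite [w * _]mulr_sumr mulr_suml jp_sum; apply: eq_bigr => i _.
rewrite mulr_sumr jp_sum; apply: eq_bigr => j _.
by rewrite -!scalerAr -scalerAl !jpZ !mxE; ring.
Qed.

(** A vector of the kernel gives a polynomial [p] with the integral of [w p^2] equal to 0, hence
    [p = 0]. *)
Lemma gram_unit : gram n w \in unitmx.
Proof.
rewrite -row_free_unit -kermx_eq0; apply/eqP/row_matrixP => i; rewrite row0.
set v := row i _.
have vM : v *m gram n w = 0 by apply/eqP; rewrite -sub_kermx row_sub.
pose p := \sum_(i < n) v 0 i *: 'X^i.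
have pE (j : 'I_n) : p`_j = v 0 j.
  rewrite coef_sum (bigD1 j)//= big1 ?addr0.
    by rewrite coefZ coefXn eqxx mulr1.
  move=> l lj; rewrite coefZ coefXn; case: eqP => [e|]; last by rewrite mulr0.
  by case/eqP: lj; apply/val_inj.
have sp : (size p <= n)%N.
  apply: (leq_trans (size_sum _ _ _)); apply/bigmax_leqP => l _.
  by apply: (leq_trans (size_scale_leq _ _)); rewrite size_polyXn.
have : jp 0 1 (w * p * p) = 0.
  rewrite gramE// exchange_big/= big1// => j _.
  rewrite -mulr_suml; have := congr1 (fun M : 'rV[R]_n => M 0 j) vM; rewrite !mxE => e.
  rewrite (_ : \sum_(i < n) _ = 0) ?mul0r// -[RHS]e; apply: eq_bigr => l _.
  by rewrite pE.
move/(jp_eq0 ltr01) => /(_ _)/eqP.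
rewrite -mulrA mulf_eq0 (negbTE w0)/= mulf_eq0 orbb => /(_ _)/eqP p0.
apply/rowP => j; rewrite -pE p0 ?coef0 ?mxE// => x xI.
by rewrite 2!hornerM -expr2 mulr_ge0 ?sqr_ge0// wge0.
Qed.

Lemma size_dualb (j : 'I_n) : (size (@dualb _ n w j) <= n)%N.
Proof.
apply: (leq_trans (size_sum _ _ _)); apply/bigmax_leqP => l _.
by apply: (leq_trans (size_scale_leq _ _)); rewrite size_polyXn.
Qed.

Lemma dualbE p (j : 'I_n) : (size p <= n)%N -> jp 0 1 (w * p * @dualb _ n w j) = p`_j.
Proof.
move=> sp; rewrite mulr_sumr jp_sum.
under eq_bigr => i _.
  rewrite -scalerAr jpZ {1}(poly_coefE sp) [w * _]mulr_sumr mulr_suml jp_sum.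
  rewrite (eq_bigr (fun l : 'I_n => p`_l * gram n w l i)); last first.
    by move=> l _; rewrite -scalerAr -scalerAl jpZ mxE.
  rewrite mulr_sumr.
  over.
rewrite exchange_big/= (bigD1 j)//= [X in _ + X]big1 ?addr0.
  have := congr1 (fun M : 'M[R]_n => M j j) (mulmxV gram_unit); rewrite !mxE eqxx mulr1n => e.
  rewrite -[RHS]mulr1 -e mulr_sumr; apply: eq_bigr => l _; ring.
move=> l lj; have := congr1 (fun M : 'M[R]_n => M l j) (mulmxV gram_unit).
rewrite !mxE (negbTE lj) => e; rewrite -[RHS](mulr0 p`_l) -[X in _ = _ * X]e mulr_sumr.
by apply: eq_bigr => i _; ring.
Qed.

(** Equivalence of norms in finite dimension, with an explicit constant instead of compactness: a
    coefficient is the pairing with a dual polynomial, and Cauchy-Schwarz applies with weight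
    [w]. *)
Lemma coef_bound : exists2 C : R, 0 <= C &
  forall p (j : nat), (size p <= n)%N -> `|p`_j| ^+ 2 <= C * jp 0 1 (w * p * p).
Proof.
pose C := \sum_(j < n) jp 0 1 (w * @dualb _ n w j * dualb w j).
have J0 p : 0 <= jp 0 1 (w * p * p).
  by apply: itg_ge0 => x xI; rewrite !hornerE -mulrA -expr2 mulr_ge0 ?sqr_ge0// wge0.
exists C; first by apply: sumr_ge0.
move=> p j sp; rewrite real_normK ?num_real//.
case: (ltnP j n) => jn; last first.
  rewrite nth_default ?(leq_trans sp)// expr0n/= mulr_ge0//; exact: sumr_ge0.
have := dualbE (Ordinal jn) sp; rewrite /= => <-.
have CS d : jp 0 1 (w * p * d) ^+ 2 <= jp 0 1 (w * p * p) * jp 0 1 (w * d * d).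
  pose s x := Num.sqrt w.[x].
  have sE x : 0 <= x <= 1 -> s x ^+ 2 = w.[x] by move=> xI; rewrite sqr_sqrtr// wge0.
  have := @itg_CS _ 0 1 (fun x => s x * p.[x]) (fun x => s x * d.[x]).
  rewrite (_ : itg 0 1 _ = jp 0 1 (w * p * d)); last first.
    by apply: eq_itg => x xI; rewrite !hornerM -(sE x)//; ring.
  rewrite (_ : itg 0 1 (fun x => (s x * p.[x]) ^+ 2) = jp 0 1 (w * p * p)); last first.
    by apply: eq_itg => x xI; rewrite !hornerM -(sE x)//; ring.
  rewrite (_ : itg 0 1 (fun x => (s x * d.[x]) ^+ 2) = jp 0 1 (w * d * d)); last first.
    by apply: eq_itg => x xI; rewrite !hornerM -(sE x)//; ring.
  apply.
  - apply: ig_eq (bm_ig (bm_poly 0 1 (w * p * p))) => x xI.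
    by rewrite !hornerM -(sE x)//; ring.
  - apply: ig_eq (bm_ig (bm_poly 0 1 (w * d * d))) => x xI.
    by rewrite !hornerM -(sE x)//; ring.
  - apply: ig_eq (bm_ig (bm_poly 0 1 (w * p * d))) => x xI.
    by rewrite !hornerM -(sE x)//; ring.
apply: le_trans (CS _) _; rewrite mulrC; apply: ler_wpM2r => //.
by rewrite /C (bigD1 (Ordinal jn))//= lerDl; apply: sumr_ge0.
Qed.

End Gram.

Lemma bm_oo a c f : (exists M : R, forall x, a <= x <= c -> `|f x| <= M) ->
  (forall x, a < x < c -> {for x, continuous f}) -> bm a c f.
Proof.
move=> hM cf; split=> //.
apply/measurable_fun_itv_obnd_cbndP/measurable_fun_itv_bndo_bndcP.
apply: open_continuous_measurable_fun; first exact: interval_open.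
by move=> x; rewrite inE/= in_itv/=; exact: cf.
Qed.

Definition aff a c : {poly R} := (c - a) *: 'X + a%:P.

Lemma affE a c y : (aff a c).[y] = a + (c - a) * y.
Proof. by rewrite /aff !hornerE; ring. Qed.

Lemma size_comp_aff a c p n : (size p <= n)%N -> (size (p \Po aff a c) <= n)%N.
Proof.
move=> sp; have [->|p0] := eqVneq p 0; first by rewrite comp_poly0 size_poly0.
have sq : (size (aff a c) <= 2)%N.
  apply: leq_trans (size_polyD _ _) _; rewrite geq_max; apply/andP; split.
    by apply: leq_trans (size_scale_leq _ _) _; rewrite size_polyX.
  by apply: leq_trans (size_polyC_leq1 _) _.
apply: leq_trans (size_comp_poly_leq _ _) _.
move: sp; have : (0 < size p)%N by rewrite size_poly_gt0.
case: (size p) => // m _ /= mn; apply: leq_trans mn; rewrite ltnS.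
rewrite -[leqRHS]muln1 leq_mul2l; case: (size (aff a c)) sq => [|[|[|]]]//= _; by rewrite orbT.
Qed.

Lemma aff_in a c y : a <= c -> 0 <= y <= 1 -> a <= a + (c - a) * y <= c.
Proof. by move=> ac yI; nra. Qed.

Lemma bm_aff a c f : a < c -> bm a c f ->
  (forall x, a < x < c -> {for x, continuous f}) ->
  bm 0 1 (fun y => f (a + (c - a) * y)).
Proof.
move=> ac [_ [M fM]] cf; apply: bm_oo.
  by exists M => y yI; apply: fM; apply: aff_in => //; exact: ltW.
move=> y yI; apply: (@continuous_comp _ _ _ (fun y => a + (c - a) * y) f).
  exact: drv_cts (drvD (drv_cst y a) (drvM (drv_cst y (c - a)) (drv_id y))).
by apply: cf; nra.
Qed.

(** The change of variables is the fundamental theorem applied to [y -> itg a (a + (c - a) y) f], so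
    continuity is only needed inside. *)
Lemma itg_aff a c f : a < c -> bm a c f ->
  (forall x, a < x < c -> {for x, continuous f}) ->
  itg a c f = (c - a) * itg 0 1 (fun y => f (a + (c - a) * y)).
Proof.
move=> ac bf cf; have bg := bm_aff ac bf cf.
rewrite -itgZ; last exact: bm_ig.
pose F y := itg a (a + (c - a) * y) f.
have -> : itg a c f = F 1 - F 0.
  by rewrite /F mulr0 mulr1 addr0 itgxx subr0; congr itg; ring.
apply/esym; apply: FTC_lip => //.
- have [L L0 h] := lip_itg bf; exists (L * (c - a)); first by rewrite mulr_ge0//; lra.
  move=> x y xI yI; apply: le_trans (h _ _ _ _) _; [exact/aff_in/xI/ltW|exact/aff_in/yI/ltW|].
  rewrite (_ : _ - _ = (c - a) * (x - y)); last by ring.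
  by rewrite normrM mulrA (ger0_norm (_ : 0 <= c - a)); lra.
- exact: bmM (bm_cst _ _ _) bg.
- move=> y yI; apply: ctsM; first exact: cts_cst.
  apply: (@cts_comp _ f (fun y => a + (c - a) * y)); last by apply: cf; nra.
  exact: drv_cts (drvD (drv_cst y a) (drvM (drv_cst y (c - a)) (drv_id y))).
- move=> y yI; rewrite mulrC.
  have d := drvD (drv_cst y a) (drvM (drv_cst y (c - a)) (drv_id y)).
  have yI' : a < a + (c - a) * y < c by nra.
  by apply: (drv_eq (drv_comp d (derive_itg yI' (bm_ig bf) (cf _ yI')))); ring.
Qed.

Lemma jp_aff a c p : a < c -> jp a c p = (c - a) * jp 0 1 (p \Po aff a c).
Proof.
move=> ac; rewrite /jp itg_aff//.
- congr (_ * _); apply: eq_itg => y _; by rewrite horner_comp affE.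
- exact: bm_poly.
- by move=> x _; exact: drv_cts (drv_poly x p).
Qed.

Lemma deriv_aff a c p : deriv (p \Po aff a c) = (c - a) *: (deriv p \Po aff a c).
Proof.
by rewrite deriv_comp /aff derivD derivC addr0 derivZ derivX alg_polyC mulrC mul_polyC.
Qed.

Lemma poly_sup p n B y : (size p <= n)%N -> 0 <= y <= 1 ->
  (forall j, `|p`_j| ^+ 2 <= B) -> `|p.[y]| ^+ 2 <= n%:R ^+ 2 * B.
Proof.
move=> sp yI hB; have B0 : 0 <= B by apply: le_trans (hB 0%N); exact: sqr_ge0.
have h : `|p.[y]| <= n%:R * Num.sqrt B.
  rewrite (horner_coef_wide _ sp); apply: le_trans (ler_norm_sum _ _ _) _.
  rewrite -[n in n%:R]card_ord mulr_natl -sumr_const; apply: ler_sum => i _.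
  rewrite normrM -[leRHS]mulr1; apply: ler_pM => //.
    by rewrite -[X in X <= _]ger0_norm// -sqrtr_sqr ler_wsqrtr.
  rewrite normrX ger0_norm; last lra.
  by apply: exprn_ile1; lra.
apply: (@le_trans _ _ ((n%:R * Num.sqrt B) ^+ 2)).
  by rewrite ler_sqr ?nnegrE// mulr_ge0// ?sqrtr_ge0.
by rewrite exprMn sqr_sqrtr.
Qed.

Lemma nn_aff a c p : a < c ->
  nn a c (fun x => p.[x]) ^+ 2 = (c - a) * jp 0 1 (1 * (p \Po aff a c) * (p \Po aff a c)).
Proof.
move=> ac; rewrite nn_sqr mul1r -rmorphM/= -jp_aff//.
by apply: eq_itg => x _; rewrite hornerM expr2.
Qed.

(** All three reduce by scaling to [[0, 1]], where the coefficients are bounded by an L2 norm, of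
    weight 1 for the first two and [1 - y] for the last. The weighted one matches the test function
    [(r i.+1 - x) d'], which vanishes at the right end of its cell. *)
Lemma inverse_ineq (n : nat) : exists2 C : R, 0 < C &
  forall a c p, a < c -> (size p <= n)%N ->
  [/\ forall x, a <= x <= c -> `|p.[x]| ^+ 2 <= C / (c - a) * nn a c (fun x => p.[x]) ^+ 2,
      nn a c (fun x => (deriv p).[x]) <= C / (c - a) * nn a c (fun x => p.[x]) &
      (c - a) * nn a c (fun x => p.[x]) ^+ 2 <= C * itg a c (fun x => (c - x) * p.[x] ^+ 2)].
Proof.
have [C1 C10 h1] := @coef_bound n 1 (oner_neq0 _) (fun x _ => ltac:(rewrite hornerC; exact: ler01)).
have w0 : (1 - 'X : {poly R}) != 0.
  apply/eqP => /(congr1 (fun p => p.[0])); rewrite !hornerE => /eqP; by rewrite subr0 oner_eq0.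
have wge x : 0 <= x <= 1 -> 0 <= (1 - 'X : {poly R}).[x] by rewrite !hornerE; lra.
have [C2 C20 h2] := @coef_bound n (1 - 'X) w0 wge.
pose N : R := n%:R; have N0 : 0 <= N by exact: ler0n.
(* One summand for each inequality. The 1 ensures [C <= C ^+ 2], as the bound on the derivative is
   proved in squared form. *)
pose C := 1 + N ^+ 2 * C1 + N ^+ 4 * C1 + N ^+ 2 * C2.
have t1 : 0 <= N ^+ 2 * C1 by rewrite mulr_ge0 ?exprn_ge0.
have t2 : 0 <= N ^+ 4 * C1 by rewrite mulr_ge0 ?exprn_ge0.
have t3 : 0 <= N ^+ 2 * C2 by rewrite mulr_ge0 ?exprn_ge0.
exists C; first by rewrite /C; lra.
move=> a c p ac sp; set q := p \Po aff a c.
have sq : (size q <= n)%N by exact: size_comp_aff.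
set J := jp 0 1 (1 * q * q).
have J0 : 0 <= J.
  by apply: itg_ge0 => x _; rewrite mul1r hornerM -expr2 sqr_ge0.
have l0 : 0 < c - a by lra.
have E := nn_aff p ac; rewrite -/q -/J in E.
have xE x : a <= x <= c -> exists2 y, 0 <= y <= 1 & x = a + (c - a) * y.
  move=> xI; exists ((x - a) / (c - a)); last by field; apply/eqP; lra.
  by rewrite divr_ge0 ?ler_pdivrMr//; lra.
split.
- move=> x /xE[y yI ->]; rewrite E -affE -horner_comp -/q.
  apply: le_trans (poly_sup sq yI (fun j => h1 q j sq)) _.
  rewrite -/J -/N mulrA mulfVK ?gt_eqF// mulrA; apply: ler_wpM2r => //; rewrite /C; lra.
- have Cl : 0 <= C / (c - a) by rewrite divr_ge0//; [rewrite /C|]; lra.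
  rewrite -ler_sqr ?nnegrE; [|exact: nn_ge0|exact: mulr_ge0 Cl (nn_ge0 _ _ _)].
  rewrite exprMn E nn_aff//.
  have -> : 1 * (deriv p \Po aff a c) * (deriv p \Po aff a c) =
    (c - a) ^- 2 *: (deriv q * deriv q).
    rewrite /q deriv_aff -scalerAl -scalerAr !scalerA mul1r.
    rewrite (_ : _ ^- 2 * _ * _ = 1) ?scale1r//; field; exact: lt0r_neq0.
  rewrite jpZ.
  have dB y : 0 <= y <= 1 -> (deriv q).[y] ^+ 2 <= N ^+ 4 * C1 * J.
    move=> yI; rewrite -real_normK ?num_real//.
    have sd : (size (deriv q) <= n)%N.
      case: (eqVneq q 0) => [->|q0]; first by rewrite derivC size_poly0.
      exact: leq_trans (ltnW (lt_size_deriv q0)) sq.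
    apply: le_trans (poly_sup sd yI (_ : forall j, _ <= N ^+ 2 * (C1 * J))) _; last first.
      by rewrite -/N le_eqVlt; apply/orP; left; apply/eqP; ring.
    move=> j; rewrite coef_deriv; case: (ltnP j.+1 n) => jn.
      rewrite -[_ *+ _]mulr_natl normrM exprMn; apply: ler_pM; rewrite ?sqr_ge0//; last exact: h1.
      by rewrite normr_nat ler_sqr ?nnegrE// ler_nat ltnW.
    rewrite nth_default ?(leq_trans sq)// mul0rn normr0 expr0n/=.
    by rewrite !mulr_ge0// exprn_ge0.
  have : jp 0 1 (deriv q * deriv q) <= N ^+ 4 * C1 * J * (1 - 0).
    rewrite -itg_cst//; apply: itg_le; [exact/bm_ig/bm_poly|exact/bm_ig/bm_cst|].
    by move=> x xI; rewrite hornerM -expr2; exact: dB.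
  rewrite subr0 mulr1 => hJ.
  have -> : (C / (c - a)) ^+ 2 * ((c - a) * J) = (c - a) * ((c - a) ^- 2 * (C ^+ 2 * J)).
    by field; exact: lt0r_neq0.
  apply: ler_wpM2l; first exact: ltW.
  apply: ler_wpM2l; first by rewrite invr_ge0 sqr_ge0.
  apply: le_trans hJ _; apply: ler_wpM2r => //.
  apply: (@le_trans _ _ C); first by rewrite /C; lra.
  have C1' : 1 <= C by rewrite /C; lra.
  by rewrite expr2 ler_peMr//; lra.
- have hJ : J <= N ^+ 2 * C2 * jp 0 1 ((1 - 'X) * q * q).
    rewrite -[leRHS]mulr1 -[X in _ <= _ * X](subr0 1) -itg_cst//; apply: itg_le.
    + exact/bm_ig/bm_poly.
    + exact/bm_ig/bm_cst.
    move=> y yI; rewrite mul1r hornerM -expr2 -real_normK ?num_real// -mulrA.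
    by apply: (poly_sup sq yI) => j; exact: h2.
  rewrite E; have -> : itg a c (fun x => (c - x) * p.[x] ^+ 2) =
     (c - a) ^+ 2 * jp 0 1 ((1 - 'X) * q * q).
    have -> : itg a c (fun x => (c - x) * p.[x] ^+ 2) = jp a c ((c%:P - 'X) * p * p).
      by apply: eq_itg => x _; rewrite !hornerM hornerD hornerN hornerC hornerX; ring.
    rewrite jp_aff// (_ : _ \Po _ = (c - a) *: ((1 - 'X) * q * q)).
      by rewrite jpZ; ring.
    rewrite !rmorphM/= -/q rmorphB/= comp_polyC comp_polyX !scalerAl.
    congr (_ * _ * _).
    by rewrite /aff scalerBr -[1]/(1%:P) -!mul_polyC -polyCM mulr1 polyCB; ring.
  rewrite mulrA -expr2 mulrCA; apply: ler_wpM2l; first exact: sqr_ge0.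
  apply: le_trans hJ _; apply: ler_wpM2r; last by rewrite /C; lra.
  apply: itg_ge0 => y yI; rewrite hornerM hornerM -mulrA -expr2 mulr_ge0 ?sqr_ge0//; exact: wge.
Qed.

End PolyIntegral.

Definition grc {R : realType} (a c : R) (f : R -> R) (j : nat) : R :=
  itg 0 1 (fun y => (f (a + (c - a) * y) - f a) * y ^+ j).

Definition gre {R : realType} (k : nat) (a c : R) (j : 'I_k) : {poly R} :=
  ('X * dualb 'X j) \Po ((c - a)^-1 *: ('X - a%:P)).

(* The projection is [f a + y v(y)] in the variable [y = (x - a) / (c - a)],
   where [v] of degree less than [k] represents a moment functional for the
   weight [y] on [0, 1]. *)
Definition grp {R : realType} (k : nat) (a c : R) (f : R -> R) : {poly R} :=
  (f a)%:P + \sum_(j < k) grc a c f j *: gre a c j.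

(** What the change of variables to the reference interval requires of a function on a cell; it also
    implies [bm]. *)
Definition cb {R : realType} (a c : R) (f : R -> R) : Prop :=
  (exists M : R, forall x, a <= x <= c -> `|f x| <= M) /\
  (forall x, a < x < c -> {for x, continuous f}).

(** * Existence, uniqueness and stability of the Gauss-Radau projection *)

Section GaussRadau.
Context {R : realType}.
Implicit Types (a c : R) (f g : R -> R) (p q : {poly R}) (k : nat).

Lemma cb_bm a c f : cb a c f -> bm a c f.
Proof. by move=> [h1 h2]; exact: bm_oo. Qed.

Lemma cb_poly a c p : cb a c (fun x => p.[x]).
Proof.
split; last by move=> x _; exact: cts_poly.
by have [_] := bm_poly a c p.
Qed.

Lemma cbB a c f g : cb a c f -> cb a c g -> cb a c (fun x => f x - g x).
Proof.
move=> hf hg; split; last by move=> x xI; apply: ctsB; [apply hf.2|apply hg.2].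
by have [_] := bmB (cb_bm hf) (cb_bm hg).
Qed.

Lemma cbM a c f g : cb a c f -> cb a c g -> cb a c (fun x => f x * g x).
Proof.
move=> hf hg; split; last by move=> x xI; apply: ctsM; [apply hf.2|apply hg.2].
by have [_] := bmM (cb_bm hf) (cb_bm hg).
Qed.

Lemma cb_sub a c a' c' f : a <= a' -> c' <= c -> cb a c f -> cb a' c' f.
Proof.
move=> aa cc [[M fM] cf]; split; last by move=> x xI; apply: cf; lra.
by exists M => x xI; apply: fM; lra.
Qed.

Lemma X_neq0 : ('X : {poly R}) != 0.
Proof. by rewrite polyX_eq0. Qed.

Lemma X_ge0 (x : R) : 0 <= x <= 1 -> 0 <= ('X : {poly R}).[x].
Proof. by rewrite hornerX => /andP[]. Qed.

Lemma greE k a c (j : 'I_k) y : a < c ->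
  (gre a c j).[a + (c - a) * y] = y * (dualb 'X j).[y].
Proof.
move=> ac; rewrite /gre horner_comp hornerM hornerX !hornerE.
by have -> : (c - a)^-1 * (a + (c - a) * y - a) = y by field; apply/eqP; lra.
Qed.

Lemma size_gre k a c (j : 'I_k) : (size (gre a c j) <= k.+1)%N.
Proof.
have sd : (size (('X : {poly R}) * dualb 'X j)%R <= k.+1)%N.
  apply: leq_trans (size_polyMleq _ _) _; rewrite size_polyX /= ltnS.
  exact: size_dualb.
move: sd; set p := 'X * _ => sp.
rewrite /gre -/p; have [->|p0] := eqVneq p 0; first by rewrite comp_poly0 size_poly0.
set l := _ *: _; have sq : (size l <= 2)%N.
  by apply: leq_trans (size_scale_leq _ _) _; rewrite size_XsubC.
apply: leq_trans (size_comp_poly_leq _ _) _.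
move: sp; have : (0 < size p)%N by rewrite size_poly_gt0.
case: (size p) => // m _ /= mn; apply: leq_trans mn; rewrite ltnS.
by rewrite -[leqRHS]muln1 leq_mul2l; case: (size l) sq => [|[|[|]]]//= _; rewrite orbT.
Qed.

Lemma size_grp k a c f : (size (grp k a c f) <= k.+1)%N.
Proof.
apply: leq_trans (size_polyD _ _) _; rewrite geq_max; apply/andP; split.
  by apply: leq_trans (size_polyC_leq1 _) _.
apply: (leq_trans (size_sum _ _ _)); apply/bigmax_leqP => l _.
by apply: (leq_trans (size_scale_leq _ _)); exact: size_gre.
Qed.

Lemma grpE k a c f y : a < c -> (grp k a c f).[a + (c - a) * y] =
  f a + y * (\sum_(j < k) grc a c f j *: dualb 'X j).[y].
Proof.
move=> ac; rewrite /grp hornerD hornerC !horner_sum mulr_sumr; congr (_ + _).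
by apply: eq_bigr => j _; rewrite !hornerZ greE//; ring.
Qed.

Lemma grp_left k a c f : a < c -> (grp k a c f).[a] = f a.
Proof.
by move=> ac; have := grpE k f 0 ac; rewrite mulr0 addr0 mul0r addr0.
Qed.

(** In the reference variable the projection minus [f a] is [y q(y)]. By duality its pairing with
    [y^j] is [grc a c f j], the corresponding moment of [f - f a], and [v] is a combination of such
    powers. *)
Lemma grp_orth k a c f (v : {poly R}) : a < c -> cb a c f -> (size v <= k)%N ->
  itg a c (fun x => ((grp k a c f).[x] - f x) * v.[x]) = 0.
Proof.
move=> ac cf sv.
have cg : cb a c (fun x => ((grp k a c f).[x] - f x) * v.[x]).
  by apply: cbM (cb_poly _ _ _); apply: cbB cf; exact: cb_poly.
rewrite (itg_aff ac (cb_bm cg) cg.2); apply/eqP; rewrite mulf_eq0; apply/orP; right; apply/eqP.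
set V := v \Po aff a c; have sV : (size V <= k)%N by exact: size_comp_aff.
set q := \sum_(j < k) grc a c f j *: dualb 'X j.
have bf : bm 0 1 (fun y => f (a + (c - a) * y) - f a).
  by apply: bmB (bm_cst _ _ _); exact: bm_aff (cb_bm cf) cf.2.
rewrite (_ : itg _ _ _ = jp 0 1 ('X * V * q) -
   itg 0 1 (fun y => (f (a + (c - a) * y) - f a) * V.[y])); last first.
  rewrite /jp -itgB; [|exact/bm_ig/bm_poly|by apply/bm_ig/bmM => //; exact: bm_poly].
  apply: eq_itg => y yI; rewrite grpE// !hornerM hornerX -/q /V horner_comp affE; ring.
rewrite /q mulr_sumr jp_sum.
have -> : itg 0 1 (fun y => (f (a + (c - a) * y) - f a) * V.[y]) =
    \sum_(j < k) V`_j * grc a c f j.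
  transitivity (\sum_(j < k) itg 0 1 (fun y =>
      V`_j * ((f (a + (c - a) * y) - f a) * y ^+ j))); last first.
    by apply: eq_bigr => j _; rewrite itgZ//; apply/bm_ig/bmM => //; apply/bmX/bm_id.
  rewrite -itg_sum; last by move=> j; apply/igZ/bm_ig/bmM => //; apply/bmX/bm_id.
  apply: eq_itg => y _; rewrite (horner_coef_wide _ sV) mulr_sumr.
  by apply: eq_bigr => j _; ring.
apply/eqP; rewrite subr_eq0; apply/eqP; apply: eq_bigr => j _.
by rewrite -scalerAr jpZ dualbE ?X_neq0//; [ring|exact: X_ge0].
Qed.

(** The difference of two candidates vanishes at [a], so it is [(x - a) w] with [w] an admissible
    test function. Testing with [w] gives that the integral of [(x - a) w^2] is 0. *)
Lemma grp_uniq k a c f q : a < c -> cb a c f -> (size q <= k.+1)%N -> q.[a] = f a ->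
  (forall v : {poly R}, (size v <= k)%N -> itg a c (fun x => (q.[x] - f x) * v.[x]) = 0) ->
  q = grp k a c f.
Proof.
move=> ac cf sq qa qo; apply/eqP; rewrite -subr_eq0; set e := q - _.
have ea : root e a by rewrite /root hornerD hornerN grp_left// qa subrr.
have [w ew] := factor_theorem e a ea.
have se : (size e <= k.+1)%N.
  by apply: leq_trans (size_polyD _ _) _; rewrite geq_max sq size_polyN size_grp.
have sw : (size w <= k)%N.
  have [->|w0] := eqVneq w 0; first by rewrite size_poly0.
  by move: se; rewrite ew size_Mmonic ?monicXsubC// size_XsubC addn2.
have : jp a c (e * w) = 0.
  transitivity (itg a c (fun x => (q.[x] - f x) * w.[x]) -
     itg a c (fun x => ((grp k a c f).[x] - f x) * w.[x])).
    rewrite -itgB.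
    - by apply: eq_itg => x _; rewrite hornerM hornerD hornerN; ring.
    - by apply/bm_ig/bmM; [apply: bmB (cb_bm cf)|]; exact: bm_poly.
    - by apply/bm_ig/bmM; [apply: bmB (cb_bm cf)|]; exact: bm_poly.
  by rewrite qo// grp_orth// subrr.
move/(jp_eq0 ac) => /(_ _)/eqP; rewrite ew !mulf_eq0 polyXsubC_eq0 orbF orbb => -> //.
move=> x xI; rewrite !hornerM hornerXsubC mulrAC -expr2 mulr_ge0 ?sqr_ge0//; lra.
Qed.

Lemma grp_poly k a c p : a < c -> (size p <= k.+1)%N -> grp k a c (fun x => p.[x]) = p.
Proof.
move=> ac sp; apply/esym; apply: grp_uniq => //; first exact: cb_poly.
move=> v _; rewrite -[RHS](mul0r (c - a)) -itg_cst; last exact: ltW.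
by apply: eq_itg => x _; rewrite subrr mul0r.
Qed.

Lemma grcB a c f g j : a < c -> cb a c f -> cb a c g ->
  grc a c (fun x => f x - g x) j = grc a c f j - grc a c g j.
Proof.
move=> ac cf cg; rewrite /grc -itgB.
- by apply: eq_itg => y _; ring.
- apply/bm_ig/bmM; last exact/bmX/bm_id.
  by apply: bmB (bm_cst _ _ _); exact: bm_aff (cb_bm cf) cf.2.
- apply/bm_ig/bmM; last exact/bmX/bm_id.
  by apply: bmB (bm_cst _ _ _); exact: bm_aff (cb_bm cg) cg.2.
Qed.

Lemma grpB k a c f g : a < c -> cb a c f -> cb a c g ->
  grp k a c (fun x => f x - g x) = grp k a c f - grp k a c g.
Proof.
move=> ac cf cg; rewrite /grp; under eq_bigr do rewrite grcB// scalerBl.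
by rewrite sumrB polyCB; ring.
Qed.

Lemma grc_bound a c f j M : a < c -> cb a c f ->
  (forall x, a <= x <= c -> `|f x - f a| <= M) -> `|grc a c f j| <= M.
Proof.
move=> ac cf hM; rewrite -[leRHS]mulr1 -[X in M * X](subr0 1); apply: itg_bound => //.
  apply/bm_ig/bmM; last exact/bmX/bm_id.
  by apply: bmB (bm_cst _ _ _); exact: bm_aff (cb_bm cf) cf.2.
move=> y yI; rewrite normrM -[leRHS]mulr1; apply: ler_pM => //.
  by apply: hM; apply: aff_in => //; exact: ltW.
by rewrite normrX exprn_ile1// ger0_norm; lra.
Qed.

(** The moments only see [f - f a], hence a bound by the oscillation from the left end. The shape
    functions are images of fixed polynomials of [[0, 1]], so the constant is the same for all
    cells, and each derivative costs the length of the cell. *)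
Lemma grp_stable k : exists2 C : R, 0 < C & forall a c f M, a < c -> cb a c f ->
  (forall x, a <= x <= c -> `|f x - f a| <= M) ->
  forall x, a <= x <= c -> `|(grp k a c f).[x] - f a| <= C * M /\
    `|(deriv (grp k a c f)).[x]| <= C * M / (c - a).
Proof.
pose D : 'I_k -> {poly R} := fun j => 'X * dualb 'X j.
have bD (p : {poly R}) : exists2 B : R, 0 <= B & forall y, 0 <= y <= 1 -> `|p.[y]| <= B.
  have [_ [B hB]] := bm_poly 0 1 p; exists B => //.
  by apply: le_trans (normr_ge0 _) (hB 0 _); lra.
have /choice[B1 hB1] : forall j, exists B : R, 0 <= B /\ forall y, 0 <= y <= 1 -> `|(D j).[y]| <= B.
  by move=> j; have [B h1 h2] := bD (D j); exists B.
have /choice[B2 hB2] : forall j, exists B : R, 0 <= B /\ forall y, 0 <= y <= 1 -> `|(deriv (D j)).[y]| <= B.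
  by move=> j; have [B h1 h2] := bD (deriv (D j)); exists B.
pose C := 1 + \sum_j B1 j + \sum_j B2 j.
have s1 : 0 <= \sum_j B1 j by apply: sumr_ge0 => j _; case: (hB1 j).
have s2 : 0 <= \sum_j B2 j by apply: sumr_ge0 => j _; case: (hB2 j).
exists C; first by rewrite /C; lra.
move=> a c f M ac cf hM x xI.
have M0 : 0 <= M by apply: le_trans (normr_ge0 _) (hM x xI).
have [y yI ->] : exists2 y, 0 <= y <= 1 & x = a + (c - a) * y.
  exists ((x - a) / (c - a)); last by field; apply/eqP; lra.
  by rewrite divr_ge0 ?ler_pdivrMr//; lra.
split.
  rewrite grpE// addrAC subrr add0r horner_sum mulr_sumr.
  apply: le_trans (ler_norm_sum _ _ _) _.
  apply: (@le_trans _ _ (\sum_j B1 j * M)).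
    apply: ler_sum => j _; rewrite hornerZ mulrCA normrM mulrC; apply: ler_pM => //.
      by have := (hB1 j).2 y yI; rewrite /D hornerM hornerX.
    exact: grc_bound.
  by rewrite -mulr_suml; apply: ler_wpM2r => //; rewrite /C; lra.
have dE : (deriv (grp k a c f)).[a + (c - a) * y] =
    (c - a)^-1 * \sum_(j < k) grc a c f j * (deriv (D j)).[y].
  rewrite /grp derivD derivC add0r linear_sum horner_sum mulr_sumr.
  apply: eq_bigr => j _; rewrite -[X in X.[_]]/(deriv (grc a c f j *: gre a c j)) derivZ hornerZ /gre deriv_comp hornerM horner_comp -/(D j).
  rewrite derivZ derivXsubC !hornerZ hornerXsubC hornerC.
  have -> : (c - a)^-1 * (a + (c - a) * y - a) = y by field; apply/eqP; lra.
  ring.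
rewrite dE normrM [`|_^-1|]ger0_norm ?invr_ge0; last lra.
rewrite mulrC; apply: ler_wpM2r; first by rewrite invr_ge0; lra.
apply: le_trans (ler_norm_sum _ _ _) _.
apply: (@le_trans _ _ (\sum_j B2 j * M)).
  apply: ler_sum => j _; rewrite normrM mulrC; apply: ler_pM => //.
    exact: (hB2 j).2.
  exact: grc_bound.
by rewrite -mulr_suml; apply: ler_wpM2r => //; rewrite /C; lra.
Qed.

(** The projection reproduces [p], so stability is applied to [f - p], which differs from its left
    value by at most [2 M]. *)
Lemma grp_best k : exists2 C : R, 0 < C & forall a c f p M, a < c -> cb a c f ->
  (size p <= k.+1)%N -> (forall x, a <= x <= c -> `|f x - p.[x]| <= M) ->
  forall x, a <= x <= c -> `|f x - (grp k a c f).[x]| <= C * M.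
Proof.
have [C0 C00 h] := grp_stable k; exists (2 + 2 * C0); first lra.
move=> a c f p M ac cf sp fM x xI.
have cp := cb_poly a c p; have cfp := cbB cf cp.
have aI : a <= a <= c by lra.
have fM' y : a <= y <= c -> `|(f y - p.[y]) - (f a - p.[a])| <= 2 * M.
  by move=> yI; have := fM y yI; have := fM a aI; have := ler_normB (f y - p.[y]) (f a - p.[a]); lra.
have [h1 _] := h a c _ _ ac cfp fM' x xI.
rewrite grpB// grp_poly// hornerD hornerN in h1.
have e1 := fM x xI; have e2 := fM a aI.
rewrite (_ : f x - _ = (f x - p.[x]) - (f a - p.[a]) -
  ((grp k a c f).[x] - p.[x] - (f a - p.[a]))); last by ring.
apply: le_trans (ler_normB _ _) _.
have := fM' x xI; lra.
Qed.

End GaussRadau.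

(** * Broken functions and the upwind form *)

(** The cells are half-open, so that exactly one term is active at each point of [[0, b[]. At [b]
    the value is 0, which is why comparisons with [pw] are made away from right ends. *)
Definition pw {R : realType} (N : nat) (r : nat -> R) (F : nat -> R -> R) (x : R) : R :=
  \sum_(i < N) \1_(`[r i, r i.+1[%classic : set R) x * F i x.

Definition jmp {R : realType} (N : nat) (r : nat -> R) (v : nat -> R -> R) (i : nat) : R :=
  (if (i.+1 < N)%N then v i.+1 (r i.+1) else 0) - v i (r i.+1).

(* The outer value of [v] at [b] is taken to be 0. *)
Definition upw {R : realType} (N : nat) (r : nat -> R) (g : R -> R)
    (v dv f : nat -> R -> R) : R :=
  2^-1 * \sum_(i < N) (itg (r i) (r i.+1) (fun x => g x * dv i x * f i x)
    + g (r i.+1) * jmp N r v i * f i (r i.+1)).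

(* Density of the variation of [v]: the jump at the right end of an element is
   spread over this element. *)
Definition vard {R : realType} (N : nat) (r : nat -> R) (v dv : nat -> R -> R)
    (i : nat) (x : R) : R :=
  `|dv i x| + `|jmp N r v i / (r i.+1 - r i)|.

Section Mesh.
Context {R : realType} (b : R) (N : nat) (r : nat -> R).
Hypothesis hm : is_mesh b N r.
Implicit Types (f g : R -> R) (v dv : nat -> R -> R).

Lemma mesh_lt i : (i < N)%N -> r i < r i.+1.
Proof. by case: hm => _ _ h; exact: h. Qed.

Lemma mesh_le i j : (i <= j)%N -> (j <= N)%N -> r i <= r j.
Proof.
elim: j => [|j ih]; first by rewrite leqn0 => /eqP->.
rewrite leq_eqVlt => /orP[/eqP->//|]; rewrite ltnS => ij jN.
by apply: le_trans (ih ij (ltnW jN)) _; apply/ltW/mesh_lt.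
Qed.

Lemma mesh_ge0 i : (i <= N)%N -> 0 <= r i.
Proof. by move=> iN; have := mesh_le (leq0n i) iN; case: hm => ->. Qed.

Lemma mesh_leb i : (i <= N)%N -> r i <= b.
Proof. by move=> iN; have := mesh_le iN (leqnn N); case: hm => _ ->. Qed.

Lemma mesh_in i x : (i < N)%N -> r i <= x <= r i.+1 -> 0 <= x <= b.
Proof.
by move=> iN xI; have := mesh_ge0 (ltnW iN); have := mesh_leb iN; lra.
Qed.

Lemma bm_cell i f : (i < N)%N -> bm 0 b f -> bm (r i) (r i.+1) f.
Proof. by move=> iN; apply: bm_sub; [exact: mesh_ge0 (ltnW iN)|exact: mesh_leb]. Qed.

Lemma cell_exists x : 0 <= x < b -> exists2 i, (i < N)%N & r i <= x < r i.+1.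
Proof.
case: hm => r0 rN _ xI.
suff h j : (j <= N)%N -> x < r j -> exists2 i, (i < j)%N & r i <= x < r i.+1.
  by apply: h (leqnn N) _; rewrite rN; lra.
elim: j => [|j ih] jN xj; first by rewrite r0 in xj; lra.
case: (ltP x (r j)) => h; last by exists j => //; rewrite h.
by have [i ij xi] := ih (ltnW jN) h; exists i => //; exact: ltnW.
Qed.

Lemma pwE F i x : (i < N)%N -> r i <= x < r i.+1 -> pw N r F x = F i x.
Proof.
move=> iN xI; rewrite /pw (bigD1 (Ordinal iN))//= indicE mem_set ?mul1r; last first.
  by rewrite /= in_itv.
rewrite big1 ?addr0// => j ji; rewrite indicE memNset ?mul0r//= in_itv/= => xj.
have : (j < i)%N || (i < j)%N by rewrite -neq_ltn.
case/orP => h.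
  by have := mesh_le h (ltnW iN); lra.
by have := mesh_le h (ltnW (ltn_ord j)); lra.
Qed.

Lemma bm_indic (A : set R) : measurable A -> bm 0 b (\1_A : R -> R).
Proof.
move=> mA; split; first exact: measurable_indic.
by exists 1 => x _; rewrite indicE; case: (_ \in _); rewrite ?normr1 ?normr0.
Qed.

Lemma bm_pw F : (forall i, bm 0 b (F i)) -> bm 0 b (pw N r F).
Proof.
by move=> hF; apply: bm_sum => i; apply: bmM => //; exact: bm_indic.
Qed.

Lemma itg_cells f : ig 0 b f -> itg 0 b f = \sum_(i < N) itg (r i) (r i.+1) f.
Proof.
move=> igf; case: hm => r0 rN _.
suff h j : (j <= N)%N -> itg 0 (r j) f = \sum_(i < j) itg (r i) (r i.+1) f.
  by rewrite -h// rN.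
elim: j => [|j ih] jN; first by rewrite r0 itgxx big_ord0.
rewrite big_ord_recr/= -ih ?(ltnW jN)//; apply: itg_split.
- exact: mesh_ge0 (ltnW jN).
- exact/ltW/mesh_lt.
- by apply: ig_sub igf => //; exact: mesh_leb.
Qed.

Lemma nn_pw F i : (i < N)%N -> (forall i, bm 0 b (F i)) ->
  nn (r i) (r i.+1) (pw N r F) = nn (r i) (r i.+1) (F i).
Proof.
move=> iN hF; apply/eqP; rewrite eq_le; apply/andP; split; apply: nn_le;
  try exact/(bm_cell iN)/bm_pw; try exact/(bm_cell iN);
  by move=> x xI; rewrite (@pwE _ i)//; lra.
Qed.

Lemma nn_cells f : bm 0 b f -> nn 0 b f ^+ 2 = \sum_(i < N) nn (r i) (r i.+1) f ^+ 2.
Proof.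
move=> bf; rewrite nn_sqr itg_cells; last exact/bm_ig/bmX.
by apply: eq_bigr => i _; rewrite nn_sqr.
Qed.

Lemma sum_CS (I : finType) (x y : I -> R) :
  (\sum_i x i * y i) ^+ 2 <= (\sum_i x i ^+ 2) * (\sum_i y i ^+ 2).
Proof.
set A := \sum_i x i ^+ 2; set B := \sum_i y i ^+ 2; set C := \sum_i _.
have A0 : 0 <= A by apply: sumr_ge0 => i _; exact: sqr_ge0.
have key s t : 0 <= s ^+ 2 * A - 2 * s * t * C + t ^+ 2 * B.
  have : 0 <= \sum_i (s * x i - t * y i) ^+ 2 by apply: sumr_ge0 => i _; exact: sqr_ge0.
  rewrite (_ : \sum_i _ = s ^+ 2 * A - 2 * s * t * C + t ^+ 2 * B)//.
  rewrite !mulr_sumr -sumrB -big_split/=; apply: eq_bigr => i _; ring.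
have [A00|A1] := eqVneq A 0.
  have x0 i : x i = 0.
    have : \sum_i x i ^+ 2 == 0 by rewrite -/A A00.
    rewrite psumr_eq0; last by move=> j _; exact: sqr_ge0.
    by move/allP => /(_ i (mem_index_enum _))/=; rewrite sqrf_eq0 => /eqP.
  by rewrite A00 mul0r /C big1 ?expr0n// => i _; rewrite x0 mul0r.
have A2 : 0 < A by rewrite lt_neqAle eq_sym A1.
have := key C A; rewrite (_ : _ + _ = A * (A * B - C ^+ 2)); last by ring.
rewrite pmulr_rge0//; lra.
Qed.

Lemma sum_nn_CS f g : bm 0 b f -> bm 0 b g ->
  \sum_(i < N) nn (r i) (r i.+1) f * nn (r i) (r i.+1) g <= nn 0 b f * nn 0 b g.
Proof.
move=> bf bg; rewrite -ler_sqr ?nnegrE ?mulr_ge0 ?nn_ge0//; last first.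
  by apply: sumr_ge0 => i _; rewrite mulr_ge0 ?nn_ge0.
by rewrite exprMn !nn_cells//; exact: sum_CS.
Qed.

(** On a cell, [2 g p p' = (g p^2)' - A p^2], and the jump term is half of [g] times the difference
    of the squares of the two traces, minus a square. Both discarded terms have the good sign
    because [g] is nonnegative and nondecreasing; the rest telescopes. *)
Lemma upw_diss g A (p : nat -> {poly R}) : prim 0 b g A ->
  (forall x, 0 <= x <= b -> 0 <= A x) -> (forall x, 0 <= x <= b -> 0 <= g x) ->
  upw N r g (fun i x => (p i).[x]) (fun i x => (deriv (p i)).[x]) (fun i x => (p i).[x]) <= 0.
Proof.
move=> pg A0 g0; rewrite /upw pmulr_rle0; last by rewrite invr_gt0.
(* The square of the trace from the right of each node, weighted by [g]; it is 0 at the last node,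
   in accordance with the outer value 0. *)
pose s i := if (i < N)%N then g (r i) * (p i).[r i] ^+ 2 else 0.
apply: (@le_trans _ _ (\sum_(i < N) 2^-1 * (s i.+1 - s i))).
  apply: ler_sum => -[i iN] _ /=.
  have ri := mesh_lt iN.
  have pp : prim (r i) (r i.+1) (fun x => (p i).[x]) (fun x => (deriv (p i)).[x]).
    apply: prim_FTC; [exact: lip_poly|exact: bm_poly|by move=> x _; exact: cts_poly|].
    by move=> x _; exact: drv_poly.
  have pg' := prim_sub (mesh_ge0 (ltnW iN)) (mesh_leb iN) pg.
  have [bk /(_ _ _ (lexx _) (ltW ri) (lexx _))] := primM pg' (primM pp pp).
  have bA : bm (r i) (r i.+1) A by case: pg'.
  have bg : bm (r i) (r i.+1) g by apply/bm_lip/(prim_lip pg').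
  have bp := bm_poly (r i) (r i.+1) (p i).
  have bdp := bm_poly (r i) (r i.+1) (deriv (p i)).
  have i1 : ig (r i) (r i.+1) (fun x => A x * (p i).[x] ^+ 2) by exact/bm_ig/bmM/bmX.
  have i2 : ig (r i) (r i.+1) (fun x => 2 * (g x * (deriv (p i)).[x] * (p i).[x])).
    by apply/igZ/bm_ig/bmM => //; exact: bmM.
  rewrite [X in _ = X -> _](_ : _ = itg (r i) (r i.+1) (fun x => A x * (p i).[x] ^+ 2 +
     2 * (g x * (deriv (p i)).[x] * (p i).[x]))); last by apply: eq_itg => x _; ring.
  rewrite (itgD i1 i2) itgZ; last by apply/bm_ig/bmM => //; exact: bmM.
  have : 0 <= itg (r i) (r i.+1) (fun x => A x * (p i).[x] ^+ 2).
    apply: itg_ge0 => x xI; rewrite mulr_ge0 ?sqr_ge0// A0//.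
    exact: mesh_in xI.
  have gi : 0 <= g (r i.+1) by apply: g0; apply: (@mesh_in i) => //; lra.
  rewrite /s iN /jmp; set I1 := itg _ _ _; set I2 := itg _ _ _.
  set y := (p i).[r i.+1]; set z := (p i).[r i].
  case: ifP => _; last by move=> h e; nra.
  set e := (p i.+1).[_]; have := sqr_ge0 (e - y); nra.
rewrite -mulr_sumr -(big_mkord xpredT (fun i => s i.+1 - s i)) telescope_sumr//.
rewrite /s ltnn sub0r mulrN oppr_le0 mulr_ge0//; case: ifP => // N0.
rewrite mulr_ge0 ?sqr_ge0// g0//; apply: (@mesh_in 0) => //.
by rewrite lexx ltW// mesh_lt.
Qed.

Section UpwBound.
Context (v dv : nat -> R -> R).
Hypothesis bdv : forall i, bm 0 b (dv i).

Lemma bm_vard i : bm 0 b (vard N r v dv i).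
Proof. by apply: bmD; [exact: bm_norm|exact: bm_cst]. Qed.

Definition vr := nn 0 b (pw N r (vard N r v dv)).

Lemma vr_ge0 : 0 <= vr.
Proof. exact: nn_ge0. Qed.

Lemma dv_le_vard i : (i < N)%N ->
  nn (r i) (r i.+1) (dv i) <= nn (r i) (r i.+1) (pw N r (vard N r v dv)).
Proof.
move=> iN; rewrite nn_pw//; last exact: bm_vard.
apply: nn_le; [exact: bm_cell|exact/bm_cell/bm_vard|].
by move=> x _; rewrite [leRHS]ger0_norm ?addr_ge0// lerDl.
Qed.

(** On a cell of length [l] the constant [J / l] has norm [|J| / sqrt l]; this is the reason for the
    scaling of the jumps in [vard]. *)
Lemma jmp_le_vard i : (i < N)%N ->
  `|jmp N r v i| <= Num.sqrt (r i.+1 - r i) * nn (r i) (r i.+1) (pw N r (vard N r v dv)).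
Proof.
move=> iN; have ri := mesh_lt iN; rewrite nn_pw//; last exact: bm_vard.
have h0 : 0 < r i.+1 - r i by lra.
apply: (@le_trans _ _ (Num.sqrt (r i.+1 - r i) *
    nn (r i) (r i.+1) (fun=> jmp N r v i / (r i.+1 - r i)))).
  rewrite nn_cst; last exact: ltW.
  rewrite mulrCA -expr2 sqr_sqrtr; last exact: ltW.
  by rewrite normrM normfV (gtr0_norm h0) mulfVK// gt_eqF.
apply: ler_wpM2l; first exact: sqrtr_ge0.
apply: nn_le; [exact: bm_cst|exact/bm_cell/bm_vard|].
by move=> x _; rewrite [leRHS]ger0_norm ?addr_ge0// lerDr.
Qed.

(** The jump brings a factor [sqrt l], for a cell of length [l], and the inverse inequality for the
    trace of [p] brings [1 / sqrt l]. They cancel cell by cell, so nothing is asked of the ratio of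
    neighbouring cells. *)
Lemma upw_bound C n : 0 < C ->
  (forall a c (p : {poly R}), a < c -> (size p <= n)%N ->
    forall x, a <= x <= c -> `|p.[x]| ^+ 2 <= C / (c - a) * nn a c (fun x => p.[x]) ^+ 2) ->
  forall g M (p : nat -> {poly R}), 0 <= M -> bm 0 b g ->
  (forall x, 0 <= x <= b -> `|g x| <= M) -> (forall i, (i < N)%N -> (size (p i) <= n)%N) ->
  `|upw N r g v dv (fun i x => (p i).[x])| <=
    M * (1 + C) * vr * nn 0 b (pw N r (fun i x => (p i).[x])).
Proof.
move=> C0 inv g M p M0 bg gM sp.
set P := pw N r (fun i x => (p i).[x]).
have bp i : bm 0 b (fun x => (p i).[x]) by exact: bm_poly.
have bP : bm 0 b P by exact: bm_pw.
set V := pw N r (vard N r v dv).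
have bV : bm 0 b V by exact/bm_pw/bm_vard.
have cell (i : 'I_N) : `|itg (r i) (r i.+1) (fun x => g x * dv i x * (p i).[x])
      + g (r i.+1) * jmp N r v i * (p i).[r i.+1]| <=
    M * (2 + C) * (nn (r i) (r i.+1) V * nn (r i) (r i.+1) P).
  have iN := ltn_ord i; have ri := mesh_lt iN.
  have h0 : 0 < r i.+1 - r i by lra.
  have := dv_le_vard iN; have := jmp_le_vard iN; rewrite -/V.
  set m := nn _ _ V => jm dm.
  rewrite (nn_pw iN bp); set q := nn _ _ (fun x => (p i).[x]).
  have m0 : 0 <= m by exact: nn_ge0.
  have q0 : 0 <= q by exact: nn_ge0.
  have e1 : `|itg (r i) (r i.+1) (fun x => g x * dv i x * (p i).[x])| <= M * (m * q).
    apply: le_trans (nn_CS _ _) _; try exact: bm_cell.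
      by apply: bm_cell => //; exact: bmM.
    rewrite mulrA; apply: ler_pM; rewrite ?nn_ge0//.
    apply: (@le_trans _ _ (nn (r i) (r i.+1) (fun x => M * dv i x))).
      apply: nn_le; [by apply: bm_cell => //; exact: bmM|by apply: bm_cell => //; apply: bmM => //; exact: bm_cst|].
      move=> x xI; rewrite !normrM (ger0_norm M0); apply: ler_wpM2r => //; apply: gM.
      by apply: (mesh_in iN); lra.
    rewrite nnZ; last exact: bm_cell.
    by rewrite (ger0_norm M0); apply: ler_wpM2l.
  have e2 : `|g (r i.+1) * jmp N r v i * (p i).[r i.+1]| <= M * (1 + C) * (m * q).
    have rI : r i <= r i.+1 <= r i.+1 by lra.
    have h1 := inv _ _ _ ri (sp i iN) (r i.+1) rI.
    rewrite !normrM -!mulrA; apply: ler_pM => //.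
      exact/gM/(mesh_in iN rI).
    rewrite -ler_sqr ?nnegrE ?mulr_ge0//; last by rewrite addr_ge0// ltW.
    rewrite exprMn.
    apply: (@le_trans _ _ (((r i.+1 - r i) * m ^+ 2) * (C / (r i.+1 - r i) * q ^+ 2))).
      apply: ler_pM; rewrite ?sqr_ge0//.
      apply: (@le_trans _ _ ((Num.sqrt (r i.+1 - r i) * m) ^+ 2)).
        by rewrite ler_sqr ?nnegrE// mulr_ge0 ?sqrtr_ge0.
      by rewrite exprMn sqr_sqrtr// ltW.
    rewrite [leLHS](_ : _ = C * (m ^+ 2 * q ^+ 2)); last by field; exact: lt0r_neq0.
    rewrite exprMn exprMn; apply: ler_wpM2r; first by rewrite mulr_ge0 ?sqr_ge0.
    by nra.
  apply: le_trans (ler_normD _ _) _; apply: le_trans (lerD e1 e2) _.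
  by rewrite le_eqVlt; apply/orP; left; apply/eqP; ring.
rewrite /upw normrM ger0_norm ?invr_ge0//.
have CS := sum_nn_CS bV bP; rewrite -/vr in CS.
apply: (@le_trans _ _ (2^-1 * (M * (2 + C) * (vr * nn 0 b P)))).
  apply: ler_wpM2l; first by rewrite invr_ge0.
  apply: le_trans (ler_norm_sum _ _ _) _.
  apply: (@le_trans _ _ (\sum_(i < N) M * (2 + C) * (nn (r i) (r i.+1) V * nn (r i) (r i.+1) P))).
    exact: ler_sum.
  by rewrite -mulr_sumr; apply: ler_wpM2l CS; rewrite mulr_ge0//; lra.
have : 0 <= M * vr * nn 0 b P by rewrite !mulr_ge0 ?nn_ge0.
rewrite -subr_ge0 => h; rewrite -subr_ge0.
rewrite (_ : _ - _ = M * vr * nn 0 b P * (C / 2)); last by field.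
by rewrite mulr_ge0//; lra.
Qed.

End UpwBound.

Lemma aa_lip f L : 0 < b -> 0 <= L -> bm 0 b f ->
  (forall x y, 0 <= x <= b -> 0 <= y <= b -> `|f x - f y| <= L * `|x - y|) ->
  forall x, 0 <= x <= b -> `|aa f x| <= L.
Proof.
move=> hb L0 bf hf x xI; have [->|x0] := eqVneq x 0; first by rewrite /aa invr0 mulr0 normr0.
have xp : 0 < x by rewrite lt_neqAle eq_sym x0; lra.
have ix : ig 0 x f by apply: ig_sub (bm_ig bf); lra.
have e : f x - av f x = itg 0 x (fun s => f x - f s) / x.
  rewrite (itgB (bm_ig (bm_cst 0 x (f x))) ix) itg_cst; last exact: ltW.
  by rewrite /av; field.
rewrite /aa e !normrM normfV (gtr0_norm xp).
rewrite ler_pdivrMr// ler_pdivrMr//.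
rewrite -[X in _ * X](subr0 x); apply: itg_bound; first exact: ltW.
  by apply: igB => //; exact/bm_ig/bm_cst.
move=> s sI; apply: le_trans (hf _ _ xI _) _; first lra.
by apply: ler_wpM2l => //; rewrite ger0_norm; lra.
Qed.

Lemma adm_bounded f M : 0 < b -> bm 0 b f -> (forall x, 0 < x < b -> `|aa f x| <= M) -> adm b f.
Proof.
move=> hb bf h; split=> //; split.
  apply: measurable_funM; last exact: bm_inv.
  by have [] := bmB bf (bm_av bf).
exists (`|M| + `|aa f 0| + `|aa f b|) => x xI.
have [->|x0] := eqVneq x 0; first by have := normr_ge0 M; have := normr_ge0 (aa f b); lra.
have [->|xb] := eqVneq x b; first by have := normr_ge0 M; have := normr_ge0 (aa f 0); lra.
have xI' : 0 < x < b by rewrite !lt_neqAle eq_sym x0 xb/=.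
have := h x xI'; have := ler_norm M; have := normr_ge0 (aa f b); have := normr_ge0 (aa f 0); lra.
Qed.

(** * The broken energy norm controls [aa] *)

Section Embedding.
Context (v dv : nat -> R -> R) (hb : 0 < b).
Hypothesis bv : forall i, bm 0 b (v i).
Hypothesis bdv : forall i, bm 0 b (dv i).
Hypothesis pv : forall i, (i < N)%N -> prim (r i) (r i.+1) (v i) (dv i).

Let J i := jmp N r v i / (r i.+1 - r i).
Let m := pw N r (fun i x => dv i x + J i).
Let mu := pw N r (vard N r v dv).

Let bJ i : bm 0 b (fun x => dv i x + J i).
Proof. by apply: bmD (bdv i) _; exact: bm_cst. Qed.

Let bm_m : bm 0 b m.
Proof. exact: bm_pw. Qed.

Let bm_mu : bm 0 b mu.
Proof. exact/bm_pw/bm_vard. Qed.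

Lemma pw_vard_ge0 x : 0 <= pw N r (vard N r v dv) x.
Proof.
apply: sumr_ge0 => i _; by rewrite mulr_ge0// addr_ge0.
Qed.

(** The ramp [J i (x - r i)] starts from 0 on each cell and reaches the jump at its right end, so
    adding it makes the function continuous across the nodes, with density [m]. *)
Lemma continuous_part i x : (i < N)%N -> r i <= x <= r i.+1 ->
  v i x + J i * (x - r i) = v 0%N 0 + itg 0 x m.
Proof.
have base j : (j < N)%N -> v j (r j) = v 0%N 0 + itg 0 (r j) m ->
  forall y, r j <= y <= r j.+1 -> v j y + J j * (y - r j) = v 0%N 0 + itg 0 y m.
  move=> jN e y yI; have rj := mesh_lt jN.
  have y0 := mesh_in jN yI.
  rewrite (@itg_split _ 0 (r j) y); [|exact: mesh_ge0 (ltnW jN)|lra|]; last first.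
    by apply: ig_sub (bm_ig bm_m); lra.
  rewrite addrA -e.
  have -> : itg (r j) y m = itg (r j) y (fun x => dv j x + J j).
    apply: eq_itg_oo.
    - by apply: ig_sub (bm_ig bm_m); have := mesh_ge0 (ltnW jN); lra.
    - by apply: ig_sub (bm_ig (bJ j)); have := mesh_ge0 (ltnW jN); lra.
    by move=> z zI; rewrite /m (@pwE _ j)//; lra.
  have [_ /(_ (r j) y (lexx _) _ _)] := pv jN.
  move=> h; rewrite itgD; last 2 first.
  - by apply: ig_sub (bm_ig (bdv j)); have := mesh_ge0 (ltnW jN); lra.
  - exact/bm_ig/bm_cst.
  rewrite -h; [|lra..]; rewrite itg_cst; [ring|lra].
elim: i x => [|i ih] x iN xI; apply: base => //.
  by case: hm => -> _ _; rewrite itgxx addr0.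
have iN' := ltnW iN; have ri := mesh_lt iN'.
have /ih -/(_ iN') : r i <= r i.+1 <= r i.+1 by lra.
rewrite -/(r i.+1) => <-; rewrite /J /jmp iN divfK; first by ring.
by rewrite gt_eqF//; lra.
Qed.

(* Outside of its jumps, the broken function is the primitive of [m] minus
   the function [J (x - r_i)], which is at most [x mu(x)]. *)
Lemma aa_pw_le x : 0 < x < b -> `|aa (pw N r v) x| <= 2 * av mu x + mu x.
Proof.
move=> xI; have bV : bm 0 b (pw N r v) by exact: bm_pw.
pose j x := pw N r (fun i x => J i * (x - r i)) x.
have bj : bm 0 b j.
  by apply: bm_pw => i; apply: bmM (bm_cst _ _ _) _; apply: bmB (bm_id _ _) (bm_cst _ _ _).
have VE y : 0 <= y < b -> pw N r v y = v 0%N 0 + itg 0 y m - j y.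
  move=> /cell_exists[i iN yI]; rewrite /j !(@pwE _ i)//.
  by rewrite -(@continuous_part i)//; [ring|lra].
have mu0 y : 0 <= mu y by exact: pw_vard_ge0.
have jle y : 0 <= y < b -> `|j y| <= y * mu y.
  move=> yI; have [i iN yi] := cell_exists yI; rewrite /j /mu !(@pwE _ i)//.
  rewrite normrM mulrC; apply: ler_pM => //; last by rewrite lerDr.
  by have := mesh_ge0 (ltnW iN); rewrite ger0_norm; lra.
have mle y : 0 <= y < b -> `|m y| <= mu y.
  move=> yI; have [i iN yi] := cell_exists yI; rewrite /m /mu !(@pwE _ i)//.
  exact: ler_normD.
have igx f : bm 0 b f -> ig 0 x f by move=> bf; apply: ig_sub (bm_ig bf); lra.
pose I := itg 0 x mu.
have I0 : 0 <= I by apply: itg_ge0.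
have Wle s : 0 <= s <= x -> `|itg 0 x m - itg 0 s m| <= I.
  move=> sI; rewrite (@itg_split _ 0 s x m); [|lra|lra|exact: igx].
  rewrite addrAC subrr add0r; apply: le_trans (itg_norm _) _.
    by apply: ig_sub (bm_ig bm_m); lra.
  apply: (@le_trans _ _ (itg s x mu)).
    apply: itg_le; [by apply: ig_norm; apply: ig_sub (bm_ig bm_m); lra|by apply: ig_sub (bm_ig bm_mu); lra|].
    by move=> z zI; apply: mle; lra.
  rewrite /I (@itg_split _ 0 s x mu); [|lra|lra|exact: igx].
  by rewrite lerDr; apply: itg_ge0.
have x0 : x != 0 by apply/eqP; lra.
have e : pw N r v x - av (pw N r v) x =
   itg 0 x (fun s => (itg 0 x m - itg 0 s m) + j s) / x - j x.
  have bW : bm 0 b (fun s => itg 0 s m) by exact/bm_lip/lip_itg.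
  have bWx : bm 0 b (fun s => itg 0 x m - itg 0 s m) by exact: bmB (bm_cst _ _ _) bW.
  have -> : av (pw N r v) x = itg 0 x (fun s => (v 0%N 0 + itg 0 x m) - ((itg 0 x m - itg 0 s m) + j s)) / x.
    congr (_ / _); apply: eq_itg => s sI; rewrite VE; [ring|lra].
  rewrite itgB; [|exact/bm_ig/bm_cst|exact/igx/bmD].
  rewrite itg_cst; last lra.
  rewrite VE; last lra.
  by field.
have le1 : `|itg 0 x (fun s => (itg 0 x m - itg 0 s m) + j s)| <= 2 * I * x.
  have bW : bm 0 b (fun s => itg 0 x m - itg 0 s m).
    by apply: bmB (bm_cst _ _ _) _; exact/bm_lip/lip_itg.
  rewrite itgD; [|exact: igx|exact: igx].
  apply: le_trans (ler_normD _ _) _.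
  have h1 : `|itg 0 x (fun s => itg 0 x m - itg 0 s m)| <= I * (x - 0).
    by apply: itg_bound; [lra|exact: igx|exact: Wle].
  have h2 : `|itg 0 x j| <= x * I.
    apply: le_trans (itg_norm _) _; first exact: igx.
    rewrite -itgZ; last exact: igx.
    apply: itg_le; [exact/ig_norm/igx|exact/igZ/igx|].
    move=> s sI; apply: le_trans (jle _ _) _; first lra.
    by apply: ler_wpM2r => //; lra.
  by move: h1 h2; rewrite subr0; lra.
have le2 : `|j x| <= x * mu x by apply: jle; lra.
have xp : 0 < x by lra.
rewrite /aa e normrM normfV (gtr0_norm xp) ler_pdivrMr//.
rewrite (_ : (2 * av mu x + mu x) * x = 2 * I + x * mu x); last by rewrite /av -/I; field.
apply: le_trans (ler_normB _ _) _; apply: lerD le2.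
by rewrite normrM normfV (gtr0_norm xp) ler_pdivrMr.
Qed.

Lemma adm_pw : adm b (pw N r v).
Proof.
have [_ [M hM]] := bm_mu; have [_ [M' hM']] := bm_av bm_mu.
apply: (@adm_bounded _ (2 * M' + M)) => //; first exact: bm_pw.
move=> x xI; apply: le_trans (aa_pw_le xI) _; apply: lerD; last first.
  by apply: le_trans (ler_norm _) (hM x _); lra.
by apply: ler_wpM2l => //; apply: le_trans (ler_norm _) (hM' x _); lra.
Qed.

(** Hardy's inequality applied to the pointwise bound: [5 = 2 * 2 + 1]. This turns a bound on the
    energy norm into one on the nonlinear coefficients. *)
Lemma nn_aa_pw : nn 0 b (aa (pw N r v)) <= 5 * vr v dv.
Proof.
have bav := bm_av bm_mu.
apply: (@le_trans _ _ (nn 0 b (fun x => 2 * av mu x + mu x))).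
  apply: nn_le; [by case: adm_pw|by apply: bmD => //; apply: bmM => //; exact: bm_cst|].
  by move=> x xI; apply: le_trans (aa_pw_le xI) (ler_norm _).
apply: le_trans (nnD _ bm_mu) _; first by apply: bmM => //; exact: bm_cst.
rewrite nnZ// ger0_norm//; have := hardy hb bm_mu; rewrite -/(vr v dv).
by rewrite /vr -/mu; lra.
Qed.

End Embedding.

End Mesh.

(* Half of the difference of the right-hand sides [gt f * f' + sg f * aa f],
   except for the derivatives of [f - g]. *)
Definition HH {R : realType} (b : R) (f g dg : R -> R) (x : R) : R :=
  2^-1 * ((gt b f x - gt b g x) * dg x + (sg b f x * aa f x - sg b g x * aa g x)).

(** * Lipschitz estimates for the coefficients and the sources *)

Section SourceEstimates.
Context {R : realType} (b : R) (hb : 0 < b).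
Implicit Types (f g : R -> R).

Lemma gt_sub_le f g E : adm b f -> adm b g ->
  (forall x, 0 <= x <= b -> `|GG b f x - GG b g x| <= E) ->
  forall x, 0 <= x <= b -> `|gt b f x - gt b g x| <= E.
Proof.
move=> af ag h x xI; have bf := bm_GG af; have bg := bm_GG ag.
rewrite /gt -(avzB bf bg xI); apply: (@avz_bound _ b) => //; exact: bmB.
Qed.

Lemma sg_sub_le f g E : adm b f -> adm b g ->
  (forall x, 0 <= x <= b -> `|GG b f x - GG b g x| <= E) ->
  forall x, 0 <= x <= b -> `|sg b f x - sg b g x| <= 2 * E.
Proof.
move=> af ag h x xI; have := gt_sub_le af ag h xI; have := h x xI.
rewrite /sg (_ : _ - _ - (_ - _) = (GG b f x - GG b g x) - (gt b f x - gt b g x)); last by ring.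
by have := ler_normB (GG b f x - GG b g x) (gt b f x - gt b g x); lra.
Qed.

Lemma gt_sub2_le f1 g1 f0 g0 E : adm b f1 -> adm b g1 -> adm b f0 -> adm b g0 ->
  (forall x, 0 <= x <= b ->
    `|GG b f1 x - GG b g1 x - (GG b f0 x - GG b g0 x)| <= E) ->
  forall x, 0 <= x <= b ->
    `|gt b f1 x - gt b g1 x - (gt b f0 x - gt b g0 x)| <= E.
Proof.
move=> af1 ag1 af0 ag0 h x xI.
have bf1 := bm_GG af1; have bg1 := bm_GG ag1.
have bf0 := bm_GG af0; have bg0 := bm_GG ag0.
rewrite /gt -(avzB bf1 bg1 xI) -(avzB bf0 bg0 xI) -(@avzB _ b)//; [|exact: bmB|exact: bmB].
by apply: (@avz_bound _ b) => //; apply: bmB; exact: bmB.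
Qed.

Lemma sg_sub2_le f1 g1 f0 g0 E : adm b f1 -> adm b g1 -> adm b f0 -> adm b g0 ->
  (forall x, 0 <= x <= b ->
    `|GG b f1 x - GG b g1 x - (GG b f0 x - GG b g0 x)| <= E) ->
  forall x, 0 <= x <= b ->
    `|sg b f1 x - sg b g1 x - (sg b f0 x - sg b g0 x)| <= 2 * E.
Proof.
move=> af1 ag1 af0 ag0 h x xI; have := gt_sub2_le af1 ag1 af0 ag0 h xI; have := h x xI.
set G := GG b f1 x - _ - _; set T := gt b f1 x - _ - _.
rewrite /sg (_ : _ - _ - (_ - _) = G - T); last by rewrite /G /T; ring.
by have := ler_normB G T; lra.
Qed.

Lemma bm_sg f : adm b f -> bm 0 b (sg b f).
Proof. by move=> af; apply: bmB; [exact: bm_GG|exact: bm_gt]. Qed.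

Lemma bm_HH f g dg : adm b f -> adm b g -> bm 0 b dg -> bm 0 b (HH b f g dg).
Proof.
move=> af ag bd; apply: bmM; first exact: bm_cst.
apply: bmD; first by apply: bmM bd; apply: bmB; exact: bm_gt.
by apply: bmB; apply: bmM; try exact: bm_sg; [case: af|case: ag].
Qed.

(* [sg f * aa f = AA f * (x * aa f)] and [0 <= AA f <= nn (aa f) ^+ 2]. *)
Lemma nn_sg_aa f e K : adm b f -> adm b e -> nn 0 b (aa f) <= K ->
  nn 0 b (fun x => sg b f x * aa e x) <= 3 * K ^+ 2 * nn 0 b e.
Proof.
move=> af ae fK; have [be bae] := ae.
have K0 : 0 <= K by apply: le_trans fK; exact: nn_ge0.
have bx : bm 0 b (fun x => x * aa e x) by apply: bmM bae; exact: bm_id.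
apply: (@le_trans _ _ (nn 0 b (fun x => K ^+ 2 * (x * aa e x)))).
  apply: nn_le; [by apply: bmM bae; exact: bm_sg|by apply: bmM bx; exact: bm_cst|].
  move=> x xI; have xI' : 0 < x <= b by lra.
  have /andP[s0 sK] := sg_bound af xI'.
  rewrite normrM [leRHS]normrM [X in _ <= _ * X]normrM [leRHS]mulrA.
  apply: ler_wpM2r => //.
  rewrite (ger0_norm s0) (ger0_norm (sqr_ge0 K)) (gtr0_norm (_ : 0 < x)); last lra.
  apply: le_trans sK _; apply: ler_wpM2r; first lra.
  by rewrite ler_sqr ?nnegrE ?nn_ge0.
rewrite nnZ// (ger0_norm (sqr_ge0 K)); have := nn_x_aa hb ae.
by have := sqr_ge0 K; nra.
Qed.

Lemma nn_mul_sup f g M : bm 0 b f -> bm 0 b g -> 0 <= M ->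
  (forall x, 0 < x < b -> `|f x| <= M) -> nn 0 b (fun x => f x * g x) <= M * nn 0 b g.
Proof.
move=> bf bg M0 fM; have -> : M * nn 0 b g = nn 0 b (fun x => M * g x).
  by rewrite nnZ// ger0_norm.
apply: nn_le; [exact: bmM|by apply: bmM => //; exact: bm_cst|].
by move=> x xI; rewrite !normrM (ger0_norm M0); apply: ler_wpM2r => //; exact: fM.
Qed.

Lemma HH_split f g dg x : adm b f -> adm b g -> 0 <= x <= b ->
  HH b f g dg x = 2^-1 * ((gt b f x - gt b g x) * dg x +
    (sg b f x * aa (fun y => f y - g y) x + (sg b f x - sg b g x) * aa g x)).
Proof.
move=> [bf _] [bg _] xI; rewrite /HH (aaB bf bg xI); ring.
Qed.

(** Differences of coefficients are bounded uniformly in [r] by the L2 norm of [f - g], and they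
    multiply [dg] and [aa g], which belong to the smooth argument. The argument [f] enters only
    through [nn 0 b (aa f)], the quantity that the energy norm controls. *)
Lemma nn_HH K M : 0 <= K -> 0 <= M -> exists2 C : R, 0 < C &
  forall f g dg, adm b f -> adm b g -> bm 0 b dg ->
  nn 0 b (aa f) <= K -> nn 0 b (aa g) <= K ->
  (forall x, 0 < x < b -> `|dg x| <= M) -> (forall x, 0 < x < b -> `|aa g x| <= M) ->
  nn 0 b (HH b f g dg) <= C * nn 0 b (fun x => f x - g x).
Proof.
move=> K0 M0; pose B := Num.sqrt b; have B0 : 0 <= B by exact: sqrtr_ge0.
exists (1 + 18 * K * M * B + 3 * K ^+ 2).
  by rewrite -addrA ltr_pwDl// addr_ge0 ?mulr_ge0// sqr_ge0.
move=> f g dg af ag bd fK gK dM aM; set e := nn 0 b (fun x => f x - g x).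
have e0 : 0 <= e by exact: nn_ge0.
have ae := admB af ag; have [bf baf] := af; have [bg bag] := ag.
have GE x : 0 <= x <= b -> `|GG b f x - GG b g x| <= 6 * K * e.
  move=> xI; apply: le_trans (GG_sub_le hb af ag xI) _; rewrite -/e; nra.
have gE := gt_sub_le af ag GE; have sE := sg_sub_le af ag GE.
rewrite (@eq_nn _ 0 b _ (fun x => 2^-1 * ((gt b f x - gt b g x) * dg x +
    (sg b f x * aa (fun y => f y - g y) x + (sg b f x - sg b g x) * aa g x)))); last first.
  by move=> x xI; rewrite HH_split.
have b1 : bm 0 b (fun x => (gt b f x - gt b g x) * dg x).
  by apply: bmM bd; apply: bmB; exact: bm_gt.
have b2 : bm 0 b (fun x => sg b f x * aa (fun y => f y - g y) x).
  by apply: bmM; [exact: bm_sg|case: ae].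
have b3 : bm 0 b (fun x => (sg b f x - sg b g x) * aa g x).
  by apply: bmM bag; apply: bmB; exact: bm_sg.
have Ke0 : 0 <= 6 * K * e by rewrite !mulr_ge0.
have n1 : nn 0 b (fun x => (gt b f x - gt b g x) * dg x) <= 6 * K * e * (M * B).
  apply: le_trans (nn_mul_sup _ bd Ke0 _) _.
  - by apply: bmB; exact: bm_gt.
  - by move=> x xI; apply: gE; lra.
  apply: ler_wpM2l => //; rewrite /B -[X in Num.sqrt X]subr0.
  by apply: nn_sup => //; exact: ltW.
have n2 := nn_sg_aa af ae fK; rewrite -/e in n2.
have n3 : nn 0 b (fun x => (sg b f x - sg b g x) * aa g x) <= 2 * (6 * K * e) * (M * B).
  apply: le_trans (nn_mul_sup _ bag (_ : 0 <= 2 * (6 * K * e)) _) _.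
  - by apply: bmB; exact: bm_sg.
  - by rewrite mulr_ge0.
  - by move=> x xI; apply: sE; lra.
  apply: ler_wpM2l; first by rewrite mulr_ge0.
  by rewrite /B -[X in Num.sqrt X]subr0; apply: nn_sup => //; exact: ltW.
rewrite nnZ; last by apply: bmD => //; exact: bmD.
rewrite ger0_norm ?invr_ge0//.
have := nnD b1 (bmD b2 b3); have := nnD b2 b3.
set x1 := nn _ _ _ in n1 *; set x2 := nn _ _ _ in n2 *; set x3 := nn _ _ _ in n3 *.
move=> h1 h2.
have hK : 0 <= K ^+ 2 * e by rewrite mulr_ge0 ?sqr_ge0.
have hM : 0 <= K * M * B * e by rewrite !mulr_ge0.
set y1 := nn _ _ _ in h1 h2; set y2 := nn _ _ _ in h2 *.
have : y2 <= 18 * (K * M * B * e) + 3 * (K ^+ 2 * e) by lra.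
by move=> h3; nra.
Qed.

(** * Differences of sources between two times: [f] is discrete, [g] is exact, and [tau] is the time
    step *)

Section FourPoint.
Context (K M : R) (K0 : 0 <= K) (M0 : 0 <= M).
Context (f1 f0 g1 g0 dg1 dg0 : R -> R) (tau : R).
Hypotheses (af1 : adm b f1) (af0 : adm b f0) (ag1 : adm b g1) (ag0 : adm b g0).
Hypotheses (bd1 : bm 0 b dg1) (bd0 : bm 0 b dg0) (tau0 : 0 <= tau).
Hypotheses (f1K : nn 0 b (aa f1) <= K) (f0K : nn 0 b (aa f0) <= K).
Hypotheses (g1K : nn 0 b (aa g1) <= K) (g0K : nn 0 b (aa g0) <= K).
Hypothesis gtau : nn 0 b (fun x => g1 x - g0 x) <= M * tau.
Hypothesis agtau : nn 0 b (aa (fun x => g1 x - g0 x)) <= M * tau.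
Hypothesis dgtau : nn 0 b (fun x => dg1 x - dg0 x) <= M * tau.
Hypothesis dg1M : forall x, 0 < x < b -> `|dg1 x| <= M.
Hypothesis ag1M : forall x, 0 < x < b -> `|aa g1 x| <= M.

Let e1 x := f1 x - g1 x.
Let e0 x := f0 x - g0 x.
Let de x := e1 x - e0 x.
Let dz := nn 0 b de.
Let z0 := nn 0 b e0.
Hypothesis z01 : z0 <= 1.

Let ae1 : adm b e1. Proof. exact: admB. Qed.
Let ae0 : adm b e0. Proof. exact: admB. Qed.
Let ade : adm b de. Proof. exact: admB. Qed.

(** With [f = g + e], the mixed difference of squares splits into a term linear in [de = e1 - e0]
    and a term in [e0] times the increment of [g], of size [tau]. *)
Lemma XX_sub2_le x : 0 <= x <= b ->
  `|XX b f1 x - XX b g1 x - (XX b f0 x - XX b g0 x)| <= 12 * K * dz + 6 * M * tau * z0.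
Proof.
move=> xI; rewrite !XX_sub//.
have [bf1 baf1] := af1; have [bg1 bag1] := ag1; have [bf0 baf0] := af0.
have [bg0 bag0] := ag0; have [be1 bae1] := ae1; have [be0 bae0] := ae0.
have [bde bade] := ade.
have bdg : bm 0 b (fun s => g1 s - g0 s) by exact: bmB.
have [_ badg] := admB ag1 ag0.
have bx k : bm 0 b k -> bm 0 b (fun s => s * k s) by move=> h; apply: bmM h; exact: bm_id.
have igx k : bm 0 b k -> ig x b k by move=> h; apply: ig_sub (bm_ig h); lra.
rewrite -itgB; [|by apply: igx; apply: bmM; [exact: bx|exact: bmD]..].
rewrite (@eq_itg _ _ _ _ (fun s => (s * aa de s) * (aa f1 s + aa g1 s + aa e0 s) +
    (s * aa e0 s) * (2 * aa (fun y => g1 y - g0 y) s))); last first.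
  move=> s sI; have sI' : 0 <= s <= b by lra.
  rewrite -/e1 -/e0 (aaB bg1 bg0 sI') (aaB be1 be0 sI') (aaB bf1 bg1 sI') (aaB bf0 bg0 sI').
  ring.
have b1 : bm 0 b (fun s => aa f1 s + aa g1 s + aa e0 s) by apply: bmD => //; exact: bmD.
have b2 : bm 0 b (fun s => 2 * aa (fun y => g1 y - g0 y) s) by apply: bmM badg; exact: bm_cst.
rewrite itgD; [|by apply: igx; apply: bmM => //; exact: bx..].
apply: le_trans (ler_normD _ _) _; apply: lerD.
  apply: le_trans (itg_mul_le _ _ xI) _ => //; first exact: bx.
  have n1 := nn_x_aa hb ade; rewrite -/dz in n1.
  have n2 : nn 0 b (fun s => aa f1 s + aa g1 s + aa e0 s) <= 4 * K.
    have h1 := nnD (bmD baf1 bag1) bae0; have h2 := nnD baf1 bag1.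
    have h3 : nn 0 b (aa e0) <= nn 0 b (aa f0) + nn 0 b (aa g0).
      rewrite (@eq_nn _ 0 b (aa e0) (fun s => aa f0 s - aa g0 s)); first exact: nnB.
      by move=> s sI; rewrite (@aaB _ b).
    by have := f1K; have := g1K; have := f0K; have := g0K; lra.
  have -> : 12 * K * dz = (3 * dz) * (4 * K) by ring.
  by apply: ler_pM; rewrite ?nn_ge0.
apply: le_trans (itg_mul_le _ _ xI) _ => //; first exact: bx.
have -> : 6 * M * tau * z0 = (3 * z0) * (2 * (M * tau)) by ring.
apply: ler_pM; rewrite ?nn_ge0//; first exact: nn_x_aa.
by rewrite nnZ// ger0_norm//; apply: ler_wpM2l.
Qed.

Let c1 := 18 * K + 36 * K ^+ 2 + 72 * K ^+ 2 * M + 6 * M.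
Let S := dz + tau * z0.

Let dz0 : 0 <= dz. Proof. exact: nn_ge0. Qed.
Let z00 : 0 <= z0. Proof. exact: nn_ge0. Qed.
Let S0 : 0 <= S. Proof. by rewrite addr_ge0// mulr_ge0. Qed.
Let c10 : 0 <= c1. Proof. by rewrite !addr_ge0 ?mulr_ge0 ?sqr_ge0. Qed.

Let df_le : nn 0 b (fun x => f1 x - f0 x) <= dz + M * tau.
Proof.
have [bde _] := ade; have [bg1 _] := ag1; have [bg0 _] := ag0.
rewrite (@eq_nn _ 0 b _ (fun x => de x + (g1 x - g0 x))); last first.
  by move=> x _; rewrite /de /e1 /e0; ring.
by have := nnD bde (bmB bg1 bg0); rewrite -/dz; have := gtau; lra.
Qed.

(** The second-order bound on the exponential leaves a product of differences; [z0 <= 1] turns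
    [z0 * dz] into a term linear in [dz]. *)
Lemma GG_sub2_le x : 0 <= x <= b ->
  `|GG b f1 x - GG b g1 x - (GG b f0 x - GG b g0 x)| <= c1 * S.
Proof.
move=> xI; have := @expRN_diff2 _ (XX b f1 x) (XX b g1 x) (XX b f0 x) (XX b g0 x)
  (XX_ge0 _ xI) (XX_ge0 _ xI) (XX_ge0 _ xI) (XX_ge0 _ xI).
rewrite -!GGE; move/le_trans; apply.
have h1 := XX_sub2_le xI.
have h2 : `|XX b f0 x - XX b g0 x| <= 6 * K * z0.
  apply: le_trans (XX_sub_le hb af0 ag0 xI) _; rewrite -/e0 -/z0.
  have -> : 6 * K * z0 = 3 * z0 * (2 * K) by ring.
  by apply: ler_wpM2l; [rewrite mulr_ge0|have := g0K; have := f0K; lra].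
have h3 : `|XX b f1 x - XX b f0 x| <= 6 * K * (dz + M * tau).
  apply: le_trans (XX_sub_le hb af1 af0 xI) _.
  have := nn_ge0 0 b (fun y => f1 y - f0 y); have := nn_ge0 0 b (aa f1).
  have := nn_ge0 0 b (aa f0); move: df_le f1K f0K => *.
  have -> : 6 * K * (dz + M * tau) = 3 * (dz + M * tau) * (2 * K) by ring.
  by apply: ler_pM; lra.
have h4 : `|XX b g1 x - XX b g0 x| <= 6 * K * (M * tau).
  apply: le_trans (XX_sub_le hb ag1 ag0 xI) _.
  have := nn_ge0 0 b (fun y => g1 y - g0 y); have := nn_ge0 0 b (aa g1).
  have := nn_ge0 0 b (aa g0); move: gtau g1K g0K => *.
  have -> : 6 * K * (M * tau) = 3 * (M * tau) * (2 * K) by ring.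
  by apply: ler_pM; lra.
have h5 : `|XX b f0 x - XX b g0 x| * (`|XX b f1 x - XX b f0 x| + `|XX b g1 x - XX b g0 x|)
    <= (6 * K * z0) * (6 * K * (dz + M * tau) + 6 * K * (M * tau)).
  by apply: ler_pM => //; exact: lerD.
apply: le_trans (lerD h1 h5) _.
have hz : z0 * dz <= dz by rewrite -[leRHS]mul1r ler_wpM2r.
have K2 : 0 <= K ^+ 2 by exact: sqr_ge0.
have t1 : K ^+ 2 * (z0 * dz) <= K ^+ 2 * dz by apply: ler_wpM2l.
have t2 : 0 <= K * (tau * z0) by rewrite !mulr_ge0.
have t3 : 0 <= K ^+ 2 * (tau * z0) by rewrite !mulr_ge0.
have t4 : 0 <= K ^+ 2 * M * dz by rewrite !mulr_ge0.
have t5 : 0 <= M * dz by rewrite mulr_ge0.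
have t6 : 0 <= K * dz by rewrite mulr_ge0.
rewrite /c1 /S; nra.
Qed.

Let al := nn 0 b (aa e0).

(** The summand [tau * al] comes from [sg b f1 - sg b f0] multiplied by [aa e0]. The L2 norm of [e0]
    does not control [aa e0], so the energy norm of the error enters the estimate of time
    differences here, with a factor [tau]. *)
Lemma nn_HH2 :
  nn 0 b (fun x => HH b f1 g1 dg1 x - HH b f0 g0 dg0 x) <=
  (3 * c1 * M * Num.sqrt b + 30 * K * M + 27 * K ^+ 2) * (S + tau * al).
Proof.
set B := Num.sqrt b; have B0 : 0 <= B by exact: sqrtr_ge0.
have al0 : 0 <= al by exact: nn_ge0.
have [bf1 baf1] := af1; have [bg1 bag1] := ag1; have [bf0 baf0] := af0.
have [bg0 bag0] := ag0; have [be1 bae1] := ae1; have [be0 bae0] := ae0.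
have [bde bade] := ade; have [bdg badg] := admB ag1 ag0.
have alK : al <= 2 * K.
  rewrite /al (@eq_nn _ 0 b (aa e0) (fun s => aa f0 s - aa g0 s)).
    by have := nnB baf0 bag0; have := f0K; have := g0K; lra.
  by move=> s sI; rewrite (@aaB _ b).
have nsup k : bm 0 b k -> (forall x, 0 < x < b -> `|k x| <= M) -> nn 0 b k <= M * B.
  by move=> bk kM; rewrite /B -[X in Num.sqrt X]subr0; apply: nn_sup => //; exact: ltW.
have oc x : 0 < x < b -> 0 <= x <= b by lra.
have L0 : 0 <= c1 * S by rewrite mulr_ge0.
have G2 x : 0 <= x <= b -> `|GG b f0 x - GG b g0 x| <= 6 * K * z0.
  move=> xI; apply: le_trans (GG_sub_le hb af0 ag0 xI) _; rewrite -/e0 -/z0.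
  have -> : 6 * K * z0 = 3 * z0 * (2 * K) by ring.
  by apply: ler_wpM2l; [rewrite mulr_ge0|have := g0K; have := f0K; lra].
have G3 x : 0 <= x <= b -> `|GG b f1 x - GG b f0 x| <= 6 * K * (dz + M * tau).
  move=> xI; apply: le_trans (GG_sub_le hb af1 af0 xI) _.
  have := nn_ge0 0 b (fun y => f1 y - f0 y); have := nn_ge0 0 b (aa f1).
  have := nn_ge0 0 b (aa f0); move: df_le f1K f0K => *.
  have -> : 6 * K * (dz + M * tau) = 3 * (dz + M * tau) * (2 * K) by ring.
  by apply: ler_pM; lra.
have bgt f : adm b f -> bm 0 b (gt b f) by exact: bm_gt.
have bsg f : adm b f -> bm 0 b (sg b f) by exact: bm_sg.
pose k1 x := gt b f1 x - gt b g1 x - (gt b f0 x - gt b g0 x).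
pose k2 x := gt b f0 x - gt b g0 x.
pose k5 x := sg b f1 x - sg b g1 x - (sg b f0 x - sg b g0 x).
pose k6 x := sg b f0 x - sg b g0 x.
pose k4 x := sg b f1 x - sg b f0 x.
have b1 : bm 0 b k1 by apply: bmB; apply: bmB; exact: bgt.
have b2 : bm 0 b k2 by apply: bmB; exact: bgt.
have b5 : bm 0 b k5 by apply: bmB; apply: bmB; exact: bsg.
have b6 : bm 0 b k6 by apply: bmB; exact: bsg.
have b4 : bm 0 b k4 by apply: bmB; exact: bsg.
have z6 : 0 <= 6 * K * z0 by rewrite !mulr_ge0.
have t1 : nn 0 b (fun x => k1 x * dg1 x) <= c1 * S * (M * B).
  apply: le_trans (nn_mul_sup b1 bd1 L0 _) _.
    by move=> x /oc xI; apply: gt_sub2_le => // y yI; exact: GG_sub2_le.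
  by apply: ler_wpM2l => //; exact: nsup.
have bdd : bm 0 b (fun x => dg1 x - dg0 x) by exact: bmB.
have t2 : nn 0 b (fun x => k2 x * (dg1 x - dg0 x)) <= 6 * K * z0 * (M * tau).
  apply: le_trans (nn_mul_sup b2 bdd z6 _) _.
    by move=> x /oc xI; exact: gt_sub_le.
  exact: ler_wpM2l.
have t3 : nn 0 b (fun x => sg b f1 x * aa de x) <= 3 * K ^+ 2 * dz by exact: nn_sg_aa.
have z4 : 0 <= 2 * (6 * K * (dz + M * tau)) by rewrite !mulr_ge0// addr_ge0// mulr_ge0.
have t4 : nn 0 b (fun x => k4 x * aa e0 x) <= 2 * (6 * K * (dz + M * tau)) * al.
  by apply: nn_mul_sup => // x /oc xI; exact: sg_sub_le.
have z5 : 0 <= 2 * (c1 * S) by rewrite mulr_ge0.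
have t5 : nn 0 b (fun x => k5 x * aa g1 x) <= 2 * (c1 * S) * (M * B).
  apply: le_trans (nn_mul_sup b5 bag1 z5 _) _.
    by move=> x /oc xI; apply: sg_sub2_le => // y yI; exact: GG_sub2_le.
  by apply: ler_wpM2l => //; exact: nsup.
have z7 : 0 <= 2 * (6 * K * z0) by rewrite mulr_ge0.
have t6 : nn 0 b (fun x => k6 x * aa (fun y => g1 y - g0 y) x) <= 2 * (6 * K * z0) * (M * tau).
  apply: le_trans (nn_mul_sup b6 badg z7 _) _.
    by move=> x /oc xI; exact: sg_sub_le.
  exact: ler_wpM2l.
have B1 : bm 0 b (fun x => k1 x * dg1 x) by exact: bmM.
have B2 : bm 0 b (fun x => k2 x * (dg1 x - dg0 x)) by exact: bmM.
have B3 : bm 0 b (fun x => sg b f1 x * aa de x) by apply: bmM => //; exact: bsg.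
have B4 : bm 0 b (fun x => k4 x * aa e0 x) by exact: bmM.
have B5 : bm 0 b (fun x => k5 x * aa g1 x) by exact: bmM.
have B6 : bm 0 b (fun x => k6 x * aa (fun y => g1 y - g0 y) x) by exact: bmM.
rewrite (@eq_nn _ 0 b _ (fun x => 2^-1 * (k1 x * dg1 x + (k2 x * (dg1 x - dg0 x) +
   (sg b f1 x * aa de x + (k4 x * aa e0 x + (k5 x * aa g1 x +
    k6 x * aa (fun y => g1 y - g0 y) x))))))); last first.
  move=> x xI; rewrite !HH_split// -/e1 -/e0 /de (aaB be1 be0 xI) (aaB bg1 bg0 xI).
  by rewrite /k1 /k2 /k4 /k5 /k6; ring.
rewrite nnZ; last by do 4 apply: bmD => //; exact: bmD.
rewrite ger0_norm ?invr_ge0//.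
have s5 := nnD B5 B6; have s4 := nnD B4 (bmD B5 B6).
have s3 := nnD B3 (bmD B4 (bmD B5 B6)).
have s2 := nnD B2 (bmD B3 (bmD B4 (bmD B5 B6))).
have s1 := nnD B1 (bmD B2 (bmD B3 (bmD B4 (bmD B5 B6)))).
have sum : nn 0 b (fun x => k1 x * dg1 x + (k2 x * (dg1 x - dg0 x) +
   (sg b f1 x * aa de x + (k4 x * aa e0 x + (k5 x * aa g1 x +
    k6 x * aa (fun y => g1 y - g0 y) x))))) <=
  c1 * S * (M * B) + (6 * K * z0 * (M * tau) + (3 * K ^+ 2 * dz +
  (2 * (6 * K * (dz + M * tau)) * al + (2 * (c1 * S) * (M * B) + 2 * (6 * K * z0) * (M * tau))))).
  apply: le_trans s1 _; apply: lerD t1 _; apply: le_trans s2 _; apply: lerD t2 _.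
  apply: le_trans s3 _; apply: lerD t3 _; apply: le_trans s4 _; apply: lerD t4 _.
  by apply: le_trans s5 _; exact: lerD t5 t6.
have h2 : 0 <= (2 : R)^-1 by rewrite invr_ge0.
apply: le_trans (ler_wpM2l h2 sum) _.
have u1 : 0 <= c1 * M * B * S by rewrite !mulr_ge0.
have u2 : 0 <= K * M * (tau * z0) by rewrite !mulr_ge0.
have u3 : 0 <= K ^+ 2 * dz by rewrite mulr_ge0 ?sqr_ge0.
have u4 : 0 <= K * M * (tau * al) by rewrite !mulr_ge0.
have u5 : K * dz * al <= K * dz * (2 * K) by apply: ler_wpM2l; rewrite ?mulr_ge0.
have u6 : 0 <= c1 * M * B * (tau * al) by rewrite !mulr_ge0.
have u7 : 0 <= K ^+ 2 * (tau * z0) by rewrite !mulr_ge0 ?sqr_ge0.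
have u8 : 0 <= K ^+ 2 * (tau * al) by rewrite !mulr_ge0 ?sqr_ge0.
have u9 : 0 <= K * M * dz by rewrite !mulr_ge0.
rewrite [leRHS](_ : _ = 3 * (c1 * M * B * S) + 3 * (c1 * M * B * (tau * al)) +
  30 * (K * M * dz) + 30 * (K * M * (tau * z0)) + 30 * (K * M * (tau * al)) +
  27 * (K ^+ 2 * dz) + 27 * (K ^+ 2 * (tau * z0)) + 27 * (K ^+ 2 * (tau * al))); last first.
  by rewrite /S; ring.
rewrite [leLHS](_ : _ = 2^-1 * (3 * (c1 * M * B * S) + 18 * (K * M * (tau * z0)) +
  3 * (K ^+ 2 * dz) + 12 * (K * dz * al) + 12 * (K * M * (tau * al)))); last first.
  by ring.
have u10 : K * dz * (2 * K) = 2 * (K ^+ 2 * dz) by ring.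
lra.
Qed.

End FourPoint.

End SourceEstimates.

(** * The error equation *)

(** The right end is excluded because a glued function takes there the value from the next cell. *)
Lemma bm_eq_co {R : realType} (a c : R) (f g : R -> R) :
  (forall x, a <= x < c -> f x = g x) -> bm a c f -> bm a c g.
Proof.
move=> fg [mf [M fM]]; split.
  apply/measurable_fun_itv_bndo_bndcP; move/measurable_fun_itv_bndo_bndcP: mf.
  by apply: eq_measurable_fun => x; rewrite inE/= in_itv/=; exact: fg.
exists (`|M| + `|g c|) => x xI; have [->|xc] := eqVneq x c; first by rewrite lerDr.
have xc' : x < c by rewrite lt_neqAle xc; lra.
rewrite -fg; last by lra.
by apply: le_trans (fM _ xI) _; have := ler_norm M; have := normr_ge0 (g c); lra.
Qed.

Definition glob {R : realType} (N : nat) (r : nat -> R) (p : nat -> {poly R}) : R -> R :=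
  pw N r (fun i x => (p i).[x]).

Section SchemeAtOneTime.
Context {R : realType} (b : R) (hb : 0 < b) (N : nat) (r : nat -> R).
Hypothesis hm : is_mesh b N r.
Context (k : nat) (p dp : nat -> {poly R}) (tr : traces R) (U : R).
Hypothesis hloc : forall i, (i < N)%N -> local_equation k r p dp tr i.
Hypothesis htr : forall i, (i.+1 < N)%N -> transmission r p tr i.
Hypothesis hU : u_hat tr N = U.
Hypothesis hg : g_hat tr N = 1.
Hypothesis hw : w_hat tr 0%N = 0.
Hypothesis hz : z_hat tr 0%N = 0.

Let P := glob N r p.

Lemma bm_glob q : bm 0 b (glob N r q).
Proof. by apply: bm_pw => i; exact: bm_poly. Qed.

Lemma prim_poly a c (q : {poly R}) : prim a c (fun x => q.[x]) (fun x => (deriv q).[x]).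
Proof.
apply: prim_FTC; [exact: lip_poly|exact: bm_poly|by move=> x _; exact: cts_poly|].
by move=> x _; exact: drv_poly.
Qed.

Lemma adm_glob q : adm b (glob N r q).
Proof.
apply: (@adm_pw _ b N r hm _ (fun i x => (deriv (q i)).[x])) => //.
- by move=> i; exact: bm_poly.
- by move=> i; exact: bm_poly.
- by move=> i _; exact: prim_poly.
Qed.

Let aP : adm b P := adm_glob p.

Lemma globE q i x : (i < N)%N -> r i <= x < r i.+1 -> glob N r q x = (q i).[x].
Proof. by move=> iN xI; rewrite /glob (@pwE _ b N r hm _ i). Qed.

Let ig0 i x f : (i < N)%N -> r i <= x <= r i.+1 -> bm 0 b f -> ig 0 x f.
Proof.
by move=> iN xI bf; apply: ig_sub (bm_ig bf) => //; have := mesh_in hm iN xI; lra.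
Qed.

Let splitP f i x : (i < N)%N -> r i <= x <= r i.+1 -> bm 0 b f ->
  itg 0 x f = itg 0 (r i) f + itg (r i) x f.
Proof.
move=> iN xI bf; apply: itg_split; [exact: (mesh_ge0 hm) (ltnW iN)|lra|].
exact: ig0 iN xI bf.
Qed.

Let itgP i x : (i < N)%N -> r i <= x <= r i.+1 ->
  itg (r i) x P = \int[leb R]_(s in `[r i, x]) (p i).[s].
Proof.
move=> iN xI; rewrite -itgE; apply: eq_itg_oo.
- apply: ig_sub (bm_ig (bm_cell hm iN (bm_glob p))); lra.
- exact/bm_ig/bm_poly.
by move=> s sI; rewrite /P (@globE _ i)//; lra.
Qed.

(** Elimination of the traces starts here: the transmission conditions chain the cell formulas
    together, so that the fields depend on the glued polynomial [P] alone. *)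
Let wE i x : (i < N)%N -> r i <= x <= r i.+1 -> w_h r p tr i x = itg 0 x P.
Proof.
suff h : (i < N)%N -> w_hat tr i = itg 0 (r i) P.
  by move=> iN xI; rewrite /w_h h// -itgP// (splitP iN xI (bm_glob p)).
elim: i {x} => [|i ih] iN; first by case: hm => -> _ _; rewrite hw itgxx.
have [_ + _ _] := htr iN; rewrite /w_h [X in _ = _ + X]/(\int[leb R]_(s in _) _).
rewrite -[X in _ = _ + X]itgE itgxx addr0 => <-.
have iN' := ltnW iN; have ri := mesh_lt hm iN'.
rewrite ih// -itgP//; last by lra.
by rewrite -(splitP iN' _ (bm_glob p))//; lra.
Qed.

Let utE i x : (i < N)%N -> r i <= x <= r i.+1 -> x != 0 -> ut_h r p tr i x = av P x.
Proof. by move=> iN xI x0; rewrite /ut_h /tilde (negbTE x0) (wE iN xI). Qed.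

Let gE i x : (i < N)%N -> r i <= x <= r i.+1 -> g_h r p tr i x = GG b P x.
Proof.
move=> iN.
have cell j y : (j < N)%N -> r j <= y <= r j.+1 ->
    g_h r p tr j y = g_hat tr j.+1 * expR (- (XX b P y - XX b P (r j.+1))).
  move=> jN yI; rewrite /g_h -itgE; congr (_ * expR (- _)).
  have y0 := mesh_in hm jN yI.
  rewrite (XX_diff aP); [|lra|lra|exact: (mesh_leb hm jN)].
  have bs : bm y (r j.+1) (fun s => s * aa P s ^+ 2).
    case: aP => _ ba; apply: (@bm_sub _ 0 b); [lra|exact: (mesh_leb hm jN)|].
    by apply: bmM; [exact: bm_id|exact: bmX].
  have e s : y <= s < r j.+1 -> s * aa P s ^+ 2 =
     s^-1 * ((p j).[s] - ut_h r p tr j s) ^+ 2.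
    move=> sI; have [->|s0] := eqVneq s 0; first by rewrite invr0 !mul0r.
    rewrite utE//; [|lra]; rewrite /aa {1}/P (@globE _ j)//; [|lra].
    by field.
  apply/esym/eq_itg_oo; [exact: bm_ig|exact/bm_ig/(bm_eq_co e)|].
  by move=> s sI; apply: e; lra.
(* The value of [g] is prescribed at the outer end, so this induction runs from the last node
   inwards, unlike those for [w] and [z]. *)
suff gh j : (j < N)%N -> g_hat tr (N - j)%N = GG b P (r (N - j)%N).
  move=> xI; rewrite cell//.
  have -> : i.+1 = (N - (N - i.+1))%N by rewrite subKn.
  rewrite gh; last by rewrite ltn_subrL (leq_trans _ iN).
  by rewrite !GGE -expRD; congr expR; ring.
elim: j => [|j ih] jN.
  rewrite subn0 hg GGE /XX; case: hm => _ -> _; by rewrite itgxx oppr0 expR0.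
have [m mE] : exists m, (N - j)%N = m.+2.
  by exists (N - j).-2; move: jN; rewrite -subn_gt0 subnS; case: (N - j)%N => [|[]].
have mE' : (N - j.+1)%N = m.+1 by rewrite subnS mE.
rewrite mE'; have mN : (m.+1 < N)%N by rewrite -mE' ltn_subrL/= (leq_ltn_trans _ jN).
have [_ _ _] := htr mN.
have ri := mesh_lt hm mN; have ri' := mesh_lt hm (ltnW mN).
rewrite !cell//; [|lra|exact: ltnW|lra]; rewrite subrr oppr0 expR0 mulr1 => ->.
rewrite -mE ih ?(ltnW jN)// mE !GGE -expRD; congr expR; ring.
Qed.

Let zE i x : (i < N)%N -> r i <= x <= r i.+1 -> z_h r p tr i x = itg 0 x (GG b P).
Proof.
have bG := bm_GG aP.
have c j y : (j < N)%N -> r j <= y <= r j.+1 ->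
    itg (r j) y (GG b P) = \int[leb R]_(s in `[r j, y]) g_h r p tr j s.
  by move=> jN yI; rewrite -itgE; apply: eq_itg => s sI; rewrite gE//; lra.
suff h : (i < N)%N -> z_hat tr i = itg 0 (r i) (GG b P).
  by move=> iN xI; rewrite /z_h h// -c// (splitP iN xI bG).
elim: i {x} => [|i ih] iN; first by case: hm => -> _ _; rewrite hz itgxx.
have [_ _ + _] := htr iN; rewrite /z_h.
have iN' := ltnW iN; have ri := mesh_lt hm iN'; have ri' := mesh_lt hm iN.
rewrite -[X in _ = _ + X]itgE itgxx addr0 => <-.
rewrite ih// -c//; last by lra.
by rewrite -(splitP iN' _ bG)//; lra.
Qed.

Let gtE i x : (i < N)%N -> r i <= x <= r i.+1 -> gt_h r p tr i x = gt b P x.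
Proof.
move=> iN xI; rewrite /gt_h /tilde /gt /avz; case: eqP => [x0|_].
  by rewrite gE// -x0.
by rewrite zE.
Qed.

Let dgtE i x : (i < N)%N -> r i < x < r i.+1 -> derive1 (gt_h r p tr i) x = AA b P x.
Proof.
move=> iN xI; have x0 : 0 < x < b.
  by have := mesh_ge0 hm (ltnW iN); have := mesh_leb hm iN; lra.
have d : is_derive x 1 (gt_h r p tr i) (AA b P x).
  apply: drv_near (gt_derive hb aP x0); near=> y; rewrite gtE//.
  have : r i < y < r i.+1 by near: y; exact: near_in_oo.
  lra.
by rewrite derive1E; case: d.
Unshelve. all: by end_near. Qed.

Definition outer (i : nat) : R := if (i.+1 < N)%N then (p i.+1).[r i.+1] else U.

(** Integration by parts back to the nonconservative form. The flux at the left end uses the inner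
    trace and cancels; the one at the right end leaves the upwind jump. The two terms in [AA]
    combine into [AA (P - av P) = sg * aa P]. *)
Lemma scheme_cell i (phi : {poly R}) : (i < N)%N -> (size phi <= k.+1)%N ->
  itg (r i) (r i.+1) (fun x => (dp i).[x] * phi.[x]) =
  2^-1 * (itg (r i) (r i.+1) (fun x => gt b P x * (deriv (p i)).[x] * phi.[x]) +
    gt b P (r i.+1) * (outer i - (p i).[r i.+1]) * phi.[r i.+1]) +
  itg (r i) (r i.+1) (fun x => 2^-1 * (sg b P x * aa P x) * phi.[x]).
Proof.
move=> iN sphi; have ri := mesh_lt hm iN.
have rI : r i <= r i.+1 <= r i.+1 by lra.
have rI' : r i <= r i <= r i.+1 by lra.
have [_ baP] := aP.
have bgt := bm_cell hm iN (bm_gt hb aP); have bAA := bm_cell hm iN (bm_AA hb aP).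
have bsg := bm_cell hm iN (bm_sg hb aP); have baa := bm_cell hm iN baP.
have bp := bm_poly (r i) (r i.+1) (p i); have bf := bm_poly (r i) (r i.+1) phi.
have bp' := bm_poly (r i) (r i.+1) (deriv (p i)).
have bf' := bm_poly (r i) (r i.+1) (deriv phi).
have bav := bm_cell hm iN (bm_av (bm_glob p)); rewrite -/P in bav.
have h2 : bm (r i) (r i.+1) (fun=> 2^-1 : R) by exact: bm_cst.
have := hloc iN sphi.
rewrite itg_oo; last exact/bm_ig/bmM/bm_poly/bm_poly.
have -> : \int[leb R]_(x in `]r i, r i.+1[) (2^-1 * gt_h r p tr i x * (p i).[x] * (deriv phi).[x])
    = itg (r i) (r i.+1) (fun x => 2^-1 * (gt b P x * (p i).[x] * (deriv phi).[x])).
  rewrite -itg_oo; last by apply/igZ/bm_ig/bmM => //; exact: bmM.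
  apply: eq_Rintegral => x; rewrite inE/= in_itv/= => xI.
  by rewrite gtE//; [ring|lra].
have -> : \int[leb R]_(x in `]r i, r i.+1[)
     (2^-1 * derive1 (gt_h r p tr i) x * ut_h r p tr i x * phi.[x])
    = itg (r i) (r i.+1) (fun x => 2^-1 * (AA b P x * av P x * phi.[x])).
  rewrite -itg_oo; last by apply/igZ/bm_ig/bmM => //; exact: bmM.
  apply: eq_Rintegral => x; rewrite inE/= in_itv/= => xI.
  have x0 : x != 0 by have := mesh_ge0 hm (ltnW iN) => ?; apply/eqP; lra.
  by rewrite dgtE// utE//; [ring|lra].
have -> : flux_right r p tr i = 2^-1 * gt b P (r i.+1) * outer i.
  rewrite /outer; case: ifP => iN1.
    have [-> _ _ _] := htr iN1; rewrite /flux_left gtE//.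
    by rewrite lexx ltW// (mesh_lt hm).
  have eN : i.+1 = N by apply/eqP; rewrite eqn_leq iN leqNgt iN1.
  by rewrite /flux_right gtE// eN hU.
rewrite {1}/flux_left gtE//.
have pgt := prim_sub (mesh_ge0 hm (ltnW iN)) (mesh_leb hm iN) (prim_gt hb aP).
have [_ /(_ _ _ (lexx _) (ltW ri) (lexx _))] :=
  primM pgt (primM (prim_poly (r i) (r i.+1) (p i)) (prim_poly (r i) (r i.+1) phi)).
have i1 : ig (r i) (r i.+1) (fun x => AA b P x * (p i).[x] * phi.[x]).
  by apply/bm_ig/bmM => //; exact: bmM.
have i2 : ig (r i) (r i.+1) (fun x => gt b P x * (deriv (p i)).[x] * phi.[x]).
  by apply/bm_ig/bmM => //; exact: bmM.
have i3 : ig (r i) (r i.+1) (fun x => gt b P x * (p i).[x] * (deriv phi).[x]).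
  by apply/bm_ig/bmM => //; exact: bmM.
have i4 : ig (r i) (r i.+1) (fun x => AA b P x * av P x * phi.[x]).
  by apply/bm_ig/bmM => //; exact: bmM.
rewrite [X in _ = X -> _](_ : _ = itg (r i) (r i.+1) (fun x => AA b P x * (p i).[x] * phi.[x]
   + gt b P x * (deriv (p i)).[x] * phi.[x] + gt b P x * (p i).[x] * (deriv phi).[x])); last first.
  by apply: eq_itg => x _; ring.
rewrite (itgD (igD i1 i2) i3) (itgD i1 i2).
have -> : itg (r i) (r i.+1) (fun x => 2^-1 * (sg b P x * aa P x) * phi.[x]) =
  2^-1 * (itg (r i) (r i.+1) (fun x => AA b P x * (p i).[x] * phi.[x]) -
          itg (r i) (r i.+1) (fun x => AA b P x * av P x * phi.[x])).
  rewrite -(itgB i1 i4) -itgZ; last exact: igB.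
  apply: eq_itg_oo.
  - by apply/bm_ig/bmM => //; apply: bmM => //; exact: bmM.
  - by apply/igZ/igB.
  move=> x xI; rewrite /AA /aa.
  have -> : P x = (p i).[x] by rewrite /P (@globE _ i)//; lra.
  ring.
rewrite (itgZ _ i3) (itgZ _ i4); lra.
Qed.

Section Exact.
Context (u ur ut : R -> R).
Hypothesis au : adm b u.
Hypothesis bur : bm 0 b ur.
Hypothesis but : bm 0 b ut.
Hypothesis uU : u b = U.
Hypothesis eqn : forall x, 0 < x < b ->
  ut x = 2^-1 * (gt b u x * ur x + sg b u x * aa u x).

Definition zeta (i : nat) (x : R) : R := (p i).[x] - u x.
Definition dzeta (i : nat) (x : R) : R := (deriv (p i)).[x] - ur x.

(** The exact solution has no jumps and equals [U] at [b], so the jump of the scheme is that of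
    [p - u] with outer value 0. The discrete coefficient stays in front of the error, and its
    difference from the exact one multiplies [ur] inside [HH]. *)
Lemma error_cell i (phi : {poly R}) : (i < N)%N -> (size phi <= k.+1)%N ->
  itg (r i) (r i.+1) (fun x => ((dp i).[x] - ut x) * phi.[x]) =
  2^-1 * (itg (r i) (r i.+1) (fun x => gt b P x * dzeta i x * phi.[x]) +
    gt b P (r i.+1) * jmp N r zeta i * phi.[r i.+1]) +
  itg (r i) (r i.+1) (fun x => HH b P u ur x * phi.[x]).
Proof.
move=> iN sphi; have := scheme_cell iN sphi; have ri := mesh_lt hm iN.
have cell (f : R -> R) : bm 0 b f -> bm (r i) (r i.+1) f by exact: (bm_cell hm iN).
have jE : outer i - (p i).[r i.+1] = jmp N r zeta i.
  rewrite /outer /jmp /zeta; case: ifP => iN1; first by ring.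
  have -> : i.+1 = N by apply/eqP; rewrite eqn_leq iN leqNgt iN1.
  by case: hm => _ -> _; rewrite uU; ring.
rewrite jE => e; have [bu bau] := au; have [_ baP] := aP.
have bf := bm_poly (r i) (r i.+1) phi; have bf0 := bm_poly 0 b phi.
have bp' := bm_poly 0 b (deriv (p i)).
have i1 : ig (r i) (r i.+1) (fun x => (dp i).[x] * phi.[x]) by exact/bm_ig/bmM/bm_poly/bm_poly.
have i2 : ig (r i) (r i.+1) (fun x => ut x * phi.[x]) by apply/bm_ig/bmM => //; exact: cell.
have bgP := bm_gt hb aP; have bgu := bm_gt hb au.
have bsP := bm_sg hb aP; have bsu := bm_sg hb au.
have i3 : ig (r i) (r i.+1) (fun x => gt b P x * (deriv (p i)).[x] * phi.[x]).
  by apply/bm_ig/cell/bmM => //; exact: bmM.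
have i4 : ig (r i) (r i.+1) (fun x => gt b P x * ur x * phi.[x]).
  by apply/bm_ig/cell/bmM => //; exact: bmM.
have i5 : ig (r i) (r i.+1) (fun x => 2^-1 * (sg b P x * aa P x) * phi.[x]).
  by apply/bm_ig/cell/bmM => //; apply: bmM (bm_cst _ _ _) _; exact: bmM.
have i6 : ig (r i) (r i.+1) (fun x => HH b P u ur x * phi.[x]).
  by apply/bm_ig/cell/bmM => //; exact: bm_HH.
have -> : itg (r i) (r i.+1) (fun x => ((dp i).[x] - ut x) * phi.[x]) =
  itg (r i) (r i.+1) (fun x => (dp i).[x] * phi.[x]) -
  itg (r i) (r i.+1) (fun x => ut x * phi.[x]).
  by rewrite -(itgB i1 i2); apply: eq_itg => x _; ring.
have -> : itg (r i) (r i.+1) (fun x => gt b P x * dzeta i x * phi.[x]) =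
  itg (r i) (r i.+1) (fun x => gt b P x * (deriv (p i)).[x] * phi.[x]) -
  itg (r i) (r i.+1) (fun x => gt b P x * ur x * phi.[x]).
  by rewrite -(itgB i3 i4); apply: eq_itg => x _; rewrite /dzeta; ring.
rewrite e.
have -> : itg (r i) (r i.+1) (fun x => ut x * phi.[x]) =
  2^-1 * itg (r i) (r i.+1) (fun x => gt b P x * ur x * phi.[x]) +
  (itg (r i) (r i.+1) (fun x => 2^-1 * (sg b P x * aa P x) * phi.[x]) -
   itg (r i) (r i.+1) (fun x => HH b P u ur x * phi.[x])).
  rewrite -(itgZ _ i4) -(itgB i5 i6) -(itgD (igZ _ i4) (igB i5 i6)).
  apply: eq_itg_oo => //; first exact: igD (igZ _ i4) (igB i5 i6).
  move=> x xI; rewrite eqn; last by have := mesh_ge0 hm (ltnW iN); have := mesh_leb hm iN; lra.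
  by rewrite /HH; ring.
ring.
Qed.

End Exact.

End SchemeAtOneTime.

(** * Weak derivatives in dimension one *)

(** Lebesgue points, with the mean value written on symmetric intervals. *)
Definition lpt {R : realType} (f : R -> R) (c : R) : Prop :=
  forall eta : R, 0 < eta -> exists2 e0 : R, 0 < e0 & forall e, 0 < e < e0 ->
    itg (c - e) (c + e) (fun s => `|f s - f c|) <= eta * e.

(** A continuous approximation of the Dirac mass: the tent of height [1 / e] and integral 1
    supported in [[-e, e]]. *)
Definition tent {R : realType} (e y : R) : R := Num.max 0 (e^-1 - `|y| / e ^+ 2).

Section WeakDerivative.
Context {R : realType} (b : R) (hb : 0 < b).
Implicit Types (f g D : R -> R).

Lemma lebesgue_pts f : ig 0 b f -> {ae leb R, forall x, 0 < x < b -> lpt f x}.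
Proof.
move=> igf; pose fp := f \_ `]0, b[.
have i1 : (leb R).-integrable `]0, b[ (EFin \o f).
  by apply: integrableS igf => // x; rewrite /= !in_itv/=; lra.
have i2 : (leb R).-integrable setT (EFin \o fp).
  by rewrite -restrict_EFin; apply/integrable_restrict => //=; rewrite setTI.
have fpE y : 0 < y < b -> fp y = f y by move=> yI; rewrite /fp patchE mem_set//= in_itv.
have := lebesgue_differentiation (open_integrable_locally openT i2).
apply: filterS; first exact: (ae_filter_ringOfSetsType (leb R)).
move=> x hx xI eta eta0.
have /hx : nbhs (0%E : \bar R) [set y | (y < (eta / 2)%:E)%E].
  by apply: open_nbhs_nbhs; split; [exact: open_ereal_lt_ereal|rewrite /= lte_fin divr_gt0].
move=> [e1 /= e10 he1].
exists (Num.min e1 (Num.min x (b - x))); first by rewrite !lt_min e10; lra.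
move=> e; rewrite !lt_min => /andP[e0 /andP[ee1 /andP[ex eb]]].
have := he1 e; rewrite /= sub0r normrN (gtr0_norm e0) => /(_ ee1 e0).
rewrite /davg /iavg lebesgue_measure_ball; last exact: ltW.
have igd : ig (x - e) (x + e) (fun s => f s - f x).
  by apply: igB; [apply: ig_sub igf; lra|exact/bm_ig/bm_cst].
have ballE : ball x e = `]x - e, x + e[%classic by exact: ball_itv.
have -> : (\int[leb R]_(y in ball x e) `|((center (fp x) \o fp) y)%:E|)%E =
    (itg (x - e) (x + e) (fun s => `|f s - f x|))%:E.
  rewrite -itg_oo; last exact: ig_norm.
  rewrite /Rintegral fineK.
    rewrite ballE; apply: eq_integral => y; rewrite inE/= in_itv/= => yI.
    by rewrite /= !fpE; [|lra|lra].
  apply: integrable_fin_num => //.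
  have := ig_norm igd; apply: integrableS => // y; rewrite /= !in_itv/=; lra.
rewrite inver -[e *+ 2]mulr_natr.
rewrite gt_eqF ?mulr_gt0// -EFinM lte_fin ltr_pdivrMl ?mulr_gt0//.
by move/ltW/le_trans; apply; rewrite le_eqVlt; apply/orP; left; apply/eqP; field.
Qed.

Lemma tent_ge0 (e y : R) : 0 <= tent e y.
Proof. by rewrite /tent le_max lexx. Qed.

Lemma tent_le (e y : R) : 0 < e -> tent e y <= e^-1.
Proof.
move=> e0; rewrite /tent ge_max invr_ge0 (ltW e0)/= gerBl.
by rewrite divr_ge0// sqr_ge0.
Qed.

Lemma tent0 (e y : R) : 0 < e -> e <= `|y| -> tent e y = 0.
Proof.
move=> e0 ey; rewrite /tent; apply/max_idPl.
rewrite subr_le0 ler_pdivlMr ?exprn_gt0// expr2 mulKf ?gt_eqF//.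
Qed.

Lemma tentE (e y : R) : 0 < e -> `|y| <= e -> tent e y = e^-1 - `|y| / e ^+ 2.
Proof.
move=> e0 ye; rewrite /tent; apply/max_idPr.
rewrite subr_ge0 ler_pdivrMr ?exprn_gt0// expr2 mulKf ?gt_eqF//.
Qed.

Lemma cts_tent (e c x : R) : {for x, continuous (fun s => tent e (s - c))}.
Proof.
rewrite /tent; apply: (@continuous_max _ _ (fun=> 0) (fun s => e^-1 - `|s - c| / e ^+ 2)).
  exact: cts_cst.
apply: ctsB; first exact: cts_cst.
apply: ctsM; last exact: cts_cst.
apply: (@cts_comp _ (fun y => `|y|) (fun s => s - c)).
  by apply: ctsB; [exact: cts_id|exact: cts_cst].
exact: norm_continuous.
Qed.

Lemma bm_tent (a1 a2 e c : R) : bm a1 a2 (fun s => tent e (s - c)).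
Proof.
apply: bm_cont; apply: continuous_subspaceT => x; exact: cts_tent.
Qed.

Lemma itg_tent_loc f (e c : R) : 0 < e -> 0 <= c - e -> c + e <= b ->
  bm (c - e) (c + e) (fun=> 0 : R) -> ig 0 b (fun s => f s * tent e (s - c)) ->
  itg 0 b (fun s => f s * tent e (s - c)) =
  itg (c - e) (c + e) (fun s => f s * tent e (s - c)).
Proof.
move=> e0 ce1 ce2 _ igf.
rewrite (@itg_split _ 0 (c - e) b)//; [|lra].
rewrite (@itg_split _ (c - e) (c + e) b)//; [|lra|by apply: ig_sub igf; lra].
have z s : e <= `|s - c| -> f s * tent e (s - c) = 0 by move=> h; rewrite tent0// mulr0.
rewrite (@eq_itg _ 0 (c - e) _ (fun=> 0)); last first.
  by move=> s sI; apply: z; rewrite ler0_norm; lra.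
rewrite (@eq_itg _ (c + e) b _ (fun=> 0)); last first.
  by move=> s sI; apply: z; rewrite ger0_norm; lra.
by rewrite !itg_cst// !mul0r add0r addr0.
Qed.

Lemma itg_tent1 (e c : R) : 0 < e ->
  itg (c - e) (c + e) (fun s => tent e (s - c)) = 1.
Proof.
move=> e0; have en : e != 0 by rewrite gt_eqF.
rewrite (@itg_split _ (c - e) c (c + e)); [|lra|lra|exact/bm_ig/bm_tent].
have -> : itg (c - e) c (fun s => tent e (s - c)) =
    jp (c - e) c ((e^-1)%:P + e ^- 2 *: ('X - c%:P)).
  apply: eq_itg => s sI; rewrite tentE//; last by rewrite ler0_norm; lra.
  by rewrite hornerD hornerC hornerZ hornerXsubC ler0_norm; [field|lra].
have -> : itg c (c + e) (fun s => tent e (s - c)) =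
    jp c (c + e) ((e^-1)%:P - e ^- 2 *: ('X - c%:P)).
  apply: eq_itg => s sI; rewrite tentE//; last by rewrite ger0_norm; lra.
  by rewrite hornerD hornerN hornerC hornerZ hornerXsubC ger0_norm; [field|lra].
have ftc a1 a2 (p : {poly R}) : a1 <= a2 -> jp a1 a2 (deriv p) = p.[a2] - p.[a1].
  move=> le; apply: FTC_lip => //; [exact: lip_poly|exact: bm_poly|..].
  by move=> x _; exact: cts_poly.
pose p1 := e^-1 *: ('X - c%:P) + (2 * e ^+ 2)^-1 *: ('X - c%:P) ^+ 2.
pose p2 := e^-1 *: ('X - c%:P) - (2 * e ^+ 2)^-1 *: ('X - c%:P) ^+ 2.
have d2 : deriv (('X - c%:P) ^+ 2) = 2 *: ('X - c%:P) :> {poly R}.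
  by rewrite expr2 derivM derivXsubC mul1r mulr1 -mulr2n -scaler_nat.
have -> : (e^-1)%:P + e ^- 2 *: ('X - c%:P) = deriv p1.
  rewrite /p1 derivD !derivZ d2 derivXsubC alg_polyC scalerA; congr (_ + _ *: _).
  by field.
have -> : (e^-1)%:P - e ^- 2 *: ('X - c%:P) = deriv p2.
  rewrite /p2 derivB !derivZ d2 derivXsubC alg_polyC scalerA; congr (_ - _ *: _).
  by field.
rewrite !ftc; [|lra|lra].
rewrite /p1 /p2 !hornerD !hornerN !hornerZ !horner_exp !hornerXsubC; field.
exact: en.
Qed.

(** The tent has mass 1 and is at most [1 / e], so the error is a mean deviation of [f] from
    [f c]. *)
Lemma tent_conv f (e c eta : R) : 0 < e -> 0 <= c - e -> c + e <= b -> ig 0 b f ->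
  ig 0 b (fun s => f s * tent e (s - c)) ->
  itg (c - e) (c + e) (fun s => `|f s - f c|) <= eta * e ->
  `|itg 0 b (fun s => f s * tent e (s - c)) - f c| <= eta.
Proof.
move=> e0 h1 h2 igf igt le.
have bt a1 a2 : bm a1 a2 (fun s => tent e (s - c)) by exact: bm_tent.
rewrite itg_tent_loc//; last exact: bm_cst.
have igt' : ig (c - e) (c + e) (fun s => f s * tent e (s - c)) by apply: ig_sub igt; lra.
have igc : ig (c - e) (c + e) (fun s => f c * tent e (s - c)) by exact/igZ/bm_ig.
rewrite -[X in _ - X]mulr1 -(itg_tent1 c e0) -itgZ; last exact: bm_ig.
rewrite -(itgB igt' igc); apply: le_trans (itg_norm (igB igt' igc)) _.
have igf' : ig (c - e) (c + e) (fun s => `|f s - f c|).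
  by apply: ig_norm; apply: igB; [apply: ig_sub igf; lra|exact/bm_ig/bm_cst].
apply: (@le_trans _ _ (itg (c - e) (c + e) (fun s => e^-1 * `|f s - f c|))).
  apply: itg_le; [exact/ig_norm/igB|exact: igZ|].
  move=> s sI; rewrite -mulrBl normrM mulrC; apply: ler_wpM2r => //.
  by rewrite ger0_norm ?tent_ge0// tent_le.
rewrite itgZ// mulrC ler_pdivrMr//.
Qed.

End WeakDerivative.

Definition l2 {R : realType} (b : R) (f : R -> R) : Prop :=
  measurable_fun `[0, b] f /\ ig 0 b (fun x => f x ^+ 2).

(** A C^1 smoothing of the Heaviside function at [c]. The integral starts at distance 1 to the left
    of the support of the tent, so that the differentiation formula holds at every point. *)
Definition step {R : realType} (e c x : R) : R :=
  itg (c - e - 1) x (fun s => tent e (s - c)).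

(** * Weak derivatives in L2 and increments at Lebesgue points *)

Section Sobolev.
Context {R : realType} (b : R) (hb : 0 < b).
Implicit Types (a c d e x : R) (f g D : R -> R).

Lemma ig_dom a c f g : measurable_fun `[a, c] f -> ig a c g ->
  (forall x, a <= x <= c -> `|f x| <= g x) -> ig a c f.
Proof.
move=> mf igg fg.
apply: (@le_integrable _ _ R (leb R) _ _ (EFin \o f) (EFin \o g)) => //.
  exact/measurable_EFinP.
move=> x; rewrite /= in_itv/= lee_fin => xI.
by apply: le_trans (fg _ xI) (ler_norm _).
Qed.

Lemma l2_mul f g : l2 b f -> l2 b g -> ig 0 b (fun x => f x * g x).
Proof.
move=> [mf f2] [mg g2]; apply: (@ig_dom _ _ _ (fun x => f x ^+ 2 + g x ^+ 2)).
- exact: measurable_funM.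
- exact: igD.
move=> x _; rewrite normrM -(real_normK (num_real (f x))) -(real_normK (num_real (g x))).
have := normr_ge0 (f x); have := normr_ge0 (g x); nra.
Qed.

Lemma bm_l2 f : bm 0 b f -> l2 b f.
Proof. by move=> bf; split; [case: bf|exact/bm_ig/bmX]. Qed.

Lemma l2_bm f g : l2 b f -> bm 0 b g -> l2 b (fun x => f x * g x).
Proof.
move=> [mf f2] [mg [M gM]]; split; first exact: measurable_funM.
apply: (@ig_dom _ _ _ (fun x => M ^+ 2 * f x ^+ 2)); last 1 first.
- move=> x xI; rewrite exprMn ger0_norm; last by apply: mulr_ge0; exact: sqr_ge0.
  rewrite mulrC; apply: ler_wpM2r; first exact: sqr_ge0.
  rewrite -(real_normK (num_real (g x))); apply: lerXn2r (gM _ xI);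
    rewrite nnegrE//; exact: le_trans (normr_ge0 _) (gM _ xI).
- apply: measurable_funX; exact: measurable_funM.
- exact: igZ.
Qed.

Lemma l2_ig f : l2 b f -> ig 0 b f.
Proof.
move=> lf; have := l2_mul lf (bm_l2 (bm_cst 0 b 1)).
by apply: ig_eq => x _; rewrite mulr1.
Qed.

Lemma l2_CS f a c : 0 <= a -> a <= c -> c <= b -> l2 b f ->
  `|itg a c f| <= Num.sqrt (c - a) * nn a c f.
Proof.
move=> a0 ac cb lf; have [_ f2] := lf.
have igf : ig a c f by apply: ig_sub (l2_ig lf).
have h1 : ig a c (fun x => 1 ^+ 2 : R) by exact/bm_ig/bm_cst.
have h2 : ig a c (fun x => f x ^+ 2) by apply: ig_sub f2.
have h3 : ig a c (fun x => 1 * f x) by exact: igZ.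
have := itg_CS h1 h2 h3; rewrite itgZ// mul1r.
rewrite (itg_cst _ ac) expr1n mul1r => le.
rewrite -(@ler_pXn2r _ 2)// ?nnegrE ?mulr_ge0 ?sqrtr_ge0 ?nn_ge0//.
by rewrite real_normK ?num_real// exprMn sqr_sqrtr ?subr_ge0// nn_sqr.
Qed.

Lemma nn_sub_l2 f a c : 0 <= a -> a <= c -> c <= b -> l2 b f -> nn a c f <= nn 0 b f.
Proof.
move=> a0 ac cb [_ f2]; rewrite !nnE ler_sqrt; last by apply: itg_ge0 => x _; exact: sqr_ge0.
rewrite (@itg_split _ 0 a b)//; [|lra].
rewrite (@itg_split _ a c b)//; [|by apply: ig_sub f2].
have h a1 a2 : 0 <= itg a1 a2 (fun x => f x ^+ 2) by apply: itg_ge0 => x _; exact: sqr_ge0.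
by have := h 0 a; have := h c b; lra.
Qed.

Lemma window f k a c : 0 <= a -> a <= c -> c <= b -> l2 b f -> bm a c k ->
  (forall x, a <= x <= c -> `|k x| <= 1) ->
  `|itg a c (fun x => f x * k x)| <= Num.sqrt (c - a) * nn 0 b f.
Proof.
move=> a0 ac cb lf bk k1.
pose k' x := if a <= x <= c then k x else 0.
have bk' : bm 0 b k'.
  split; last first.
    exists 1 => x xI; rewrite /k'; case: ifP => [/k1//|_]; by rewrite normr0.
  have -> : k' = k \_ `[a, c].
    apply/funext => x; rewrite /k' patchE; case: ifPn => h.
      by rewrite mem_set//= in_itv.
    by rewrite memNset//= in_itv/=; exact/negP.
  apply: (@measurable_funS _ _ _ _ setT) => //.
  by apply/(measurable_restrictT k) => //; case: bk.
have -> : itg a c (fun x => f x * k x) = itg a c (fun x => f x * k' x).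
  by apply: eq_itg => x xI; rewrite /k' xI.
have lfk := l2_bm lf bk'.
apply: le_trans (l2_CS a0 ac cb lfk) _; apply: ler_wpM2l; first exact: sqrtr_ge0.
apply: le_trans (nn_sub_l2 a0 ac cb lfk) _.
rewrite !nnE ler_sqrt; last by apply: itg_ge0 => x _; exact: sqr_ge0.
case: lfk => _ l1; case: lf => _ l2; apply: itg_le => // x xI; rewrite exprMn.
rewrite ler_piMr ?sqr_ge0// -(real_normK (num_real _)) expr_le1//.
by rewrite /k'; case: ifP => [/k1//|_]; rewrite normr0.
Qed.

Lemma ig_tent e c a1 a2 : ig a1 a2 (fun s : R => tent e (s - c)).
Proof. exact/bm_ig/bm_tent. Qed.

Lemma step_lo e c x : 0 < e -> x <= c - e -> step e c x = 0.
Proof.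
move=> e0 xc; have [x1|x1] := leP (c - e - 1) x; last by rewrite /step itg_gt.
rewrite /step (@eq_itg _ _ _ _ (fun=> 0)) ?itg_cst ?mul0r// => s sI.
by rewrite tent0// ler0_norm; lra.
Qed.

Lemma step_hi e c x : 0 < e -> c + e <= x -> step e c x = 1.
Proof.
move=> e0 xc; rewrite /step (@itg_split _ _ (c - e) x); [|lra..|exact: ig_tent].
rewrite (@itg_split _ _ (c + e) x); [|lra..|exact: ig_tent].
have z a1 a2 : a1 <= a2 -> (forall s, a1 <= s <= a2 -> e <= `|s - c|) ->
    itg a1 a2 (fun s => tent e (s - c)) = 0.
  move=> le h; rewrite (@eq_itg _ _ _ _ (fun=> 0)) ?itg_cst ?mul0r// => s sI.
  by rewrite tent0// h.
rewrite itg_tent1// !z; [by rewrite add0r addr0|lra| |lra|].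
- by move=> s sI; rewrite ger0_norm; lra.
- by move=> s sI; rewrite ler0_norm; lra.
Qed.

Lemma step_bound e c x : 0 < e -> 0 <= step e c x <= 1.
Proof.
move=> e0; apply/andP; split; first by apply: itg_ge0 => s _; exact: tent_ge0.
have [xc|/ltW xc] := leP x (c + e); last by rewrite step_hi.
have [x1|x1] := ltP x (c - e - 1); first by rewrite /step itg_gt.
rewrite -[leRHS](@step_hi e c (c + e))//.
rewrite /step (@itg_split _ _ x (c + e))//; last exact: ig_tent.
by rewrite lerDl; apply: itg_ge0 => s _; exact: tent_ge0.
Qed.

Lemma step_derive e c x : 0 < e -> is_derive x 1 (step e c) (tent e (x - c)).
Proof.
move=> e0; have [x1|x1] := leP x (c - e - 1); last first.
  apply: (@derive_itg _ _ (x + 1)); [lra|exact: ig_tent|exact: cts_tent].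
have -> : tent e (x - c) = 0 by rewrite tent0// ler0_norm; lra.
apply: (drv_near _ (drv_cst x 0)).
have : \forall y \near x, x - 1 < y < c - e by apply: near_in_oo; lra.
by apply: filterS => y yI; rewrite step_lo//; lra.
Qed.

(** The test function is a smoothed indicator of [[c, d]], the difference of two steps. Its
    derivative is a difference of tents, which recover [f c] and [f d] because these are Lebesgue
    points. *)
Lemma weak_derivative_lpt f f' c d : l2 b f -> l2 b f' -> weak_derivative 0 b f f' ->
  lpt f c -> lpt f d -> 0 < c -> c < d -> d < b -> f d - f c = itg c d f'.
Proof.
move=> lf lf' wd lc ld c0 cd db.
apply/eqP; rewrite -subr_eq0 -normr_le0; apply/ler_addgt0Pl => eta eta0; rewrite addr0.
pose K := nn 0 b f'.
have K0 : 0 <= K by exact: nn_ge0.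
have [ec ec0 hc] := lc (eta / 4) ltac:(lra).
have [ed ed0 hd] := ld (eta / 4) ltac:(lra).
(* Each of the four windows of length [e] around [c] and [d] costs at most [rho K <= eta / 8], and
   each of the two tents [eta / 4]: the total is [eta]. *)
pose rho := eta / (8 * (K + 1)).
have rho0 : 0 < rho by rewrite divr_gt0//; lra.
pose e := Num.min (rho ^+ 2) (Num.min (ec / 2) (Num.min (ed / 2)
  (Num.min (c / 2) (Num.min ((b - d) / 2) ((d - c) / 2))))).
have e0 : 0 < e by rewrite /e !lt_min exprn_gt0//=; lra.
have : e <= e by [].
rewrite {2}/e !le_min => /andP[e1 /andP[e2 /andP[e3 /andP[e4 /andP[e5 e6]]]]].
have se : Num.sqrt e <= rho by rewrite -(gtr0_norm rho0) -sqrtr_sqr ler_wsqrtr.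
have k1 : rho * K <= eta / 8.
  rewrite /rho invfM mulrA -mulrA ler_piMr//; first lra.
  by rewrite mulrC ler_pdivrMr; lra.
clearbody rho e.
pose phi x := step e c x - step e d x.
pose kap x := tent e (x - c) - tent e (x - d).
have dphi x : is_derive x 1 phi (kap x) by apply: drvB; exact: step_derive.
have dphiE : derive1 phi = kap.
  by apply/funext => x; rewrite derive1E; have [_ ->] := dphi x.
have ckap x : {for x, continuous kap} by apply: ctsB; exact: cts_tent.
have tphi : test_function 0 b phi.
  split; first by move=> x; have [] := dphi x.
    by rewrite dphiE.
  exists (c - e), (d + e); split; [(clear -c0 cd db e0 e4 e5 e6; lra)|(clear -c0 cd db e0 e4 e5 e6; lra)|] => x.
  rewrite in_itv/= negb_and -!ltNge => /orP[xc|xd]; rewrite /phi.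
    by rewrite !step_lo ?subrr//; (clear -c0 cd db e0 e4 e5 e6 xc; lra).
  by rewrite !step_hi ?subrr//; (clear -c0 cd db e0 e4 e5 e6 xd; lra).
have bkap a1 a2 : bm a1 a2 kap by apply: bmB; exact: bm_tent.
have cphi x : {for x, continuous phi} by exact: drv_cts (dphi x).
have bphi a1 a2 : bm a1 a2 phi by apply: bm_cont; apply: continuous_subspaceT.
have lfk g k : l2 b g -> bm 0 b k -> ig 0 b (fun x => g x * k x).
  by move=> lg /bm_l2; exact: l2_mul.
have := wd _ tphi; rewrite dphiE (itg_oo (lfk _ _ lf (bkap _ _))).
rewrite (itg_oo (lfk _ _ lf' (bphi _ _))).
have bt y a1 a2 : bm a1 a2 (fun s => tent e (s - y)) by exact: bm_tent.
rewrite (@eq_itg _ 0 b (fun x => f x * kap x)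
  (fun x => f x * tent e (x - c) - f x * tent e (x - d))); last by move=> x _; rewrite /kap mulrBr.
rewrite itgB; [|exact: lfk..].
have Hc := @tent_conv _ b f e c (eta / 4) e0 ltac:(clear -c0 cd db e0 e4 e5 e6; lra) ltac:(clear -c0 cd db e0 e4 e5 e6; lra) (l2_ig lf)
  (lfk _ _ lf (bt c _ _)) (hc e ltac:(clear -ec0 e0 e2; lra)).
have Hd := @tent_conv _ b f e d (eta / 4) e0 ltac:(clear -c0 cd db e0 e4 e5 e6; lra) ltac:(clear -c0 cd db e0 e4 e5 e6; lra) (l2_ig lf)
  (lfk _ _ lf (bt d _ _)) (hd e ltac:(clear -ed0 e0 e3; lra)).
have igp := lfk _ _ lf' (bphi 0 b).
rewrite [X in _ = - X](@itg_split _ 0 (c - e) b)//; [|(clear -c0 cd db e0 e4 e5 e6; lra)..].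
rewrite [itg (c - e) b _](@itg_split _ (c - e) c b); [|(clear -c0 cd db e0 e4 e5 e6; lra)..|by apply: ig_sub igp; (clear -c0 cd db e0 e4 e5 e6; lra)].
rewrite [itg c b _](@itg_split _ c (c + e) b); [|(clear -c0 cd db e0 e4 e5 e6; lra)..|by apply: ig_sub igp; (clear -c0 cd db e0 e4 e5 e6; lra)].
rewrite [itg (c + e) b _](@itg_split _ _ (d - e) b); [|(clear -c0 cd db e0 e4 e5 e6; lra)..|by apply: ig_sub igp; (clear -c0 cd db e0 e4 e5 e6; lra)].
rewrite [itg (d - e) b _](@itg_split _ _ d b); [|(clear -c0 cd db e0 e4 e5 e6; lra)..|by apply: ig_sub igp; (clear -c0 cd db e0 e4 e5 e6; lra)].
rewrite [itg d b _](@itg_split _ _ (d + e) b); [|(clear -c0 cd db e0 e4 e5 e6; lra)..|by apply: ig_sub igp; (clear -c0 cd db e0 e4 e5 e6; lra)].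
have igf' := l2_ig lf'.
rewrite [itg c d f'](@itg_split _ c (c + e) d); [|(clear -c0 cd db e0 e4 e5 e6; lra)..|by apply: ig_sub igf'; (clear -c0 cd db e0 e4 e5 e6; lra)].
rewrite [itg (c + e) d f'](@itg_split _ _ (d - e) d); [|(clear -c0 cd db e0 e4 e5 e6; lra)..|by apply: ig_sub igf'; (clear -c0 cd db e0 e4 e5 e6; lra)].
have z a1 a2 : a1 <= a2 -> (forall s, a1 <= s <= a2 -> phi s = 0) ->
    itg a1 a2 (fun s => f' s * phi s) = 0.
  move=> le h; rewrite (@eq_itg _ _ _ _ (fun=> 0)) ?itg_cst ?mul0r// => s sI.
  by rewrite h// mulr0.
rewrite (z 0 (c - e)); [|(clear -c0 cd db e0 e4 e5 e6; lra)|by move=> s sI; rewrite /phi !step_lo ?subrr//; (clear -c0 cd db e0 e4 e5 e6 sI; lra)].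
rewrite (z (d + e) b); [|(clear -c0 cd db e0 e4 e5 e6; lra)|by move=> s sI; rewrite /phi !step_hi ?subrr//; (clear -c0 cd db e0 e4 e5 e6 sI; lra)].
rewrite (@eq_itg _ (c + e) (d - e) (fun s => f' s * phi s) f'); last first.
  by move=> s sI; rewrite /phi step_hi ?step_lo ?subr0 ?mulr1//; (clear -c0 cd db e0 e4 e5 e6 sI; lra).
have w1 a1 : 0 <= a1 -> a1 + e <= b ->
    `|itg a1 (a1 + e) (fun s => f' s * phi s)| <= rho * K.
  move=> a10 a1b; apply: (@le_trans _ _ (Num.sqrt (a1 + e - a1) * K)).
    apply: window => //; first (clear -c0 cd db e0 e4 e5 e6 a10 a1b; lra).
    move=> x _; have := step_bound c x e0; have := step_bound d x e0.
    by rewrite /phi ler_norml; clear; lra.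
  by rewrite addrAC subrr add0r ler_wpM2r.
have w2 a1 : 0 <= a1 -> a1 + e <= b ->
    (forall s, a1 <= s <= a1 + e -> 0 <= phi s <= 1) ->
    `|itg a1 (a1 + e) f' - itg a1 (a1 + e) (fun s => f' s * phi s)| <= rho * K.
  move=> a10 a1b hp; rewrite -itgB; [|by apply: ig_sub igf'; (clear -c0 cd db e0 e4 e5 e6 a10 a1b; lra)|by apply: ig_sub igp; (clear -c0 cd db e0 e4 e5 e6 a10 a1b; lra)].
  rewrite (@eq_itg _ _ _ _ (fun s => f' s * (1 - phi s))); last first.
    by move=> s _; ring.
  apply: (@le_trans _ _ (Num.sqrt (a1 + e - a1) * K)).
    apply: window => //; [(clear -c0 cd db e0 e4 e5 e6 a10 a1b; lra)|by apply: bmB => //; exact: bm_cst|].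
    by move=> x xI; have := hp x xI; rewrite ler_norml; clear; lra.
  by rewrite addrAC subrr add0r ler_wpM2r.
have := w1 (c - e) ltac:(clear -c0 cd db e0 e4 e5 e6; lra) ltac:(clear -c0 cd db e0 e4 e5 e6; lra); rewrite subrK => W1.
have W2 := w1 d ltac:(clear -c0 cd db e0 e4 e5 e6; lra) ltac:(clear -c0 cd db e0 e4 e5 e6; lra).
have W3 := w2 c ltac:(clear -c0 cd db e0 e4 e5 e6; lra) ltac:(clear -c0 cd db e0 e4 e5 e6; lra).
have := w2 (d - e) ltac:(clear -c0 cd db e0 e4 e5 e6; lra) ltac:(clear -c0 cd db e0 e4 e5 e6; lra); rewrite subrK => W4.
have {}W3 : `|itg c (c + e) f' - itg c (c + e) (fun s => f' s * phi s)| <= rho * K.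
  apply: W3 => s sI; rewrite /phi (@step_lo e d s)//; last (clear -c0 cd db e0 e4 e5 e6 sI; lra).
  by rewrite subr0 step_bound.
have {}W4 : `|itg (d - e) d f' - itg (d - e) d (fun s => f' s * phi s)| <= rho * K.
  apply: W4 => s sI; rewrite /phi (@step_hi e c s)//; last (clear -c0 cd db e0 e4 e5 e6 sI; lra).
  by have := step_bound d s e0; clear; lra.
move: Hc Hd W1 W2 W3 W4 k1.
set A1 := itg 0 b _; set A2 := itg 0 b _.
move=> Hc Hd W1 W2 W3 W4 k1 E.
move: Hc Hd W1 W2 W3 W4 k1 E; rewrite !ler_norml; clear; lra.
Qed.

(** A null set contains no interval. With a continuity argument, this is how properties known for
    almost all times are carried to all times. *)
Lemma ae_dense (P : R -> Prop) : {ae leb R, forall x, P x} ->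
  forall a c : R, a < c -> exists2 x, a < x < c & P x.
Proof.
move=> [A [mA A0 PA]] a c ac; apply: contrapT => H.
have sub : `]a, c[%classic `<=` A.
  move=> x; rewrite /= in_itv/= => xI; apply: PA => /= Px; apply: H; by exists x.
have : (leb R `]a, c[%classic <= leb R A)%E by apply: le_measure => //; rewrite inE.
by rewrite A0 lebesgue_measure_itv/= lte_fin ac -EFinD lee_fin; lra.
Qed.

Lemma weak_derivative_ae f f' : l2 b f -> l2 b f' -> weak_derivative 0 b f f' ->
  exists c, {ae leb R, forall x, 0 < x < b -> f x = c + itg 0 x f'}.
Proof.
move=> lf lf' wd; have aelp := lebesgue_pts (l2_ig lf).
have [x0 x0I lx0] := ae_dense aelp hb.
exists (f x0 - itg 0 x0 f'); apply: filterS aelp; first exact: (ae_filter_ringOfSetsType (leb R)).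
move=> x lx xI; have igf' := l2_ig lf'.
have [xx|xx|<-] := ltgtP x x0; last by rewrite subrK.
- have := weak_derivative_lpt lf lf' wd (lx xI) (lx0 x0I) ltac:(lra) xx ltac:(lra).
  rewrite (@itg_split _ 0 x x0); [lra|lra|lra|by apply: ig_sub igf'; lra].
- have := weak_derivative_lpt lf lf' wd (lx0 x0I) (lx xI) ltac:(lra) xx ltac:(lra).
  rewrite (@itg_split _ 0 x0 x); [lra|lra|lra|by apply: ig_sub igf'; lra].
Qed.

End Sobolev.

(** The antiderivative without constant term: at index 0 the quotient is 0, since [0^-1 = 0]. *)
Definition primp {R : realType} (p : {poly R}) : {poly R} :=
  \poly_(i < (size p).+1) (p`_i.-1 / i%:R).

Lemma deriv_primp {R : realType} (p : {poly R}) : deriv (primp p) = p.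
Proof.
apply/polyP => i; rewrite coef_deriv coef_poly ltnS /=.
case: ltnP => [_|ip]; last by rewrite mul0rn nth_default.
by rewrite -[LHS]mulr_natr mulfVK// pnatr_eq0.
Qed.

Lemma size_primp {R : realType} (p : {poly R}) : (size (primp p) <= (size p).+1)%N.
Proof. exact: size_poly. Qed.

Lemma within_eps {R : realType} (a c : R) (f : R -> R) : {within `[a, c], continuous f} ->
  forall x e, a <= x <= c -> 0 < e ->
  exists2 d, 0 < d & forall y, a <= y <= c -> `|y - x| < d -> `|f y - f x| <= e.
Proof.
move=> cf x e xI e0; have xI' : [set` `[a, c]] x by rewrite /= in_itv.
move/subspace_continuousP : cf => /(_ x xI') /cvgrPdist_le/(_ _ e0).
rewrite !near_withinE => -[d /= d0 hg]; exists d => // y yI yx.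
by rewrite distrC; apply: hg; rewrite /= ?in_itv//= distrC.
Qed.

Lemma eps_within {R : realType} (a c : R) (f : R -> R) :
  (forall x e, a <= x <= c -> 0 < e ->
    exists2 d, 0 < d & forall y, a <= y <= c -> `|y - x| < d -> `|f y - f x| <= e) ->
  {within `[a, c], continuous f}.
Proof.
move=> fL; apply/subspace_continuousP => x; rewrite /= in_itv/= => xI.
apply/cvgrPdist_le => e e0; rewrite near_withinE.
have [d d0 H] := fL x e xI e0.
exists d => // y /= yd yI; rewrite distrC; apply: H; last by rewrite distrC.
by move: yI; rewrite in_itv.
Qed.

Lemma holder_within {R : realType} (a c K : R) (f : R -> R) : 0 <= K ->
  (forall x y, a <= x -> x <= y -> y <= c -> `|f x - f y| <= K * Num.sqrt (y - x)) ->
  {within `[a, c], continuous f}.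
Proof.
move=> K0 fL; apply: eps_within => x e xI e0.
pose d := (e / (K + 1)) ^+ 2.
have K1 : 0 < K + 1 by lra.
have eK : 0 < e / (K + 1) by rewrite divr_gt0.
have d0 : 0 < d by rewrite exprn_gt0.
have key y1 y2 : a <= y1 -> y1 <= y2 -> y2 <= c -> y2 - y1 < d -> `|f y1 - f y2| <= e.
  move=> h1 h2 h3 h4; apply: le_trans (fL _ _ h1 h2 h3) _.
  apply: (@le_trans _ _ (K * (e / (K + 1)))).
    apply: ler_wpM2l => //; rewrite -(gtr0_norm eK) -sqrtr_sqr ler_wsqrtr//; exact: ltW.
  rewrite mulrA ler_pdivrMr// mulrC; apply: ler_wpM2l; lra.
exists d => // y yI; rewrite ltr_norml => yd.
have [xy|/ltW yx] := leP x y; last by apply: key; lra.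
by rewrite distrC; apply: key; lra.
Qed.

(** * Sobolev functions as iterated primitives and their polynomial approximation *)

Section SobolevChain.
Context {R : realType} (b : R) (hb : 0 < b).
Implicit Types (a c d e x y : R) (f g : R -> R).

Lemma itg_holder f x y : 0 <= x -> x <= y -> y <= b -> l2 b f ->
  `|itg 0 x f - itg 0 y f| <= nn 0 b f * Num.sqrt (y - x).
Proof.
move=> x0 xy yb lf; rewrite (@itg_split _ 0 x y)//; last by apply: ig_sub (l2_ig lf).
rewrite opprD addNKr normrN; apply: le_trans (l2_CS x0 xy yb lf) _.
by rewrite mulrC; apply: ler_wpM2r; [exact: sqrtr_ge0|exact: nn_sub_l2].
Qed.

Lemma bm_itg_l2 f : l2 b f -> bm 0 b (fun x => itg 0 x f).
Proof.
move=> lf; apply/bm_cont/(@holder_within _ _ _ (nn 0 b f)); first exact: nn_ge0.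
by move=> x y x0 xy yb; exact: itg_holder.
Qed.

Lemma eq_itg_ae f g x : measurable_fun `[0, b] f -> measurable_fun `[0, b] g ->
  ig 0 b f -> ig 0 b g -> 0 <= x <= b ->
  {ae leb R, forall s, 0 < s < b -> f s = g s} -> itg 0 x f = itg 0 x g.
Proof.
move=> mf mg jf jg xI fg.
have [jf' jg'] : ig 0 x f /\ ig 0 x g by split; [apply: ig_sub jf|apply: ig_sub jg]; lra.
have sub : `]0, x[%classic `<=` `[0, b]%classic by move=> s; rewrite /= !in_itv/=; lra.
rewrite -!itg_oo// /Rintegral; congr fine; apply: ae_eq_integral => //.
- by apply/measurable_EFinP; apply: measurable_funS mf.
- by apply/measurable_EFinP; apply: measurable_funS mg.
apply: filterS fg; first exact: (ae_filter_ringOfSetsType (leb R)).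
by move=> s h; rewrite /= in_itv/= => sI; rewrite h//; lra.
Qed.

Lemma eq_ae_cts f g : {within `[0, b], continuous f} -> {within `[0, b], continuous g} ->
  {ae leb R, forall s, 0 < s < b -> f s = g s} -> forall x, 0 <= x <= b -> f x = g x.
Proof.
move=> cf cg fg x xI; apply/eqP; rewrite -subr_eq0 -normr_le0.
apply/ler_addgt0Pl => e e0; rewrite addr0.
have e2 : 0 < e / 2 by slim_lra.
have [d1 d10 H1] := within_eps cf xI e2.
have [d2 d20 H2] := within_eps cg xI e2.
pose d := Num.min d1 d2.
have d0 : 0 < d by rewrite lt_min d10.
have [dd1 dd2] : d <= d1 /\ d <= d2 by rewrite !ge_min !lexx orbT.
clearbody d.
have lr : Num.max 0 (x - d) < Num.min b (x + d) by have := hb; rewrite gt_max !lt_min; slim_lra.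
have [y + fgy] := ae_dense fg lr.
rewrite gt_max lt_min => yI.
have yI' : 0 < y < b by slim_lra.
have := H1 y ltac:(slim_lra) ltac:(rewrite ltr_norml; slim_lra).
have := H2 y ltac:(slim_lra) ltac:(rewrite ltr_norml; slim_lra).
by rewrite fgy// !ler_norml; slim_lra.
Qed.

Section Chain.
Context (m : nat) (D : nat -> R -> R).
Hypothesis lD : forall j, (j <= m)%N -> l2 b (D j).
Hypothesis wD : forall j, (j < m)%N -> weak_derivative 0 b (D j) (D j.+1).

(** Each weak derivative below the highest one is replaced by its continuous representative. The
    almost everywhere equalities become equalities under the integral, so each function is an
    everywhere valid primitive of the next. *)
Lemma sobolev_chain : exists v : nat -> R -> R, [/\ v m = D m,
  forall j, (j < m)%N -> exists c, forall x, 0 <= x <= b -> v j x = c + itg 0 x (v j.+1) &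
  forall j, (j <= m)%N -> l2 b (v j) /\ {ae leb R, forall x, 0 < x < b -> D j x = v j x}].
Proof.
have /choice[cc ccP] j : exists c, (j < m)%N ->
    {ae leb R, forall x, 0 < x < b -> D j x = c + itg 0 x (D j.+1)}.
  case: (ltnP j m) => jm; last by exists 0.
  by have [c cP] := weak_derivative_ae hb (lD (ltnW jm)) (lD jm) (wD jm); exists c.
pose v j x := if (j < m)%N then cc j + itg 0 x (D j.+1) else D j x.
have vm : v m = D m by apply/funext => x; rewrite /v ltnn.
have lv j : (j <= m)%N -> l2 b (v j).
  rewrite leq_eqVlt => /orP[/eqP->|jm]; first by rewrite vm; exact: lD.
  apply: bm_l2; rewrite /v jm; apply: bmD; first exact: bm_cst.
  exact/bm_itg_l2/lD.
have aev j : (j <= m)%N -> {ae leb R, forall x, 0 < x < b -> D j x = v j x}.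
  rewrite leq_eqVlt => /orP[/eqP->|jm].
    by rewrite vm; apply: aeW.
  by rewrite /v jm; exact: ccP.
exists v; split => [//|j jm|j jm]; last by split; [exact: lv|exact: aev].
exists (cc j) => x xI; rewrite {1}/v jm.
congr (_ + _); apply: eq_itg_ae => //.
- by have [] := lD jm.
- by have [] := lv _ jm.
- exact/l2_ig/lD.
- exact/l2_ig/lv.
- exact: aev.
Qed.

Context (v : nat -> R -> R).
Hypothesis vm : v m = D m.
Hypothesis vP : forall j, (j < m)%N ->
  exists c, forall x, 0 <= x <= b -> v j x = c + itg 0 x (v j.+1).
Hypothesis lv : forall j, (j <= m)%N -> l2 b (v j).

Lemma chain_sub j x y : (j < m)%N -> 0 <= x -> x <= y -> y <= b ->
  v j y - v j x = itg x y (v j.+1).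
Proof.
move=> jm x0 xy yb; have [c h] := vP jm; rewrite !h; [|lra..].
rewrite (@itg_split _ 0 x y)//; last by apply: ig_sub (l2_ig (lv jm)).
by ring.
Qed.

Lemma chain_within j : (j < m)%N -> {within `[0, b], continuous (v j)}.
Proof.
move=> jm; apply: (@holder_within _ _ _ (nn 0 b (v j.+1))); first exact: nn_ge0.
have [c h] := vP jm; move=> x y x0 xy yb; rewrite !h; [|lra..].
rewrite opprD addrACA subrr add0r; apply: itg_holder => //; exact: lv.
Qed.

(** At the lowest order the increment is bounded by Cauchy-Schwarz; each further order integrates
    the polynomial found for the derivative and gains one factor [c - a]. The norm of the highest
    derivative is kept local, to be summed over cells later. *)
Lemma taylor_chain a c n : 0 <= a -> a <= c -> c <= b ->
  forall j, (j + n.+1)%N = m -> exists2 P : {poly R}, (size P <= n.+1)%N &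
    forall x, a <= x <= c ->
      `|v j x - P.[x]| <= (c - a) ^+ n * (Num.sqrt (c - a) * nn a c (D m)).
Proof.
move=> a0 ac cb; elim: n => [|n ih] j jn.
  have jm : (j < m)%N by rewrite -jn addn1.
  have jE : j.+1 = m by rewrite -jn addn1.
  exists (v j a)%:P => [|x xI]; first exact: size_polyC_leq1.
  rewrite hornerC expr0 mul1r chain_sub//; [|lra..].
  rewrite jE vm; have lm := lD (leqnn m).
  apply: le_trans (l2_CS a0 _ _ lm) _; [lra|lra|].
  apply: ler_pM; rewrite ?sqrtr_ge0 ?nn_ge0//; first by apply: ler_wsqrtr; lra.
  rewrite !nnE; apply: ler_wsqrtr; rewrite [leRHS](@itg_split _ a x c); [|lra..|].
    by rewrite lerDl; apply: itg_ge0 => s _; exact: sqr_ge0.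
  by case: lm => _; apply: ig_sub.
have jm : (j < m)%N by rewrite -jn addnS ltnS leq_addr.
have [P sP hP] := ih j.+1 ltac:(by rewrite -jn !addnS addSn).
pose Q := primp P; exists (Q + (v j a - Q.[a])%:P) => [|x xI].
  apply: leq_trans (size_polyD _ _) _; rewrite geq_max (leq_trans (size_primp _) _)//=.
  exact: leq_trans (size_polyC_leq1 _) _.
have -> : v j x - (Q + (v j a - Q.[a])%:P).[x] = (v j x - v j a) - (Q.[x] - Q.[a]).
  by rewrite hornerD hornerC; ring.
rewrite chain_sub//; [|lra..].
have [_ ->] := prim_poly a c Q; [|lra..]; rewrite deriv_primp.
have igv : ig a x (v j.+1) by apply: ig_sub (l2_ig (lv jm)); lra.
have igP : ig a x (fun y => P.[y]) by exact/bm_ig/bm_poly.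
rewrite -itgB//; apply: le_trans (itg_bound _ (igB igv igP) _) _; [lra| |].
  by move=> s sI; apply: hP; lra.
rewrite mulrC exprS -mulrA; apply: ler_wpM2r; last lra.
by rewrite mulr_ge0 ?exprn_ge0 ?mulr_ge0 ?sqrtr_ge0 ?nn_ge0//; lra.
Qed.

End Chain.

(* For m >= 2, a continuous representative is C^1 with 1/2-Hoelder derivative;
   the latter is expressed by a bound on the increments of order two. *)
Lemma sobolev m D f M : (2 <= m)%N -> 0 <= M ->
  (forall j, (j <= m)%N -> l2 b (D j)) ->
  (forall j, (j < m)%N -> weak_derivative 0 b (D j) (D j.+1)) ->
  nn 0 b (D 1%N) <= M -> nn 0 b (D 2%N) <= M ->
  {within `[0, b], continuous f} -> (forall x, 0 < x < b -> f x = D 0%N x) ->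
  let K := (Num.sqrt b + (Num.sqrt b)^-1) * M in
  [/\ forall x y, 0 <= x -> x <= y -> y <= b -> `|f y - f x| <= K * (y - x),
    forall x y e, 0 <= x -> x <= y -> 0 <= e -> y + e <= b ->
      `|(f (y + e) - f y) - (f (x + e) - f x)| <= M * Num.sqrt (y - x) * e &
    forall a c, 0 <= a -> a <= c -> c <= b -> exists2 P : {poly R}, (size P <= m)%N &
      forall x, a <= x <= c ->
        `|f x - P.[x]| <= (c - a) ^+ m.-1 * (Num.sqrt (c - a) * nn a c (D m))].
Proof.
move=> m2 M0 lD wD M1 M2 cf fD K.
have [v [vm vP lv']] := sobolev_chain lD wD.
have lv j : (j <= m)%N -> l2 b (v j) by move=> jm; have [] := lv' _ jm.
have m0 : (0 < m)%N by exact: leq_trans m2.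
have m1 : (1 < m)%N by [].
have nnv j : (j <= m)%N -> nn 0 b (v j) = nn 0 b (D j).
  move=> jm; rewrite !nnE; congr Num.sqrt; have [_ av] := lv' _ jm.
  have [mv v2] := lv _ jm; have [md d2] := lD _ jm.
  apply: eq_itg_ae => //; [exact: measurable_funX|exact: measurable_funX|have := hb; slim_lra|].
  apply: filterS av; first exact: (ae_filter_ringOfSetsType (leb R)).
  by move=> x h xI; rewrite h.
have fv x : 0 <= x <= b -> f x = v 0%N x.
  apply: eq_ae_cts => //; first exact: (chain_within vP lv).
  have [_ av] := lv' 0%N isT.
  apply: filterS av; first exact: (ae_filter_ringOfSetsType (leb R)).
  by move=> y h yI; rewrite fD// h.
have hold x y : 0 <= x -> x <= y -> y <= b -> `|v 1%N x - v 1%N y| <= M * Num.sqrt (y - x).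
  move=> x0 xy yb; have [c h] := vP _ m1; rewrite !h; [|slim_lra..].
  rewrite opprD addrACA subrr add0r; apply: le_trans (itg_holder x0 xy yb (lv _ m2)) _.
  by apply: ler_wpM2r; [exact: sqrtr_ge0|rewrite nnv].
have hold2 x y : 0 <= x <= b -> 0 <= y <= b -> `|v 1%N x - v 1%N y| <= M * Num.sqrt b.
  wlog xy : x y / x <= y => [hw xI yI|xI yI].
    have [xy|/ltW yx] := leP x y; first exact: hw.
    by rewrite distrC; exact: hw.
  apply: le_trans (hold x y _ _ _) _; [slim_lra..|].
  by apply: ler_wpM2l => //; apply: ler_wsqrtr; slim_lra.
have cv1 := chain_within vP lv m1.
have bv1 : bm 0 b (v 1%N) by exact: bm_cont.
have sb : 0 < Num.sqrt b by rewrite sqrtr_gt0.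
(* A value is the mean plus an oscillation: the mean is at most [M / sqrt b] and the oscillation at
   most [M sqrt b], whence [K]. *)
have supv x : 0 <= x <= b -> `|v 1%N x| <= K.
  move=> xI; rewrite -(ler_pM2r hb).
  have igv : ig 0 b (fun s => v 1%N s) by exact: bm_ig.
  have E : v 1%N x * b = itg 0 b (fun s => v 1%N x - v 1%N s) + itg 0 b (v 1%N).
    by rewrite itgB ?itg_cst//; [ring|exact: ltW|exact/bm_ig/bm_cst].
  rewrite -{1}(gtr0_norm hb) -normrM E; apply: le_trans (ler_normD _ _) _.
  have h1 : `|itg 0 b (fun s => v 1%N x - v 1%N s)| <= M * Num.sqrt b * (b - 0).
    apply: itg_bound; [exact: ltW|by apply: igB => //; exact/bm_ig/bm_cst|].
    by move=> s sI; exact: hold2.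
  have h2 : `|itg 0 b (v 1%N)| <= Num.sqrt b * M.
    apply: le_trans (l2_CS (lexx _) (ltW hb) (lexx _) (lv _ m0)) _.
    by rewrite subr0; apply: ler_wpM2l; [exact: sqrtr_ge0|rewrite nnv].
  apply: le_trans (lerD h1 h2) _; rewrite subr0 le_eqVlt; apply/orP; left; apply/eqP.
  rewrite /K.
  have := esym (sqr_sqrtr (ltW hb)); move: sb; generalize (Num.sqrt b) => q q0 ->.
  by field; exact: lt0r_neq0.
have dv x : 0 < x < b -> is_derive x 1 f (v 1%N x).
  move=> xI; have [c h] := vP _ m0.
  have d1 : is_derive x 1 (fun y => c + itg 0 y (v 1%N)) (v 1%N x).
    have d2 : is_derive x 1 (fun y => itg 0 y (v 1%N)) (v 1%N x).
      apply: (@derive_itg _ _ b) => //; first exact: bm_ig.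
      exact: (@cts_within _ _ 0 b).
    by have := drvD (drv_cst x c) d2; rewrite add0r.
  apply: (drv_near _ d1); have := near_in_oo xI; apply: filterS => y yI.
  by rewrite fv ?h//; slim_lra.
split.
- move=> x y x0 xy yb; apply: (@MVT_bound _ x y K f (v 1%N)) => //.
  + by apply: continuous_subspaceW cf => s; rewrite /= !in_itv/=; slim_lra.
  + by move=> s sI; apply: dv; slim_lra.
  + by move=> s sI; apply: supv; slim_lra.
- move=> x y e x0 xy e0 yeb.
  pose F s := f (y + s) - f (x + s).
  have : `|F e - F 0| <= M * Num.sqrt (y - x) * (e - 0).
    apply: (@MVT_bound _ 0 e _ F (fun s => v 1%N (y + s) - v 1%N (x + s))) => //.
    + apply: eps_within => s eta sI eta0.
      have e2 : 0 < eta / 2 by slim_lra.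
      have ysI : 0 <= y + s <= b by slim_lra.
      have xsI : 0 <= x + s <= b by slim_lra.
      have [d1 d10 H1] := within_eps cf ysI e2.
      have [d2 d20 H2] := within_eps cf xsI e2.
      exists (Num.min d1 d2) => [|s' s'I]; first by rewrite lt_min d10.
      rewrite lt_min => /andP[k1 k2].
      have := H1 (y + s') ltac:(slim_lra); 
      have -> : y + s' - (y + s) = s' - s by ring.
      move=> /(_ k1) G1.
      have := H2 (x + s') ltac:(slim_lra).
      have -> : x + s' - (x + s) = s' - s by ring.
      move=> /(_ k2) G2; move: G1 G2; rewrite /F !ler_norml; slim_lra.
    + move=> s sI; have sh a : a = x \/ a = y -> is_derive s 1 (fun s => f (a + s)) (v 1%N (a + s)).
        move=> ha; rewrite -[v 1%N _]mulr1; apply: drv_comp.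
          by have := drvD (drv_cst s a) (drv_id s); rewrite add0r.
        by apply: dv; case: ha => ->; slim_lra.
      by apply: drvB; apply: sh; [right|left].
    + move=> s sI; rewrite distrC; apply: le_trans (hold (x + s) (y + s) _ _ _) _; [slim_lra..|].
      by rewrite opprD addrACA subrr addr0.
  rewrite subr0 /F !addr0; congr (`|_| <= _); ring.
- move=> a c a0 ac cb; have [|P sP hP] := taylor_chain lD vm vP lv a0 ac cb (n := m.-1) (j := 0%N).
    by rewrite add0n prednK.
  exists P; first by rewrite -(prednK m0).
  by move=> x xI; rewrite fv; [exact: hP|slim_lra].
Qed.

End SobolevChain.

(** * From Sobolev and Bochner norms to bounds on representatives *)

Section Norms.
Context {R : realType} (b : R) (hb : 0 < b).
Implicit Types (a c : R) (f : R -> R).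

Lemma measurable_oo_cc a c f : measurable_fun `]a, c[ f -> measurable_fun `[a, c] f.
Proof.
by move=> mf; apply/measurable_fun_itv_bndo_bndcP/measurable_fun_itv_obnd_cbndP.
Qed.

Lemma ig_sqr_le a c f (A : R) : measurable_fun `[a, c] f ->
  (\int[leb R]_(x in `]a, c[) ((f x) ^+ 2)%:E <= A%:E)%E ->
  ig a c (fun x => f x ^+ 2) /\ itg a c (fun x => f x ^+ 2) <= A.
Proof.
move=> mf le.
have mf2 : measurable_fun `[a, c] (fun x => f x ^+ 2) by exact: measurable_funX.
have jf : ig a c (fun x => f x ^+ 2).
  apply/integrableP; split; first exact/measurable_EFinP.
  under eq_integral do rewrite /= normrX real_normK ?num_real//.
  apply: le_lt_trans (ltry A); apply: le_trans le.
  have [ac|ca] := ltP a c; last first.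
    move: ca; rewrite le_eqVlt => /orP[/eqP->|ca].
      by rewrite set_itv1 integral_set1 integral_ge0// => x _; rewrite lee_fin sqr_ge0.
    rewrite !set_itv_ge ?bnd_simp -?ltNge -?leNgt// ?ltW//.
  rewrite -integral_itv_obnd_cbnd; last exact/measurable_EFinP/measurable_fun_itv_obnd_cbndP.
  rewrite integral_itv_bndo_bndc//.
  apply/measurable_EFinP; apply: measurable_funS mf2 => // x; rewrite /= !in_itv/=; lra.
split => //; rewrite -itg_oo// /Rintegral -lee_fin fineK//.
apply: integrable_fin_num => //; apply: integrableS jf => // x; rewrite /= !in_itv/=; lra.
Qed.

Lemma ae_imp (P Q : R -> Prop) : {ae leb R, forall x, P x} -> (forall x, P x -> Q x) ->
  {ae leb R, forall x, Q x}.
Proof.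
move=> [A [mA A0 PA]] PQ; exists A; split => // x nQ; apply: PA => /= Px; apply: nQ.
exact: PQ.
Qed.

Lemma leb_setT_gt0 : (0 < leb R [set: R])%E.
Proof.
have h : (leb R `]0%R, 1%R[%classic <= leb R [set: R])%E by apply: le_measure => //; rewrite inE.
apply: lt_le_trans h.
by rewrite lebesgue_measure_itv/= lte_fin ltr01 -EFinD lte_fin subr0.
Qed.

Lemma Lp_norm_oo f M : 0 <= M -> measurable_fun `]0, b[ f -> (Lp_norm 0 b +oo f <= M%:E)%E ->
  l2 b f /\ forall a c, 0 <= a -> a <= c -> c <= b -> nn a c f <= M * Num.sqrt (c - a).
Proof.
move=> M0 /measurable_oo_cc mf; rewrite /Lp_norm unlock.
have mu0 := leb_setT_gt0.
rewrite mu0 => /ess_sup_inf.ess_supP aeM.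
have aeM' : {ae leb R, forall x, 0 < x < b -> `|f x| <= M}.
  apply: (ae_imp aeM) => x /=; rewrite patchE => + xI.
  by rewrite mem_set ?lee_fin//= in_itv.
have key a c : 0 <= a -> a <= c -> c <= b ->
    ig a c (fun x => f x ^+ 2) /\ itg a c (fun x => f x ^+ 2) <= M ^+ 2 * (c - a).
  move=> a0 ac cb; apply: ig_sqr_le.
    apply: measurable_funS mf => // x; rewrite /= !in_itv/=; lra.
  have -> : (M ^+ 2 * (c - a))%:E = (\int[leb R]_(x in `]a, c[) (M ^+ 2)%:E)%E.
    rewrite integral_cst//.
    have mE : leb R `]a, c[%classic = (c - a)%:E.
      rewrite lebesgue_measure_itv/= lte_fin.
      by case: ltP => [_|ca]; rewrite -?EFinD//; have -> : c - a = 0 by lra.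
    exact: (congr1 (fun z => (M ^+ 2)%:E * z)%E (esym mE)).
  apply: ae_ge0_le_integral => //.
  - by move=> x _; rewrite lee_fin sqr_ge0.
  - apply/measurable_EFinP; apply: measurable_funX.
    apply: measurable_funS mf => // x; rewrite /= !in_itv/=; lra.
  - by move=> x _; rewrite lee_fin sqr_ge0.
  apply: filterS aeM'; first exact: (ae_filter_ringOfSetsType (leb R)).
  move=> x h; rewrite /= in_itv/= => xI; rewrite lee_fin -(real_normK (num_real (f x))).
  by apply: lerXn2r; rewrite ?nnegrE// h//; lra.
split; first by split => //; have [] := key 0 b (lexx _) (ltW hb) (lexx _).
move=> a c a0 ac cb; have [_ le] := key a c a0 ac cb.
rewrite nnE -(ger0_norm M0) -sqrtr_sqr -sqrtrM ?sqr_ge0//; exact: ler_wsqrtr.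
Qed.

Lemma Lp_norm_2 f M : 0 <= M -> measurable_fun `]0, b[ f -> (Lp_norm 0 b 2%:E f <= M%:E)%E ->
  l2 b f /\ nn 0 b f <= M.
Proof.
move=> M0 /measurable_oo_cc mf le.
have [] := @ig_sqr_le 0 b f (M ^+ 2) mf.
  have : (Lp_norm 0 b 2%:E f `^ 2 <= M%:E `^ 2)%E.
    by apply: gt0_ler_poweR => //; rewrite ?in_itv/= ?Lnorm_ge0 ?lee_fin ?M0 ?leey.
  rewrite /Lp_norm poweR_Lnorm ?pnatr_eq0//= powR_mulrn// => /(le_trans _); apply.
  rewrite integral_mkcond/= le_eqVlt; apply/orP; left; apply/eqP; apply: eq_integral => x _.
  rewrite !patchE; case: ifPn => _; rewrite /= ?powR_mulrn ?normr_ge0//.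
    by rewrite real_normK ?num_real.
  by rewrite normr0 expr0n.
move=> h1 h2; split; first by split.
by rewrite nnE -(ger0_norm M0) -sqrtr_sqr; exact: ler_wsqrtr.
Qed.

Lemma W_norm_lt m p f M : (W_norm 0 b m p f < M%:E)%E -> exists D : nat -> R -> R,
  [/\ D 0%N = f,
    forall j, (j <= m)%N -> measurable_fun `]0, b[ (D j) /\ (Lp_norm 0 b p (D j) <= M%:E)%E &
    forall j, (j < m)%N -> weak_derivative 0 b (D j) (D j.+1)].
Proof.
move=> /ereal_inf_lt[_ [D [D0 mD wD] <-] lt]; exists D; split => // j jm.
split; first by have [] := mD j jm.
apply: ltW; apply: le_lt_trans lt.
rewrite (bigD1 (Ordinal (jm : (j < m.+1)%N)))//= leeDl// sume_ge0// => i _.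
exact: Lnorm_ge0.
Qed.

Lemma Linfty_Bochner_ae T nrm (v : R -> R -> R) : (forall f, 0 <= nrm f)%E ->
  Linfty_Bochner T nrm v ->
  exists2 M : R, 0 < M & {ae leb R, forall t, 0 < t < T -> (nrm (v t) < M%:E)%E}.
Proof.
move=> nrm0 [_]; rewrite unlock.
have mu0 := leb_setT_gt0.
rewrite mu0; set L := ess_sup_inf.ess_sup _ _ => Loo.
have aeL : {ae leb R, forall t, 0 < t < T -> (nrm (v t) <= L)%E}.
  have := ess_sup_inf.ess_sup_ge (leb R) (abse \o (fun t => nrm (v t)) \_ `]0, T[).
  move/ae_imp; apply => t /=; rewrite patchE => + tI.
  by rewrite mem_set/= ?in_itv// gee0_abs.
exists (`|fine L| + 1); first by rewrite ltr_wpDl.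
apply: filterS aeL; first exact: (ae_filter_ringOfSetsType (leb R)).
move=> t h tI; apply: le_lt_trans (h tI) _.
case: L Loo {h} => [l _|//|_]; last exact: ltNyr.
by rewrite lte_fin /=; have := ler_norm l; lra.
Qed.

End Norms.

(** * Regularity of the exact solution *)

Definition hold {R : realType} (b C : R) (f : R -> R) : Prop :=
  forall x y, 0 <= x -> x <= y -> y <= b -> `|f y - f x| <= C * Num.sqrt (y - x).

(* [f0] and [f1] are meant to be the values of a function at two times with
   distance [tau]. *)
Definition gd {R : realType} (b C tau : R) (f0 f1 : R -> R) : Prop :=
  [/\ forall x, 0 <= x <= b -> [/\ `|f0 x| <= C, `|f1 x| <= C & `|f1 x - f0 x| <= C * tau],
      hold b C f0, hold b C f1 & hold b (C * tau) (fun x => f1 x - f0 x)].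

(** Weighted means with their limits at 0. [wav 0 f] is the average of [f], and [wav 1] of a
    derivative is [aa] of its primitive, so that regularity of both reduces to one family of
    operators. *)
Definition wav {R : realType} (j : nat) (f : R -> R) (x : R) : R :=
  if x == 0 then f 0 / j.+1%:R else itg 0 x (fun s => s ^+ j * f s) / x ^+ j.+1.

Section Good.
Context {R : realType} (b : R) (hb : 0 < b).
Implicit Types (x y C tau : R) (f g : R -> R).

Lemma hold_bm C f : 0 <= C -> hold b C f -> bm 0 b f.
Proof.
move=> C0 h; apply/bm_cont/(holder_within C0) => x y x0 xy yb.
by rewrite distrC; exact: h.
Qed.

Lemma hold_le C C' f : C <= C' -> hold b C f -> hold b C' f.
Proof.
move=> CC h x y x0 xy yb; apply: le_trans (h x y x0 xy yb) _.
by apply: ler_wpM2r; first exact: sqrtr_ge0.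
Qed.

Lemma holdD C C' f g : hold b C f -> hold b C' g -> hold b (C + C') (fun x => f x + g x).
Proof.
move=> hf hg x y x0 xy yb; rewrite opprD addrACA mulrDl.
exact: le_trans (ler_normD _ _) (lerD (hf x y x0 xy yb) (hg x y x0 xy yb)).
Qed.

Lemma holdM C C' A A' f g : 0 <= A -> 0 <= A' ->
  (forall x, 0 <= x <= b -> `|f x| <= A) -> (forall x, 0 <= x <= b -> `|g x| <= A') ->
  hold b C f -> hold b C' g -> hold b (A * C' + A' * C) (fun x => f x * g x).
Proof.
move=> A0 A0' fA gA hf hg x y x0 xy yb.
have := hf x y x0 xy yb; have := hg x y x0 xy yb.
have := fA y ltac:(lra); have := gA x ltac:(lra).
rewrite (_ : f y * g y - f x * g x = f y * (g y - g x) + g x * (f y - f x)); last by ring.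
set s := Num.sqrt _ => h1 h2 h3 h4.
apply: le_trans (ler_normD _ _) _; rewrite !normrM mulrDl -!mulrA.
by apply: lerD; apply: ler_pM.
Qed.

Lemma hold_lip L f : 0 <= L -> (forall x y, 0 <= x -> x <= y -> y <= b -> `|f y - f x| <= L * (y - x)) ->
  hold b (L * Num.sqrt b) f.
Proof.
move=> L0 h x y x0 xy yb; apply: le_trans (h x y x0 xy yb) _.
rewrite -mulrA; apply: ler_wpM2l => //.
rewrite -{1}(sqr_sqrtr (_ : 0 <= y - x)); last lra.
by rewrite expr2; apply: ler_wpM2r; [exact: sqrtr_ge0|apply: ler_wsqrtr; lra].
Qed.

Lemma wav_sub f g j x : bm 0 b f -> bm 0 b g -> 0 <= x <= b ->
  wav j f x - wav j g x = wav j (fun s => f s - g s) x.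
Proof.
move=> bf bg xI; rewrite /wav; case: eqP => _; first by rewrite mulrBl.
have bs h : bm 0 b h -> ig 0 x (fun s => s ^+ j * h s).
  move=> bh; apply: (@ig_sub _ 0 b) => //; first lra.
  by apply/bm_ig/bmM => //; apply: bmX; exact: bm_id.
rewrite -mulrBl -itgB; [|exact: bs..].
by congr (_ / _); apply: eq_itg => s _; rewrite mulrBr.
Qed.

Lemma wav_itg_le f j C x : 0 <= C -> bm 0 b f -> 0 <= x <= b ->
  (forall s, 0 <= s <= x -> `|f s| <= C) ->
  `|itg 0 x (fun s => s ^+ j * f s)| <= C * x ^+ j.+1.
Proof.
move=> C0 bf xI fC; rewrite exprSr mulrA -[X in _ * X](subr0 x); apply: itg_bound; first lra.
  apply: (@ig_sub _ 0 b) => //; first lra.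
  by apply/bm_ig/bmM => //; apply: bmX; exact: bm_id.
move=> s sI; rewrite normrM mulrC; apply: ler_pM => //; first exact: fC.
rewrite normrX ger0_norm; last lra.
by apply: lerXn2r; rewrite ?nnegrE; lra.
Qed.

Lemma wav_bound f j C x : 0 <= C -> bm 0 b f -> 0 <= x <= b ->
  (forall s, 0 <= s <= b -> `|f s| <= C) -> `|wav j f x| <= C.
Proof.
move=> C0 bf xI fC; rewrite /wav; case: eqP => [_|/eqP x0].
  rewrite normrM normfV (ger0_norm (ler0n _ _)) ler_pdivrMr ?ltr0n//.
  apply: le_trans (fC 0 _) _; first by have := hb; lra.
  by rewrite ler_peMr// ler1n.
have xp : 0 < x by rewrite lt_neqAle eq_sym x0; lra.
rewrite normrM normfV (gtr0_norm (exprn_gt0 _ xp)) ler_pdivrMr ?exprn_gt0//.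
by apply: wav_itg_le => // s sI; apply: fC; lra.
Qed.

Lemma wav_cst j c x : 0 <= x <= b -> wav j (fun=> c) x = c / j.+1%:R.
Proof.
move=> xI; rewrite /wav; case: eqP => // /eqP x0.
have -> : itg 0 x (fun s => s ^+ j * c) = c / j.+1%:R * x ^+ j.+1.
  have [_ h] := prim_poly 0 x (primp (c *: 'X^j)).
  rewrite (_ : itg _ _ _ = itg 0 x (fun s => (deriv (primp (c *: 'X^j))).[s])).
    rewrite -h; [|lra..].
    have hp y : (primp (c *: 'X^j)).[y] = c / j.+1%:R * y ^+ j.+1.
      have [->|c0] := eqVneq c 0.
        by rewrite scale0r /primp size_poly0 horner_poly big_ord1 coef0 !mul0r.
      rewrite /primp size_scale// size_polyXn horner_poly big_ord_recr big1/=.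
        by rewrite add0r coefZ coefXn eqxx mulr1.
      move=> i _; rewrite coefZ coefXn; case: i => -[|i] /= ij.
        by rewrite invr0 mulr0 mul0r.
      by rewrite (ltn_eqF (_ : (i < j)%N))// mulr0 !mul0r.
    by rewrite !hp expr0n/= mulr0 subr0.
  by apply: eq_itg => s _; rewrite deriv_primp hornerZ hornerXn mulrC.
by rewrite mulfK// expf_neq0.
Qed.

(** Up to the constant [f 0], the function is O([sqrt s]). Passing from [x] to [y] adds a piece of
    integral and changes the weight; both cost at most a multiple of
    [(y - x) / y * sqrt y <= sqrt (y - x)]. The multiples are 1 and 2, the latter since
    [1 - q^(j+1) <= 2 (1 - q)] for [j <= 1]. *)
Lemma hold_wav f j C : (j <= 1)%N -> 0 <= C -> hold b C f -> hold b (3 * C) (wav j f).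
Proof.
move=> j1 C0 hf; have bf := hold_bm C0 hf.
pose f0 s := f s - f 0.
have bf0 : bm 0 b f0 by apply: bmB => //; exact: bm_cst.
have f0s s : 0 <= s <= b -> `|f0 s| <= C * Num.sqrt s.
  by move=> sI; have := hf 0 s; rewrite subr0; apply; lra.
have E x : 0 <= x <= b -> wav j f x = wav j f0 x + f 0 / j.+1%:R.
  move=> xI; rewrite -(wav_sub j bf (bm_cst 0 b (f 0)) xI) wav_cst//; ring.
have f0x x : 0 <= x <= b -> `|itg 0 x (fun s => s ^+ j * f0 s)| <= C * Num.sqrt x * x ^+ j.+1.
  move=> xI; apply: wav_itg_le => //; first by rewrite mulr_ge0// sqrtr_ge0.
  move=> s sI; apply: le_trans (f0s s _) _; first lra.
  by apply: ler_wpM2l => //; apply: ler_wsqrtr; lra.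
move=> x y x0 xy yb; rewrite !E; [|lra..].
rewrite opprD addrACA subrr addr0.
have [yx|yx] := eqVneq y x.
  by rewrite yx !subrr normr0 mulr_ge0 ?sqrtr_ge0//; lra.
have xy' : x < y by rewrite lt_neqAle eq_sym yx.
have yp : 0 < y by lra.
have syx : (y - x) / y * Num.sqrt y <= Num.sqrt (y - x).
  rewrite mulrAC ler_pdivrMr//.
  rewrite -{1}(sqr_sqrtr (_ : 0 <= y - x)); last lra.
  have ey : Num.sqrt y * Num.sqrt y = y by rewrite -expr2 sqr_sqrtr// ltW.
  rewrite -[X in _ <= _ * X]ey.
  rewrite expr2 -mulrA ler_wpM2l ?sqrtr_ge0// ler_wpM2r ?sqrtr_ge0//.
  by apply: ler_wsqrtr; lra.
have sxy : Num.sqrt x <= Num.sqrt y by apply: ler_wsqrtr.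
have sy0 : 0 <= Num.sqrt y by exact: sqrtr_ge0.
have igf a c : 0 <= a -> c <= b -> ig a c (fun s => s ^+ j * f0 s).
  move=> a0 cb; apply: (@ig_sub _ 0 b) => //.
  by apply/bm_ig/bmM => //; apply: bmX; exact: bm_id.
have wy : wav j f0 y = itg 0 y (fun s => s ^+ j * f0 s) / y ^+ j.+1.
  by rewrite /wav gt_eqF.
rewrite wy (@itg_split _ 0 x y)//; last by apply: igf.
have h1 : `|itg x y (fun s => s ^+ j * f0 s) / y ^+ j.+1| <= C * Num.sqrt (y - x).
  rewrite normrM normfV (gtr0_norm (exprn_gt0 _ yp)) ler_pdivrMr ?exprn_gt0//.
  apply: (@le_trans _ _ (y ^+ j * (C * Num.sqrt y) * (y - x))).
    apply: itg_bound => //; first by apply: igf.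
    move=> s sI; rewrite normrM normrX; apply: ler_pM => //.
      by rewrite ger0_norm; [apply: lerXn2r; rewrite ?nnegrE|]; lra.
    apply: le_trans (f0s s _) _; first lra.
    by apply: ler_wpM2l => //; apply: ler_wsqrtr; lra.
  rewrite exprSr (_ : y ^+ j * _ * _ = C * ((y - x) / y * Num.sqrt y) * (y ^+ j * y)).
    apply: ler_wpM2r; first by rewrite mulr_ge0 ?exprn_ge0//; exact: ltW.
    by apply: ler_wpM2l.
  by field; rewrite gt_eqF.
have h2 : `|itg 0 x (fun s => s ^+ j * f0 s) / y ^+ j.+1 - wav j f0 x| <=
    2 * C * Num.sqrt (y - x).
  have [x00|x00] := eqVneq x 0.
    rewrite x00 itgxx mul0r /wav eqxx /f0 subrr mul0r subr0 normr0.
    by rewrite !mulr_ge0 ?sqrtr_ge0.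
  have xp : 0 < x by rewrite lt_neqAle eq_sym x00.
  rewrite /wav (negbTE x00) -mulrBr normrM.
  have q1 : `|(y ^+ j.+1)^-1 - (x ^+ j.+1)^-1| * x ^+ j.+1 <= 2 * ((y - x) / y).
    have le : (y ^+ j.+1)^-1 <= (x ^+ j.+1)^-1.
      rewrite lef_pV2 ?posrE ?exprn_gt0//; apply: lerXn2r; rewrite ?nnegrE; lra.
    rewrite ler0_norm ?subr_le0// opprB mulrBl mulVf ?expf_neq0//.
    rewrite mulrC -exprVn -exprMn.
    have -> : (y - x) / y = 1 - x / y by rewrite mulrBl mulfV// gt_eqF.
    have q0 : 0 <= x / y by rewrite divr_ge0// ltW.
    have q1 : x / y <= 1 by rewrite ler_pdivrMr//; lra.
    case: j j1 {f0x wy h1 E igf le} => [|[|//]] _; first by rewrite expr1; lra.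
    by move: q0 q1; set q := x / y => q0 q1; nra.
  have xI : 0 <= x <= b by lra.
  apply: le_trans (ler_wpM2r (normr_ge0 _) (f0x x xI)) _.
  rewrite -(mulrA (C * Num.sqrt x)) [X in _ * X <= _]mulrC.
  apply: (@le_trans _ _ (C * Num.sqrt y * (2 * ((y - x) / y)))).
    apply: ler_pM => //; rewrite ?mulr_ge0 ?sqrtr_ge0 ?exprn_ge0//.
    by apply: ler_wpM2l.
  rewrite (_ : _ * _ = 2 * C * ((y - x) / y * Num.sqrt y)); last by ring.
  by apply: ler_wpM2l => //; lra.
rewrite (mulrDl (itg 0 x _)); move: h1 h2.
set a1 := itg 0 x _ / _; set a2 := itg x y _ / _; set a3 := wav _ _ _.
set s := Num.sqrt _ => h1 h2.
rewrite (_ : a1 + a2 - a3 = a2 + (a1 - a3)); last by ring.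
apply: le_trans (ler_normD _ _) _; lra.
Qed.

Lemma gdD C C' tau f0 f1 g0 g1 : gd b C tau f0 f1 -> gd b C' tau g0 g1 ->
  gd b (C + C') tau (fun x => f0 x + g0 x) (fun x => f1 x + g1 x).
Proof.
move=> [sf f2 f3 f4] [sg g2 g3 g4]; split; [|exact: holdD|exact: holdD|].
  move=> x xI; have [a1 a2 a3] := sf x xI; have [c1 c2 c3] := sg x xI.
  split; [exact: le_trans (ler_normD _ _) (lerD _ _)|exact: le_trans (ler_normD _ _) (lerD _ _)|].
  by rewrite opprD addrACA mulrDl; exact: le_trans (ler_normD _ _) (lerD _ _).
rewrite mulrDl (_ : (fun x => _) = fun x => (f1 x - f0 x) + (g1 x - g0 x)); first exact: holdD.
by apply/funext => x; ring.
Qed.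

Lemma gdM C C' tau f0 f1 g0 g1 : 0 <= C -> 0 <= C' -> 0 <= tau ->
  gd b C tau f0 f1 -> gd b C' tau g0 g1 ->
  gd b (4 * C * C') tau (fun x => f0 x * g0 x) (fun x => f1 x * g1 x).
Proof.
move=> C0 C'0 t0 [sf f2 f3 f4] [sg g2 g3 g4].
have CC : 0 <= C * C' by exact: mulr_ge0.
have CCt : 0 <= C * C' * tau by exact: mulr_ge0.
have sf0 x : 0 <= x <= b -> `|f0 x| <= C by move=> /sf[].
have sf1 x : 0 <= x <= b -> `|f1 x| <= C by move=> /sf[].
have sfd x : 0 <= x <= b -> `|f1 x - f0 x| <= C * tau by move=> /sf[].
have sg0 x : 0 <= x <= b -> `|g0 x| <= C' by move=> /sg[].
have sg1 x : 0 <= x <= b -> `|g1 x| <= C' by move=> /sg[].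
have sgd x : 0 <= x <= b -> `|g1 x - g0 x| <= C' * tau by move=> /sg[].
have E x : f1 x * g1 x - f0 x * g0 x = (f1 x - f0 x) * g1 x + f0 x * (g1 x - g0 x) by ring.
have le1 (a c A A' : R) : `|a| <= A -> `|c| <= A' -> `|a * c| <= A * A'.
  by move=> h1 h2; rewrite normrM; exact: ler_pM.
split.
- move=> x xI; split.
  + by apply: le_trans (le1 _ _ _ _ (sf0 _ xI) (sg0 _ xI)) _; lra.
  + by apply: le_trans (le1 _ _ _ _ (sf1 _ xI) (sg1 _ xI)) _; lra.
  rewrite E; apply: le_trans (ler_normD _ _) _.
  have := le1 _ _ _ _ (sfd _ xI) (sg1 _ xI).
  have := le1 _ _ _ _ (sf0 _ xI) (sgd _ xI); lra.
- by apply: hold_le (holdM C0 C'0 sf0 sg0 f2 g2); lra.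
- by apply: hold_le (holdM C0 C'0 sf1 sg1 f3 g3); lra.
have Ct : 0 <= C * tau by exact: mulr_ge0.
have Ct' : 0 <= C' * tau by exact: mulr_ge0.
have := holdD (holdM Ct C'0 sfd sg1 f4 g3) (holdM C0 Ct' sf0 sgd f2 g4).
under eq_fun do rewrite -E.
by apply: hold_le; lra.
Qed.

Lemma gd_wav C tau j f0 f1 : (j <= 1)%N -> 0 <= C -> 0 <= tau -> gd b C tau f0 f1 ->
  gd b (3 * C) tau (wav j f0) (wav j f1).
Proof.
move=> j1 C0 t0 [sf f2 f3 f4].
have Ct : 0 <= C * tau by exact: mulr_ge0.
have b0 := hold_bm C0 f2; have b1 := hold_bm C0 f3; have bd := hold_bm Ct f4.
split; [|exact: hold_wav|exact: hold_wav|].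
  move=> x xI; split.
  - apply: le_trans (wav_bound j C0 b0 xI _) _; [by move=> s /sf[]|lra].
  - apply: le_trans (wav_bound j C0 b1 xI _) _; [by move=> s /sf[]|lra].
  rewrite wav_sub//; apply: le_trans (wav_bound j Ct bd xI _) _; [by move=> s /sf[]|lra].
move=> x y x0 xy yb; rewrite !wav_sub//; [|lra..].
by rewrite -(mulrA _ C tau); apply: hold_wav.
Qed.

Lemma gd_primr C tau f0 f1 : 0 <= C -> 0 <= tau -> gd b C tau f0 f1 ->
  gd b ((b ^+ 2 + b * Num.sqrt b) * C) tau
    (fun x => itg x b (fun s => s * f0 s)) (fun x => itg x b (fun s => s * f1 s)).
Proof.
move=> C0 t0 [sf f2 f3 f4].
have Ct : 0 <= C * tau by exact: mulr_ge0.
have b0 := hold_bm C0 f2; have b1 := hold_bm C0 f3; have bd := hold_bm Ct f4.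
have hb0 := ltW hb.
have sb := sqrtr_ge0 b.
have igs f a c : bm 0 b f -> 0 <= a -> c <= b -> ig a c (fun s => s * f s).
  move=> bf a0 cb; apply: (@ig_sub _ 0 b) => //.
  by apply/bm_ig/bmM => //; exact: bm_id.
have sup f A x y : 0 <= A -> bm 0 b f -> (forall s, 0 <= s <= b -> `|f s| <= A) ->
    0 <= x -> x <= y -> y <= b -> `|itg x y (fun s => s * f s)| <= b * A * (y - x).
  move=> A0 bf fA x0 xy yb; apply: itg_bound => //; first exact: igs.
  move=> s sI; rewrite normrM; apply: ler_pM => //; last by apply: fA; slim_lra.
  by rewrite ger0_norm; slim_lra.
have sup2 f A x : 0 <= A -> bm 0 b f -> (forall s, 0 <= s <= b -> `|f s| <= A) ->
    0 <= x <= b -> `|itg x b (fun s => s * f s)| <= (b ^+ 2 + b * Num.sqrt b) * A.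
  move=> A0 bf fA xI; apply: le_trans (sup f A x b A0 bf fA _ _ _) _; [slim_lra..|].
  apply: (@le_trans _ _ (b * A * b)); first by apply: ler_wpM2l; [exact: mulr_ge0|slim_lra].
  by have := mulr_ge0 (mulr_ge0 hb0 sb) A0; slim_lra.
have hol f A : 0 <= A -> bm 0 b f -> (forall s, 0 <= s <= b -> `|f s| <= A) ->
    hold b ((b ^+ 2 + b * Num.sqrt b) * A) (fun x => itg x b (fun s => s * f s)).
  move=> A0 bf fA; have bA : 0 <= b * A by exact: mulr_ge0.
  apply: (@hold_le (b * A * Num.sqrt b)).
    have := mulr_ge0 (sqr_ge0 b) A0; slim_lra.
  apply: hold_lip => // x y x0 xy yb.
  rewrite (@itg_split _ x y b)//; last exact: igs.
  by rewrite opprD addrCA subrr addr0 normrN; exact: sup.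
have E x : 0 <= x -> itg x b (fun s => s * f1 s) - itg x b (fun s => s * f0 s) =
    itg x b (fun s => s * (f1 s - f0 s)).
  move=> x0; rewrite -itgB; [|exact: igs..].
  by apply: eq_itg => s _; rewrite mulrBr.
split.
- move=> x xI; split; [by apply: sup2 => // s /sf[]|by apply: sup2 => // s /sf[]|].
  by rewrite E; [rewrite -mulrA; apply: sup2 => // s /sf[]|slim_lra].
- by apply: hol => // s /sf[].
- by apply: hol => // s /sf[].
move=> x y x0 xy yb; rewrite !E//; last slim_lra.
by rewrite -(mulrA _ C tau); apply: hol => // s /sf[].
Qed.

(** The mixed increment uses the second-order bound on the exponential: its product of a time
    increment and two space increments gives the term [2 C^2]. *)
Lemma gd_exp C tau f0 f1 : 0 <= C -> 0 <= tau ->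
  (forall x, 0 <= x <= b -> 0 <= f0 x /\ 0 <= f1 x) -> gd b C tau f0 f1 ->
  gd b (1 + C + 2 * C ^+ 2) tau (fun x => expR (- f0 x)) (fun x => expR (- f1 x)).
Proof.
move=> C0 t0 pf [sf f2 f3 f4].
have C2 := sqr_ge0 C.
have e1 (a : R) : 0 <= a -> `|expR (- a)| <= 1 + C + 2 * C ^+ 2.
  move=> a0; rewrite gtr0_norm ?expR_gt0//.
  have : expR (- a) <= 1 by rewrite -expR0 ler_expR; lra.
  lra.
have CC : C <= 1 + C + 2 * C ^+ 2 by lra.
have hol f : (forall x, 0 <= x <= b -> 0 <= f x) -> hold b C f ->
    hold b (1 + C + 2 * C ^+ 2) (fun x => expR (- f x)).
  move=> f0p hf; apply: (hold_le CC) => x y x0 xy yb.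
  by apply: le_trans (expRN_diff _ _) (hf x y x0 xy yb); apply: f0p; lra.
split.
- move=> x xI; have [p0 p1] := pf x xI; split; [exact: e1|exact: e1|].
  apply: le_trans (expRN_diff p1 p0) _; have [_ _ h] := sf x xI.
  by apply: le_trans h _; apply: ler_wpM2r.
- by apply: hol => // x /pf[].
- by apply: hol => // x /pf[].
move=> x y x0 xy yb.
have yI : 0 <= y <= b by lra.
have xI : 0 <= x <= b by lra.
have [p0y p1y] := pf y yI; have [p0x p1x] := pf x xI.
apply: le_trans (expRN_diff2 p1y p0y p1x p0x) _.
have h1 := f4 x y x0 xy yb; have h2 := f3 x y x0 xy yb; have h3 := f2 x y x0 xy yb.
have [_ _ h4] := sf x xI.
have s0 := sqrtr_ge0 (y - x).
move: h1 h2 h3 s0; set s := Num.sqrt _ => h1 h2 h3 s0.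
have ts : 0 <= tau * s by exact: mulr_ge0.
have h5 : `|f1 x - f0 x| * (`|f1 y - f1 x| + `|f0 y - f0 x|) <= C * tau * (2 * (C * s)).
  apply: ler_pM => //; lra.
by have := mulr_ge0 C2 ts; lra.
Qed.

End Good.

Section DerivativeBound.
Context {R : realType}.
Implicit Types (x a B e : R) (f : R -> R).

Lemma drv_bound f x a B : is_derive x 1 f a ->
  (exists2 d, 0 < d & forall e, 0 < e < d -> `|f (x + e) - f x| <= B * e) -> `|a| <= B.
Proof.
move=> [df da] [d d0 h]; apply/ler_addgt0Pr => e e0.
move: df; rewrite /derivable -da /derive => /cvg_ex[l lP].
have -> : lim ((fun h0 : R => h0^-1 *: ((f \o shift x) (h0 *: 1) - f x)) @ 0^') = l by exact: cvg_lim.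
move/cvgrPdist_le : lP => /(_ e e0)[d1 /= d10 H].
pose t := Num.min d d1 / 2.
have m0 : 0 < Num.min d d1 by rewrite lt_min d0.
have t0 : 0 < t by rewrite /t; lra.
have [td td1] : t < d /\ t < d1.
  have : Num.min d d1 <= d by rewrite ge_min lexx.
  have : Num.min d d1 <= d1 by rewrite ge_min lexx orbT.
  by rewrite /t; lra.
have := H t; rewrite /= sub0r normrN (gtr0_norm t0) => /(_ td1 (lt0r_neq0 t0)).
rewrite /GRing.scale/= mulr1 [t + x]addrC => H1.
have H2 : `|t^-1 * (f (x + t) - f x)| <= B.
  rewrite normrM normfV (gtr0_norm t0) mulrC ler_pdivrMr//; apply: h; lra.
by move: H1 H2; rewrite !ler_norml; clear; lra.
Qed.

Lemma drv_shift f x s a : is_derive (x + s) 1 f a -> is_derive s 1 (fun e => f (x + e)) a.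
Proof.
move=> h; rewrite -[a]mulr1; apply: drv_comp => //.
by have := drvD (drv_cst s x) (drv_id s); rewrite add0r.
Qed.

(** Used in time: a bound given by a Bochner norm holds for almost all times, and continuity extends
    it to every time. *)
Lemma ae_le_cts (a c M : R) f : a < c -> {within `[a, c], continuous f} ->
  {ae leb R, forall x, a < x < c -> f x <= M} -> forall x, a <= x <= c -> f x <= M.
Proof.
move=> ac cf ae x xI; apply/ler_addgt0Pr => e e0.
have [d d0 H] := within_eps cf xI e0.
have lr : Num.max a (x - d) < Num.min c (x + d) by rewrite gt_max !lt_min; lra.
have [y + fy] := ae_dense ae lr.
rewrite gt_max lt_min => yI.
have := fy ltac:(lra); have := H y ltac:(lra) ltac:(rewrite ltr_norml; lra).
by rewrite ler_norml; lra.
Qed.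

Lemma le_cts (a c M : R) f : a < c -> {within `[a, c], continuous f} ->
  (forall x, a < x < c -> f x <= M) -> forall x, a <= x <= c -> f x <= M.
Proof. by move=> ac cf h; apply: ae_le_cts => //; exact: aeW. Qed.

Lemma withinB (a c : R) f g : {within `[a, c], continuous f} -> {within `[a, c], continuous g} ->
  {within `[a, c], continuous (fun x => f x - g x)}.
Proof. by move=> cf cg x; apply: continuousB; [exact: cf|exact: cg]. Qed.

Lemma within_norm (a c : R) f : {within `[a, c], continuous f} ->
  {within `[a, c], continuous (fun x => `|f x|)}.
Proof. by move=> cf x; apply: (continuous_comp (cf x)); exact: norm_continuous. Qed.

Lemma within_sub (a c a' c' : R) f : a <= a' -> c' <= c -> {within `[a, c], continuous f} ->
  {within `[a', c'], continuous f}.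
Proof.
by move=> h1 h2 cf; apply: continuous_subspaceW cf => s; rewrite /= !in_itv/=; lra.
Qed.

End DerivativeBound.

(** * The exact solution through the functionals, and its equation in nonconservative form *)

Section Exact.
Context {R : realType} (b T : R) (hb : 0 < b) (hT : 0 < T).
Context (Ub : R -> R) (u w g z : R -> R -> R).
Hypothesis hex : exact_solution b T Ub u w g z.
Implicit Types (s t x y e : R).

Lemma exact_joint t x e : 0 <= t <= T -> 0 <= x <= b -> 0 < e ->
  exists2 d, 0 < d & forall s y, 0 <= s <= T -> 0 <= y <= b -> `|s - t| < d -> `|y - x| < d ->
    `|u s y - u t x| <= e.
Proof.
move=> tI xI e0; have cu := exact_u_cont hex.
have tx : (`[0, T] `*` `[0, b])%classic (t, x) by split; rewrite /= in_itv.
move/subspace_continuousP : cu => /(_ _ tx) /cvgrPdist_le/(_ e e0).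
rewrite near_withinE => -[[P Q] [/= [d1 /= d10 hP] [d2 /= d20 hQ]] H].
exists (Num.min d1 d2) => [|s y sI yI]; first by rewrite lt_min d10.
rewrite !lt_min => /andP[s1 s2] /andP[y1 y2]; rewrite distrC.
apply: (H (s, y)); last by split; rewrite /= in_itv.
by split; [apply: hP; rewrite /= distrC|apply: hQ; rewrite /= distrC].
Qed.

Lemma exact_cx t : 0 <= t <= T -> {within `[0, b], continuous (u t)}.
Proof.
move=> tI; apply: eps_within => x e xI e0; have [d d0 H] := exact_joint tI xI e0.
by exists d => // y yI yx; apply: H; rewrite // subrr normr0.
Qed.

Lemma exact_ct x : 0 <= x <= b -> {within `[0, T], continuous (fun t => u t x)}.
Proof.
move=> xI; apply: eps_within => t e tI e0; have [d d0 H] := exact_joint tI xI e0.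
by exists d => // s sI st; apply: H; rewrite // subrr normr0.
Qed.

Variables (K M : R).
Hypotheses (K0 : 0 <= K) (M0 : 0 <= M).
Hypothesis uL : forall t, 0 <= t <= T -> forall x y, 0 <= x -> x <= y -> y <= b ->
  `|u t y - u t x| <= K * (y - x).
Hypothesis uF : forall t, 0 <= t <= T -> forall x y e, 0 <= x -> x <= y -> 0 <= e -> y + e <= b ->
  `|(u t (y + e) - u t y) - (u t (x + e) - u t x)| <= M * Num.sqrt (y - x) * e.

Lemma exact_lip t x y : 0 <= t <= T -> 0 <= x <= b -> 0 <= y <= b ->
  `|u t x - u t y| <= K * `|x - y|.
Proof.
wlog xy : x y / x <= y => [hw|tI xI yI].
  move=> tI xI yI; have [xy|/ltW yx] := leP x y; first exact: hw.
  by rewrite distrC [`|x - y|]distrC; exact: hw.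
by rewrite distrC [`|x - y|]ler0_norm ?opprB; [apply: uL; lra|lra].
Qed.

Lemma exact_bm t : 0 <= t <= T -> bm 0 b (u t).
Proof. by move=> tI; apply/bm_lip; exists K => // x y xI yI; exact: exact_lip. Qed.

Lemma exact_aa t x : 0 <= t <= T -> 0 <= x <= b -> `|aa (u t) x| <= K.
Proof.
move=> tI; apply: aa_lip => //; first exact: exact_bm.
by move=> y1 y2 h1 h2; exact: exact_lip.
Qed.

Lemma exact_adm t : 0 <= t <= T -> adm b (u t).
Proof.
move=> tI; apply: (adm_bounded hb (exact_bm tI) (M := K)) => x xI; apply: exact_aa => //; lra.
Qed.

Lemma exact_w t x : 0 <= t <= T -> 0 <= x <= b -> w t x = itg 0 x (u t).
Proof.
move=> tI xI; have tI' : t \in `[0, T] by rewrite in_itv.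
have [cw _ _] := exact_wgz_cont hex tI'; have [w0 _] := exact_center hex tI'.
have cI : {within `[0, b], continuous (fun x => itg 0 x (u t))}.
  exact/lip_cont/lip_itg/exact_bm.
have : `|(w t x - itg 0 x (u t)) - (w t 0 - itg 0 0 (u t))| <= 0 * (x - 0).
  apply: (@MVT_bound _ 0 x 0 (fun x => w t x - itg 0 x (u t)) (fun=> 0)); [lra| | |].
  - by apply: (@within_sub _ 0 b) => //; [lra|exact: withinB].
  - move=> y yI; apply: (drv_eq (drvB (a := u t y) (c := u t y) _ _) (subrr _)).
      by apply: (exact_w_r hex) => //; rewrite in_itv/=; lra.
    apply: (@derive_itg _ _ b); [lra|exact/bm_ig/exact_bm|].
    by apply: (@cts_within _ _ 0 b); [lra|exact: exact_cx].
  - by move=> y _; rewrite normr0.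
by rewrite mul0r normr_le0 w0 itgxx !subr0 subr_eq0 => /eqP.
Qed.

Lemma cts_aa f x : bm 0 b f -> 0 < x < b -> {for x, continuous f} ->
  {for x, continuous (aa f)}.
Proof.
move=> bf xI cf; apply: ctsM; last by apply: ctsV; rewrite gt_eqF//; lra.
by apply: ctsB => //; apply: drv_cts (prim_W bf xI cf).
Qed.

Lemma exact_ctsx t x : 0 <= t <= T -> 0 < x < b -> {for x, continuous (u t)}.
Proof. by move=> tI xI; apply: (@cts_within _ _ 0 b) => //; exact: exact_cx. Qed.

(** [g] times the exponential of [XX] has derivative 0 inside and equals 1 at [b]. *)
Lemma exact_g t x : 0 <= t <= T -> 0 <= x <= b -> g t x = GG b (u t) x.
Proof.
move=> tI xI; have tI' : t \in `[0, T] by rewrite in_itv.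
have [_ cg _] := exact_wgz_cont hex tI'; have [_ gb] := exact_outer hex tI'.
have [bu baa] := exact_adm tI.
have bx : bm 0 b (fun s => s * aa (u t) s ^+ 2) by apply: bmM; [exact: bm_id|exact: bmX].
have cX : {within `[0, b], continuous (XX b (u t))} by exact/lip_cont/lip_itgr.
pose D y := g t y * expR (XX b (u t) y).
have : `|D b - D x| <= 0 * (b - x).
  apply: (@MVT_bound _ x b 0 D (fun=> 0)); [lra| | |].
  - apply: (@within_sub _ 0 b) => //; first lra.
    move=> y; apply: cvgM; first exact: cg.
    by apply: (continuous_comp (cX y)); exact: continuous_expR.
  - move=> y yI; have yb : 0 < y < b by lra.
    have dg : is_derive y 1 (g t) (y^-1 * g t y * (u t y - w t y / y) ^+ 2).
      by apply: (exact_g_r hex) => //; rewrite in_itv/=; lra.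
    have dX : is_derive y 1 (XX b (u t)) (- (y * aa (u t) y ^+ 2)).
      apply: (@derive_itgr _ 0 b) => //; first exact: bm_ig.
      apply: ctsM; first exact: cts_id.
      by apply: ctsX; apply: cts_aa => //; exact: exact_ctsx.
    apply: drv_eq (drvM dg (drv_exp dX)) _.
    rewrite exact_w//; last lra.
    rewrite /aa /av; field; rewrite gt_eqF//; lra.
  - by move=> y _; rewrite normr0.
rewrite mul0r normr_le0 subr_eq0 /D gb mul1r /XX itgxx expR0 => /eqP E.
by rewrite GGE expRN -[RHS]mul1r E mulfK// gt_eqF ?expR_gt0.
Qed.

Lemma exact_z t x : 0 <= t <= T -> 0 <= x <= b -> z t x = itg 0 x (GG b (u t)).
Proof.
move=> tI xI; have tI' : t \in `[0, T] by rewrite in_itv.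
have [_ _ cz] := exact_wgz_cont hex tI'; have [_ z0] := exact_center hex tI'.
have bG := bm_GG (exact_adm tI).
have cI : {within `[0, b], continuous (fun x => itg 0 x (GG b (u t)))} by exact/lip_cont/lip_itg.
have : `|(z t x - itg 0 x (GG b (u t))) - (z t 0 - itg 0 0 (GG b (u t)))| <= 0 * (x - 0).
  apply: (@MVT_bound _ 0 x 0 (fun x => z t x - itg 0 x (GG b (u t))) (fun=> 0)); [lra| | |].
  - by apply: (@within_sub _ 0 b) => //; [lra|exact: withinB].
  - move=> y yI; apply: (drv_eq (drvB (a := g t y) (c := g t y) _ _) (subrr _)).
      by apply: (exact_z_r hex) => //; rewrite in_itv/=; lra.
    rewrite exact_g//; last lra.
    apply: (@derive_itg _ _ b); [lra|exact: bm_ig|].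
    by apply: cts_GG; [exact: hb|exact: exact_adm|lra].
  - by move=> y _; rewrite normr0.
by rewrite mul0r normr_le0 z0 itgxx !subr0 subr_eq0 => /eqP.
Qed.

Lemma exact_gt t x : 0 <= t <= T -> 0 < x <= b -> z t x / x = gt b (u t) x.
Proof.
move=> tI xI; rewrite exact_z//; last lra.
by rewrite /gt /avz gt_eqF//; lra.
Qed.

Lemma exact_nn_aa t : 0 <= t <= T -> nn 0 b (aa (u t)) <= K * Num.sqrt b.
Proof.
move=> tI; have [_ baa] := exact_adm tI.
apply: le_trans (nn_sup (ltW hb) baa K0 _) _; last by rewrite subr0.
by move=> x xI; apply: exact_aa => //; lra.
Qed.

(** Differentiability in [r] is given for the product of [g~] and [u] only; it passes to [u] because
    [g~] is differentiable and bounded below by a positive constant. *)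
Lemma exact_drv t x : 0 < t < T -> 0 < x < b ->
  is_derive x 1 (u t) (derive1 (u t) x).
Proof.
move=> tI xI; have tI' : 0 <= t <= T by lra.
have d1 := exact_gu_r hex (_ : t \in `]0, T[) (_ : x \in `]0, b[).
have {}d1 := d1 ltac:(by rewrite in_itv) ltac:(by rewrite in_itv).
have d2 : is_derive x 1 (gt b (u t)) (AA b (u t) x).
  exact: (gt_derive hb (exact_adm tI')).
have g0 y : 0 < y < b -> gt b (u t) y != 0.
  move=> yI; rewrite gt_eqF//; apply: lt_le_trans (expR_gt0 _) _.
  by apply: (gt_lower (exact_adm tI')); lra.
have d3 : derivable (fun y => (2 * (2^-1 * (z t y / y) * u t y)) * (gt b (u t) y)^-1) x 1.
  apply: derivableM; first by apply: derivableM; [exact: derivable_cst|exact: d1].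
  by apply: derivableV; [exact: g0|have [] := d2].
rewrite derive1E; apply: DeriveDef; last exact: erefl.
have d4 : is_derive x 1 (fun y => (2 * (2^-1 * (z t y / y) * u t y)) * (gt b (u t) y)^-1)
    ('D_1 (fun y => (2 * (2^-1 * (z t y / y) * u t y)) * (gt b (u t) y)^-1) x).
  exact: DeriveDef.
suff : is_derive x 1 (u t) ('D_1 (fun y => (2 * (2^-1 * (z t y / y) * u t y)) * (gt b (u t) y)^-1) x) by case.
apply: (drv_near _ d4).
have := near_in_oo xI; apply: filterS => y yI; rewrite exact_gt//; last lra.
by field; exact: g0.
Qed.

(** Expanding the derivative of the product leaves [AA (u - av u)], which is [sg * aa u]: the same
    form as in the discrete equation after integration by parts. *)
Lemma exact_pde t x : 0 < t < T -> 0 < x < b ->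
  is_derive t 1 (fun s => u s x)
    (2^-1 * (gt b (u t) x * derive1 (u t) x + sg b (u t) x * aa (u t) x)).
Proof.
move=> tI xI; have tI' : 0 <= t <= T by lra.
have tIo : t \in `]0, T[ by rewrite in_itv.
have xIo : x \in `]0, b[ by rewrite in_itv.
have du := exact_u_t hex tIo xIo; have := exact_evolution hex tIo xIo.
have d1 := exact_drv tI xI.
have d2 : is_derive x 1 (gt b (u t)) (AA b (u t) x) by exact: (gt_derive hb (exact_adm tI')).
have zg y : 0 < y < b -> z t y / y = gt b (u t) y by move=> yI; rewrite exact_gt//; lra.
have d3 : is_derive x 1 (fun y => z t y / y) (AA b (u t) x).
  by apply: (drv_near _ d2); have := near_in_oo xI; apply: filterS => y yI; rewrite zg.
have d4 : is_derive x 1 (fun y => 2^-1 * (z t y / y) * u t y)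
    (2^-1 * (AA b (u t) x * u t x + gt b (u t) x * derive1 (u t) x)).
  apply: drv_eq (drvM (drvZ 2^-1 d3) d1) _; rewrite zg//; ring.
move: d1 d4; set D := derive1 (u t) x => d1 d4.
rewrite /time_derivative !derive1E; have [_ ->] := d4; have [_ ->] := d3.
rewrite exact_w//; last lra.
move=> E; apply: DeriveDef => //; rewrite -[LHS](subrK (2^-1 *
  (AA b (u t) x * u t x + gt b (u t) x * D))) E.
rewrite /aa /AA /av; field; rewrite gt_eqF//; lra.
Qed.

End Exact.

(* Points of ]0, b[ converging to [x] in [0, b]. *)
Definition inner {R : realType} (b x : R) (n : nat) : R := x + (b / 2 - x) / n.+2%:R.

(** The derivatives of the solution are known in the open interval only. The approximating points
    come from a contraction towards [b / 2], so distances do not grow and Hoelder constants survive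
    in the limit. *)
Definition ext {R : realType} (b : R) (f : R -> R) (x : R) : R :=
  lim ((fun n => f (inner b x n)) @ \oo).

(** * Extension of Hoelder functions to the closed interval *)

Section Extension.
Context {R : realType} (b : R) (hb : 0 < b).
Implicit Types (x y C : R) (f : R -> R) (n : nat).

Definition hold_in C f : Prop := forall x y, 0 < x -> x <= y -> y < b ->
  `|f y - f x| <= C * Num.sqrt (y - x).

Lemma inner_weight n : 0 < (n.+2%:R : R)^-1 <= 2^-1.
Proof. by rewrite invr_gt0 ltr0n/= lef_pV2 ?posrE ?ltr0n// ler_nat. Qed.

Lemma inner_in x n : 0 <= x <= b -> 0 < inner b x n < b.
Proof.
by have := inner_weight n; rewrite /inner; set q := _^-1 => qI xI; have := hb; nra.
Qed.

Lemma inner_near x n : 0 <= x <= b -> `|inner b x n - x| <= b / n.+2%:R.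
Proof.
move=> xI; rewrite /inner addrC addKr normrM normfV (ger0_norm (ler0n _ _)).
by apply: ler_wpM2r; [rewrite invr_ge0 ler0n|rewrite ler_norml; lra].
Qed.

Lemma inner_mono x y n : x <= y -> inner b x n <= inner b y n /\
  inner b y n - inner b x n <= y - x.
Proof.
by have := inner_weight n; rewrite /inner; set q := _^-1 => qI xy; split; nra.
Qed.

Lemma small_inv (e : R) : 0 < e -> exists n0, forall n, (n0 <= n)%N -> b / n.+2%:R < e.
Proof.
move=> e0; exists (Num.trunc (b / e)) => n h.
rewrite ltr_pdivrMr ?ltr0n// mulrC -ltr_pdivrMr//.
apply: lt_le_trans (truncnS_gt _) _; rewrite ler_nat ltnS; exact: leq_trans h (leqnSn _).
Qed.

Lemma hold_in_sym C f x y d : 0 <= C -> hold_in C f -> 0 < x < b -> 0 < y < b ->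
  `|x - y| <= d -> `|f x - f y| <= C * Num.sqrt d.
Proof.
move=> C0 hf; wlog xy : x y / x <= y => [hw|xI yI].
  move=> xI yI; have [xy|/ltW yx] := leP x y; first exact: hw.
  by rewrite distrC [`|f x - _|]distrC; exact: hw.
rewrite distrC [`|f x - _|]distrC ger0_norm ?subr_ge0// => xyd.
apply: le_trans (hf x y _ xy _) _; [lra|lra|].
by apply: ler_wpM2l => //; exact: ler_wsqrtr.
Qed.

Lemma ext_cvg C f x : 0 <= C -> hold_in C f -> 0 <= x <= b ->
  (fun n => f (inner b x n)) @ \oo --> ext b f x.
Proof.
move=> C0 hf xI; apply/cvg_ex; suff : cvg ((fun n => f (inner b x n)) @ \oo) by move/cvg_ex.
apply: cauchy_cvg; apply/cauchy_exP => e e0.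
pose d := (e / (2 * (C + 1))) ^+ 2 / 2.
have q0 : 0 < e / (2 * (C + 1)) by apply: divr_gt0 => //; lra.
have d0 : 0 < d by rewrite /d divr_gt0// exprn_gt0.
have [n0 hn0] := small_inv d0.
exists (f (inner b x n0)); exists n0 => // n /= hn; rewrite /ball/=.
apply: (@le_lt_trans _ _ (C * Num.sqrt (2 * d))).
  apply: (hold_in_sym C0 hf); [exact: inner_in|exact: inner_in|].
  have := le_lt_trans (inner_near n xI) (hn0 _ hn).
  have := le_lt_trans (inner_near n0 xI) (hn0 _ (leqnn _)).
  by rewrite ler_norml !ltr_norml; lra.
have -> : 2 * d = (e / (2 * (C + 1))) ^+ 2 by rewrite /d mulrC divfK.
rewrite sqrtr_sqr (gtr0_norm q0).
apply: (@le_lt_trans _ _ ((C + 1) * (e / (2 * (C + 1))))); first by apply: ler_wpM2r; [exact: ltW|lra].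
have -> : (C + 1) * (e / (2 * (C + 1))) = e / 2 by field; rewrite gt_eqF//; lra.
lra.
Qed.

Lemma ext_in C f x : 0 <= C -> hold_in C f -> 0 < x < b -> ext b f x = f x.
Proof.
move=> C0 hf xI; have xI' : 0 <= x <= b by lra.
apply: (@cvg_unique _ _ ((fun n => f (inner b x n)) @ \oo)) => //; first exact: (ext_cvg C0 hf).
apply/cvgrPdist_le => e e0.
pose d := (e / (C + 1)) ^+ 2.
have q0 : 0 < e / (C + 1) by apply: divr_gt0 => //; lra.
have d0 : 0 < d by rewrite /d exprn_gt0.
have [n0 hn0] := small_inv d0; exists n0 => // n /= hn.
apply: (@le_trans _ _ (C * Num.sqrt d)).
  apply: (hold_in_sym C0 hf) => //; first exact: inner_in.
  by rewrite distrC; exact: ltW (le_lt_trans (inner_near n xI') (hn0 _ hn)).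
rewrite /d sqrtr_sqr (gtr0_norm q0).
by rewrite mulrA ler_pdivrMr; [rewrite mulrC; apply: ler_wpM2l|]; lra.
Qed.

Lemma norm_lim_le (v : nat -> R) l A : v @ \oo --> l -> (forall n, `|v n| <= A) -> `|l| <= A.
Proof.
move=> vl vA; have cl : (fun n => `|v n|) @ \oo --> `|l| by exact: cvg_norm.
rewrite -(cvg_lim _ cl)//; apply: limr_le; first by apply/cvg_ex; exists `|l|.
by apply: nearW.
Qed.

Lemma ext_bound C f A : 0 <= C -> hold_in C f -> (forall x, 0 < x < b -> `|f x| <= A) ->
  forall x, 0 <= x <= b -> `|ext b f x| <= A.
Proof.
move=> C0 hf fA x xI; apply: norm_lim_le (ext_cvg C0 hf xI) _ => n.
exact/fA/inner_in.
Qed.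

Lemma ext_hold C f : 0 <= C -> hold_in C f -> hold b C (ext b f).
Proof.
move=> C0 hf x y x0 xy yb.
have xI : 0 <= x <= b by lra.
have yI : 0 <= y <= b by lra.
apply: norm_lim_le (cvgB (ext_cvg C0 hf yI) (ext_cvg C0 hf xI)) _ => n.
have [h1 h2] := inner_mono n xy.
have := inner_in n xI; have := inner_in n yI => i1 i2.
apply: le_trans (hf _ _ _ h1 _) _; [lra|lra|].
by apply: ler_wpM2l => //; exact: ler_wsqrtr.
Qed.

Lemma ext_sub C C' f g x : 0 <= C -> hold_in C f -> hold_in C g -> 0 <= C' ->
  hold_in C' (fun x => f x - g x) -> 0 <= x <= b ->
  ext b (fun x => f x - g x) x = ext b f x - ext b g x.
Proof.
move=> C0 hf hg C0' hfg xI.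
apply: (@cvg_unique _ _ ((fun n => f (inner b x n) - g (inner b x n)) @ \oo)) => //.
  exact: (ext_cvg C0' hfg).
by apply: cvgB; [exact: (ext_cvg C0 hf)|exact: (ext_cvg C0 hg)].
Qed.

Lemma gd_ext C tau f0 f1 : 0 <= C -> 0 <= tau ->
  (forall x, 0 < x < b -> [/\ `|f0 x| <= C, `|f1 x| <= C & `|f1 x - f0 x| <= C * tau]) ->
  hold_in C f0 -> hold_in C f1 -> hold_in (C * tau) (fun x => f1 x - f0 x) ->
  gd b C tau (ext b f0) (ext b f1).
Proof.
move=> C0 t0 sf h0 h1 hd; have Ct : 0 <= C * tau by exact: mulr_ge0.
split; [|exact: ext_hold|exact: ext_hold|].
  move=> x xI; split.
  - by apply: (ext_bound C0 h0) => // y /sf[].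
  - by apply: (ext_bound C0 h1) => // y /sf[].
  by rewrite -(ext_sub C0 h1 h0 Ct hd xI); apply: (ext_bound Ct hd) => // y /sf[].
move=> x y x0 xy yb; rewrite -!(ext_sub C0 h1 h0 Ct hd); [|lra..].
exact: ext_hold.
Qed.

Lemma gd_cst c : gd b `|c| 0 (fun=> c) (fun=> c).
Proof.
have h C : 0 <= C -> hold b C (fun=> c : R).
  by move=> C0 x y *; rewrite subrr normr0 mulr_ge0// sqrtr_ge0.
split; [|exact: h|exact: h|].
  by move=> x _; rewrite subrr normr0 mulr0.
by move=> x y *; rewrite !subrr normr0 mulr0 mul0r.
Qed.

End Extension.

(* [v] plays the role of the derivative of [f]. *)
Definition rhs {R : realType} (b : R) (f v : R -> R) (x : R) : R :=
  2^-1 * (gt b f x * v x + sg b f x * aa f x).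

(** * Regularity of the right-hand side of the equation *)

Section RightHandSide.
Context {R : realType} (b : R) (hb : 0 < b).
Implicit Types (x y C tau : R) (f v : R -> R).

(** By the product rule, the integral of [s v(s)] over [[0, x]] is [x f x] minus the integral of
    [f], that is [x^2 * aa f x]. *)
Lemma aa_wav f v C x : 0 <= C -> hold b C v -> prim 0 b f v -> 0 < x <= b ->
  aa f x = wav 1 v x.
Proof.
move=> C0 hv pf xI; rewrite /wav gt_eqF; last lra.
have x0 : x != 0 by rewrite gt_eqF//; lra.
have bv := hold_bm C0 hv.
have bf : bm 0 b f by apply/bm_lip/(prim_lip pf).
have pid : prim 0 b (fun s : R => s) (fun=> 1).
  have := prim_poly 0 b 'X; rewrite derivX.
  by apply: prim_eq => s _; rewrite ?hornerX ?hornerC.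
have [_ h] := primM pid pf.
have := h 0 x (lexx _) ltac:(lra) ltac:(lra).
rewrite mul0r subr0 itgD; last 2 first.
- by apply: (@ig_sub _ 0 b); [lra|lra|apply/bm_ig/bmM => //; exact: bm_cst].
- by apply: (@ig_sub _ 0 b); [lra|lra|apply/bm_ig/bmM => //; exact: bm_id].
rewrite (@eq_itg _ 0 x (fun s => 1 * f s) f); last by move=> s _; rewrite mul1r.
rewrite (@eq_itg _ 0 x (fun s => s ^+ 1 * v s) (fun s => s * v s)); last by move=> s _; rewrite expr1.
rewrite /aa /av => E; have -> : itg 0 x (fun s => s * v s) = x * f x - itg 0 x f by rewrite E; ring.
by field.
Qed.

(** The right-hand side is built from [v] by means, products, a primitive and an exponential, each
    of which preserves [gd]. Thus [u_t] inherits from [u_r] its Hoelder bound in [r] and its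
    Lipschitz bound in time. *)
Lemma gd_rhs C : 0 <= C -> exists2 C', C <= C' & forall tau f0 f1 v0 v1, 0 <= tau ->
  adm b f0 -> adm b f1 -> prim 0 b f0 v0 -> prim 0 b f1 v1 -> gd b C tau v0 v1 ->
  gd b C' tau (rhs b f0 v0) (rhs b f1 v1) /\
  forall x, 0 <= x <= b -> `|aa f1 x - aa f0 x| <= C' * tau.
Proof.
move=> C0.
(* In this order, the constants bound [aa f], its square, the exponent, [g], [g~], [g - g~] and the
   sum of the two products. *)
pose C1 := 3 * C; pose C2 := 4 * C1 * C1.
pose C3 := (b ^+ 2 + b * Num.sqrt b) * C2.
pose C4 := 1 + C3 + 2 * C3 ^+ 2.
pose C5 := 3 * C4.
pose C6 := C4 + 4 * 1 * C5.
pose C7 := 4 * C5 * C + 4 * C6 * C1.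
have C10 : 0 <= C1 by rewrite mulr_ge0.
have C20 : 0 <= C2 by rewrite !mulr_ge0.
have C30 : 0 <= C3 by rewrite mulr_ge0// addr_ge0 ?sqr_ge0// mulr_ge0 ?sqrtr_ge0// ltW.
have C40 : 0 <= C4 by rewrite /C4; have := sqr_ge0 C3; slim_lra.
have C50 : 0 <= C5 by rewrite mulr_ge0.
have C60 : 0 <= C6 by rewrite /C6; slim_lra.
have C70 : 0 <= C7 by rewrite /C7 addr_ge0// !mulr_ge0.
exists (4 * 1 * C7 + C1 + C); first by rewrite /C1; slim_lra.
move=> tau f0 f1 v0 v1 t0 a0 a1 p0 p1 gv.
have [_ hv0 hv1 _] := gv.
have ga := gd_wav hb (isT : (1 <= 1)%N) C0 t0 gv; rewrite -/C1 in ga.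
have gaa := gdM C10 C10 t0 ga ga; rewrite -/C2 in gaa.
have gX := gd_primr hb C20 t0 gaa; rewrite -/C3 in gX.
have XE f v : hold b C v -> prim 0 b f v -> forall x, 0 <= x <= b ->
    itg x b (fun s => s * (wav 1 v s * wav 1 v s)) = XX b f x.
  move=> hv pf x xI; apply: eq_itg => s sI; have [->|s0] := eqVneq s 0; first by rewrite !mul0r.
  by rewrite -(aa_wav C0 hv pf) ?expr2// lt_neqAle eq_sym s0; slim_lra.
have eqgd D t g0 g1 g0' g1' : (forall x, 0 <= x <= b -> g0 x = g0' x) ->
    (forall x, 0 <= x <= b -> g1 x = g1' x) -> gd b D t g0 g1 -> gd b D t g0' g1'.
  move=> e0 e1 [sg h0 h1 hd]; split.
  - by move=> x xI; rewrite -e0// -e1//; exact: sg.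
  - by move=> x y x0 xy yb; rewrite -!e0; [exact: h0|slim_lra..].
  - by move=> x y x0 xy yb; rewrite -!e1; [exact: h1|slim_lra..].
  - by move=> x y x0 xy yb; rewrite -!e1 -?e0; [exact: hd|slim_lra..].
have {}gX : gd b C3 tau (XX b f0) (XX b f1).
  by apply: eqgd gX => x xI; apply: XE.
have gG : gd b C4 tau (GG b f0) (GG b f1).
  have := gd_exp C30 t0 _ gX; rewrite -/C4 => h.
  apply: (eqgd _ _ (fun x => expR (- XX b f0 x)) (fun x => expR (- XX b f1 x))).
  - by move=> x _; rewrite GGE.
  - by move=> x _; rewrite GGE.
  by apply: h => x xI; split; exact: XX_ge0.
have gT : gd b C5 tau (gt b f0) (gt b f1).
  have := gd_wav hb (isT : (0 <= 1)%N) C40 t0 gG; rewrite -/C5.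
  have E f x : wav 0 (GG b f) x = gt b f x.
    rewrite /wav /gt /avz; case: eqP => _; first by rewrite divr1.
    by rewrite /av expr1; congr (_ / _); apply: eq_itg => s _; rewrite expr0 mul1r.
  by apply: eqgd => x _; exact: E.
have gc c : gd b `|c| tau (fun=> c) (fun=> c).
  have := gd_cst b c => -[s h0 h1 hd]; split => //.
    by move=> x xI; rewrite subrr normr0 mulr_ge0.
  by move=> x y *; rewrite !subrr normr0 !mulr_ge0 ?sqrtr_ge0.
have gS : gd b C6 tau (sg b f0) (sg b f1).
  have := gc (-1); rewrite normrN1 => g1.
  have := gdD gG (gdM ler01 C50 t0 g1 gT); rewrite -/C6.
  by apply: eqgd => x _; rewrite mulN1r.
have g2 := gc (2^-1); rewrite ger0_norm in g2; last by rewrite invr_ge0.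
have gR := gdM C50 C0 t0 gT gv.
have gS2 := gdM C60 C10 t0 gS ga.
have gsum := gdD gR gS2; rewrite -/C7 in gsum.
have h20 : 0 <= 2^-1 :> R by slim_lra.
have gfin := gdM h20 C70 t0 g2 gsum.
have sgE f v x : adm b f -> hold b C v -> prim 0 b f v -> 0 <= x <= b ->
    sg b f x * wav 1 v x = sg b f x * aa f x.
  move=> af hv pf xI; have [->|x0] := eqVneq x 0.
    by rewrite /sg gt0E subrr !mul0r.
  by rewrite (aa_wav C0 hv pf)// lt_neqAle eq_sym x0; slim_lra.
have gdle D D' g0 g1 : D <= D' -> 0 <= D -> gd b D tau g0 g1 -> gd b D' tau g0 g1.
  move=> DD D0 [s h0 h1 hd]; split; [|exact: hold_le h0|exact: hold_le h1|].
    move=> x xI; have [k1 k2 k3] := s x xI; split; [slim_lra|slim_lra|].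
    by apply: le_trans k3 _; exact: ler_wpM2r.
  by apply: hold_le hd; exact: ler_wpM2r.
split.
  apply: (gdle (4 * 2^-1 * C7)); [by rewrite /C1; slim_lra|slim_lra|].
  apply: eqgd gfin => x xI; rewrite /rhs; congr (_ * (_ + _)); exact: sgE.
move=> x xI; have [->|x0] := eqVneq x 0.
  rewrite /aa !invr0 !mulr0 subrr normr0 mulr_ge0//; slim_lra.
have xI' : 0 < x <= b by rewrite lt_neqAle eq_sym x0; slim_lra.
rewrite (aa_wav C0 hv1 p1)// (aa_wav C0 hv0 p0)//.
have [/(_ x xI)[_ _ k] _ _ _] := ga.
by apply: le_trans k _; apply: ler_wpM2r => //; slim_lra.
Qed.

End RightHandSide.

(* All that is used of the exact solution: [ur] and [ut] are its derivatives,
   extended to the closed interval. *)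
Record regular_solution (R : realType) (k : nat) (b T C : R) (u ur ut : R -> R -> R) : Prop := {
  reg_C : 0 <= C;
  reg_lip : forall t x y, 0 <= t <= T -> 0 <= x -> x <= y -> y <= b ->
    `|u t y - u t x| <= C * (y - x);
  reg_time : forall s t x, 0 <= s -> s <= t -> t <= T -> 0 <= x <= b ->
    `|u t x - u s x| <= C * (t - s);
  reg_poly : {ae leb R, forall t, 0 < t < T -> forall a c, 0 <= a -> a <= c -> c <= b ->
    exists2 P : {poly R}, (size P <= k.+1)%N &
      forall x, a <= x <= c -> `|u t x - P.[x]| <= C * (c - a) ^+ k.+1};
  reg_prim : forall t, 0 < t < T -> prim 0 b (u t) (ur t);
  reg_rhs : forall t x, ut t x = rhs b (u t) (ur t) x;
  reg_taylor : forall s t x, 0 < s < T -> 0 < t < T -> 0 <= x <= b ->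
    `|u t x - u s x - (t - s) * ut s x| <= C * (t - s) ^+ 2;
  reg_gd : forall s t, 0 < s -> s <= t -> t < T ->
    gd b C (t - s) (ur s) (ur t) /\ gd b C (t - s) (ut s) (ut t);
  reg_aa : forall s t x, 0 < s -> s <= t -> t < T -> 0 <= x <= b ->
    `|aa (u t) x - aa (u s) x| <= C * (t - s);
  reg_poly_t : {ae leb R, forall t, 0 < t < T -> exists D : R -> R,
    [/\ l2 b D, nn 0 b D <= C & forall a c, 0 <= a -> a <= c -> c <= b ->
      exists2 P : {poly R}, (size P <= k.+1)%N & forall x, a <= x <= c ->
        `|ut t x - P.[x]| <= (c - a) ^+ k * (Num.sqrt (c - a) * nn a c D)]}
}.

(** * Space and time derivatives of the exact solution *)

Section ExactDerivatives.
Context {R : realType} (b T : R) (hb : 0 < b) (hT : 0 < T).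
Context (Ub : R -> R) (u w g z : R -> R -> R).
Hypothesis hex : exact_solution b T Ub u w g z.
Variables (K M : R).
Hypotheses (K0 : 0 <= K) (M0 : 0 <= M).
Hypothesis uL : forall t, 0 <= t <= T -> forall x y, 0 <= x -> x <= y -> y <= b ->
  `|u t y - u t x| <= K * (y - x).
Hypothesis uF : forall t, 0 <= t <= T -> forall x y e, 0 <= x -> x <= y -> 0 <= e -> y + e <= b ->
  `|(u t (y + e) - u t y) - (u t (x + e) - u t x)| <= M * Num.sqrt (y - x) * e.
Implicit Types (s t x y e : R).

Let drv t x : 0 < t < T -> 0 < x < b -> is_derive x 1 (u t) (derive1 (u t) x).
Proof. exact: (exact_drv hb hex K0 uL). Qed.

Let adm_u t : 0 <= t <= T -> adm b (u t).
Proof. exact: (exact_adm hb K0 uL). Qed.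

Lemma exact_ur_bound t x : 0 < t < T -> 0 < x < b -> `|derive1 (u t) x| <= K.
Proof.
move=> tI xI; apply: (drv_bound (drv tI xI)); exists (b - x); first lra.
by move=> e eI; rewrite -[X in _ * X](addrK x) [e + x]addrC; apply: uL; lra.
Qed.

(** The difference of [u_r] at two points is the derivative at 0 of a difference of two translates,
    whose increments are the second-order ones of [uF]. *)
Lemma exact_ur_hold t : 0 < t < T -> hold_in b M (derive1 (u t)).
Proof.
move=> tI x y x0 xy yb.
have d1 : is_derive (0 : R) 1 (fun s => u t (y + s)) (derive1 (u t) y).
  by apply: drv_shift; rewrite addr0; apply: drv => //; lra.
have d2 : is_derive (0 : R) 1 (fun s => u t (x + s)) (derive1 (u t) x).
  by apply: drv_shift; rewrite addr0; apply: drv => //; lra.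
apply: (drv_bound (drvB d1 d2)); exists (b - y); first lra.
move=> e eI; rewrite add0r !addr0.
have -> : u t (y + e) - u t (x + e) - (u t y - u t x) =
  u t (y + e) - u t y - (u t (x + e) - u t x) by ring.
apply: uF; lra.
Qed.

Definition exact_ur t : R -> R := ext b (derive1 (u t)).

Definition exact_ut t : R -> R := rhs b (u t) (exact_ur t).

Lemma exact_urE t x : 0 < t < T -> 0 < x < b -> exact_ur t x = derive1 (u t) x.
Proof. by move=> tI xI; apply: (ext_in hb M0) => //; exact: exact_ur_hold. Qed.

Lemma exact_ur_le t x : 0 < t < T -> 0 <= x <= b -> `|exact_ur t x| <= K.
Proof.
move=> tI xI; apply: (ext_bound hb M0 (exact_ur_hold tI)) => // y yI.
exact: exact_ur_bound.
Qed.

Lemma exact_prim t : 0 < t < T -> prim 0 b (u t) (exact_ur t).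
Proof.
move=> tI; have hv := ext_hold hb M0 (exact_ur_hold tI).
have bv := hold_bm M0 hv.
apply: prim_FTC => //.
- exists K => // x y xI yI; apply: (exact_lip uL) => //; lra.
- move=> x xI; apply: (@cts_within _ _ 0 b) => //.
  by apply: (holder_within M0) => y1 y2 h1 h2 h3; rewrite distrC; exact: hv.
- by move=> x xI; rewrite exact_urE//; exact: drv.
Qed.

Lemma gt_01 t x : 0 <= t <= T -> 0 <= x <= b -> 0 <= gt b (u t) x <= 1.
Proof.
move=> tI xI; rewrite gt_le1// ?andbT; last exact: adm_u.
by apply: le_trans (gt_lower (adm_u tI) xI); exact/ltW/expR_gt0.
Qed.

Lemma sg_le1 t x : 0 <= t <= T -> 0 <= x <= b -> `|sg b (u t) x| <= 1.
Proof.
move=> tI xI; have := gt_01 tI xI; have := GG_gt0 b (u t) x.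
have := GG_le1 (u t) xI; rewrite /sg ler_norml; lra.
Qed.

Lemma exact_ut_le t x : 0 < t < T -> 0 <= x <= b -> `|exact_ut t x| <= K.
Proof.
move=> tI xI; have tI' : 0 <= t <= T by lra.
rewrite /exact_ut /rhs normrM ger0_norm ?invr_ge0// mulrC ler_pdivrMr//.
apply: le_trans (ler_normD _ _) _.
rewrite [`|gt _ _ _ * _|]normrM [`|sg _ _ _ * _|]normrM mulrDr mulr1.
have := gt_01 tI' xI => gI; apply: lerD; rewrite -[leRHS]mul1r; apply: ler_pM => //.
- by rewrite ger0_norm; lra.
- exact: exact_ur_le.
- exact: sg_le1.
- exact: (exact_aa hb K0 uL).
Qed.

Lemma exact_time t x : 0 < t < T -> 0 < x < b ->
  is_derive t 1 (fun s => u s x) (exact_ut t x).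
Proof.
by move=> tI xI; rewrite /exact_ut /rhs exact_urE//; exact: (exact_pde hb hex K0 uL).
Qed.

Lemma exact_lip_time s t x : 0 <= s -> s <= t -> t <= T -> 0 <= x <= b ->
  `|u t x - u s x| <= K * (t - s).
Proof.
move=> s0 st tT; apply: (@le_cts _ 0 b _ (fun x => `|u t x - u s x|)) => //.
  by apply/within_norm/withinB; apply: (exact_cx hex); lra.
move=> y yI; apply: (@MVT_bound _ s t K (fun r => u r y) (fun r => exact_ut r y)) => //.
- by apply: (@within_sub _ 0 T) => //; apply: (exact_ct hex); lra.
- by move=> r rI; apply: exact_time => //; lra.
- by move=> r rI; apply: exact_ut_le; lra.
Qed.

Lemma exact_ur_near t x y p : 0 < t < T -> 0 < x -> x <= p -> p <= y -> y < b ->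
  `|u t y - u t x - (y - x) * exact_ur t p| <= M * Num.sqrt (y - x) * (y - x).
Proof.
move=> tI x0 xp py yb.
pose F r := u t r - r * exact_ur t p.
have -> : u t y - u t x - (y - x) * exact_ur t p = F y - F x by rewrite /F; ring.
apply: (@MVT_bound _ x y _ F (fun r => exact_ur t r - exact_ur t p)); first lra.
- apply: withinB; first by apply: (@within_sub _ 0 b); [lra|lra|apply: (exact_cx hex); lra].
  by apply/lip_cont/lipM; [exact: lip_id|exact: lip_cst].
- move=> r rI; apply: drvB; first by rewrite exact_urE//; [apply: drv => //; lra|lra].
  by apply: drv_eq (drvM (drv_id r) (drv_cst r _)) _; ring.
move=> r rI; rewrite !exact_urE//; [|lra..].
by apply: (hold_in_sym M0 (exact_ur_hold tI)); [lra|lra|rewrite ler_norml; lra].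
Qed.

(** Interpolation: [u_r] is within [M sqrt e] of a difference quotient of step [e], and the quotient
    moves by at most [2 K (t - s) / e]. Optimizing over [e] later gives continuity of [u_r] in
    time. *)
Lemma exact_ur_modulus s t x e : 0 < s -> s <= t -> t < T -> 0 < x < b -> 0 < e < b / 2 ->
  `|exact_ur t x - exact_ur s x| * e <= 2 * (M * Num.sqrt e * e) + 2 * K * (t - s).
Proof.
move=> s0 st tT xI eI.
have gen (a1 a2 a3 a4 p q B D : R) : `|a1 - a3 - p| <= B -> `|a2 - a4 - q| <= B ->
    `|a3 - a4| <= D -> `|a1 - a2| <= D -> `|p - q| <= 2 * B + 2 * D.
  by rewrite !ler_norml; lra.
(* An interval of length [e] containing [x] is taken on the side with room; [e < b / 2] keeps it
   inside. *)
have [c [c0 cx xc cb]] : exists c, [/\ 0 < c, c <= x, x <= c + e & c + e < b].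
  have [xb|xb] := ltP x (b / 2); first by exists x; split; lra.
  by exists (x - e); split; lra.
have tI : 0 < t < T by lra.
have sI : 0 < s < T by lra.
have cI : 0 <= c <= b by lra.
have ceI : 0 <= c + e <= b by lra.
have e0 : 0 < e by lra.
have ce : c + e - c = e by ring.
have h1 := exact_ur_near tI c0 cx xc cb; rewrite ce in h1.
have h2 := exact_ur_near sI c0 cx xc cb; rewrite ce in h2.
rewrite -{1}(gtr0_norm e0) -normrM mulrBl ![_ * e in leLHS]mulrC -(mulrA 2 K).
by apply: gen h1 h2 _ _; apply: exact_lip_time => //; exact: ltW.
Qed.

Lemma exact_ur_cts x t0 t1 : 0 < x < b -> 0 < t0 -> t1 < T ->
  {within `[t0, t1], continuous (fun t => exact_ur t x)}.
Proof.
move=> xI t00 t1T; apply: eps_within => t e tI e0.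
pose q := e / (4 * (M + 1)).
have q0 : 0 < q by apply: divr_gt0 => //; have := M0; lra.
pose h := Num.min (b / 4) (q ^+ 2).
have h0 : 0 < h by rewrite lt_min exprn_gt0 ?andbT//; have := hb; lra.
have hb4 : h <= b / 4 by rewrite ge_min lexx.
have hq : Num.sqrt h <= q.
  by rewrite -(gtr0_norm q0) -sqrtr_sqr ler_wsqrtr// ge_min lexx orbT.
have Mq : M * Num.sqrt h <= e / 4.
  apply: (@le_trans _ _ ((M + 1) * q)).
    by apply: ler_pM => //; lra.
  by rewrite /q le_eqVlt; apply/orP; left; apply/eqP; field; rewrite gt_eqF//; have := M0; lra.
have d0 : 0 < e * h / (4 * (K + 1)) by rewrite divr_gt0 ?mulr_gt0//; have := K0; lra.
exists (e * h / (4 * (K + 1))) => // s sI st.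
have Kd d : 0 <= d -> d < e * h / (4 * (K + 1)) -> 2 * K * d <= e * h / 2.
  move=> d00; rewrite ltr_pdivlMr; last by have := K0; lra.
  by have := K0; have := mulr_ge0 K0 d00; lra.
have key s1 s2 : t0 <= s1 -> s1 <= s2 -> s2 <= t1 -> s2 - s1 < e * h / (4 * (K + 1)) ->
    `|exact_ur s2 x - exact_ur s1 x| <= e.
  move=> k1 k2 k3 k4; rewrite -(ler_pM2r h0).
  apply: le_trans (exact_ur_modulus _ k2 _ xI _) _; [lra|lra|have := hb; lra|].
  have := Kd _ _ k4; rewrite subr_ge0 => /(_ k2) k5.
  have := ler_wpM2r (ltW h0) Mq; lra.
have [ts|/ltW ts] := leP t s.
  by apply: key; [lra|lra|lra|]; move: st; rewrite ltr_norml; lra.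
by rewrite distrC; apply: key; [lra|lra|lra|]; move: st; rewrite ltr_norml; lra.
Qed.

Lemma lip_within_time (f : R -> R) L t0 t1 : 0 <= L ->
  (forall s t, t0 <= s -> s <= t -> t <= t1 -> `|f t - f s| <= L * (t - s)) ->
  {within `[t0, t1], continuous f}.
Proof.
move=> L0 h; apply: lip_cont; exists L => // s t sI tI.
wlog st : s t sI tI / s <= t => [hw|].
  have [st|/ltW ts] := leP s t; first exact: hw.
  by rewrite distrC [`|s - t|]distrC; exact: hw.
by rewrite distrC [`|s - t|]ler0_norm ?opprB; [apply: h; lra|lra].
Qed.

Lemma exact_GG_time s t x : 0 <= s -> s <= t -> t <= T -> 0 <= x <= b ->
  `|GG b (u t) x - GG b (u s) x| <= 6 * K ^+ 2 * b * (t - s).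
Proof.
move=> s0 st tT xI.
have sI : 0 <= s <= T by lra.
have tI : 0 <= t <= T by lra.
apply: le_trans (GG_sub_le hb (adm_u tI) (adm_u sI) xI) _.
have n1 := exact_nn_aa hb K0 uL tI; have n2 := exact_nn_aa hb K0 uL sI.
have n3 : nn 0 b (fun y => u t y - u s y) <= K * (t - s) * Num.sqrt b.
  rewrite -{2}(subr0 b); apply: nn_sup; first exact: ltW.
  - by apply: bmB; [case: (adm_u tI)|case: (adm_u sI)].
  - by rewrite mulr_ge0//; lra.
  by move=> y yI; apply: exact_lip_time => //; lra.
have sb : Num.sqrt b ^+ 2 = b by rewrite sqr_sqrtr// ltW.
have -> : 6 * K ^+ 2 * b * (t - s) =
    3 * (K * (t - s) * Num.sqrt b) * (K * Num.sqrt b + K * Num.sqrt b).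
  by rewrite -{1}sb; ring.
apply: ler_pM; rewrite ?mulr_ge0 ?addr_ge0 ?nn_ge0//; last exact: lerD.
by apply: ler_wpM2l.
Qed.

(** This continuity is what allows Sobolev bounds on [u_t], valid for almost all times, to be
    extended to all interior times. *)
Lemma exact_ut_cts x t0 t1 : 0 < x < b -> 0 < t0 -> t1 < T ->
  {within `[t0, t1], continuous (fun t => exact_ut t x)}.
Proof.
move=> xI t00 t1T; have xI' : 0 <= x <= b by lra.
have KKb : 0 <= 6 * K ^+ 2 * b by rewrite !mulr_ge0 ?sqr_ge0// ltW.
have gl s t y : t0 <= s -> s <= t -> t <= t1 -> 0 <= y <= b ->
    `|GG b (u t) y - GG b (u s) y| <= 6 * K ^+ 2 * b * (t - s).
  by move=> h1 h2 h3 yI; apply: exact_GG_time; lra.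
have cgt : {within `[t0, t1], continuous (fun t => gt b (u t) x)}.
  apply: (lip_within_time KKb) => s t h1 h2 h3.
  apply: gt_sub_le => //; [apply: adm_u; lra|apply: adm_u; lra|by move=> y; exact: gl].
have csg : {within `[t0, t1], continuous (fun t => sg b (u t) x)}.
  apply: (lip_within_time (mulr_ge0 (ler0n R 2) KKb)) => s t h1 h2 h3.
  rewrite -(mulrA 2); apply: sg_sub_le => //; [apply: adm_u; lra|apply: adm_u; lra|].
  by move=> y; exact: gl.
have caa : {within `[t0, t1], continuous (fun t => aa (u t) x)}.
  have L0 : 0 <= 2 * K / x by rewrite divr_ge0 ?mulr_ge0//; lra.
  apply: (lip_within_time L0) => s t h1 h2 h3.
  have tI : 0 <= t <= T by lra.
  have sI : 0 <= s <= T by lra.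
  have [bt _] := adm_u tI; have [bs _] := adm_u sI.
  rewrite -(@aaB _ b)// /aa normrM normfV (gtr0_norm (_ : 0 < x)); last lra.
  rewrite mulrAC ler_wpM2r//; first by rewrite invr_ge0; lra.
  have d1 y : 0 <= y <= b -> `|u t y - u s y| <= K * (t - s).
    by move=> yI; apply: exact_lip_time => //; lra.
  have : `|av (fun y => u t y - u s y) x| <= K * (t - s).
    by apply: (av_bound (b := b)); [exact: bmB|lra|move=> y yI; apply: d1; lra].
  have := d1 x xI'; rewrite !ler_norml; lra.
have M2 (f1 f2 : R -> R) : {within `[t0, t1], continuous f1} -> {within `[t0, t1], continuous f2} ->
    {within `[t0, t1], continuous (fun t => f1 t * f2 t : R)}.
  by move=> c1 c2 r; apply: cvgM; [exact: c1|exact: c2].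
have cur := exact_ur_cts xI t00 t1T.
have D2 (f1 f2 : R -> R) : {within `[t0, t1], continuous f1} -> {within `[t0, t1], continuous f2} ->
    {within `[t0, t1], continuous (fun t => f1 t + f2 t : R)}.
  by move=> c1 c2 r; apply: cvgD; [exact: c1|exact: c2].
apply: (M2 (fun=> 2^-1)); first by apply: continuous_subspaceT => r; exact: cts_cst.
by apply: D2; apply: M2.
Qed.

End ExactDerivatives.

Lemma W_norm_ge0 {R : realType} (b : R) m p f : (0 <= W_norm 0 b m p f)%E.
Proof.
apply: le_ereal_inf_tmp => _ [D _ <-]; apply: sume_ge0 => i _; exact: Lnorm_ge0.
Qed.

Lemma gd_le {R : realType} (b C C' tau : R) f0 f1 : C <= C' -> 0 <= tau ->
  gd b C tau f0 f1 -> gd b C' tau f0 f1.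
Proof.
move=> CC t0 [s h0 h1 hd]; split; [|exact: hold_le h0|exact: hold_le h1|].
  move=> x xI; have [k1 k2 k3] := s x xI; split; [lra|lra|].
  by apply: le_trans k3 _; exact: ler_wpM2r.
by apply: hold_le hd; exact: ler_wpM2r.
Qed.

(** * Regularity of the exact solution for all times *)

Section ExactRegularity.
Context {R : realType} (k : nat) (hk : (1 <= k)%N) (b T : R) (hb : 0 < b) (hT : 0 < T).
Context (Ub : R -> R) (u w g z : R -> R -> R).
Hypothesis hex : exact_solution b T Ub u w g z.
Implicit Types (s t x y e : R).

Let ae_imp2 (P Q : R -> Prop) : {ae leb R, forall x, P x} -> (forall x, P x -> Q x) ->
  {ae leb R, forall x, Q x} := @ae_imp R P Q.

(** The bounds on increments are closed conditions, so the continuity of [u] in time carries them to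
    all times. The approximating polynomials depend on time, so that part stays almost everywhere;
    the projection will later remove the restriction. *)
Lemma exact_space_regularity : Linfty_Bochner T (W_norm 0 b k.+1 +oo%E) u ->
  exists K M : R, [/\ 0 <= K, 0 <= M,
  forall t, 0 <= t <= T -> forall x y, 0 <= x -> x <= y -> y <= b ->
    `|u t y - u t x| <= K * (y - x),
  forall t, 0 <= t <= T -> forall x y e, 0 <= x -> x <= y -> 0 <= e -> y + e <= b ->
    `|(u t (y + e) - u t y) - (u t (x + e) - u t x)| <= M * Num.sqrt (y - x) * e &
  {ae leb R, forall t, 0 < t < T -> forall a c, 0 <= a -> a <= c -> c <= b ->
    exists2 P : {poly R}, (size P <= k.+1)%N &
      forall x, a <= x <= c -> `|u t x - P.[x]| <= K * (c - a) ^+ k.+1}].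
Proof.
move=> /(Linfty_Bochner_ae (fun f => W_norm_ge0 b k.+1 +oo%E f))[A A0 aeA].
pose M := A * Num.sqrt b; pose K := (Num.sqrt b + (Num.sqrt b)^-1) * M.
have M0 : 0 <= M by rewrite mulr_ge0 ?sqrtr_ge0// ltW.
have K0 : 0 <= K by rewrite mulr_ge0// addr_ge0 ?invr_ge0 ?sqrtr_ge0.
have hgood : {ae leb R, forall t, 0 < t < T -> [/\
  forall x y, 0 <= x -> x <= y -> y <= b -> `|u t y - u t x| <= K * (y - x),
  forall x y e, 0 <= x -> x <= y -> 0 <= e -> y + e <= b ->
    `|(u t (y + e) - u t y) - (u t (x + e) - u t x)| <= M * Num.sqrt (y - x) * e &
  forall a c, 0 <= a -> a <= c -> c <= b ->
    exists2 P : {poly R}, (size P <= k.+1)%N &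
      forall x, a <= x <= c -> `|u t x - P.[x]| <= A * (c - a) ^+ k.+1]}.
  apply: (ae_imp2 aeA) => t At tI.
  have [D [D0 mD wD]] := W_norm_lt (At tI).
  have nD j (jk : (j <= k.+1)%N) := Lp_norm_oo hb (ltW A0) (proj1 (mD j jk)) (proj2 (mD j jk)).
  have nM j : (j <= k.+1)%N -> nn 0 b (D j) <= M.
    move=> jk; have [_ h] := nD j jk; have := h 0 b (lexx _) (ltW hb) (lexx _).
    by rewrite subr0.
  have tI' : 0 <= t <= T by slim_lra.
  have [h1 h2 h3] := sobolev hb (m := k.+1) (D := D) hk M0 (fun j jk => proj1 (nD j jk)) wD
    (nM 1%N isT) (nM 2%N hk) (exact_cx hex tI') (fun x _ => esym (congr1 (@^~ x) D0)).
  split => // a c a0 ac cb; have [P sP hP] := h3 a c a0 ac cb; exists P => // x xI.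
  apply: le_trans (hP x xI) _; have [_ h] := nD k.+1 (leqnn _).
  apply: (@le_trans _ _ ((c - a) ^+ k * (Num.sqrt (c - a) * (A * Num.sqrt (c - a))))).
    apply: ler_wpM2l; first by rewrite exprn_ge0//; slim_lra.
    by apply: ler_wpM2l; [exact: sqrtr_ge0|exact: h].
  have sq : Num.sqrt (c - a) * Num.sqrt (c - a) = c - a by rewrite -expr2 sqr_sqrtr//; slim_lra.
  by rewrite [X in _ * X]mulrCA sq mulrCA -exprSr.
exists (K + A), M; split => //; first by rewrite addr_ge0// ltW.
- move=> t tI x y x0 xy yb; apply: (@le_trans _ _ (K * (y - x))); last first.
    by apply: ler_wpM2r; slim_lra.
  move: t tI; apply: (@ae_le_cts _ 0 T _ (fun t => `|u t y - u t x|)) => //.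
    by apply/within_norm/withinB; apply: (exact_ct hex); slim_lra.
  by apply: (ae_imp2 hgood) => t h tI; have [h1 _ _] := h tI; exact: h1.
- move=> t tI x y e x0 xy e0 yb; move: t tI.
  apply: (@ae_le_cts _ 0 T _ (fun t => `|(u t (y + e) - u t y) - (u t (x + e) - u t x)|)) => //.
    by apply/within_norm/withinB; apply/withinB; apply: (exact_ct hex); slim_lra.
  by apply: (ae_imp2 hgood) => t h tI; have [_ h1 _] := h tI; exact: h1.
apply: (ae_imp2 hgood) => t h tI a c a0 ac cb.
have [_ _ /(_ a c a0 ac cb)[P sP hP]] := h tI; exists P => // x xI.
apply: le_trans (hP x xI) _; apply: ler_wpM2r; last by slim_lra.
by rewrite exprn_ge0//; slim_lra.
Qed.

Section TimeRegularity.
Variables (K M : R).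
Hypotheses (K0 : 0 <= K) (M0 : 0 <= M).
Hypothesis uL : forall t, 0 <= t <= T -> forall x y, 0 <= x -> x <= y -> y <= b ->
  `|u t y - u t x| <= K * (y - x).
Hypothesis uF : forall t, 0 <= t <= T -> forall x y e, 0 <= x -> x <= y -> 0 <= e -> y + e <= b ->
  `|(u t (y + e) - u t y) - (u t (x + e) - u t x)| <= M * Num.sqrt (y - x) * e.

Let ur := exact_ur b u.
Let ut := exact_ut b u.

(** The two-time statement [gd_rhs] is applied to a single time, with [tau = 0]. *)
Lemma exact_ut_hold : exists2 C, 0 <= C & forall t, 0 < t < T -> hold b C (ut t).
Proof.
have KM0 : 0 <= K + M by exact: addr_ge0.
have [C CC hC] := gd_rhs hb KM0.
exists C => [|t tI]; first lra.
have tI' : 0 <= t <= T by lra.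
have ut_adm := exact_adm hb K0 uL tI'.
have pr := exact_prim hb hex K0 M0 uL uF tI.
have h0 (f : R -> R) : hold b ((K + M) * 0) (fun x => f x - f x).
  by move=> x y *; rewrite !subrr normr0 mulr0 mul0r.
have hur : hold b (K + M) (ur t).
  apply: (@hold_le _ _ M); first by have := K0; lra.
  exact: (ext_hold hb M0 (exact_ur_hold hb hex K0 uL uF tI)).
have [] := hC 0 _ _ (ur t) (ur t) (lexx _) ut_adm ut_adm pr pr; last by case.
split => // x xI; rewrite subrr normr0 mulr0.
have := exact_ur_le hb hex K0 M0 uL uF tI xI; rewrite -/(ur t) => h.
by split => //; apply: le_trans h _; have := M0; lra.
Qed.

(** The Sobolev embedding is applied to [ut], the expression given by the equation: it agrees with
    the time derivative inside and is continuous on the closed interval. *)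
Lemma exact_time_regularity : Linfty_Bochner T (W_norm 0 b k.+1 2%:E) (time_derivative u) ->
  exists K2 M2 : R, [/\ 0 <= K2, 0 <= M2,
  forall t, 0 < t < T -> forall x y, 0 < x -> x <= y -> y < b ->
    `|ut t y - ut t x| <= K2 * (y - x),
  forall t, 0 < t < T -> forall x y e, 0 < x -> x <= y -> 0 <= e -> y + e < b ->
    `|(ut t (y + e) - ut t y) - (ut t (x + e) - ut t x)| <= M2 * Num.sqrt (y - x) * e &
  {ae leb R, forall t, 0 < t < T -> exists D : R -> R,
    [/\ l2 b D, nn 0 b D <= M2 & forall a c, 0 <= a -> a <= c -> c <= b ->
      exists2 P : {poly R}, (size P <= k.+1)%N & forall x, a <= x <= c ->
        `|ut t x - P.[x]| <= (c - a) ^+ k * (Num.sqrt (c - a) * nn a c D)]}].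
Proof.
move=> /(Linfty_Bochner_ae (fun f => W_norm_ge0 b k.+1 2%:E f))[M2 M20 aeM].
pose K2 := (Num.sqrt b + (Num.sqrt b)^-1) * M2.
have K20 : 0 <= K2 by rewrite mulr_ge0 ?(ltW M20)// addr_ge0 ?invr_ge0 ?sqrtr_ge0.
have [C C0 hC] := exact_ut_hold.
have hgood : {ae leb R, forall t, 0 < t < T -> [/\
  forall x y, 0 <= x -> x <= y -> y <= b -> `|ut t y - ut t x| <= K2 * (y - x),
  forall x y e, 0 <= x -> x <= y -> 0 <= e -> y + e <= b ->
    `|(ut t (y + e) - ut t y) - (ut t (x + e) - ut t x)| <= M2 * Num.sqrt (y - x) * e &
  exists D : R -> R,
    [/\ l2 b D, nn 0 b D <= M2 & forall a c, 0 <= a -> a <= c -> c <= b ->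
      exists2 P : {poly R}, (size P <= k.+1)%N & forall x, a <= x <= c ->
        `|ut t x - P.[x]| <= (c - a) ^+ k * (Num.sqrt (c - a) * nn a c D)]]}.
  apply: (ae_imp2 aeM) => t At tI.
  have [D [D0 mD wD]] := W_norm_lt (At tI).
  have nD j (jk : (j <= k.+1)%N) := Lp_norm_2 (ltW M20) (proj1 (mD j jk)) (proj2 (mD j jk)).
  have cut : {within `[0, b], continuous (ut t)}.
    by apply: (holder_within C0) => x y x0 xy yb; rewrite distrC; exact: hC.
  have eD x : 0 < x < b -> ut t x = D 0%N x.
    move=> xI; rewrite D0 /time_derivative derive1E.
    by have [_ ->] := exact_time hb hex K0 M0 uL uF tI xI.
  have [h1 h2 h3] := sobolev hb (m := k.+1) (D := D) hk (ltW M20) (fun j jk => proj1 (nD j jk)) wD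
    (proj2 (nD 1%N isT)) (proj2 (nD 2%N hk)) cut eD.
  split => //; exists (D k.+1); split => //; first exact: (proj1 (nD k.+1 (leqnn _))).
  exact: (proj2 (nD k.+1 (leqnn _))).
exists K2, M2; split => //; first exact: ltW.
- move=> t tI x y x0 xy yb.
  (* Continuity in time is known for interior times only, hence this compact interval around [t]. *)
  have ct z' : 0 < z' < b -> {within `[t / 2, (t + T) / 2], continuous (fun t => ut t z')}.
    by move=> zI; apply: (exact_ut_cts hb hex K0 M0 uL uF); lra.
  apply: (@ae_le_cts _ (t / 2) ((t + T) / 2) _ (fun t => `|ut t y - ut t x|)); [lra| | |lra].
    by apply/within_norm/withinB; apply: ct; lra.
  apply: (ae_imp2 hgood) => s h sI; have [h1 _ _] := h ltac:(lra); apply: h1; lra.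
- move=> t tI x y e x0 xy e0 yb.
  have ct z' : 0 < z' < b -> {within `[t / 2, (t + T) / 2], continuous (fun t => ut t z')}.
    by move=> zI; apply: (exact_ut_cts hb hex K0 M0 uL uF); lra.
  apply: (@ae_le_cts _ (t / 2) ((t + T) / 2) _
    (fun t => `|(ut t (y + e) - ut t y) - (ut t (x + e) - ut t x)|)); [lra| | |lra].
    by apply/within_norm/withinB; apply/withinB; apply: ct; lra.
  apply: (ae_imp2 hgood) => s h sI; have [_ h1 _] := h ltac:(lra); apply: h1; lra.
by apply: (ae_imp2 hgood) => t h tI; have [] := h tI.
Qed.

Variables (K2 M2 : R).
Hypotheses (K20 : 0 <= K2) (M20 : 0 <= M2).
Hypothesis utL : forall t, 0 < t < T -> forall x y, 0 < x -> x <= y -> y < b ->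
  `|ut t y - ut t x| <= K2 * (y - x).
Hypothesis utF : forall t, 0 < t < T -> forall x y e, 0 < x -> x <= y -> 0 <= e -> y + e < b ->
  `|(ut t (y + e) - ut t y) - (ut t (x + e) - ut t x)| <= M2 * Num.sqrt (y - x) * e.

Let drv t x : 0 < t < T -> 0 < x < b -> is_derive x 1 (u t) (derive1 (u t) x).
Proof. exact: (exact_drv hb hex K0 uL). Qed.

Let dtime t x : 0 < t < T -> 0 < x < b -> is_derive t 1 (fun s => u s x) (ut t x).
Proof. exact: (exact_time hb hex K0 M0 uL uF). Qed.

Let ctime s t x : 0 < s -> t < T -> 0 < x < b -> {within `[s, t], continuous (fun t => u t x)}.
Proof.
by move=> s0 tT xI; apply: (@within_sub _ 0 T); [lra|lra|apply: (exact_ct hex); lra].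
Qed.

(** An exchange of derivatives that needs no mixed derivative: the second difference of [u] in time
    and space is bounded by the mean value theorem in time, with the Lipschitz bound of [ut] in [r],
    and is divided by the space step. *)
Lemma exact_ur_lip_time s t x : 0 < s -> s <= t -> t < T -> 0 < x < b ->
  `|derive1 (u t) x - derive1 (u s) x| <= K2 * (t - s).
Proof.
move=> s0 st tT xI.
have dd r : 0 < r < T -> is_derive (0 : R) 1 (fun e => u r (x + e)) (derive1 (u r) x).
  by move=> rI; apply: drv_shift; rewrite addr0; exact: drv.
have d1 := dd t ltac:(lra); have d2 := dd s ltac:(lra).
apply: (drv_bound (drvB d1 d2)); exists (b - x); first lra.
move=> e eI; rewrite add0r !addr0.
have -> : u t (x + e) - u s (x + e) - (u t x - u s x) =
  (u t (x + e) - u t x) - (u s (x + e) - u s x) by ring.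
rewrite mulrAC; apply: (@MVT_bound _ s t _ (fun r => u r (x + e) - u r x)
  (fun r => ut r (x + e) - ut r x)) => //.
- by apply: withinB; apply: ctime => //; lra.
- by move=> r rI; apply: drvB; apply: dtime; lra.
move=> r rI; rewrite -[X in _ * X](addrK x) [e + x]addrC; apply: utL; lra.
Qed.

(** The same exchange one order higher: a second-order space increment of [ut] bounds the time
    increment of that of [u]. *)
Lemma exact_ur_mixed s t : 0 < s -> s <= t -> t < T ->
  hold_in b (M2 * (t - s)) (fun x => derive1 (u t) x - derive1 (u s) x).
Proof.
move=> s0 st tT x y x0 xy yb.
have dd r p : 0 < r < T -> 0 < p < b ->
    is_derive (0 : R) 1 (fun e => u r (p + e)) (derive1 (u r) p).
  by move=> rI pI; apply: drv_shift; rewrite addr0; exact: drv.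
have tI : 0 < t < T by lra.
have sI : 0 < s < T by lra.
have xI : 0 < x < b by lra.
have yI : 0 < y < b by lra.
have d1 := drvB (dd t y tI yI) (dd s y sI yI); have d2 := drvB (dd t x tI xI) (dd s x sI xI).
apply: (drv_bound (drvB d1 d2)); exists (b - y); first lra.
move=> e eI; rewrite add0r !addr0.
pose F r := (u r (y + e) - u r y) - (u r (x + e) - u r x).
rewrite (_ : _ - _ - _ = F t - F s); last by rewrite /F; ring.
have -> : M2 * (t - s) * Num.sqrt (y - x) * e = M2 * Num.sqrt (y - x) * e * (t - s) by ring.
apply: (@MVT_bound _ s t _ F
  (fun r => (ut r (y + e) - ut r y) - (ut r (x + e) - ut r x))) => //.
- by apply: withinB; apply: withinB; apply: ctime => //; lra.
- by move=> r rI; apply: drvB; apply: drvB; apply: dtime; lra.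
by move=> r rI; apply: utF; lra.
Qed.

End TimeRegularity.

Theorem exact_regular : Linfty_Bochner T (W_norm 0 b k.+1 +oo%E) u ->
  Linfty_Bochner T (W_norm 0 b k.+1 2%:E) (time_derivative u) ->
  exists C, regular_solution k b T C u (exact_ur b u) (exact_ut b u).
Proof.
move=> hu hut; have [K [M [K0 M0 uL uF aeu]]] := exact_space_regularity hu.
have [K2 [M2 [K20 M20 utL utF aeut]]] := exact_time_regularity K0 M0 uL uF hut.
pose C1 := K + M + K2 + M2.
have C10 : 0 <= C1 by rewrite !addr_ge0.
have [C CC hC] := gd_rhs hb C10.
have [C0 [KC [M2C K2C]]] : 0 <= C /\ K <= C /\ M2 <= C /\ K2 <= C.
  by move: CC C10; rewrite /C1; slim_lra.
have ad t : 0 <= t <= T -> adm b (u t) by exact: (exact_adm hb K0 uL).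
have pr t : 0 < t < T -> prim 0 b (u t) (exact_ur b u t).
  exact: (exact_prim hb hex K0 M0 uL uF).
have gur s t : 0 < s -> s <= t -> t < T -> gd b C1 (t - s) (exact_ur b u s) (exact_ur b u t).
  move=> s0 st tT; have ts : 0 <= t - s by slim_lra.
  have hol r : 0 < r < T -> hold_in b C1 (derive1 (u r)).
    move=> rI x y x0 xy yb.
    apply: le_trans (exact_ur_hold hb hex K0 uL uF rI x0 xy yb) _.
    by apply: ler_wpM2r; [exact: sqrtr_ge0|rewrite /C1; slim_lra].
  apply: gd_ext => //; [|apply: hol; slim_lra|apply: hol; slim_lra|].
    move=> x xI.
    have h1 := exact_ur_bound hb hex K0 uL (_ : 0 < s < T) xI.
    have h2 := exact_ur_bound hb hex K0 uL (_ : 0 < t < T) xI.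
    have h3 := exact_ur_lip_time K0 M0 uL uF utL s0 st tT xI.
    split.
    - by apply: le_trans (h1 _) _; [slim_lra|rewrite /C1; slim_lra].
    - by apply: le_trans (h2 _) _; [slim_lra|rewrite /C1; slim_lra].
    - by apply: le_trans h3 _; apply: ler_wpM2r => //; rewrite /C1; slim_lra.
  move=> x y x0 xy yb.
  apply: le_trans (exact_ur_mixed K0 M0 uL uF utF s0 st tT x0 xy yb) _.
  by apply: ler_wpM2r; [exact: sqrtr_ge0|apply: ler_wpM2r => //; rewrite /C1; slim_lra].
have hres s t : 0 < s -> s <= t -> t < T ->
    gd b C (t - s) (exact_ut b u s) (exact_ut b u t) /\
    forall x, 0 <= x <= b -> `|aa (u t) x - aa (u s) x| <= C * (t - s).
  move=> s0 st tT; apply: hC => //; [slim_lra|apply: ad; slim_lra|apply: ad; slim_lra|apply: pr; slim_lra|apply: pr; slim_lra|].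
  exact: gur.
(* [ut] is Lipschitz in time, so the first-order remainder is quadratic. The bound is proved at
   interior points and passes to the ends by continuity in [x]. *)
have tay s t x : 0 < s < T -> 0 < t < T -> 0 <= x <= b ->
    `|u t x - u s x - (t - s) * exact_ut b u s x| <= C * (t - s) ^+ 2.
  move=> sI tI; have [_ hs _ _] := proj1 (hres s s ltac:(slim_lra) (lexx _) ltac:(slim_lra)).
  apply: (@le_cts _ 0 b _ (fun x => `|u t x - u s x - (t - s) * exact_ut b u s x|)) => //.
    have cu r : 0 < r < T -> {within `[0, b], continuous (u r)}.
      by move=> rI; apply: (exact_cx hex); slim_lra.
    apply/within_norm/withinB; first by apply: withinB; exact: cu.
    apply: (holder_within (K := `|t - s| * C)); first by rewrite mulr_ge0.
    move=> x1 x2 h1 h2 h3; rewrite -mulrBr normrM -mulrA [X in _ * X <= _]distrC.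
    by apply: ler_wpM2l => //; exact: hs.
  move=> {}x xI.
  pose F r := u r x - r * exact_ut b u s x.
  have cF p q : 0 < p -> q < T -> {within `[p, q], continuous F}.
    move=> p0 qT; apply: withinB.
      by apply: (@within_sub _ 0 T); [slim_lra|slim_lra|apply: (exact_ct hex); slim_lra].
    by apply/lip_cont/lipM; [exact: lip_id|exact: lip_cst].
  have dF r : 0 < r < T -> is_derive r 1 F (exact_ut b u r x - exact_ut b u s x).
    move=> rI; apply: drvB; first exact: (exact_time hb hex K0 M0 uL uF).
    by apply: drv_eq (drvM (drv_id r) (drv_cst r _)) _; ring.
  have -> : u t x - u s x - (t - s) * exact_ut b u s x = F t - F s by rewrite /F; ring.
  have xI' : 0 <= x <= b by slim_lra.
  have dl p q : 0 < p -> p <= q -> q < T ->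
      `|exact_ut b u q x - exact_ut b u p x| <= C * (q - p).
    by move=> p0 pq qT; have [[h _ _ _] _] := hres p q p0 pq qT; have [] := h x xI'.
  have [st|ts] := leP s t.
    rewrite expr2 mulrA; apply: (@MVT_bound _ s t _ F
      (fun r => exact_ut b u r x - exact_ut b u s x)) => //.
    - by apply: cF; slim_lra.
    - by move=> r rI; apply: dF; slim_lra.
    move=> r rI; apply: le_trans (dl s r _ _ _) _; [slim_lra..|].
    by apply: ler_wpM2l => //; slim_lra.
  have -> : C * (t - s) ^+ 2 = C * (s - t) * (s - t) by ring.
  rewrite distrC.
  apply: (@MVT_bound _ t s _ F
    (fun r => exact_ut b u r x - exact_ut b u s x)); first slim_lra.
  - by apply: cF; slim_lra.
  - by move=> r rI; apply: dF; slim_lra.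
  move=> r rI; rewrite distrC; apply: le_trans (dl r s _ _ _) _; [slim_lra..|].
  by apply: ler_wpM2l => //; slim_lra.
exists C; split => //.
- move=> t x y tI x0 xy yb; apply: le_trans (uL _ tI _ _ x0 xy yb) _.
  by apply: ler_wpM2r => //; slim_lra.
- move=> s t x s0 st tT xI; apply: le_trans (exact_lip_time hb hex K0 M0 uL uF s0 st tT xI) _.
  by apply: ler_wpM2r => //; slim_lra.
- apply: (ae_imp2 aeu) => t h tI a c a0 ac cb.
  have [P sP hP] := h tI a c a0 ac cb; exists P => // x xI.
  by apply: le_trans (hP x xI) _; apply: ler_wpM2r => //; rewrite exprn_ge0//; slim_lra.
- move=> s t s0 st tT; split; last exact: (proj1 (hres s t s0 st tT)).
  by apply: gd_le (gur s t s0 st tT); slim_lra.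
- by move=> s t x s0 st tT xI; exact: (proj2 (hres s t s0 st tT)).
- apply: (ae_imp2 aeut) => t h tI; have [D [lD nD hP]] := h tI; exists D; split => //; slim_lra.
Qed.

End ExactRegularity.

(** * Projection of the exact solution *)

Section CellProjection.
Context {R : realType} (k : nat) (hk : (1 <= k)%N).
Implicit Types (a c B : R) (f F : R -> R).

Lemma cb_cst a c (v : R) : cb a c (fun=> v).
Proof.
split; first by exists `|v|.
by move=> x _; exact: cts_cst.
Qed.

Lemma grp_osc : exists2 C : R, 0 < C & forall a c f B, a < c -> cb a c f ->
  (forall x, a <= x <= c -> `|f x - f a| <= B) ->
  forall x, a <= x <= c -> `|f x - (grp k a c f).[x]| <= C * B.
Proof.
have [C C0 h] := grp_stable (R := R) k; exists (1 + C); first lra.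
move=> a c f B ac cf fB x xI; have [h1 _] := h a c f B ac cf fB x xI.
have := fB x xI; rewrite mulrDl mul1r; move: h1; rewrite !ler_norml; lra.
Qed.

(** The tangent at the left end has degree at most [k], since [k] is at least 1, and is reproduced.
    What remains is at most [B (c - a)], so stability gives both estimates, the derivative losing
    exactly the factor gained. *)
Lemma grp_deriv : exists2 C : R, 0 < C & forall a c F f B, a < c -> cb a c F ->
  prim a c F f -> (forall x, a <= x <= c -> `|f x - f a| <= B) ->
  forall x, a <= x <= c -> `|F x - (grp k a c F).[x]| <= C * B * (c - a) /\
    `|f x - (deriv (grp k a c F)).[x]| <= C * B.
Proof.
have [C C0 h] := grp_stable (R := R) k; exists (1 + C); first slim_lra.
move=> a c F f B ac cF pF fB x xI.
pose L : {poly R} := (F a)%:P + f a *: ('X - a%:P).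
have sL : (size L <= k.+1)%N.
  apply: leq_trans (size_polyD _ _) _; rewrite geq_max (leq_trans (size_polyC_leq1 _))//=.
  by apply: leq_trans (size_scale_leq _ _) _; rewrite size_XsubC ltnS.
have LE y : L.[y] = F a + f a * (y - a).
  by rewrite /L hornerD hornerC hornerZ hornerXsubC.
pose G y := F y - L.[y].
have cG : cb a c G by apply: cbB => //; exact: cb_poly.
have B0 : 0 <= B by apply: le_trans (fB a _); rewrite // lexx ltW.
have GB y : a <= y <= c -> `|G y| <= B * (y - a).
  move=> yI; rewrite /G LE; have [bf hF] := pF.
  have igf : ig a y f by apply: ig_sub (bm_ig bf); slim_lra.
  have -> : F y - (F a + f a * (y - a)) = itg a y (fun s => f s - f a).
    rewrite itgB ?itg_cst//; [|slim_lra|exact/bm_ig/bm_cst].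
    by rewrite -hF; [ring|slim_lra..].
  apply: itg_bound; [slim_lra|by apply: igB => //; exact/bm_ig/bm_cst|].
  by move=> s sI; apply: fB; slim_lra.
have Ga : G a = 0 by rewrite /G LE; ring.
have GE : grp k a c G = grp k a c F - L.
  by rewrite /G grpB//; [rewrite grp_poly|exact: cb_poly].
have hG y : a <= y <= c -> `|G y - G a| <= B * (c - a).
  move=> yI; rewrite Ga subr0; apply: le_trans (GB y yI) _.
  by apply: ler_wpM2l => //; slim_lra.
have [h1 h2] := h a c G _ ac cG hG x xI.
move: h1 h2; rewrite GE derivB Ga subr0 !hornerD !hornerN.
have -> : (deriv L).[x] = f a.
  by rewrite /L derivD derivC derivZ derivXsubC add0r hornerZ hornerC mulr1.
move=> h1; rewrite mulrA mulfK; last by rewrite gt_eqF//; slim_lra.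
move=> h2; split.
  have := GB x xI; have Bl : B * (x - a) <= B * (c - a) by apply: ler_wpM2l => //; slim_lra.
  by move: h1; rewrite /G mulrDl mul1r mulrDl !ler_norml; slim_lra.
by have := fB x xI; move: h2; rewrite mulrDl mul1r !ler_norml; slim_lra.
Qed.

End CellProjection.

Section TimeProjection.
Context {R : realType} (k : nat) (hk : (1 <= k)%N) (b T C : R) (hb : 0 < b) (hT : 0 < T).
Context (u ur ut : R -> R -> R).
Hypothesis rs : regular_solution k b T C u ur ut.
Context (N : nat) (r : nat -> R).
Hypothesis hm : is_mesh b N r.

Let h := mesh_size N r.

Definition gproj (f : R -> R) (i : nat) : {poly R} := grp k (r i) (r i.+1) f.

Lemma mesh_size_ge i : (i < N)%N -> r i.+1 - r i <= h.
Proof. by move=> iN; rewrite /h /mesh_size (le_bigmax _ _ (Ordinal iN)). Qed.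

Lemma mesh_size_ge0 : 0 <= h.
Proof. by rewrite /h /mesh_size; apply: bigmax_ge_id. Qed.

Lemma hold_cb A f : 0 <= A -> hold b A f -> cb 0 b f.
Proof.
move=> A0 hf; have [_ fM] := hold_bm A0 hf; split => // x xI.
apply: (@cts_within _ _ 0 b) => //.
by apply: (holder_within A0) => y1 y2 h1 h2 h3; rewrite distrC; exact: hf.
Qed.

Lemma cell_cb i f : (i < N)%N -> cb 0 b f -> cb (r i) (r i.+1) f.
Proof. by move=> iN; apply: cb_sub; [exact: (mesh_ge0 hm (ltnW iN))|exact: (mesh_leb hm iN)]. Qed.

Let C0 : 0 <= C := reg_C rs.

Lemma reg_hold_u t : 0 <= t <= T -> hold b (C * Num.sqrt b) (u t).
Proof. by move=> tI; apply: hold_lip => // x y x0 xy yb; exact: (reg_lip rs). Qed.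

Lemma reg_cb_u t : 0 <= t <= T -> cb 0 b (u t).
Proof.
move=> tI; apply: hold_cb (reg_hold_u tI).
by rewrite mulr_ge0 ?sqrtr_ge0.
Qed.

Lemma reg_gd0 t : 0 < t < T -> gd b C 0 (ur t) (ur t) /\ gd b C 0 (ut t) (ut t).
Proof. by move=> tI; rewrite -(subrr t); apply: (reg_gd rs); lra. Qed.

Lemma reg_cb_ut t : 0 < t < T -> cb 0 b (ut t).
Proof. by move=> /reg_gd0[_ [_ hh _ _]]; exact: hold_cb hh. Qed.

Lemma hold_cell A f i x : 0 <= A -> hold b A f -> (i < N)%N -> r i <= x <= r i.+1 ->
  `|f x - f (r i)| <= A * Num.sqrt (r i.+1 - r i).
Proof.
move=> A0 hf iN xI; have := mesh_leb hm iN; have := mesh_ge0 hm (ltnW iN) => h1 h2.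
apply: le_trans (hf (r i) x h1 _ _) _; [lra|lra|].
by apply: ler_wpM2l => //; apply: ler_wsqrtr; lra.
Qed.

Lemma proj_left f i : (i < N)%N -> (gproj f i).[r i] = f (r i).
Proof. by move=> iN; exact: grp_left (mesh_lt hm iN). Qed.

Lemma proj_sub f g i : (i < N)%N -> cb 0 b f -> cb 0 b g ->
  gproj (fun x => f x - g x) i = gproj f i - gproj g i.
Proof. by move=> iN cf cg; apply: grpB; [exact: (mesh_lt hm iN)|exact: cell_cb|exact: cell_cb]. Qed.

Lemma mesh_lt_h i : (i < N)%N -> 0 < r i.+1 - r i <= h.
Proof. by move=> iN; rewrite subr_gt0 (mesh_lt hm iN) mesh_size_ge. Qed.

End TimeProjection.

(** Approximating polynomials exist for almost all times only. At any other time, a nearby good time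
    is used: the projection is linear and stable, and [u] is Lipschitz in time, so the change of
    time costs as little as desired. *)
Lemma proj_error {R : realType} (k : nat) (hk : (1 <= k)%N) (b T C : R) (hb : 0 < b) (hT : 0 < T)
    (u ur ut : R -> R -> R) (rs : regular_solution k b T C u ur ut) :
  exists2 A : R, 0 < A & forall (N : nat) (r : nat -> R), is_mesh b N r ->
  forall t, 0 <= t <= T -> forall i x, (i < N)%N -> r i <= x <= r i.+1 ->
  `|u t x - (gproj k r (u t) i).[x]| <= A * (r i.+1 - r i) ^+ k.+1.
Proof.
have C0 := reg_C rs.
have [A1 A10 hA1] := grp_best (R := R) k; have [A2 A20 hA2] := grp_osc (R := R) k.
(* The 1 makes the constant positive even when [C] is 0. *)
exists (A1 * C + 1); first by rewrite ltr_wpDl// mulr_ge0// ltW.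
move=> N r hm t tI i x iN xI; have hi := mesh_lt_h hm iN.
have ri := mesh_lt hm iN.
have cc s : 0 <= s <= T -> cb (r i) (r i.+1) (u s).
  by move=> sI; apply: (cell_cb hm iN); exact: (reg_cb_u rs).
apply: (@le_trans _ _ (A1 * C * (r i.+1 - r i) ^+ k.+1)); last first.
  by apply: ler_wpM2r; [rewrite exprn_ge0//; slim_lra|slim_lra].
apply/ler_addgt0Pr => e e0.
pose d := e / (A2 * (2 * C) + 1).
have q0 : 0 < A2 * (2 * C) + 1 by rewrite ltr_wpDl// !mulr_ge0// ltW.
have d0 : 0 < d by rewrite divr_gt0.
have lr : Num.max 0 (t - d) < Num.min T (t + d) by rewrite gt_max !lt_min; slim_lra.
have [s + hs] := ae_dense (reg_poly rs) lr.
rewrite gt_max lt_min => sI.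
have [P sP hP] := hs ltac:(slim_lra) (r i) (r i.+1) (mesh_ge0 hm (ltnW iN)) (ltW ri) (mesh_leb hm iN).
have h1 := hA1 _ _ _ _ _ ri (cc s ltac:(slim_lra)) sP hP x xI.
have ust y : 0 <= y <= b -> `|u t y - u s y| <= C * d.
  move=> yI; have [st|ts] := leP s t.
    by apply: le_trans (reg_time rs (s := s) (t := t) _ st _ yI) _; [slim_lra|slim_lra|apply: ler_wpM2l; slim_lra].
  rewrite distrC; apply: le_trans (reg_time rs (s := t) (t := s) _ (ltW ts) _ yI) _; [slim_lra|slim_lra|].
  by apply: ler_wpM2l; slim_lra.
have ri0 := mesh_in hm iN.
have h2 : `|(u t x - u s x) - (grp k (r i) (r i.+1) (fun y => u t y - u s y)).[x]| <= A2 * (2 * C * d).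
  apply: (hA2 (r i) (r i.+1) (fun y => u t y - u s y)) => //.
    by apply: cbB; apply: cc; slim_lra.
  move=> y yI; have := ust y (ri0 _ yI); have := ust (r i) (ri0 (r i) ltac:(slim_lra)).
  by rewrite !ler_norml; slim_lra.
have sI' : 0 <= s <= T by slim_lra.
rewrite grpB// in h2; [|exact: cc|exact: cc].
have h3 : A2 * (2 * C * d) <= e.
  have dE : d * (A2 * (2 * C) + 1) = e by rewrite /d mulfVK// gt_eqF.
  by move: dE d0; clear; nra.
move: h1 h2; rewrite -mulrA hornerD hornerN /gproj !ler_norml; slim_lra.
Qed.

(** The highest derivative of [u_t] is only square integrable, so the cell errors are summed in L2.
    One factor [sqrt (c - a)] comes from the pointwise approximation and one from integration over
    the cell; together they restore the power [k + 1]. *)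
Lemma proj_error_t {R : realType} (k : nat) (hk : (1 <= k)%N) (b T C : R) (hb : 0 < b) (hT : 0 < T)
    (u ur ut : R -> R -> R) (rs : regular_solution k b T C u ur ut) :
  exists2 A : R, 0 < A & forall (N : nat) (r : nat -> R), is_mesh b N r ->
  forall t, 0 < t < T ->
  nn 0 b (fun x => ut t x - glob N r (gproj k r (ut t)) x) <= A * mesh_size N r ^+ k.+1.
Proof.
have C0 := reg_C rs.
have [A1 A10 hA1] := grp_best (R := R) k; have [A2 A20 hA2] := grp_osc (R := R) k.
exists (A1 * C + 1); first by rewrite ltr_wpDl// mulr_ge0// ltW.
move=> N r hm t tI; have H0 := mesh_size_ge0 N r; set h := mesh_size N r in H0 *.
apply: (@le_trans _ _ (A1 * C * h ^+ k.+1)); last first.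
  by apply: ler_wpM2r; [rewrite exprn_ge0|slim_lra].
apply/ler_addgt0Pr => e e0.
pose sb := Num.sqrt b; have sb0 : 0 <= sb by exact: sqrtr_ge0.
pose d := e / (A2 * (2 * C) * sb + 1).
have q0 : 0 < A2 * (2 * C) * sb + 1 by rewrite ltr_wpDl// !mulr_ge0// ltW.
have d0 : 0 < d by rewrite divr_gt0.
have lr : Num.max 0 (t - d) < Num.min T (t + d) by rewrite gt_max !lt_min; slim_lra.
have [s + hs] := ae_dense (reg_poly_t rs) lr.
rewrite gt_max lt_min => sI.
have sI' : 0 < s < T by slim_lra.
have [D [lD nD hD]] := hs sI'.
have ct q : 0 < q < T -> cb 0 b (ut q) by exact: (reg_cb_ut rs).
have bE q : 0 < q < T -> bm 0 b (fun x => ut q x - glob N r (gproj k r (ut q)) x).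
  by move=> qI; apply: bmB; [exact/cb_bm/ct|exact: bm_glob].
have gE q i x : (i < N)%N -> r i < x < r i.+1 ->
    glob N r (gproj k r (ut q)) x = (gproj k r (ut q) i).[x].
  by move=> iN xI; apply: (globE hm) => //; slim_lra.
have n1 : nn 0 b (fun x => ut s x - glob N r (gproj k r (ut s)) x) <= A1 * C * h ^+ k.+1.
  have Ch : 0 <= A1 * C * h ^+ k.+1 by rewrite !mulr_ge0 ?exprn_ge0// ltW.
  rewrite -ler_sqr ?nnegrE ?nn_ge0// (nn_cells hm (bE s sI')).
  apply: (@le_trans _ _ (\sum_(i < N) (A1 * h ^+ k.+1) ^+ 2 * nn (r i) (r i.+1) D ^+ 2)).
    apply: ler_sum => -[i iN] _ /=; have hi := mesh_lt_h hm iN; have ri := mesh_lt hm iN.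
    have [P sP hP] := hD (r i) (r i.+1) (mesh_ge0 hm (ltnW iN)) (ltW ri) (mesh_leb hm iN).
    have h1 := hA1 _ _ _ _ _ ri (cell_cb hm iN (ct s sI')) sP hP.
    rewrite -exprMn ler_sqr ?nnegrE ?nn_ge0//; last by rewrite !mulr_ge0 ?exprn_ge0 ?nn_ge0// ltW.
    rewrite -/h in hi; set di := r i.+1 - r i in hi h1 *.
    have di0 : 0 <= di by slim_lra.
    set nD' := nn (r i) (r i.+1) D in h1 *; have nD0 : 0 <= nD' by exact: nn_ge0.
    have B0 : 0 <= A1 * (di ^+ k * (Num.sqrt di * nD')).
      by rewrite !mulr_ge0 ?exprn_ge0 ?sqrtr_ge0// ltW.
    apply: le_trans (nn_sup (ltW ri) _ B0 _) _.
    - by apply: (bm_cell hm iN); exact: bE.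
    - by move=> x xI; rewrite (gE s i x iN xI) /gproj; apply: h1; slim_lra.
    have sq : Num.sqrt di * Num.sqrt di = di by rewrite -expr2 sqr_sqrtr.
    rewrite (_ : _ * _ * _ = A1 * di ^+ k.+1 * nD'); last first.
      rewrite -/di (_ : _ * _ = A1 * (di ^+ k * (Num.sqrt di * Num.sqrt di)) * nD'); last by ring.
      by rewrite sq -exprSr.
    apply: ler_wpM2r => //; apply: ler_wpM2l; first exact: ltW.
    by apply: lerXn2r; rewrite ?nnegrE//; slim_lra.
  rewrite -mulr_sumr.
  have -> : \sum_(i < N) nn (r i) (r i.+1) D ^+ 2 = nn 0 b D ^+ 2.
    rewrite nn_sqr (itg_cells hm); last by case: lD.
    by apply: eq_bigr => i _; rewrite nn_sqr.
  rewrite -exprMn ler_sqr ?nnegrE ?mulr_ge0 ?exprn_ge0 ?nn_ge0 ?(ltW A10)//.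
  by rewrite mulrAC; apply: ler_wpM2r; [rewrite exprn_ge0|apply: ler_wpM2l => //; exact: ltW].
have ust y : 0 <= y <= b -> `|ut t y - ut s y| <= C * d.
  move=> yI; have [st|ts] := leP s t.
    have [_ [g _ _ _]] := reg_gd rs (proj1 (andP sI')) st ltac:(slim_lra).
    by have [_ _ g1] := g y yI; apply: le_trans g1 _; apply: ler_wpM2l; slim_lra.
  have [_ [g _ _ _]] := reg_gd rs (proj1 (andP tI)) (ltW ts) ltac:(slim_lra).
  by rewrite distrC; have [_ _ g1] := g y yI; apply: le_trans g1 _; apply: ler_wpM2l; slim_lra.
have Ad0 : 0 <= A2 * (2 * C * d) by apply: mulr_ge0; [exact: ltW|apply: mulr_ge0; [exact: mulr_ge0|exact: ltW]].
have n2 : nn 0 b (fun x => (ut t x - glob N r (gproj k r (ut t)) x) -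
    (ut s x - glob N r (gproj k r (ut s)) x)) <= A2 * (2 * C * d) * sb.
  rewrite /sb -{2}(subr0 b).
  apply: nn_sup => //; [exact: ltW|by apply: bmB; apply: bE|].
  move=> x xI; have xI' : 0 <= x < b by slim_lra.
  have [i iN xi] := cell_exists hm xI'.
  have ri := mesh_lt hm iN; have ri0 := mesh_in hm iN.
  rewrite !(globE hm _ iN xi) /gproj.
  have -> : ut t x - (grp k (r i) (r i.+1) (ut t)).[x] - (ut s x - (grp k (r i) (r i.+1) (ut s)).[x]) =
    ut t x - ut s x - ((grp k (r i) (r i.+1) (ut t)).[x] - (grp k (r i) (r i.+1) (ut s)).[x]) by ring.
  have := hA2 (r i) (r i.+1) (fun y => ut t y - ut s y) (2 * C * d) ri
    (cbB (cell_cb hm iN (ct t tI)) (cell_cb hm iN (ct s sI'))) _ x _.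
  rewrite (grpB k ri (cell_cb hm iN (ct t tI)) (cell_cb hm iN (ct s sI'))).
  rewrite hornerD hornerN; apply; last slim_lra.
  move=> y yI; have := ust y (ri0 _ yI); have := ust (r i) (ri0 (r i) ltac:(slim_lra)).
  by rewrite !ler_norml; slim_lra.
have h3 : A2 * (2 * C * d) * sb <= e.
  have dE : d * (A2 * (2 * C) * sb + 1) = e by rewrite /d mulfVK// gt_eqF.
  by move: dE d0; clear; nra.
have := nnD (bmB (bE t tI) (bE s sI')) (bE s sI').
rewrite (@eq_nn _ 0 b _ (fun x => ut t x - glob N r (gproj k r (ut t)) x)); last first.
  by move=> x _; rewrite subrK.
slim_lra.
Qed.

(** * Energy norm of the projection error *)

Section ProjectionVariation.
Context {R : realType} (k : nat) (hk : (1 <= k)%N) (b : R) (hb : 0 < b).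

Lemma sqrt_mesh_le (N : nat) (r : nat -> R) i : is_mesh b N r -> (i < N)%N ->
  Num.sqrt (r i.+1 - r i) <= Num.sqrt (mesh_size N r).
Proof. by move=> hm iN; apply: ler_wsqrtr; exact: mesh_size_ge. Qed.

Lemma nn_le_cells (N : nat) (r : nat -> R) f A : is_mesh b N r -> bm 0 b f -> 0 <= A ->
  (forall i x, (i < N)%N -> r i <= x < r i.+1 -> `|f x| <= A) -> nn 0 b f <= A * Num.sqrt b.
Proof.
move=> hm bf A0 hA; rewrite -{2}(subr0 b); apply: nn_sup => //; first exact: ltW.
move=> x xI; have xI' : 0 <= x < b by lra.
have [i iN xi] := cell_exists hm xI'; exact: hA xi.
Qed.

Lemma nn_proj_osc : exists2 A : R, 0 < A & forall (N : nat) (r : nat -> R) f B,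
  is_mesh b N r -> 0 <= B -> hold b B f ->
  nn 0 b (fun x => f x - glob N r (gproj k r f) x) <= A * B * Num.sqrt (mesh_size N r).
Proof.
have [A A0 hA] := grp_osc (R := R) k; exists (A * Num.sqrt b); first by rewrite mulr_gt0 ?sqrtr_gt0.
move=> N r f B hm B0 hf; have H0 := mesh_size_ge0 N r.
have bf : cb 0 b f by exact: hold_cb hf.
rewrite (_ : _ * _ * _ = A * B * Num.sqrt (mesh_size N r) * Num.sqrt b); last by ring.
apply: (nn_le_cells hm); first by apply: bmB; [exact: cb_bm|exact: bm_glob].
  by rewrite !mulr_ge0 ?sqrtr_ge0// ltW.
move=> i x iN xi; rewrite (globE hm _ iN xi) -mulrA.
apply: (hA (r i) (r i.+1)); [exact: (mesh_lt hm iN)|exact: (cell_cb hm iN)| |lra].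
move=> y yI; apply: le_trans (hold_cell hm B0 hf iN yI) _.
by apply: ler_wpM2l => //; exact: sqrt_mesh_le.
Qed.

Definition err (f : R -> R) (p : nat -> {poly R}) (i : nat) (x : R) : R := f x - (p i).[x].
Definition derr (v : R -> R) (p : nat -> {poly R}) (i : nat) (x : R) : R := v x - (deriv (p i)).[x].

(** The projection is exact at left ends, so a jump of its error is a single value at the right end
    of a cell. Divided by the length of the cell it is of the same order as the error of the
    derivative, the Hoelder modulus of [f] over a cell. *)
Lemma vr_proj : exists2 A : R, 0 < A & forall (N : nat) (r : nat -> R) F f B,
  is_mesh b N r -> 0 <= B -> cb 0 b F -> prim 0 b F f -> hold b B f ->
  vr b N r (err F (gproj k r F)) (derr f (gproj k r F)) <= A * B * Num.sqrt (mesh_size N r) /\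
  nn 0 b (fun x => F x - glob N r (gproj k r F) x) <= A * B * Num.sqrt (mesh_size N r).
Proof.
have [A A0 hA] := grp_deriv (R := R) hk.
have sb : 0 < Num.sqrt b by rewrite sqrtr_gt0.
exists (A * (2 + b) * Num.sqrt b); first by rewrite !mulr_gt0//; have := hb; slim_lra.
move=> N r F f B hm B0 cF pF hf; have H0 := mesh_size_ge0 N r.
set h := mesh_size N r in H0 *; set sh := Num.sqrt h; have sh0 : 0 <= sh by exact: sqrtr_ge0.
have bf := hold_bm B0 hf.
have ABs : 0 <= A * B * sh by rewrite !mulr_ge0// ltW.
have key i x : (i < N)%N -> r i <= x <= r i.+1 ->
    `|F x - (gproj k r F i).[x]| <= A * B * sh * (r i.+1 - r i) /\
    `|f x - (deriv (gproj k r F i)).[x]| <= A * B * sh.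
  move=> iN xI; have ri := mesh_lt hm iN.
  have h1 y : r i <= y <= r i.+1 -> `|f y - f (r i)| <= B * sh.
    move=> yI; apply: le_trans (hold_cell hm B0 hf iN yI) _.
    by apply: ler_wpM2l => //; exact: sqrt_mesh_le.
  have pc : prim (r i) (r i.+1) F f.
    by apply: prim_sub pF; [exact: (mesh_ge0 hm (ltnW iN))|exact: (mesh_leb hm iN)].
  have := hA (r i) (r i.+1) F f (B * sh) ri (cell_cb hm iN cF) pc h1 x xI.
  by rewrite mulrA.
have bd i : bm 0 b (derr f (gproj k r F) i) by apply: bmB => //; exact: bm_poly.
have E2 : A * (2 + b) * Num.sqrt b * B * sh = (A * B * sh * (2 + b)) * Num.sqrt b by ring.
rewrite E2; split.
  apply: (nn_le_cells hm); first by apply: bm_pw => i; exact: bm_vard.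
    by rewrite mulr_ge0//; have := hb; slim_lra.
  move=> i x iN xi; have ri := mesh_lt hm iN.
  have xc : r i <= x <= r i.+1 by slim_lra.
  rewrite (pwE hm _ iN xi) /vard ger0_norm ?addr_ge0//.
  have [_ h1] := key i x iN xc.
  have j1 : `|jmp N r (err F (gproj k r F)) i / (r i.+1 - r i)| <= A * B * sh.
    have d0 : 0 < r i.+1 - r i by slim_lra.
    rewrite normrM normfV (gtr0_norm d0) ler_pdivrMr//.
    have [h2 _] := key i (r i.+1) iN ltac:(slim_lra).
    rewrite /jmp (_ : (if _ then _ else _) = 0); last first.
      by case: ifP => // i1; rewrite /err (proj_left k hm F i1) subrr.
    by rewrite sub0r normrN.
  have : 0 <= A * B * sh * b by rewrite mulr_ge0// ltW.
  by move: h1 j1; rewrite /derr; slim_lra.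
apply: (nn_le_cells hm).
- by apply: bmB; [exact: cb_bm|exact: bm_glob].
- by rewrite mulr_ge0//; have := hb; slim_lra.
move=> i x iN xi; rewrite (globE hm _ iN xi).
have [h1 _] := key i x iN ltac:(slim_lra).
apply: le_trans h1 _; apply: ler_wpM2l => //.
by have := mesh_leb hm iN; have := mesh_ge0 hm (ltnW iN); slim_lra.
Qed.

End ProjectionVariation.

Section CoefficientDerivative.
Context {R : realType}.

Lemma drv_quad (f : R -> R) (t a K d : R) : 0 < d ->
  (forall s, `|s - t| < d -> `|f s - f t - (s - t) * a| <= K * (s - t) ^+ 2) ->
  is_derive t 1 f a.
Proof.
move=> d0 hf; have K1 : 0 < `|K| + 1 by rewrite ltr_wpDl.
have H : (fun h0 : R => h0^-1 *: ((f \o shift t) (h0 *: 1) - f t)) @ 0^' --> a.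
  apply/cvgrPdist_le => e e0; have e1 : 0 < Num.min d (e / (`|K| + 1)).
    by rewrite lt_min d0 divr_gt0.
  exists (Num.min d (e / (`|K| + 1))) => // h; rewrite /= sub0r normrN lt_min => /andP[hd he] h0.
  rewrite /GRing.scale/= mulr1.
  have hn : 0 < `|h| by rewrite normr_gt0.
  have := hf (h + t); rewrite addrK => /(_ hd) q.
  rewrite -(ler_pM2r hn) -normrM mulrBl [X in _ - X]mulrAC mulVf// mul1r distrC mulrC.
  apply: le_trans q _; rewrite mulrC.
  have q1 : K * h ^+ 2 <= `|K| * `|h| * `|h|.
    rewrite -mulrA -expr2 real_normK ?num_real//.
    by apply: ler_wpM2r; [exact: sqr_ge0|exact: ler_norm].
  have q2 : `|K| * `|h| <= e.
    by move: he; rewrite ltr_pdivlMr//; have := normr_ge0 K; nra.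
  by rewrite mulrC; apply: le_trans q1 _; apply: ler_wpM2r.
by apply: DeriveDef; [apply/cvg_ex; exists a|exact: cvg_lim].
Qed.

End CoefficientDerivative.

(** * Coefficients of the projection as functions of time *)

Section ProjectionCoefficients.
Context {R : realType} (k : nat).
Implicit Types (a c B : R) (f g : R -> R).

Lemma grpZ a c (v : R) f : a < c -> cb a c f ->
  grp k a c (fun x => v * f x) = v *: grp k a c f.
Proof.
move=> ac cf; rewrite /grp scalerDr scaler_sumr -mul_polyC -polyCM; congr (_ + _).
apply: eq_bigr => j _; rewrite scalerA; congr (_ *: _).
rewrite /grc -itgZ.
  by apply: eq_itg => y _; rewrite -mulrBr mulrA.
apply/bm_ig/bmM; last exact/bmX/bm_id.
by apply: bmB (bm_cst _ _ _); exact: bm_aff (cb_bm cf) cf.2.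
Qed.

(** Here the constant depends on the cell. It only serves continuity and differentiability in time
    on a fixed mesh, never an error bound. *)
Lemma grp_coef_bound a c : a < c -> exists2 L : R, 0 < L & forall f B j, 0 <= B -> cb a c f ->
  (forall x, a <= x <= c -> `|f x| <= B) -> `|(grp k a c f)`_j| <= L * B.
Proof.
move=> ac; pose S (j : 'I_k) := \sum_(l < k.+1) `|(gre a c j : {poly R})`_l|.
have S0 j : 0 <= S j by apply: sumr_ge0.
have SS0 : 0 <= \sum_(j < k) 2 * S j by apply: sumr_ge0 => j _; rewrite mulr_ge0.
exists (1 + \sum_(j < k) 2 * S j); first lra.
move=> f B l B0 cf fB; rewrite /grp coefD coef_sum mulrDl mul1r.
have fa : `|f a| <= B by apply: fB; lra.
apply: le_trans (ler_normD _ _) _; apply: lerD.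
  by rewrite coefC; case: ifP => // _; rewrite normr0.
apply: le_trans (ler_norm_sum _ _ _) _; rewrite mulr_suml; apply: ler_sum => j _.
rewrite coefZ normrM mulrAC; apply: ler_pM => //.
  apply: grc_bound => // x xI; apply: le_trans (ler_normB _ _) _.
  by have := fB x xI; lra.
have [lk|kl] := ltnP l k.+1; last by rewrite nth_default ?normr0// (leq_trans (size_gre a c j)).
by rewrite /S (bigD1 (Ordinal lk))//= lerDl sumr_ge0.
Qed.

Context (b T C : R) (hb : 0 < b) (hT : 0 < T) (u ur ut : R -> R -> R).
Hypothesis rs : regular_solution k b T C u ur ut.
Context (N : nat) (r : nat -> R).
Hypothesis hm : is_mesh b N r.

Let C0 : 0 <= C := reg_C rs.

Lemma proj_coef_lip i : (i < N)%N -> exists2 L : R, 0 <= L & forall j,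
  (forall s t, 0 <= s -> s <= t -> t <= T ->
    `|(gproj k r (u t) i)`_j - (gproj k r (u s) i)`_j| <= L * (t - s)) /\
  (forall s t, 0 < s -> s <= t -> t < T ->
    `|(gproj k r (ut t) i)`_j - (gproj k r (ut s) i)`_j| <= L * (t - s)).
Proof.
move=> iN; have [L L0 hL] := grp_coef_bound (mesh_lt hm iN).
exists (L * C) => [|j]; first by rewrite mulr_ge0// ltW.
have xb x : r i <= x <= r i.+1 -> 0 <= x <= b by exact: (mesh_in hm iN).
split=> s t s0 st tT; rewrite -mulrA -coefB.
  have cu q : 0 <= q <= T -> cb (r i) (r i.+1) (u q).
    by move=> qI; apply: (cell_cb hm iN); exact: (reg_cb_u rs).
  rewrite -grpB; [|exact: (mesh_lt hm iN)|apply: cu; lra|apply: cu; lra].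
  apply: hL; [by rewrite mulr_ge0//; lra|by apply: cbB; apply: cu; lra|].
  by move=> x xI; apply: (reg_time rs) => //; exact: xb.
have cu q : 0 < q < T -> cb (r i) (r i.+1) (ut q).
  by move=> qI; apply: (cell_cb hm iN); exact: (reg_cb_ut rs).
rewrite -grpB; [|exact: (mesh_lt hm iN)|apply: cu; lra|apply: cu; lra].
apply: hL; [by rewrite mulr_ge0//; lra|by apply: cbB; apply: cu; lra|].
move=> x xI; have [_ [g _ _ _]] := reg_gd rs s0 st tT.
by have [] := g x (xb x xI).
Qed.

(** The coefficients are bounded linear functionals, so the quadratic Taylor remainder of [u] in
    time passes to them: the projection commutes with the time derivative. *)
Lemma proj_coef_derive i j t : (i < N)%N -> 0 < t < T ->
  is_derive t 1 (fun s => (gproj k r (u s) i)`_j) (gproj k r (ut t) i)`_j.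
Proof.
move=> iN tI; have ri := mesh_lt hm iN; have [L L0 hL] := grp_coef_bound ri.
apply: (@drv_quad _ _ _ _ (L * C) (Num.min t (T - t))); first by rewrite lt_min; lra.
move=> s; rewrite lt_min !ltr_norml => sI.
have cu q : 0 < q < T -> cb (r i) (r i.+1) (u q).
  by move=> qI; apply: (cell_cb hm iN); apply: (reg_cb_u rs); lra.
have cut : cb (r i) (r i.+1) (ut t) by apply: (cell_cb hm iN); exact: (reg_cb_ut rs).
have csut : cb (r i) (r i.+1) (fun x => (s - t) * ut t x) by apply: cbM => //; exact: cb_cst.
have sI' : 0 < s < T by lra.
have E : (gproj k r (u s) i)`_j - (gproj k r (u t) i)`_j - (s - t) * (gproj k r (ut t) i)`_j =
    (grp k (r i) (r i.+1) (fun x => u s x - u t x - (s - t) * ut t x))`_j.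
  rewrite grpB//; last by apply: cbB; exact: cu.
  rewrite grpB//; [|exact: cu|exact: cu].
  by rewrite grpZ// !coefB coefZ.
rewrite E -mulrA; apply: hL.
- by rewrite mulr_ge0// sqr_ge0.
- by apply: cbB => //; apply: cbB; exact: cu.
by move=> x xI; apply: (reg_taylor rs) => //; exact: (mesh_in hm iN xI).
Qed.

End ProjectionCoefficients.

(** * Energy estimates *)

Section Gronwall.
Context {R : realType}.
Implicit Types (t K e kap : R) (y dy : R -> R).

(** The square root is not differentiable at 0, so [sqrt (y + kap^2)] is used instead; [kap] is sent
    to 0 afterwards. *)
Lemma gronwall_pos y dy K e kap t1 : 0 <= t1 -> 0 <= K -> 0 <= e -> 0 < kap ->
  {within `[0, t1], continuous y} -> (forall t, 0 <= t <= t1 -> 0 <= y t) ->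
  (forall t, 0 < t < t1 -> is_derive t 1 y (dy t)) ->
  (forall t, 0 < t < t1 -> dy t <= 2 * K * y t + 2 * e * Num.sqrt (y t)) ->
  Num.sqrt (y t1) <= (Num.sqrt (y 0) + kap + e * t1) * expR (K * t1).
Proof.
move=> t10 K0 e0 k0 cy y0 hd hy.
pose v t := Num.sqrt (y t + kap ^+ 2).
have yp t : 0 <= t <= t1 -> 0 < y t + kap ^+ 2.
  by move=> tI; rewrite ltr_wpDl ?y0// exprn_gt0.
have vp t : 0 <= t <= t1 -> 0 < v t by move=> tI; rewrite sqrtr_gt0 yp.
have yv t : 0 <= t <= t1 -> Num.sqrt (y t) <= v t.
  by move=> tI; apply: ler_wsqrtr; rewrite lerDl sqr_ge0.
have vv t : 0 <= t <= t1 -> v t ^+ 2 = y t + kap ^+ 2.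
  by move=> tI; rewrite sqr_sqrtr// ltW// yp.
(* The hypothesis gives [v' <= K v + e], so this quantity is nonincreasing. *)
pose phi t := v t * expR (- (K * t)) - e * t.
have ev t : is_derive t 1 (fun s => expR (- (K * s))) (- K * expR (- (K * t))).
  by apply: drv_eq (drv_exp (drvN (drvZ K (drv_id t)))) _; ring.
have dphi t : 0 < t < t1 -> is_derive t 1 phi
    (dy t * (2 * v t)^-1 * expR (- (K * t)) + v t * (- K * expR (- (K * t))) - e).
  move=> tI; have tI' : 0 <= t <= t1 by lra.
  have d1 : is_derive t 1 (fun s => y s + kap ^+ 2) (dy t).
    by have := drvD (hd t tI) (drv_cst t (kap ^+ 2)); rewrite addr0.
  have d2 : is_derive t 1 v ((2 * v t)^-1 * dy t).
    by apply: (drv_comp (f := Num.sqrt) d1); apply: is_derive1_sqrt; exact: yp.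
  apply: drv_eq (drvB (drvM d2 (ev t)) (drvZ e (drv_id t))) _.
  by rewrite mulr1 [_^-1 * dy t]mulrC; ring.
have cphi : {within `[0, t1], continuous phi}.
  apply: withinB.
    move=> t; apply: cvgM.
      apply: (continuous_comp (f := (fun s => y s + kap ^+ 2) : subspace `[0, t1] -> R)).
        by apply: cvgD; [exact: cy|exact: cvg_cst].
      exact: sqrt_continuous.
    apply: (continuous_subspaceT (f := fun s => expR (- (K * s)))) => s.
    exact: drv_cts (ev s).
  by apply/lip_cont/lipM; [exact: lip_cst|exact: lip_id].
have dec : phi t1 <= phi 0.
  move: t10; rewrite le_eqVlt => /orP[/eqP<-//|t10].
  have := @MVT _ phi (fun t => dy t * (2 * v t)^-1 * expR (- (K * t)) +
    v t * (- K * expR (- (K * t))) - e) 0 t1 t10.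
  move=> /(_ (fun t tI => dphi t ltac:(by move: tI; rewrite in_itv)) cphi)[t].
  rewrite in_itv/= => tI E; rewrite -subr_le0 E subr0 pmulr_lle0//.
  have tI' : 0 <= t <= t1 by lra.
  have h1 := hy t tI; have h2 := vp t tI'; have h3 := yv t tI'; have h4 := vv t tI'.
  have E1 : 0 < expR (- (K * t)) <= 1.
    rewrite expR_gt0 -expR0 ler_expR oppr_le0 mulr_ge0//; lra.
  have s0 := sqrtr_ge0 (y t); have yt0 := y0 t tI'.
  have q : dy t * (2 * v t)^-1 <= K * v t + e.
    rewrite ler_pdivrMr ?mulr_gt0//.
    have e3 : e * Num.sqrt (y t) <= e * v t by apply: ler_wpM2l.
    have K3 : K * y t <= K * v t ^+ 2.
      by apply: ler_wpM2l => //; rewrite h4 lerDl sqr_ge0.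
    by move: h1 e3 K3; rewrite expr2; lra.
  have := ler_wpM2r (ltW (proj1 (andP E1))) q.
  have : e * expR (- (K * t)) <= e * 1 by apply: ler_wpM2l => //; case/andP: E1.
  lra.
have v0 : v 0 <= Num.sqrt (y 0) + kap.
  have z : 0 <= (0 : R) <= t1 by lra.
  rewrite -ler_sqr ?nnegrE ?addr_ge0 ?sqrtr_ge0 ?(ltW k0) ?(ltW (vp 0 z))//.
  rewrite vv// sqrrD sqr_sqrtr ?y0//.
  have : 0 <= Num.sqrt (y 0) * kap by rewrite mulr_ge0 ?sqrtr_ge0// ltW.
  lra.
have t1I : 0 <= t1 <= t1 by rewrite lexx t10.
apply: le_trans (yv _ t1I) _.
have : v t1 * expR (- (K * t1)) <= Num.sqrt (y 0) + kap + e * t1.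
  move: dec; rewrite /phi !mulr0 oppr0 expR0 mulr1; lra.
by move=> /(ler_wpM2r (ltW (expR_gt0 (K * t1)))); rewrite -mulrA -expRD addNr expR0 mulr1.
Qed.

Lemma gronwall y dy K e t1 : 0 <= t1 -> 0 <= K -> 0 <= e ->
  {within `[0, t1], continuous y} -> (forall t, 0 <= t <= t1 -> 0 <= y t) ->
  (forall t, 0 < t < t1 -> is_derive t 1 y (dy t)) ->
  (forall t, 0 < t < t1 -> dy t <= 2 * K * y t + 2 * e * Num.sqrt (y t)) ->
  Num.sqrt (y t1) <= (Num.sqrt (y 0) + e * t1) * expR (K * t1).
Proof.
move=> t10 K0 e0 cy y0 hd hy; apply/ler_addgt0Pr => d d0.
have E0 := expR_gt0 (K * t1).
have := gronwall_pos t10 K0 e0 (divr_gt0 d0 E0) cy y0 hd hy.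
by rewrite addrAC mulrDl mulfVK ?gt_eqF.
Qed.

End Gronwall.

Definition ip {R : realType} (N : nat) (r : nat -> R) (p q : nat -> {poly R}) : R :=
  \sum_(i < N) itg (r i) (r i.+1) (fun x => (p i).[x] * (q i).[x]).

Section InnerProduct.
Context {R : realType} (b : R) (hb : 0 < b) (N : nat) (r : nat -> R).
Hypothesis hm : is_mesh b N r.
Implicit Types (p q : nat -> {poly R}) (n : nat).

Let ig_pq p q i a c : ig a c (fun x => (p i).[x] * (q i).[x]).
Proof. by apply/bm_ig/bmM; exact: bm_poly. Qed.

Lemma ipE p q : ip N r p q = itg 0 b (fun x => glob N r p x * glob N r q x).
Proof.
rewrite (itg_cells hm); last by apply/bm_ig/bmM; exact: bm_glob.
apply: eq_bigr => i _; apply: eq_itg_oo => //.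
  by apply/bm_ig/(bm_cell hm (ltn_ord i))/bmM; exact: bm_glob.
by move=> x xI; rewrite !(globE hm _ (ltn_ord i))//; lra.
Qed.

Lemma ip_nn p : ip N r p p = nn 0 b (glob N r p) ^+ 2.
Proof. by rewrite ipE nn_sqr; apply: eq_itg => x _; rewrite expr2. Qed.

Lemma ip_le p q : `|ip N r p q| <= nn 0 b (glob N r p) * nn 0 b (glob N r q).
Proof. by rewrite ipE; apply: nn_CS; exact: bm_glob. Qed.

(** In terms of coefficients the inner product is a finite sum of products, so it can be
    differentiated in time without differentiating under an integral. *)
Lemma ip_coef n p q : (forall i, (i < N)%N -> (size (p i) <= n)%N /\ (size (q i) <= n)%N) ->
  ip N r p q = \sum_(i < N) \sum_(j < n) \sum_(l < n)
    (p i)`_j * (q i)`_l * itg (r i) (r i.+1) (fun x => x ^+ (j + l)).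
Proof.
move=> sz; apply: eq_bigr => i _; have [sp sq] := sz i (ltn_ord i).
have igX (j l : nat) a c : ig a c (fun x : R => x ^+ (j + l)) by exact/bm_ig/bmX/bm_id.
transitivity (itg (r i) (r i.+1) (fun x => \sum_(j < n) \sum_(l < n)
    (p i)`_j * (q i)`_l * x ^+ (j + l))).
  apply: eq_itg => x _; rewrite (horner_coef_wide _ sp) (horner_coef_wide _ sq) mulr_suml.
  apply: eq_bigr => j _; rewrite mulr_sumr; apply: eq_bigr => l _.
  by rewrite exprD; ring.
rewrite itg_sum; last by move=> j; apply: ig_sum => l; exact: igZ.
apply: eq_bigr => j _; rewrite itg_sum; last by move=> l; exact: igZ.
by apply: eq_bigr => l _; rewrite itgZ.
Qed.

Lemma ip_derive n (p : R -> nat -> {poly R}) (dp : nat -> {poly R}) t :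
  (\forall s \near t, forall i, (i < N)%N -> (size (p s i) <= n)%N) ->
  (forall i, (i < N)%N -> (size (p t i) <= n)%N /\ (size (dp i) <= n)%N) ->
  (forall i j, (i < N)%N -> is_derive t 1 (fun s => (p s i)`_j) (dp i)`_j) ->
  is_derive t 1 (fun s => ip N r (p s) (p s)) (2 * ip N r dp (p t)).
Proof.
move=> szn sz hd.
pose F s := \sum_(i < N) \sum_(j < n) \sum_(l < n)
    (p s i)`_j * (p s i)`_l * itg (r i) (r i.+1) (fun x => x ^+ (j + l)).
apply: (drv_near (f := F)).
  by apply: filterS szn => s h; rewrite /F -ip_coef// => i iN; split; exact: h.
have szt i : (i < N)%N -> (size (dp i) <= n)%N /\ (size (p t i) <= n)%N.
  by move=> iN; have [] := sz i iN.
rewrite (ip_coef szt).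
have -> : 2 * (\sum_(i < N) \sum_(j < n) \sum_(l < n)
    (dp i)`_j * (p t i)`_l * itg (r i) (r i.+1) (fun x => x ^+ (j + l))) =
  \sum_(i < N) \sum_(j < n) \sum_(l < n)
    ((dp i)`_j * (p t i)`_l + (p t i)`_j * (dp i)`_l) * itg (r i) (r i.+1) (fun x => x ^+ (j + l)).
  rewrite mulrDl mul1r -big_split/=; apply: eq_bigr => i _.
  rewrite {2}exchange_big/= -big_split/=; apply: eq_bigr => j _.
  rewrite -big_split/=; apply: eq_bigr => l _.
  by rewrite [(l + j)%N]addnC; ring.
apply: drv_sum => i; apply: drv_sum => j; apply: drv_sum => l.
have d1 := drvM (hd i j (ltn_ord i)) (hd i l (ltn_ord i)).
by apply: drv_eq (drvM d1 (drv_cst t _)) _; ring.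
Qed.

Lemma within_sum (I : Type) (s : seq I) (t0 t1 : R) (F : I -> R -> R) :
  (forall i, {within `[t0, t1], continuous (F i)}) ->
  {within `[t0, t1], continuous (fun t => \sum_(i <- s) F i t)}.
Proof.
move=> cF; elim: s => [|i s ih].
  rewrite (_ : (fun t => _) = fun=> 0); last by apply/funext => t; rewrite big_nil.
  exact/lip_cont/lip_cst.
rewrite (_ : (fun t => _) = fun t => F i t + \sum_(j <- s) F j t); last first.
  by apply/funext => t; rewrite big_cons.
by move=> t; apply: cvgD; [exact: cF|exact: ih].
Qed.

Lemma ip_within n (p : R -> nat -> {poly R}) t0 t1 :
  (forall s i, t0 <= s <= t1 -> (i < N)%N -> (size (p s i) <= n)%N) ->
  (forall i j, (i < N)%N -> {within `[t0, t1], continuous (fun s => (p s i)`_j)}) ->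
  {within `[t0, t1], continuous (fun s => ip N r (p s) (p s))}.
Proof.
move=> sz hc.
pose F s := \sum_(i < N) \sum_(j < n) \sum_(l < n)
    (p s i)`_j * (p s i)`_l * itg (r i) (r i.+1) (fun x => x ^+ (j + l)).
have cF : {within `[t0, t1], continuous F}.
  apply: within_sum => i; apply: within_sum => j; apply: within_sum => l.
  have iN := ltn_ord i.
  move=> s; apply: cvgM; first by apply: cvgM; exact: hc.
  exact: cvg_cst.
have FE s : t0 <= s <= t1 -> ip N r (p s) (p s) = F s.
  by move=> sI; rewrite /F -ip_coef// => i iN; split; exact: sz.
apply: eps_within => s e sI e0; have [d d0 h] := within_eps cF sI e0.
by exists d => // s' s'I s's; rewrite !FE//; exact: h.
Qed.

End InnerProduct.

(** * The upwind form on differences and on the projection error *)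

Section UpwLinear.
Context {R : realType} (b : R) (hb : 0 < b) (N : nat) (r : nat -> R).
Hypothesis hm : is_mesh b N r.
Implicit Types (f g : R -> R) (v dv : nat -> R -> R).

Lemma jmpB v1 v2 i : jmp N r (fun i x => v1 i x - v2 i x) i = jmp N r v1 i - jmp N r v2 i.
Proof. by rewrite /jmp; case: ifP => _; ring. Qed.

Lemma upwB g v1 dv1 v2 dv2 (f : nat -> R -> R) : bm 0 b g -> (forall i, bm 0 b (dv1 i)) ->
  (forall i, bm 0 b (dv2 i)) -> (forall i, bm 0 b (f i)) ->
  upw N r g (fun i x => v1 i x - v2 i x) (fun i x => dv1 i x - dv2 i x) f =
  upw N r g v1 dv1 f - upw N r g v2 dv2 f.
Proof.
move=> bg b1 b2 bf; rewrite /upw -mulrBr -sumrB; congr (_ * _); apply: eq_bigr => i _.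
have igs (dv : nat -> R -> R) : (forall i, bm 0 b (dv i)) ->
    ig (r i) (r i.+1) (fun x => g x * dv i x * f i x).
  by move=> bd; apply/bm_ig/(bm_cell hm (ltn_ord i))/bmM => //; exact: bmM.
rewrite jmpB (_ : itg _ _ _ = itg (r i) (r i.+1) (fun x => g x * dv1 i x * f i x) -
  itg (r i) (r i.+1) (fun x => g x * dv2 i x * f i x)); first by ring.
by rewrite -itgB; [apply: eq_itg => x _; ring|exact: igs|exact: igs].
Qed.

Lemma upw_gB g1 g2 v dv (f : nat -> R -> R) : bm 0 b g1 -> bm 0 b g2 -> (forall i, bm 0 b (dv i)) ->
  (forall i, bm 0 b (f i)) ->
  upw N r (fun x => g1 x - g2 x) v dv f = upw N r g1 v dv f - upw N r g2 v dv f.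
Proof.
move=> b1 b2 bd bf; rewrite /upw -mulrBr -sumrB; congr (_ * _); apply: eq_bigr => i _.
have igs g : bm 0 b g -> ig (r i) (r i.+1) (fun x => g x * dv i x * f i x).
  by move=> bg; apply/bm_ig/(bm_cell hm (ltn_ord i))/bmM => //; exact: bmM.
rewrite (_ : itg _ _ _ = itg (r i) (r i.+1) (fun x => g1 x * dv i x * f i x) -
  itg (r i) (r i.+1) (fun x => g2 x * dv i x * f i x)); first by ring.
by rewrite -itgB; [apply: eq_itg => x _; ring|exact: igs|exact: igs].
Qed.

Lemma eq_upw g v dv v' dv' (f : nat -> R -> R) : (forall i x, v i x = v' i x) -> (forall i x, dv i x = dv' i x) ->
  upw N r g v dv f = upw N r g v' dv' f.
Proof.
move=> e1 e2; have -> : v = v' by apply/funext => i; apply/funext => x.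
by have -> : dv = dv' by apply/funext => i; apply/funext => x.
Qed.

Lemma nn_eq_oo a c f g : bm a c f -> bm a c g -> (forall x, a < x < c -> f x = g x) ->
  nn a c f = nn a c g.
Proof.
move=> bf bg fg; rewrite !nnE; congr Num.sqrt; apply: eq_itg_oo.
- exact/bm_ig/bmX.
- exact/bm_ig/bmX.
by move=> x xI; rewrite fg.
Qed.

Lemma aa_eq_co f g x : 0 < x < b -> bm 0 b f -> bm 0 b g -> (forall y, 0 <= y < b -> f y = g y) ->
  aa f x = aa g x.
Proof.
move=> xI bf bg fg; rewrite /aa /av fg; last lra.
by congr ((_ - _ / _) / _); apply: eq_itg => y yI; apply: fg; lra.
Qed.

Lemma nn_glob_cell (p : nat -> {poly R}) i : (i < N)%N ->
  nn (r i) (r i.+1) (fun x => (p i).[x]) = nn (r i) (r i.+1) (glob N r p).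
Proof. by move=> iN; rewrite (nn_pw hm iN)// => j; exact: bm_poly. Qed.

Lemma nn_globD (p q : nat -> {poly R}) :
  nn 0 b (glob N r (fun i => p i + q i)) <= nn 0 b (glob N r p) + nn 0 b (glob N r q).
Proof.
apply: le_trans (nnD (bm_glob _ _ _ p) (bm_glob _ _ _ q)).
rewrite le_eqVlt; apply/orP; left; apply/eqP; apply: eq_nn => x _.
by rewrite /glob /pw -big_split/=; apply: eq_bigr => i _; rewrite hornerD mulrDr.
Qed.

Section ProjectionError.
Variables (k : nat) (Ci L : R) (g A F dF : R -> R) (d : nat -> {poly R}).
Hypotheses (Ci0 : 0 < Ci) (L0 : 0 <= L).
Hypothesis inv : forall a c (p : {poly R}), a < c -> (size p <= k.+1)%N ->
  nn a c (fun x => (deriv p).[x]) <= Ci / (c - a) * nn a c (fun x => p.[x]).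
Hypothesis pg : prim 0 b g A.
Hypothesis AL : forall x, 0 <= x <= b -> `|A x| <= L.
Hypothesis gL : forall x y, 0 <= x -> x <= y -> y <= b -> `|g y - g x| <= L * (y - x).
Hypothesis cF : cb 0 b F.
Hypothesis pF : prim 0 b F dF.
Hypothesis sd : forall i, (i < N)%N -> (size (d i) <= k.+1)%N.

Let q := gproj k r F.
Let eta x := F x - glob N r q x.

(* Integration by parts, as the projection error vanishes at the left ends;
   then [g] may be replaced by its increments, by orthogonality. *)
Lemma upw_proj_le : `|upw N r g (err F q) (derr dF q) (fun i x => (d i).[x])| <=
  2^-1 * (L * (1 + Ci)) * (nn 0 b eta * nn 0 b (glob N r d)).
Proof.
have [bA hg] := pg; have [bdF hF] := pF.
have bg : bm 0 b g by exact/bm_lip/(prim_lip pg).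
have bF : bm 0 b F by exact: cb_bm.
have beta : bm 0 b eta by apply: bmB => //; exact: bm_glob.
have bG := bm_glob b N r d.
rewrite /upw normrM ger0_norm ?invr_ge0// -mulrA; apply: ler_wpM2l; first by rewrite invr_ge0.
apply: le_trans (ler_norm_sum _ _ _) _.
apply: (@le_trans _ _ (L * (1 + Ci) *
    \sum_(i < N) nn (r i) (r i.+1) eta * nn (r i) (r i.+1) (glob N r d))); last first.
  apply: ler_wpM2l; last exact: (sum_nn_CS hm).
  by rewrite mulr_ge0//; have := Ci0; lra.
rewrite mulr_sumr; apply: ler_sum => -[i iN] _ /=; have ri := mesh_lt hm iN.
have ri0 := mesh_ge0 hm (ltnW iN); have rb := mesh_leb hm iN.
have cell f : bm 0 b f -> bm (r i) (r i.+1) f by exact: (bm_cell hm iN).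
pose e x := F x - (q i).[x].
have be : bm 0 b e by apply: bmB => //; exact: bm_poly.
have pe : prim (r i) (r i.+1) e (derr dF q i).
  apply: primB; [by apply: prim_sub pF|exact: prim_poly].
have pgc : prim (r i) (r i.+1) g A by apply: prim_sub pg.
have pd := prim_poly (r i) (r i.+1) (d i).
have [_ H] := primM (primM pgc pe) pd.
have e0 : e (r i) = 0 by rewrite /e /q (proj_left k hm F iN) subrr.
have := H (r i) (r i.+1) (lexx _) (ltW ri) (lexx _); rewrite e0 mulr0 mul0r subr0.
have bd := bm_poly 0 b (d i); have bdd := bm_poly 0 b (deriv (d i)).
have bde : bm 0 b (derr dF q i) by apply: bmB => //; exact: bm_poly.
have i1 : ig (r i) (r i.+1) (fun x => A x * e x * (d i).[x]).
  by apply/bm_ig/cell/bmM => //; exact: bmM.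
have i2 : ig (r i) (r i.+1) (fun x => g x * derr dF q i x * (d i).[x]).
  by apply/bm_ig/cell/bmM => //; exact: bmM.
have i3 : ig (r i) (r i.+1) (fun x => g x * e x * (deriv (d i)).[x]).
  by apply/bm_ig/cell/bmM => //; exact: bmM.
have -> : itg (r i) (r i.+1) (fun x => (A x * e x + g x * derr dF q i x) * (d i).[x] +
    g x * e x * (deriv (d i)).[x]) =
  itg (r i) (r i.+1) (fun x => A x * e x * (d i).[x]) +
  itg (r i) (r i.+1) (fun x => g x * derr dF q i x * (d i).[x]) +
  itg (r i) (r i.+1) (fun x => g x * e x * (deriv (d i)).[x]).
  rewrite -(itgD i1 i2) -(itgD (igD i1 i2) i3).
  by apply: eq_itg => x _; ring.
have jE : jmp N r (err F q) i = - e (r i.+1).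
  rewrite /jmp (_ : (if _ then _ else _) = 0) ?sub0r//.
  by case: ifP => // i1'; rewrite /err /q (proj_left k hm F i1') subrr.
rewrite jE => E.
have orth : itg (r i) (r i.+1) (fun x => e x * (deriv (d i)).[x]) = 0.
  have sdd : (size (deriv (d i)) <= k)%N.
    apply: leq_trans (size_poly _ _) _; have := sd iN; by case: (size _).
  have := grp_orth ri (cell_cb hm iN cF) sdd.
  rewrite -/(gproj k r F i) -/q => O; rewrite -[RHS]oppr0 -O -itgN.
    by apply: eq_itg => x _; rewrite /e; ring.
  apply/bm_ig/bmM; [apply: bmB; [exact: bm_poly|exact: cell]|exact: bm_poly].
have i4 : ig (r i) (r i.+1) (fun x => e x * (deriv (d i)).[x]) by exact/bm_ig/cell/bmM.
have bgc : bm 0 b (fun x => g x - g (r i)) by apply: bmB => //; exact: bm_cst.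
have gE : itg (r i) (r i.+1) (fun x => g x * e x * (deriv (d i)).[x]) =
    itg (r i) (r i.+1) (fun x => (g x - g (r i)) * e x * (deriv (d i)).[x]).
  rewrite -[LHS]subr0 -(mulr0 (g (r i))) -orth -itgZ// -itgB//; last exact: igZ.
  by apply: eq_itg => x _; ring.
have nE : nn (r i) (r i.+1) e = nn (r i) (r i.+1) eta.
  apply: nn_eq_oo; [exact: cell|exact: cell|].
  by move=> x xI; rewrite /e /eta (globE hm _ iN)//; lra.
have nD := nn_glob_cell d iN.
rewrite (_ : _ + _ * _ * _ = - (itg (r i) (r i.+1) (fun x => A x * e x * (d i).[x]) +
    itg (r i) (r i.+1) (fun x => (g x - g (r i)) * e x * (deriv (d i)).[x]))); last first.
  by rewrite -gE; move: E; rewrite /derr; lra.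
rewrite normrN; apply: le_trans (ler_normD _ _) _.
have h0 : 0 < r i.+1 - r i by lra.
have sup f M : bm 0 b f -> 0 <= M -> (forall x, r i <= x <= r i.+1 -> `|f x| <= M) ->
    nn (r i) (r i.+1) (fun x => f x * e x) <= M * nn (r i) (r i.+1) eta.
  move=> bf M0 fM; rewrite -nE.
  have -> : M * nn (r i) (r i.+1) e = nn (r i) (r i.+1) (fun x => M * e x).
    by rewrite nnZ ?ger0_norm//; exact: cell.
  apply: nn_le; [exact/cell/bmM|apply: bmM; [exact: bm_cst|exact: cell]|].
  by move=> x xI; rewrite !normrM; apply: ler_wpM2r => //; rewrite [`|M|]ger0_norm//; apply: fM; lra.
have t1 : `|itg (r i) (r i.+1) (fun x => A x * e x * (d i).[x])| <=
    L * nn (r i) (r i.+1) eta * nn (r i) (r i.+1) (glob N r d).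
  apply: le_trans (nn_CS _ _) _; [exact/cell/bmM|exact: cell|].
  rewrite nD; apply: ler_wpM2r; first exact: nn_ge0.
  by apply: sup => // x xI; apply: AL; lra.
have t2 : `|itg (r i) (r i.+1) (fun x => (g x - g (r i)) * e x * (deriv (d i)).[x])| <=
    L * nn (r i) (r i.+1) eta * (Ci * nn (r i) (r i.+1) (glob N r d)).
  apply: le_trans (nn_CS _ _) _; [exact/cell/bmM|exact: cell|].
  apply: (@le_trans _ _ ((L * (r i.+1 - r i) * nn (r i) (r i.+1) eta) *
      (Ci / (r i.+1 - r i) * nn (r i) (r i.+1) (glob N r d)))).
    apply: ler_pM; rewrite ?nn_ge0//; last by rewrite -nD; apply: inv => //; exact: sd.
    apply: sup => //; first by rewrite mulr_ge0// ltW.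
    move=> x xI; apply: le_trans (gL _ _ _) _; [lra..|].
    by apply: ler_wpM2l => //; lra.
  rewrite le_eqVlt; apply/orP; left; apply/eqP; field; exact: lt0r_neq0.
rewrite (_ : _ * (_ * _) = L * nn (r i) (r i.+1) eta * nn (r i) (r i.+1) (glob N r d) +
  L * nn (r i) (r i.+1) eta * (Ci * nn (r i) (r i.+1) (glob N r d))); last by ring.
exact: lerD.
Qed.

End ProjectionError.

End UpwLinear.

Lemma vr_sub {R : realType} (b : R) (N : nat) (r : nat -> R) v1 dv1 v2 dv2 : is_mesh b N r ->
  (forall i, bm 0 b (dv1 i)) -> (forall i, bm 0 b (dv2 i)) ->
  vr b N r (fun i x => v1 i x - v2 i x) (fun i x => dv1 i x - dv2 i x) <=
  vr b N r v1 dv1 + vr b N r v2 dv2.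
Proof.
move=> hm b1 b2; have bp v dv : (forall i, bm 0 b (dv i)) -> bm 0 b (pw N r (vard N r v dv)).
  by move=> bd; apply: bm_pw => i; exact: bm_vard.
have b3 i : bm 0 b (fun x => dv1 i x - dv2 i x) by exact: bmB.
apply: le_trans (nnD (bp v1 dv1 b1) (bp v2 dv2 b2)); apply: nn_le.
- exact: bp.
- by apply: bmD; exact: bp.
move=> x _; rewrite /pw -big_split/=.
apply: le_trans (ler_norm_sum _ _ _) _; apply: le_trans (ler_norm _).
apply: ler_sum => i _; rewrite -mulrDr normrM.
rewrite (ger0_norm (_ : 0 <= \1__ x)); last by rewrite indicE.
apply: ler_wpM2l; first by rewrite indicE.
rewrite /vard ger0_norm ?addr_ge0// jmpB mulrBl.
apply: le_trans (lerD (ler_normB _ _) (ler_normB _ _)) _; lra.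
Qed.

(** * Energy estimates at a fixed time *)

Section FixedTime.
Context {R : realType} (k : nat) (hk : (1 <= k)%N) (b : R) (hb : 0 < b).
Context (N : nat) (r : nat -> R).
Hypothesis hm : is_mesh b N r.
Implicit Types (d p : nat -> {poly R}).

Definition inverse_cst (Ci : R) : Prop := 0 < Ci /\ forall (a c : R) (p : {poly R}),
  a < c -> (size p <= k.+1)%N ->
  [/\ forall x, a <= x <= c -> `|p.[x]| ^+ 2 <= Ci / (c - a) * nn a c (fun x => p.[x]) ^+ 2,
      nn a c (fun x => (deriv p).[x]) <= Ci / (c - a) * nn a c (fun x => p.[x]) &
      (c - a) * nn a c (fun x => p.[x]) ^+ 2 <= Ci * itg a c (fun x => (c - x) * p.[x] ^+ 2)].

(* The values at one time of the data of the error equation. *)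
Record snapshot := Snapshot {
  s_u : R -> R; s_ur : R -> R; s_ut : R -> R;
  s_p : nat -> {poly R}; s_dp : nat -> {poly R}; s_tr : traces R; s_U : R
}.

Implicit Types (s : snapshot).

Definition s_q s := gproj k r (s_u s).
Definition s_qt s := gproj k r (s_ut s).
Definition s_d s i := s_p s i - s_q s i.
Definition s_dd s i := s_dp s i - s_qt s i.
Definition s_P s := glob N r (s_p s).
Definition s_E s x := s_u s x - glob N r (s_q s) x.
Definition s_Et s x := s_ut s x - glob N r (s_qt s) x.
Definition s_err s := err (s_u s) (s_q s).
Definition s_derr s := derr (s_ur s) (s_q s).
(** The broken energy norm, on broken polynomials. *)
Definition pvr d := vr b N r (fun i x => (d i).[x]) (fun i x => (deriv (d i)).[x]).
Definition s_n s := nn 0 b (glob N r (s_d s)).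

Record wf_snapshot (Cu : R) s : Prop := {
  w_adm : adm b (s_u s);
  w_cb : cb 0 b (s_u s);
  w_prim : prim 0 b (s_u s) (s_ur s);
  w_cbt : cb 0 b (s_ut s);
  w_ur : forall x, 0 <= x <= b -> `|s_ur s x| <= Cu;
  w_aa : forall x, 0 <= x <= b -> `|aa (s_u s) x| <= Cu;
  w_eqn : forall x, s_ut s x = rhs b (s_u s) (s_ur s) x;
  w_out : s_u s b = s_U s;
  w_size : forall i, (i < N)%N -> (size (s_p s i) <= k.+1)%N /\ (size (s_dp s i) <= k.+1)%N;
  w_loc : forall i, (i < N)%N -> local_equation k r (s_p s) (s_dp s) (s_tr s) i;
  w_trans : forall i, (i.+1 < N)%N -> transmission r (s_p s) (s_tr s) i;
  w_tr : [/\ u_hat (s_tr s) N = s_U s, g_hat (s_tr s) N = 1, w_hat (s_tr s) 0%N = 0 &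
    z_hat (s_tr s) 0%N = 0]
}.

Lemma s_size Cu s i : wf_snapshot Cu s -> (i < N)%N ->
  (size (s_d s i) <= k.+1)%N /\ (size (s_dd s i) <= k.+1)%N.
Proof.
move=> ws iN; have [h1 h2] := w_size ws iN.
by split; apply: leq_trans (size_polyD _ _) _; rewrite geq_max size_polyN size_grp ?h1 ?h2.
Qed.

Lemma bm_derr f q i : bm 0 b f -> bm 0 b (derr f q i).
Proof. by move=> bf; apply: bmB => //; exact: bm_poly. Qed.

Section OneSnapshot.
Variables (Cu : R) (s : snapshot).
Hypothesis ws : wf_snapshot Cu s.

Lemma s_bm : [/\ bm 0 b (s_u s), bm 0 b (s_ur s), bm 0 b (s_ut s), bm 0 b (s_E s) & bm 0 b (s_Et s)].
Proof.
have bu := cb_bm (w_cb ws); have but := cb_bm (w_cbt ws).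
split => //; [by case: (w_prim ws)|apply: bmB => //; exact: bm_glob|apply: bmB => //; exact: bm_glob].
Qed.

Lemma s_zeta i x : zeta (s_p s) (s_u s) i x = (s_d s i).[x] - s_err s i x.
Proof. by rewrite /zeta /s_err /err /s_d hornerD hornerN; ring. Qed.

Lemma s_dzeta i x : dzeta (s_p s) (s_ur s) i x = (deriv (s_d s i)).[x] - s_derr s i x.
Proof. by rewrite /dzeta /s_derr /derr /s_d derivB hornerD hornerN; ring. Qed.

Lemma s_Pu x : s_P s x - s_u s x = glob N r (s_d s) x - s_E s x.
Proof.
rewrite /s_P /s_E; have -> : glob N r (s_d s) x = glob N r (s_p s) x - glob N r (s_q s) x.
  by rewrite /glob /pw -sumrB; apply: eq_bigr => i _; rewrite hornerD hornerN; ring.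
ring.
Qed.

(** The part [s_Et] of the time derivative remains on the right: the test functions have degree up
    to [k], while the projection error is orthogonal to lower degrees only. *)
Lemma s_cell i (phi : {poly R}) : (i < N)%N -> (size phi <= k.+1)%N ->
  itg (r i) (r i.+1) (fun x => (s_dd s i).[x] * phi.[x]) =
  itg (r i) (r i.+1) (fun x => s_Et s x * phi.[x]) +
  2^-1 * (itg (r i) (r i.+1) (fun x => gt b (s_P s) x * dzeta (s_p s) (s_ur s) i x * phi.[x]) +
    gt b (s_P s) (r i.+1) * jmp N r (zeta (s_p s) (s_u s)) i * phi.[r i.+1]) +
  itg (r i) (r i.+1) (fun x => HH b (s_P s) (s_u s) (s_ur s) x * phi.[x]).
Proof.
move=> iN sphi; have [bu bur but bE bEt] := s_bm; have [t1 t2 t3 t4] := w_tr ws.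
have eqn x : 0 < x < b -> s_ut s x = 2^-1 * (gt b (s_u s) x * s_ur s x + sg b (s_u s) x * aa (s_u s) x).
  by move=> _; exact: (w_eqn ws).
have := error_cell hb hm (w_loc ws) (w_trans ws) t1 t2 t3 t4 (w_adm ws) bur but (w_out ws) eqn iN sphi.
rewrite -/(s_P s) -addrA => <-.
have cell f : bm 0 b f -> bm (r i) (r i.+1) f by exact: (bm_cell hm iN).
have i1 : ig (r i) (r i.+1) (fun x => s_Et s x * phi.[x]).
  by apply/bm_ig/cell/bmM => //; exact: bm_poly.
have i2 : ig (r i) (r i.+1) (fun x => ((s_dp s i).[x] - s_ut s x) * phi.[x]).
  by apply/bm_ig/cell/bmM; [apply: bmB => //; exact: bm_poly|exact: bm_poly].
rewrite -itgD//; apply: eq_itg_oo; [by apply/bm_ig/bmM; exact: bm_poly|exact: igD|].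
move=> x xI; rewrite /s_Et (globE hm _ iN); last lra.
by rewrite /s_dd hornerD hornerN; ring.
Qed.

Lemma s_ident (phi : nat -> {poly R}) : (forall i, (i < N)%N -> (size (phi i) <= k.+1)%N) ->
  ip N r (s_dd s) phi = itg 0 b (fun x => s_Et s x * glob N r phi x) +
  upw N r (gt b (s_P s)) (zeta (s_p s) (s_u s)) (dzeta (s_p s) (s_ur s)) (fun i x => (phi i).[x]) +
  itg 0 b (fun x => HH b (s_P s) (s_u s) (s_ur s) x * glob N r phi x).
Proof.
move=> sphi; have [bu bur but bE bEt] := s_bm.
have bH : bm 0 b (HH b (s_P s) (s_u s) (s_ur s)).
  by apply: bm_HH => //; [exact: (adm_glob hb hm)|exact: (w_adm ws)].
have cells f : bm 0 b f -> itg 0 b (fun x => f x * glob N r phi x) =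
    \sum_(i < N) itg (r i) (r i.+1) (fun x => f x * (phi i).[x]).
  move=> bf; rewrite (itg_cells hm); last by apply/bm_ig/bmM => //; exact: bm_glob.
  apply: eq_bigr => i _; apply: eq_itg_oo.
  - by apply/bm_ig/(bm_cell hm (ltn_ord i))/bmM => //; exact: bm_glob.
  - by apply/bm_ig/(bm_cell hm (ltn_ord i))/bmM => //; exact: bm_poly.
  by move=> x xI; rewrite (globE hm _ (ltn_ord i))//; lra.
rewrite !cells// /upw mulr_sumr -!big_split/=; apply: eq_bigr => i _.
by rewrite s_cell ?sphi// addrA.
Qed.

Variables (K : R).
Hypothesis K0 : 0 <= K.
Hypothesis hK : nn 0 b (aa (s_P s)) <= K.
Hypothesis hKu : nn 0 b (aa (s_u s)) <= K.

Let aP : adm b (s_P s) := adm_glob hb hm (s_p s).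

Lemma s_K2 : nn 0 b (aa (s_P s)) ^+ 2 <= K ^+ 2.
Proof. by apply: lerXn2r; rewrite ?nnegrE ?nn_ge0. Qed.

Lemma s_AA x : 0 <= x <= b -> 0 <= AA b (s_P s) x <= K ^+ 2.
Proof.
by move=> xI; have := AA_bound aP xI; have := s_K2; lra.
Qed.

Lemma s_gt x : 0 <= x <= b -> expR (- (b * K ^+ 2)) <= gt b (s_P s) x <= 1.
Proof.
move=> xI; rewrite gt_le1// andbT; apply: le_trans (gt_lower aP xI).
by rewrite ler_expR lerN2; apply: ler_wpM2l; [exact: ltW|exact: s_K2].
Qed.

Lemma s_gt_lip x y : 0 <= x -> x <= y -> y <= b ->
  `|gt b (s_P s) y - gt b (s_P s) x| <= K ^+ 2 * (y - x).
Proof.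
move=> x0 xy yb; have := gt_lip hb aP x0 xy yb => h.
rewrite ger0_norm; last by case/andP: h.
by apply: le_trans (proj2 (andP h)) _; apply: ler_wpM2r; [lra|exact: s_K2].
Qed.

Variables (CH Ci : R).
Hypothesis CH0 : 0 < CH.
Hypothesis hHH : nn 0 b (HH b (s_P s) (s_u s) (s_ur s)) <= CH * nn 0 b (fun x => s_P s x - s_u s x).
Hypothesis hCi : inverse_cst Ci.

Lemma s_HH : nn 0 b (HH b (s_P s) (s_u s) (s_ur s)) <= CH * (s_n s + nn 0 b (s_E s)).
Proof.
apply: le_trans hHH _; apply: ler_wpM2l; first exact: ltW.
rewrite (@eq_nn _ 0 b _ (fun x => glob N r (s_d s) x - s_E s x)); last by move=> x _; exact: s_Pu.
by apply: nnB; [exact: bm_glob|case: s_bm].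
Qed.

(** With [d] itself as test function, the upwind form of [d] is dropped for its sign, and that of
    the projection error is bounded by the L2 norm of this error. No derivative of the projection
    error is left, so the right-hand side keeps the full order. *)
Lemma s_main : ip N r (s_dd s) (s_d s) <= CH * s_n s ^+ 2 +
  (nn 0 b (s_Et s) + (CH + K ^+ 2 * (1 + Ci)) * nn 0 b (s_E s)) * s_n s.
Proof.
have [bu bur but bE bEt] := s_bm; have [Ci0 inv] := hCi.
have sz i : (i < N)%N -> (size (s_d s i) <= k.+1)%N by move=> iN; have [] := s_size ws iN.
rewrite (s_ident sz).
have bgt := bm_gt hb aP.
have -> : upw N r (gt b (s_P s)) (zeta (s_p s) (s_u s)) (dzeta (s_p s) (s_ur s))
    (fun i x => (s_d s i).[x]) =
  upw N r (gt b (s_P s)) (fun i x => (s_d s i).[x]) (fun i x => (deriv (s_d s i)).[x])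
    (fun i x => (s_d s i).[x]) -
  upw N r (gt b (s_P s)) (s_err s) (s_derr s) (fun i x => (s_d s i).[x]).
  rewrite -(upwB hm _ _ bgt); [|by move=> i; exact: bm_poly|by move=> i; exact: bm_derr|by move=> i; exact: bm_poly].
  by apply: eq_upw => i x; [exact: s_zeta|exact: s_dzeta].
have h1 : upw N r (gt b (s_P s)) (fun i x => (s_d s i).[x]) (fun i x => (deriv (s_d s i)).[x])
    (fun i x => (s_d s i).[x]) <= 0.
  apply: (@upw_diss _ b N r hm _ _ (s_d s) (prim_gt hb aP)) => x xI; first by case/andP: (s_AA xI).
  by apply: le_trans (proj1 (andP (s_gt xI))); exact/ltW/expR_gt0.
have inv2 (a c : R) (p : {poly R}) : a < c -> (size p <= k.+1)%N ->
    nn a c (fun x => (deriv p).[x]) <= Ci / (c - a) * nn a c (fun x => p.[x]).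
  by move=> ac sp; have [] := inv a c p ac sp.
have h2 := @upw_proj_le _ b N r hm k Ci (K ^+ 2) (gt b (s_P s)) (AA b (s_P s)) (s_u s) (s_ur s)
  (s_d s) Ci0 (sqr_ge0 K) inv2
  (prim_gt hb aP).
have {}h2 := h2 _ s_gt_lip (w_cb ws) (w_prim ws) sz.
have {}h2 := h2 (fun x xI => ltac:(rewrite ger0_norm; case/andP: (s_AA xI) => //)).
have h3 : `|itg 0 b (fun x => s_Et s x * glob N r (s_d s) x)| <= nn 0 b (s_Et s) * s_n s.
  by apply: nn_CS => //; exact: bm_glob.
have h4 : `|itg 0 b (fun x => HH b (s_P s) (s_u s) (s_ur s) x * glob N r (s_d s) x)| <=
    CH * (s_n s + nn 0 b (s_E s)) * s_n s.
  apply: le_trans (nn_CS _ _) _; [by apply: bm_HH => //; exact: (w_adm ws)|exact: bm_glob|].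
  by apply: ler_wpM2r; [exact: nn_ge0|exact: s_HH].
have n0 : 0 <= s_n s := nn_ge0 _ _ _; have E0 : 0 <= nn 0 b (s_E s) := nn_ge0 _ _ _.
have K2 : 0 <= K ^+ 2 * (1 + Ci) * (nn 0 b (s_E s) * s_n s).
  by rewrite !mulr_ge0 ?sqr_ge0//; lra.
move: h1 h2 h3 h4 K2; rewrite -/(s_err s) -/(s_derr s) -/(s_E s) -/(s_n s) => h1 h2 h3 h4 K2.
move: (ler_norm (itg 0 b (fun x => s_Et s x * glob N r (s_d s) x))).
move: (ler_norm (itg 0 b (fun x => HH b (s_P s) (s_u s) (s_ur s) x * glob N r (s_d s) x))).
move: h2; rewrite ler_norml => /andP[h2 _].
move: h1 h2 h3 h4 K2; rewrite expr2.
set I1 := itg 0 b _; set I2 := itg 0 b _; set U1 := upw _ _ _ _ _ _; set U2 := upw _ _ _ _ _ _.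
lra.
Qed.

(* Testing on each cell with [(r i.+1 - x) * d'] and with 1. *)
Lemma s_vr : pvr (s_d s) <= (16 * (Ci + 1) * expR (b * K ^+ 2) ^+ 2) *
  (nn 0 b (glob N r (s_dd s)) + nn 0 b (s_Et s) + CH * (s_n s + nn 0 b (s_E s)) +
   vr b N r (s_err s) (s_derr s)).
Proof.
have gen1 (a1 a2 a3 a4 a5 X : R) : a1 = a2 + 2^-1 * (a5 - a4) + a3 -> `|a1| <= X ->
    `|a2| <= X -> `|a3| <= X -> `|a4| <= X -> a5 <= 8 * X.
  by rewrite !ler_norml; lra.
have gen2 (a1 a2 a3 a4 a5 j sh om n' : R) : a1 = a2 + 2^-1 * (a5 - a4 + j) + a3 ->
    `|a1| <= sh * om -> `|a2| <= sh * om -> `|a3| <= sh * om -> `|a4| <= sh * om ->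
    `|a5| <= sh * n' -> `|j| <= sh * (7 * om + n').
  by rewrite !ler_norml; lra.
have gen3 (G om n' c : R) : n' <= 8 * c * G * om -> G * n' <= G * (8 * c * G * om) ->
    om <= G * om -> G * om <= G ^+ 2 * om -> c * (G * om) <= c * (G ^+ 2 * om) ->
    0 <= G ^+ 2 * om -> n' + (G * (7 * om + n') + om) <= 16 * (c + 1) * G ^+ 2 * om.
  by rewrite expr2; lra.
have [bu bur but bE bEt] := s_bm; have [Ci0 inv] := hCi.
have bgt := bm_gt hb aP.
have bH : bm 0 b (HH b (s_P s) (s_u s) (s_ur s)) by apply: bm_HH => //; exact: (w_adm ws).
pose V := pw N r (vard N r (s_err s) (s_derr s)).
have bV : bm 0 b V by apply: bm_pw => i; apply: bm_vard => j; exact: bm_derr.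
have bdd := bm_glob b N r (s_dd s).
(* One density dominates all the data. Every estimate below is made on a single cell in terms of the
   norm of [Om] there, so that the squares can be summed without comparing cells. *)
pose Om x := (`|glob N r (s_dd s) x| + `|s_Et s x|) + (`|HH b (s_P s) (s_u s) (s_ur s) x| + V x).
have bOm : bm 0 b Om by apply: bmD; apply: bmD => //; exact: bm_norm.
have V0 x : 0 <= V x by exact: pw_vard_ge0.
have nnabs f : bm 0 b f -> nn 0 b (fun x => `|f x|) = nn 0 b f.
  by move=> bf; rewrite !nnE; congr Num.sqrt; apply: eq_itg => x _; rewrite real_normK ?num_real.
have nOm : nn 0 b Om <= nn 0 b (glob N r (s_dd s)) + nn 0 b (s_Et s) +
    CH * (s_n s + nn 0 b (s_E s)) + vr b N r (s_err s) (s_derr s).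
  have n1 := nnD (bm_norm bdd) (bm_norm bEt); have n2 := nnD (bm_norm bH) bV.
  have n3 := nnD (bmD (bm_norm bdd) (bm_norm bEt)) (bmD (bm_norm bH) bV).
  by move: n1 n2 n3; rewrite !nnabs// -/V => n1 n2 n3; have := s_HH; rewrite /vr -/V; lra.
(* The reciprocal of the lower bound for [g~]. *)
set G := expR (b * K ^+ 2).
have G1 : 1 <= G by rewrite -expR0 ler_expR mulr_ge0 ?sqr_ge0// ltW.
set Cc := 16 * (Ci + 1) * G ^+ 2.
have Cc0 : 0 <= Cc by rewrite !mulr_ge0 ?sqr_ge0//; lra.
apply: (@le_trans _ _ (Cc * nn 0 b Om)); last by apply: ler_wpM2l.
have bpv : bm 0 b (pw N r (vard N r (fun i x => (s_d s i).[x]) (fun i x => (deriv (s_d s i)).[x]))).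
  by apply: bm_pw => i; apply: bm_vard => j; exact: bm_poly.
have CO : 0 <= Cc * nn 0 b Om by apply: mulr_ge0 => //; exact: nn_ge0.
rewrite /pvr /vr -ler_sqr ?nnegrE ?nn_ge0// exprMn.
rewrite (nn_cells hm bpv) (nn_cells hm bOm) mulr_sumr; apply: ler_sum => -[i iN] _ /=.
have CO' : 0 <= Cc * nn (r i) (r i.+1) Om by apply: mulr_ge0 => //; exact: nn_ge0.
rewrite -exprMn ler_sqr ?nnegrE ?nn_ge0//.
have ri := mesh_lt hm iN; have ri0 := mesh_ge0 hm (ltnW iN); have rb := mesh_leb hm iN.
have h0 : 0 < r i.+1 - r i by lra.
set h := r i.+1 - r i in h0 *.
have cell f : bm 0 b f -> bm (r i) (r i.+1) f by exact: (bm_cell hm iN).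
set om := nn (r i) (r i.+1) Om; have om0 : 0 <= om by exact: nn_ge0.
have xb x : r i <= x <= r i.+1 -> 0 <= x <= b by exact: (mesh_in hm iN).
have leom f : bm 0 b f -> (forall x, r i < x < r i.+1 -> `|f x| <= Om x) -> nn (r i) (r i.+1) f <= om.
  move=> bf fO; pose f' x := if r i < x < r i.+1 then f x else 0.
  rewrite /om !nnE; apply: ler_wsqrtr; apply: itg_le_oo.
  - exact/bm_ig/cell/bmX.
  - exact/bm_ig/cell/bmX.
  move=> x xI; rewrite -(real_normK (num_real (f x))).
  by apply: lerXn2r (fO x xI); rewrite nnegrE// (le_trans _ (fO x xI)).
have O1 x : r i < x < r i.+1 -> glob N r (s_dd s) x = (s_dd s i).[x].
  by move=> xI; rewrite (globE hm _ iN)//; lra.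
have VE x : r i < x < r i.+1 -> V x = vard N r (s_err s) (s_derr s) i x.
  by move=> xI; rewrite /V (pwE hm _ iN)//; lra.
have l1 : nn (r i) (r i.+1) (fun x => (s_dd s i).[x]) <= om.
  apply: leom => [|x xI]; first exact: bm_poly.
  rewrite -O1// /Om; have := V0 x; have := normr_ge0 (s_Et s x).
  by have := normr_ge0 (HH b (s_P s) (s_u s) (s_ur s) x); lra.
have l2 : nn (r i) (r i.+1) (s_Et s) <= om.
  apply: leom => // x xI; rewrite /Om; have := V0 x; have := normr_ge0 (glob N r (s_dd s) x).
  by have := normr_ge0 (HH b (s_P s) (s_u s) (s_ur s) x); lra.
have l3 : nn (r i) (r i.+1) (HH b (s_P s) (s_u s) (s_ur s)) <= om.
  apply: leom => // x xI; rewrite /Om; have := V0 x; have := normr_ge0 (s_Et s x).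
  by have := normr_ge0 (glob N r (s_dd s) x); lra.
have l4' x : r i < x < r i.+1 -> `|s_derr s i x| <= Om x.
  move=> xI; rewrite /Om VE// /vard; have := normr_ge0 (s_Et s x).
  have := normr_ge0 (glob N r (s_dd s) x); have := normr_ge0 (HH b (s_P s) (s_u s) (s_ur s) x).
  by have := normr_ge0 (jmp N r (s_err s) i / (r i.+1 - r i)); lra.
have bde : bm 0 b (s_derr s i) by exact: bm_derr.
have l4 : nn (r i) (r i.+1) (s_derr s i) <= om by exact: leom.
have bgd f : bm 0 b f -> bm 0 b (fun x => gt b (s_P s) x * f x) by move=> bf; exact: bmM.
have gle f : bm 0 b f -> nn (r i) (r i.+1) (fun x => gt b (s_P s) x * f x) <= nn (r i) (r i.+1) f.
  move=> bf; apply: nn_le; [exact/cell/bgd|exact: cell|].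
  move=> x xI; rewrite normrM ler_piMl//; have /andP[g1 g2] := s_gt (xb x ltac:(lra)).
  by rewrite ger0_norm//; apply: le_trans g1; exact/ltW/expR_gt0.
pose D' := deriv (s_d s i); set n' := nn (r i) (r i.+1) (fun x => D'.[x]).
have n'0 : 0 <= n' by exact: nn_ge0.
have bD : bm 0 b (fun x => D'.[x]) by exact: bm_poly.
have sdd : (size D' <= k)%N.
  apply: leq_trans (size_poly _ _) _; have [+ _] := s_size ws iN; by case: (size _).
have E0 : (r i.+1)%:P - 'X != 0 :> {poly R}.
  by rewrite -oppr_eq0 opprB -size_poly_eq0 size_XsubC.
have ig2 f g : bm 0 b f -> bm 0 b g -> ig (r i) (r i.+1) (fun x => f x * g x).
  by move=> bf bg; exact/bm_ig/cell/bmM.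
have zE f : bm 0 b f -> itg (r i) (r i.+1) (fun x => gt b (s_P s) x * dzeta (s_p s) (s_ur s) i x * f x) =
    itg (r i) (r i.+1) (fun x => gt b (s_P s) x * D'.[x] * f x) -
    itg (r i) (r i.+1) (fun x => gt b (s_P s) x * s_derr s i x * f x).
  move=> bf; rewrite -itgB; [|by apply: ig2 => //; exact: bgd|by apply: ig2 => //; exact: bgd].
  by apply: eq_itg => x _; rewrite s_dzeta; ring.
(* The factor [r i.+1 - x] removes the jump and keeps the degree at most [k], as [D'] has degree
   below [k]. The weighted inverse inequality then recovers the full norm of [D'], with one power of
   the length of the cell to divide by. *)
have n'om : n' <= 8 * Ci * G * om.
  pose phi := ((r i.+1)%:P - 'X) * D'.
  have phiE x : phi.[x] = (r i.+1 - x) * D'.[x] by rewrite hornerM hornerD hornerN hornerC hornerX.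
  have sphi : (size phi <= k.+1)%N.
    apply: leq_trans (size_polyMleq _ _) _.
    have -> : size ((r i.+1)%:P - 'X : {poly R}) = 2%N by rewrite -(size_polyN) opprB size_XsubC.
    by rewrite add2n /= ltnS.
  have bphi := bm_poly 0 b phi.
  have := s_cell iN sphi; rewrite zE// phiE subrr mul0r mulr0 addr0 => E.
  have nphi : nn (r i) (r i.+1) (fun x => phi.[x]) <= h * n'.
    have -> : h * n' = nn (r i) (r i.+1) (fun x => h * D'.[x]).
      by rewrite nnZ ?ger0_norm//; [exact: ltW|exact: cell].
    apply: nn_le; [exact: cell|by apply: bmM; [exact: bm_cst|exact: cell]|].
    move=> x xI; rewrite phiE !normrM; apply: ler_wpM2r => //.
    case/andP: xI => /ltW x1 /ltW x2.
    by rewrite /h !ger0_norm ?subr_ge0 ?lerD2l ?lerN2//; exact: ltW.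
  have t f : bm 0 b f -> nn (r i) (r i.+1) f <= om ->
      `|itg (r i) (r i.+1) (fun x => f x * phi.[x])| <= om * (h * n').
    move=> bf fo; apply: le_trans (nn_CS _ _) _; [exact: cell|exact: cell|].
    by apply: ler_pM; rewrite ?nn_ge0.
  have t1 := t _ (bm_poly 0 b (s_dd s i)) l1.
  have t2 := t _ bEt l2.
  have t3 := t _ bH l3.
  have t4 := t _ (bgd _ bde) (le_trans (gle _ bde) l4).
  have [_ _ low] := inv (r i) (r i.+1) D' ri (leq_trans sdd (leqnSn k)).
  have low2 : G^-1 * itg (r i) (r i.+1) (fun x => (r i.+1 - x) * D'.[x] ^+ 2) <=
      itg (r i) (r i.+1) (fun x => gt b (s_P s) x * D'.[x] * phi.[x]).
    have bq : bm 0 b (fun x => (r i.+1 - x) * D'.[x] ^+ 2).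
      by apply: bmM; [apply: bmB; [exact: bm_cst|exact: bm_id]|exact: bmX].
    rewrite -itgZ; last exact/bm_ig/cell.
    apply: itg_le.
    - by apply/bm_ig/cell/bmM => //; exact: bm_cst.
    - by apply: ig2 => //; exact: bgd.
    move=> x xI; rewrite phiE; have /andP[g1 _] := s_gt (xb x xI).
    rewrite (_ : _ * D'.[x] * _ = gt b (s_P s) x * ((r i.+1 - x) * D'.[x] ^+ 2)); last by ring.
    apply: ler_wpM2r; first by case/andP: xI => _ x2; rewrite mulr_ge0 ?sqr_ge0// subr_ge0.
    by rewrite /G -expRN.
  have G0 : 0 < G by exact: lt_le_trans ltr01 G1.
  have main : G^-1 * (h * n' ^+ 2) <= Ci * (8 * (om * (h * n'))).
    apply: (@le_trans _ _ (Ci * (G^-1 * itg (r i) (r i.+1) (fun x => (r i.+1 - x) * D'.[x] ^+ 2)))).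
      by rewrite [leRHS]mulrCA; apply: ler_wpM2l; [rewrite invr_ge0 ltW|exact: low].
    apply: ler_wpM2l; first exact: ltW.
    apply: le_trans low2 _.
    exact: gen1 E t1 t2 t3 t4.
  have [->|n'n] := eqVneq n' 0; first by apply: mulr_ge0 => //; apply: mulr_ge0 (ltW G0); apply: mulr_ge0 (ltW Ci0).
  have n'p : 0 < n' by rewrite lt_neqAle eq_sym n'n.
  have hn : 0 < h * n' by rewrite mulr_gt0.
  rewrite -(ler_pM2r hn) -(ler_pM2l (_ : 0 < G^-1)); last by rewrite invr_gt0.
  rewrite (_ : n' * (h * n') = h * n' ^+ 2); last by ring.
  apply: le_trans main _; rewrite le_eqVlt; apply/orP; left; apply/eqP; field.
  exact: lt0r_neq0.
set sh := Num.sqrt h; have sh0 : 0 < sh by rewrite sqrtr_gt0.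
have shh : sh * sh = h by rewrite -expr2 sqr_sqrtr// ltW.
(* The constant test function isolates the jump, in terms of the data and of the derivative already
   bounded; the factor [sh] is the one by which jumps are scaled in the energy norm. *)
have jd : `|jmp N r (fun i x => (s_d s i).[x]) i| <= sh * (G * (7 * om + n') + om).
  have s1 : (size (1%R : {poly R}) <= k.+1)%N by rewrite size_poly1.
  have := s_cell iN s1; rewrite zE; last exact: bm_poly.
  rewrite hornerC mulr1 => E.
  have t f : bm 0 b f -> `|itg (r i) (r i.+1) (fun x => f x * (1 : {poly R}).[x])| <= sh * nn (r i) (r i.+1) f.
    move=> bf; rewrite (@eq_itg _ _ _ _ f); last by move=> x _; rewrite hornerC mulr1.
    by have := l2_CS ri0 (ltW ri) rb (bm_l2 bf).
  have sl f : nn (r i) (r i.+1) f <= om -> sh * nn (r i) (r i.+1) f <= sh * om.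
    by move=> fo; apply: ler_wpM2l => //; exact: ltW.
  have t1 := le_trans (t _ (bm_poly 0 b (s_dd s i))) (sl _ l1).
  have t2 := le_trans (t _ bEt) (sl _ l2).
  have t3 := le_trans (t _ bH) (sl _ l3).
  have t4 := le_trans (t _ (bgd _ bde)) (sl _ (le_trans (gle _ bde) l4)).
  have t5 : `|itg (r i) (r i.+1) (fun x => gt b (s_P s) x * D'.[x] * (1 : {poly R}).[x])| <= sh * n'.
    by apply: le_trans (t _ (bgd _ bD)) _; apply: ler_wpM2l; [exact: ltW|exact: gle].
  have rb' : 0 <= r i.+1 <= b by apply: xb; rewrite lexx ltW.
  have /andP[g1 g2] := s_gt rb'.
  have gp : 0 < gt b (s_P s) (r i.+1) by apply: lt_le_trans g1; exact: expR_gt0.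
  have jz : `|jmp N r (zeta (s_p s) (s_u s)) i| <= G * (sh * (7 * om + n')).
    have : `|gt b (s_P s) (r i.+1) * jmp N r (zeta (s_p s) (s_u s)) i| <= sh * (7 * om + n').
      exact: gen2 E t1 t2 t3 t4 t5.
    rewrite normrM (gtr0_norm gp) => le.
    have G0 : 0 < G by exact: lt_le_trans ltr01 G1.
    rewrite -ler_pdivrMl//; apply: le_trans le.
    by apply: ler_wpM2r => //; rewrite /G -expRN.
  have je : `|jmp N r (s_err s) i| <= sh * om.
    apply: le_trans (@jmp_le_vard _ b N r hm (s_err s) (s_derr s) _ i iN) _.
      by move=> j; exact: bm_derr.
    apply: ler_wpM2l; first exact: ltW.
    apply: leom => // x xI; rewrite ger0_norm// /Om; have := normr_ge0 (s_Et s x).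
    have := normr_ge0 (glob N r (s_dd s) x).
    by have := normr_ge0 (HH b (s_P s) (s_u s) (s_ur s) x); rewrite -/V; lra.
  have -> : jmp N r (fun i x => (s_d s i).[x]) i = jmp N r (zeta (s_p s) (s_u s)) i + jmp N r (s_err s) i.
    by rewrite /jmp !s_zeta; case: ifP => _; ring.
  apply: le_trans (ler_normD _ _) _; apply: le_trans (lerD jz je) _.
  by rewrite le_eqVlt; apply/orP; left; apply/eqP; ring.
rewrite (nn_pw hm iN); last by move=> j; apply: bm_vard => l; exact: bm_poly.
apply: le_trans (nnD _ _) _; [exact/bm_norm/cell|exact: bm_cst|].
have -> : nn (r i) (r i.+1) (fun x => `|(deriv (s_d s i)).[x]|) = n'.
  by rewrite /n' !nnE; congr Num.sqrt; apply: eq_itg => x _; rewrite real_normK ?num_real.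
rewrite nn_cst; last exact: ltW.
rewrite normr_id -/h normrM normfV (gtr0_norm h0) -/sh.
have -> : `|jmp N r (fun i x => (s_d s i).[x]) i| / h * sh =
    `|jmp N r (fun i x => (s_d s i).[x]) i| / sh.
  by rewrite -shh; field; exact: lt0r_neq0.
have jd2 : `|jmp N r (fun i x => (s_d s i).[x]) i| / sh <= G * (7 * om + n') + om.
  by rewrite ler_pdivrMr// mulrC.
apply: le_trans (lerD (lexx _) jd2) _.
have G0 : 0 <= G by exact: le_trans ler01 G1.
have k1 : G * n' <= G * (8 * Ci * G * om) by apply: ler_wpM2l.
have k2 : om <= G * om by rewrite -[leLHS]mul1r; apply: ler_wpM2r.
have k3 : G * om <= G ^+ 2 * om by rewrite expr2 -mulrA; rewrite -[leLHS]mul1r; apply: ler_wpM2r => //; exact: mulr_ge0.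
have k4 : Ci * (G * om) <= Ci * (G ^+ 2 * om) by apply: ler_wpM2l => //; exact: ltW.
have k5 : 0 <= G ^+ 2 * om by rewrite mulr_ge0 ?sqr_ge0.
exact: gen3.
Qed.

End OneSnapshot.

End FixedTime.

Lemma delta_estimate_sum {R : realType} (K M Ci Ch e tau va za nd : R) :
  0 <= K -> 0 <= M -> 0 < Ci -> 0 <= Ch -> 0 <= tau -> 0 <= e <= 1 -> 0 <= va -> va <= 1 ->
  0 <= za -> 0 <= nd ->
  e * tau * nd + ((1 + Ci) * (e * tau) * nd +
    6 * K * (nd + (M + 1) * tau) * (1 + Ci) * (va + e) * nd) +
    Ch * ((nd + e * tau + tau * za) + tau * (5 * (va + e))) * nd <=
  (1 + (1 + Ci) * (1 + 12 * K + 6 * K * (M + 1)) + 8 * Ch) * nd ^+ 2 +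
  (1 + (1 + Ci) * (1 + 12 * K + 6 * K * (M + 1)) + 8 * Ch) * (tau * (e + va + za)) * nd.
Proof.
move=> K0 M0 Ci0 Ch0 t0 e01 v0 hp0 za0 nd0.
have ve : va + e <= 2 by lra.
set X := tau * (e + va + za) * nd.
have tn : 0 <= tau * nd by exact: mulr_ge0.
have e0 : 0 <= e by lra.
have X1 : e * tau * nd <= X.
  by rewrite /X; have := mulr_ge0 tn v0; have := mulr_ge0 tn za0; lra.
have X2 : tau * (va + e) * nd <= X by rewrite /X; have := mulr_ge0 tn za0; lra.
have X3 : tau * za * nd <= X.
  by rewrite /X; have := mulr_ge0 tn v0; have := mulr_ge0 tn e0; lra.
have nd2 : 0 <= nd ^+ 2 by exact: sqr_ge0.
have X0 : 0 <= X by apply: le_trans X1; rewrite !mulr_ge0.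
have q1 : (va + e) * nd ^+ 2 <= 2 * nd ^+ 2 by exact: ler_wpM2r.
have KC : 0 <= K * (1 + Ci) by rewrite mulr_ge0//; lra.
have y1 : K * (1 + Ci) * ((va + e) * nd ^+ 2) <= K * (1 + Ci) * (2 * nd ^+ 2) by exact: ler_wpM2l.
have KM : 0 <= K * (1 + Ci) * (M + 1) by rewrite mulr_ge0//; lra.
have y2 : K * (1 + Ci) * (M + 1) * (tau * (va + e) * nd) <= K * (1 + Ci) * (M + 1) * X.
  exact: ler_wpM2l.
have y3 : (1 + Ci) * (e * tau * nd) <= (1 + Ci) * X by apply: ler_wpM2l => //; lra.
have y4 : Ch * (e * tau * nd + tau * za * nd + 5 * (tau * (va + e) * nd)) <= Ch * (7 * X).
  by apply: ler_wpM2l => //; lra.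
have p1 : 0 <= Ch * nd ^+ 2 by exact: mulr_ge0.
have p2 : 0 <= Ch * X by exact: mulr_ge0.
have p3 : 0 <= Ci * nd ^+ 2 by rewrite mulr_ge0// ltW.
have p4 : 0 <= K * (1 + Ci) * X by exact: mulr_ge0.
have p5 : 0 <= K * (1 + Ci) * (M + 1) * nd ^+ 2 by exact: mulr_ge0.
rewrite -[Y in _ <= _ + Y]mulrA -/X.
move: X1 y1 y2 y3 y4 p1 p2 p3 p4 p5; rewrite expr2; lra.
Qed.

(** * Energy estimate for the difference of errors at two times *)

Section TwoSnapshots.
Context {R : realType} (k : nat) (b : R) (hb : 0 < b).

Lemma vr_zeta (N : nat) (r : nat -> R) Cu (s : snapshot) : is_mesh b N r -> wf_snapshot k b N r Cu s ->
  vr b N r (zeta (s_p s) (s_u s)) (dzeta (s_p s) (s_ur s)) <=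
  pvr b N r (s_d k r s) + vr b N r (s_err k r s) (s_derr k r s).
Proof.
move=> hm ws; have [bu bur but bE bEt] := s_bm ws.
have -> : zeta (s_p s) (s_u s) = fun i x => (s_d k r s i).[x] - s_err k r s i x.
  by apply/funext => i; apply/funext => x; exact: s_zeta.
have -> : dzeta (s_p s) (s_ur s) = fun i x => (deriv (s_d k r s i)).[x] - s_derr k r s i x.
  by apply/funext => i; apply/funext => x; exact: s_dzeta.
by apply: (vr_sub _ _ hm) => i; [exact: bm_poly|exact: bm_derr].
Qed.

(** The embedding requires a glued function, to which [P - u] is equal on [[0, b[]; the value at [b]
    does not affect the norms. *)
Lemma nn_aa_sub (N : nat) (r : nat -> R) Cu (s : snapshot) : is_mesh b N r -> wf_snapshot k b N r Cu s ->
  nn 0 b (aa (fun x => s_P N r s x - s_u s x)) <=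
  5 * (pvr b N r (s_d k r s) + vr b N r (s_err k r s) (s_derr k r s)).
Proof.
move=> hm ws; have [bu bur but bE bEt] := s_bm ws.
have aP : adm b (s_P N r s) := adm_glob hb hm (s_p s).
have ag := w_adm ws.
have bd i : bm 0 b (dzeta (s_p s) (s_ur s) i) by apply: bmB => //; exact: bm_poly.
pose zt := zeta (s_p s) (s_u s).
have bz i : bm 0 b (zt i) by apply: bmB => //; exact: bm_poly.
have pz i : (i < N)%N -> prim (r i) (r i.+1) (zt i) (dzeta (s_p s) (s_ur s) i).
  move=> iN; apply: primB; first exact: prim_poly.
  apply: prim_sub (w_prim ws); [exact: (mesh_ge0 hm (ltnW iN))|exact: (mesh_leb hm iN)].
have bpw : bm 0 b (pw N r zt) by exact: bm_pw.
have bPu : bm 0 b (fun x => s_P N r s x - s_u s x) by apply: bmB => //; exact: bm_glob.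
have E x : 0 <= x < b -> s_P N r s x - s_u s x = pw N r zt x.
  move=> xI; have [i iN xi] := cell_exists hm xI.
  by rewrite (pwE hm _ iN xi) /s_P (globE hm _ iN xi).
rewrite (nn_eq_oo (g := aa (pw N r zt))).
- apply: le_trans (nn_aa_pw hm hb bz bd pz) _.
  by apply: ler_wpM2l (vr_zeta hm ws) => //.
- by have [_] := admB aP ag.
- by have [_] := adm_pw hm hb bz bd pz.
by move=> x xI; exact: (aa_eq_co xI bPu bpw E).
Qed.

Definition s_delta (r : nat -> R) (s0 s1 : snapshot) i := s_d k r s1 i - s_d k r s0 i.

(** The difference of the two error equations is tested with the increment of [d]. Everything that
    is not quadratic in this increment carries the factor [tau], times either the small parameter
    [e] or a norm of the error at the first time. The energy norm enters because the change of [g~]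
    multiplies derivatives of the error. *)
Lemma delta_estimate (K M Ci : R) : 0 <= K -> 0 <= M -> 0 < Ci -> exists2 C : R, 0 < C &
  forall (N : nat) (r : nat -> R) (s0 s1 : snapshot) (tau e : R), is_mesh b N r ->
  inverse_cst k Ci -> wf_snapshot k b N r M s0 -> wf_snapshot k b N r M s1 ->
  0 <= tau -> 0 <= e <= 1 ->
  nn 0 b (aa (s_P N r s0)) <= K -> nn 0 b (aa (s_P N r s1)) <= K ->
  nn 0 b (aa (s_u s0)) <= K -> nn 0 b (aa (s_u s1)) <= K ->
  nn 0 b (fun x => s_u s1 x - s_u s0 x) <= M * tau ->
  nn 0 b (aa (fun x => s_u s1 x - s_u s0 x)) <= M * tau ->
  nn 0 b (fun x => s_ur s1 x - s_ur s0 x) <= M * tau ->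
  vr b N r (fun i x => s_err k r s1 i x - s_err k r s0 i x)
    (fun i x => s_derr k r s1 i x - s_derr k r s0 i x) <= e * tau ->
  nn 0 b (fun x => s_E k N r s1 x - s_E k N r s0 x) <= e * tau ->
  nn 0 b (fun x => s_Et k N r s1 x - s_Et k N r s0 x) <= e * tau ->
  vr b N r (s_err k r s0) (s_derr k r s0) <= e ->
  pvr b N r (s_d k r s0) <= 1 -> s_n k b N r s0 + nn 0 b (s_E k N r s0) <= 1 ->
  ip N r (fun i => s_dd k r s1 i - s_dd k r s0 i) (s_delta r s0 s1) <=
    C * nn 0 b (glob N r (s_delta r s0 s1)) ^+ 2 + C * (tau * (e + pvr b N r (s_d k r s0) +
      (s_n k b N r s0 + nn 0 b (s_E k N r s0)))) * nn 0 b (glob N r (s_delta r s0 s1)).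
Proof.
move=> K0 M0 Ci0.
pose c1 := 18 * K + 36 * K ^+ 2 + 72 * K ^+ 2 * M + 6 * M.
pose Ch := 3 * c1 * M * Num.sqrt b + 30 * K * M + 27 * K ^+ 2.
have c10 : 0 <= c1 by rewrite !addr_ge0 ?mulr_ge0 ?sqr_ge0.
have Ch0 : 0 <= Ch by rewrite !addr_ge0 ?mulr_ge0 ?sqrtr_ge0 ?sqr_ge0.
pose C := 1 + (1 + Ci) * (1 + 12 * K + 6 * K * (M + 1)) + 8 * Ch.
have C0 : 0 < C.
  rewrite /C -addrA ltr_pwDl// addr_ge0 ?mulr_ge0//; first by slim_lra.
  by have := mulr_ge0 K0 M0; slim_lra.
exists C => // N r s0 s1 tau e hm hCi ws0 ws1 t0 e01 K0' K1' Ku0 Ku1 hu haa hur hve hE hEt hv0 hp0 hz0.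
set delta := s_delta r s0 s1; set nd := nn 0 b (glob N r delta).
have deltaE i : delta i = s_d k r s1 i - s_d k r s0 i by [].
have [bu0 bur0 but0 bE0 bEt0] := s_bm ws0; have [bu1 bur1 but1 bE1 bEt1] := s_bm ws1.
have aP0 : adm b (s_P N r s0) := adm_glob hb hm (s_p s0).
have aP1 : adm b (s_P N r s1) := adm_glob hb hm (s_p s1).
set g0 := gt b (s_P N r s0); set g1 := gt b (s_P N r s1).
have bg0 : bm 0 b g0 := bm_gt hb aP0; have bg1 : bm 0 b g1 := bm_gt hb aP1.
pose phi i x := (delta i).[x] : R.
have bphi i : bm 0 b (phi i) by exact: bm_poly.
have sz i : (i < N)%N -> (size (delta i) <= k.+1)%N.
  move=> iN; apply: leq_trans (size_polyD _ _) _; rewrite geq_max size_polyN.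
  by have [-> _] := s_size ws0 iN; have [-> _] := s_size ws1 iN.
have bdz (s : snapshot) : bm 0 b (s_ur s) -> forall i, bm 0 b (dzeta (s_p s) (s_ur s) i).
  by move=> bs i; apply: bmB => //; exact: bm_poly.
have bd1 := bdz s1 bur1; have bd0 := bdz s0 bur0.
have nd0 : 0 <= nd by exact: nn_ge0.
have v0 : 0 <= pvr b N r (s_d k r s0) by exact: vr_ge0.
set va := pvr b N r (s_d k r s0) in v0 hp0 *.
set za := s_n k b N r s0 + nn 0 b (s_E k N r s0) in hz0 *.
have za0 : 0 <= za by rewrite addr_ge0// nn_ge0.
have nPu : nn 0 b (fun x => (s_P N r s1 x - s_u s1 x) - (s_P N r s0 x - s_u s0 x)) <= nd + e * tau.
  rewrite (@eq_nn _ 0 b _ (fun x => glob N r delta x - (s_E k N r s1 x - s_E k N r s0 x))).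
    by apply: le_trans (nnB (bm_glob _ _ _ _) (bmB bE1 bE0)) _; rewrite lerD2l.
  move=> x _; rewrite !(s_Pu k).
  have -> : glob N r delta x = glob N r (s_d k r s1) x - glob N r (s_d k r s0) x.
    by rewrite /glob /pw -sumrB; apply: eq_bigr => i _; rewrite deltaE hornerD hornerN; ring.
  ring.
have nP : nn 0 b (fun x => s_P N r s1 x - s_P N r s0 x) <= nd + (M + 1) * tau.
  rewrite (@eq_nn _ 0 b _ (fun x => ((s_P N r s1 x - s_u s1 x) - (s_P N r s0 x - s_u s0 x)) +
    (s_u s1 x - s_u s0 x))); last by move=> x _; ring.
  apply: le_trans (nnD _ (bmB bu1 bu0)) _.
    by apply: bmB; apply: bmB => //; exact: bm_glob.
  have : e * tau <= 1 * tau by apply: ler_wpM2r; slim_lra.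
  slim_lra.
have supg x : 0 <= x <= b -> `|g1 x - g0 x| <= 6 * K * (nd + (M + 1) * tau).
  move: x; apply: (gt_sub_le aP1 aP0) => y yI; apply: le_trans (GG_sub_le hb aP1 aP0 yI) _.
  rewrite (_ : 6 * K * _ = 3 * (nd + (M + 1) * tau) * (2 * K)); last by ring.
  apply: ler_pM; rewrite ?mulr_ge0 ?addr_ge0 ?nn_ge0//; last slim_lra.
  by apply: ler_wpM2l.
have inv1 (a c : R) (p : {poly R}) : a < c -> (size p <= k.+1)%N -> forall x, a <= x <= c ->
    `|p.[x]| ^+ 2 <= Ci / (c - a) * nn a c (fun x => p.[x]) ^+ 2.
  by move=> ac sp; have [_ /(_ a c p ac sp)[]] := hCi.
have vrz : vr b N r (zeta (s_p s0) (s_u s0)) (dzeta (s_p s0) (s_ur s0)) <= va + e.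
  by apply: le_trans (vr_zeta hm ws0) _; exact: lerD.
have bH0 : bm 0 b (HH b (s_P N r s0) (s_u s0) (s_ur s0)) by apply: bm_HH => //; exact: (w_adm ws0).
have bH1 : bm 0 b (HH b (s_P N r s1) (s_u s1) (s_ur s1)) by apply: bm_HH => //; exact: (w_adm ws1).
have bG := bm_glob b N r delta.
have ipE : ip N r (fun i => s_dd k r s1 i - s_dd k r s0 i) delta =
    ip N r (s_dd k r s1) delta - ip N r (s_dd k r s0) delta.
  rewrite /ip -sumrB; apply: eq_bigr => i _; rewrite -itgB.
  - by apply: eq_itg => x _; rewrite hornerD hornerN; ring.
  - by apply/bm_ig/bmM; exact: bm_poly.
  - by apply/bm_ig/bmM; exact: bm_poly.
rewrite ipE (s_ident hb hm ws1 sz) (s_ident hb hm ws0 sz).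
rewrite -/g0 -/g1.
have T1 : itg 0 b (fun x => s_Et k N r s1 x * glob N r delta x) -
    itg 0 b (fun x => s_Et k N r s0 x * glob N r delta x) <= e * tau * nd.
  rewrite -itgB; [|exact/bm_ig/bmM|exact/bm_ig/bmM].
  rewrite (@eq_itg _ _ _ _ (fun x => (s_Et k N r s1 x - s_Et k N r s0 x) * glob N r delta x)).
    apply: le_trans (ler_norm _) _; apply: le_trans (nn_CS (bmB bEt1 bEt0) bG) _.
    exact: ler_wpM2r.
  by move=> x _; ring.
have ag1 := w_adm ws1; have ag0 := w_adm ws0.
have al : nn 0 b (aa (fun x => s_P N r s0 x - s_u s0 x)) <= 5 * (va + e).
  apply: le_trans (nn_aa_sub hm ws0) _; apply: ler_wpM2l => //.
  exact: lerD.
have z01 : nn 0 b (fun x => s_P N r s0 x - s_u s0 x) <= za.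
  rewrite (@eq_nn _ 0 b _ (fun x => glob N r (s_d k r s0) x - s_E k N r s0 x)).
    by apply: nnB => //; exact: bm_glob.
  by move=> x _; exact: (s_Pu k).
have T3 : itg 0 b (fun x => HH b (s_P N r s1) (s_u s1) (s_ur s1) x * glob N r delta x) -
    itg 0 b (fun x => HH b (s_P N r s0) (s_u s0) (s_ur s0) x * glob N r delta x) <=
    Ch * ((nd + e * tau + tau * za) + tau * (5 * (va + e))) * nd.
  rewrite -itgB; [|exact/bm_ig/bmM|exact/bm_ig/bmM].
  rewrite (@eq_itg _ _ _ _ (fun x => (HH b (s_P N r s1) (s_u s1) (s_ur s1) x -
    HH b (s_P N r s0) (s_u s0) (s_ur s0) x) * glob N r delta x)); last by move=> x _; ring.
  apply: le_trans (ler_norm _) _; apply: le_trans (nn_CS (bmB bH1 bH0) bG) _.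
  apply: ler_wpM2r => //.
  have h := @nn_HH2 _ b hb K M K0 M0 (s_P N r s1) (s_P N r s0) (s_u s1) (s_u s0) (s_ur s1) (s_ur s0)
    tau aP1 aP0 ag1 ag0 bur1 bur0 t0 K1' K0' Ku1 Ku0 hu haa hur.
  have {}h := h (fun x xI => w_ur ws1 (ltac:(slim_lra) : 0 <= x <= b)).
  have {}h := h (fun x xI => w_aa ws1 (ltac:(slim_lra) : 0 <= x <= b)).
  have {}h := h (le_trans z01 hz0).
  apply: le_trans h _; apply: ler_wpM2l => //.
  by apply: lerD; [apply: lerD => //|]; apply: ler_wpM2l.
have T2 : upw N r g1 (zeta (s_p s1) (s_u s1)) (dzeta (s_p s1) (s_ur s1)) phi -
    upw N r g0 (zeta (s_p s0) (s_u s0)) (dzeta (s_p s0) (s_ur s0)) phi <=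
    (1 + Ci) * (e * tau) * nd + 6 * K * (nd + (M + 1) * tau) * (1 + Ci) * (va + e) * nd.
  (* The upwind forms are split as [g1 (z1 - z0) + (g1 - g0) z0]. In the first part the increment of
     [d] is dissipated and that of the projection error is small; the second part is bounded by the
     energy norm at the first time. *)
  have -> : upw N r g1 (zeta (s_p s1) (s_u s1)) (dzeta (s_p s1) (s_ur s1)) phi -
      upw N r g0 (zeta (s_p s0) (s_u s0)) (dzeta (s_p s0) (s_ur s0)) phi =
    (upw N r g1 phi (fun i x => (deriv (delta i)).[x]) phi -
     upw N r g1 (fun i x => s_err k r s1 i x - s_err k r s0 i x)
       (fun i x => s_derr k r s1 i x - s_derr k r s0 i x) phi) +
    upw N r (fun x => g1 x - g0 x) (zeta (s_p s0) (s_u s0)) (dzeta (s_p s0) (s_ur s0)) phi.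
    rewrite (upw_gB hm)// -(upwB hm)//; last 2 first.
    - by move=> i; exact: bm_poly.
    - by move=> i; apply: bmB; exact: bm_derr.
    have -> : upw N r g1 (fun i x => phi i x - (s_err k r s1 i x - s_err k r s0 i x))
        (fun i x => (deriv (delta i)).[x] - (s_derr k r s1 i x - s_derr k r s0 i x)) phi =
      upw N r g1 (fun i x => zeta (s_p s1) (s_u s1) i x - zeta (s_p s0) (s_u s0) i x)
        (fun i x => dzeta (s_p s1) (s_ur s1) i x - dzeta (s_p s0) (s_ur s0) i x) phi.
      apply: eq_upw => i x.
        by rewrite !(s_zeta k r) /phi deltaE hornerD hornerN; ring.
      by rewrite !(s_dzeta k r) deltaE derivB hornerD hornerN; ring.
    rewrite (upwB hm)//; ring.
  have u1 : upw N r g1 phi (fun i x => (deriv (delta i)).[x]) phi <= 0.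
    apply: (@upw_diss _ b N r hm _ _ delta (prim_gt hb aP1)) => x xI.
      by case/andP: (AA_bound aP1 xI).
    by apply: le_trans (gt_lower aP1 xI); exact/ltW/expR_gt0.
  have g1le x : 0 <= x <= b -> `|g1 x| <= 1.
    move=> xI; rewrite ger0_norm; first exact: gt_le1.
    by apply: le_trans (gt_lower aP1 xI); exact/ltW/expR_gt0.
  have bde i : bm 0 b (fun x => s_derr k r s1 i x - s_derr k r s0 i x) by apply: bmB; exact: bm_derr.
  have u2 := upw_bound hm (fun i x => s_err k r s1 i x - s_err k r s0 i x) bde Ci0 inv1 ler01 bg1 g1le sz.
  have G0 : 0 <= 6 * K * (nd + (M + 1) * tau).
    by rewrite mulr_ge0 ?addr_ge0 ?mulr_ge0//; slim_lra.
  have u3 := upw_bound hm (zeta (s_p s0) (s_u s0)) bd0 Ci0 inv1 G0 (bmB bg1 bg0) supg sz.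
  move: u2 u3; rewrite -/phi -/(glob N r delta) -/nd => u2 u3.
  have w2 : 1 * (1 + Ci) * vr b N r (fun i x => s_err k r s1 i x - s_err k r s0 i x)
    (fun i x => s_derr k r s1 i x - s_derr k r s0 i x) * nd <= (1 + Ci) * (e * tau) * nd.
    by rewrite mul1r; apply: ler_wpM2r => //; apply: ler_wpM2l => //; slim_lra.
  have w3 : 6 * K * (nd + (M + 1) * tau) * (1 + Ci) * vr b N r (zeta (s_p s0) (s_u s0))
    (dzeta (s_p s0) (s_ur s0)) * nd <= 6 * K * (nd + (M + 1) * tau) * (1 + Ci) * (va + e) * nd.
    by apply: ler_wpM2r => //; apply: ler_wpM2l => //; rewrite mulr_ge0//; slim_lra.
  have := le_trans u2 w2; have := le_trans u3 w3; rewrite !ler_norml.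
  move=> /andP[_ w3'] /andP[w2' _]; slim_lra.
have fin : e * tau * nd + ((1 + Ci) * (e * tau) * nd +
    6 * K * (nd + (M + 1) * tau) * (1 + Ci) * (va + e) * nd) +
    Ch * ((nd + e * tau + tau * za) + tau * (5 * (va + e))) * nd <=
    C * nd ^+ 2 + C * (tau * (e + va + za)) * nd.
  exact: delta_estimate_sum.
move: T1 T2 T3 fin; set A := C * _ + _; clearbody A; slim_lra.
Qed.

End TwoSnapshots.

(** * The continuity argument *)

Section RealInduction.
Context {R : realType}.
Implicit Types (t m s e : R).

(** Otherwise the supremum of the times up to which [P] holds would satisfy [P], by the second
    hypothesis, and could be exceeded, by the third. *)
Lemma real_induction (P : R -> Prop) (T : R) : 0 <= T -> P 0 ->
  (forall m, 0 < m <= T -> (forall t, 0 <= t < m -> P t) -> P m) ->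
  (forall m, 0 <= m < T -> (forall t, 0 <= t <= m -> P t) ->
    exists2 e, 0 < e & forall t, m < t < m + e -> t <= T -> P t) ->
  forall t, 0 <= t <= T -> P t.
Proof.
move=> T0 P0 hl hr.
pose E := [set t | 0 <= t <= T /\ forall s, 0 <= s <= t -> P s].
have E0 : E 0.
  by split; [rewrite lexx|move=> s sI; have -> : s = 0 by lra].
have hE : has_sup E by split; [exists 0|exists T => t [] /andP[]].
have m0 : 0 <= sup E by exact: ub_le_sup (proj2 hE) _ E0.
have mT : sup E <= T by apply: ge_sup; [exists 0|move=> t [] /andP[]].
have below t : 0 <= t < sup E -> P t.
  move=> tI; have e0 : 0 < sup E - t by lra.
  have [s [sI Ps] st] := sup_adherent e0 hE.
  by apply: Ps; lra.
have Pm : P (sup E).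
  have [<-|m0'] := eqVneq 0 (sup E); first exact: P0.
  by apply: hl => //; rewrite mT andbT lt_neqAle m0' m0.
have upto t : 0 <= t <= sup E -> P t.
  move=> tI; have [->//|tm] := eqVneq t (sup E); apply: below.
  by rewrite lt_neqAle tm; lra.
have [mT'|mT'] := ltP (sup E) T; last by move=> t tI; apply: upto; lra.
have [|e e0 he] := hr (sup E) _ upto; first by lra.
have em : E (Num.min T (sup E + e / 2)).
  split; first by rewrite ge_min lexx le_min; lra.
  move=> s /andP[s0]; rewrite le_min => /andP[sT se].
  by have [sm|sm] := leP s (sup E); [apply: upto; lra|apply: he; lra].
have := ub_le_sup (proj2 hE) em; rewrite leNgt lt_min; lra.
Qed.

(** Heine's theorem by real induction: a modulus on [[0, m]] is extended by continuity at [m]. *)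
Lemma uniform_cts (f : R -> R) (T e : R) : 0 <= T -> {within `[0, T], continuous f} -> 0 < e ->
  exists2 d, 0 < d & forall s t, 0 <= s -> s <= t -> t <= T -> t - s <= d -> `|f t - f s| <= e.
Proof.
move=> T0 cf e0; have e2 : 0 < e / 2 by rewrite divr_gt0.
pose P m := exists2 d, 0 < d & forall s t, 0 <= s -> s <= t -> t <= m -> t - s <= d ->
  `|f t - f s| <= e.
suff : P T by [].
have near m : 0 <= m <= T -> exists2 d, 0 < d & forall s t, 0 <= s <= T -> 0 <= t <= T ->
    `|s - m| < d -> `|t - m| < d -> `|f t - f s| <= e.
  move=> mI; have [d d0 h] := within_eps cf mI e2; exists d => // s t sI tI sm tm.
  have := h s sI sm; have := h t tI tm; rewrite !ler_norml; slim_lra.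
apply: (@real_induction P T) => //; last by rewrite T0 lexx.
- exists 1 => [|s t s0 st t0 _]; first exact: ltr01.
  by rewrite (_ : t = s) ?subrr ?normr0 ?ltW//; slim_lra.
- move=> m mI ih; have [|d d0 h] := near m; first by slim_lra.
  have [|d1 d10 h1] := ih (Num.max 0 (m - d / 2)).
    by rewrite le_max lexx gt_max; slim_lra.
  exists (Num.min d1 (d / 2)); first by rewrite lt_min d10; slim_lra.
  move=> s t s0 st tm; rewrite le_min => /andP[ts1 ts2].
  have [tl|] := leP t (Num.max 0 (m - d / 2)); first exact: h1.
  by rewrite gt_max => /andP[_ tg]; apply: h; rewrite ?ltr_norml; slim_lra.
- move=> m mI ih; have [|d d0 h] := near m; first by slim_lra.
  have [|d1 d10 h1] := ih m; first by slim_lra.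
  exists d => // t' tI tT; exists (Num.min d1 d); first by rewrite lt_min d10.
  move=> s t s0 st tt; rewrite le_min => /andP[ts1 ts2].
  have [tm|tm] := leP t m; first exact: h1.
  by apply: h; rewrite ?ltr_norml; slim_lra.
Qed.

(** The gap between 1/2 and 1 is spent in two quarters: continuity from the left gives 3/4 at the
    end of an interval where the bound holds, and continuity to the right keeps it below 1 a little
    further. *)
Lemma continuation (V : R -> R) (T : R) : 0 <= T -> {within `[0, T], continuous V} -> V 0 <= 2^-1 ->
  (forall t1, 0 < t1 <= T -> (forall s, 0 < s < t1 -> V s <= 1) ->
    forall s, 0 < s < t1 -> V s <= 2^-1) ->
  forall s, 0 <= s <= T -> V s <= 1.
Proof.
move=> T0 cV V0 hV.
have e4 : 0 < 4^-1 :> R by rewrite invr_gt0.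
have left m : 0 < m <= T -> (forall t, 0 <= t < m -> V t <= 1) -> V m <= 3 / 4.
  move=> mI h; have [|d d0 hd] := within_eps cV (_ : 0 <= m <= T) e4; first by slim_lra.
  have dm : 0 < Num.min d m by rewrite lt_min d0; slim_lra.
  have dd : Num.min d m <= d by rewrite ge_min lexx.
  have dm' : Num.min d m <= m by rewrite ge_min lexx orbT.
  set c := Num.min d m in dm dd dm'.
  have h1 := hV m mI (fun s sI => h s (ltac:(slim_lra))) (m - c / 2) (ltac:(slim_lra)).
  have := hd (m - c / 2) (ltac:(slim_lra)); rewrite ltr_norml ler_norml => h2.
  have := h2 (ltac:(slim_lra)); slim_lra.
apply: real_induction => //; first by slim_lra.
- by move=> m mI ih; have := left m mI ih; slim_lra.
- move=> m mI ih; have Vm : V m <= 3 / 4.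
    have [->|m0] := eqVneq m 0; first by slim_lra.
    apply: left; first by rewrite lt_neqAle eq_sym m0; slim_lra.
    by move=> t tI; apply: ih; slim_lra.
  have [|d d0 hd] := within_eps cV (_ : 0 <= m <= T) e4; first by slim_lra.
  exists d => // t tI tT; have := hd t (ltac:(slim_lra)); rewrite ltr_norml ler_norml => h2.
  have := h2 (ltac:(slim_lra)); slim_lra.
Qed.

End RealInduction.

Section Continuation.
Context {R : realType} (b : R) (hb : 0 < b) (N : nat) (r : nat -> R).
Hypothesis hm : is_mesh b N r.
Context (n : nat).

Let nq (q : nat -> {poly R}) := nn 0 b (glob N r q).

Lemma ip_sqrt q : Num.sqrt (ip N r q q) = nq q.
Proof. by rewrite (ip_nn hm) sqrtr_sqr ger0_norm// nn_ge0. Qed.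

Lemma ip_gronwall (q dq : R -> nat -> {poly R}) (K e t1 : R) : 0 <= t1 -> 0 <= K -> 0 <= e ->
  (forall t i, 0 <= t <= t1 -> (i < N)%N -> (size (q t i) <= n)%N) ->
  (forall t i, 0 < t < t1 -> (i < N)%N -> (size (dq t i) <= n)%N) ->
  (forall i j, (i < N)%N -> {within `[0, t1], continuous (fun s => (q s i)`_j)}) ->
  (forall t i j, 0 < t < t1 -> (i < N)%N -> is_derive t 1 (fun s => (q s i)`_j) (dq t i)`_j) ->
  (forall t, 0 < t < t1 -> ip N r (dq t) (q t) <= K * nq (q t) ^+ 2 + e * nq (q t)) ->
  nq (q t1) <= (nq (q 0) + e * t1) * expR (K * t1).
Proof.
move=> t10 K0 e0 sq sdq cq hd hq.
have := @gronwall _ (fun t => ip N r (q t) (q t)) (fun t => 2 * ip N r (dq t) (q t)) K e t1 t10 K0 e0.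
rewrite !ip_sqrt; apply.
- by apply: (ip_within (n := n)) => // s i sI iN; exact: sq.
- by move=> t _; rewrite (ip_nn hm) sqr_ge0.
- move=> t tI; apply: (@ip_derive _ N r n).
  + exists (Num.min t (t1 - t)) => /=; first by rewrite lt_min; lra.
    move=> s /=; rewrite lt_min !ltr_norml => sI i iN; apply: sq => //; lra.
  + by move=> i iN; split; [apply: sq => //; lra|exact: sdq].
  + by move=> i j iN; exact: hd.
- move=> t tI; have := hq t tI; rewrite ip_sqrt (ip_nn hm) -/(nq _); lra.
Qed.

End Continuation.

Lemma globB {R : realType} (N : nat) (r : nat -> R) (p q : nat -> {poly R}) x :
  glob N r (fun i => p i - q i) x = glob N r p x - glob N r q x.
Proof.
by rewrite /glob /pw -sumrB; apply: eq_bigr => i _; rewrite hornerD hornerN; ring.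
Qed.

Lemma nn_globB {R : realType} (b : R) (N : nat) (r : nat -> R) (p q : nat -> {poly R}) :
  nn 0 b (glob N r (fun i => p i - q i)) <= nn 0 b (glob N r p) + nn 0 b (glob N r q).
Proof.
apply: le_trans (nnB (bm_glob _ _ _ p) (bm_glob _ _ _ q)).
by rewrite (@eq_nn _ 0 b _ (fun x => glob N r p x - glob N r q x))// => x _; exact: globB.
Qed.

Lemma within_shift {R : realType} (T s t1 : R) (f : R -> R) : 0 <= s -> s + t1 <= T ->
  {within `[0, T], continuous f} -> {within `[0, t1], continuous (fun v => f (s + v))}.
Proof.
move=> s0 sT cf; apply: eps_within => x e xI e0.
have [|d d0 hd] := within_eps cf (_ : 0 <= s + x <= T) e0; first by lra.
exists d => // y yI yx; apply: hd; first by lra.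
by rewrite (_ : s + y - _ = y - x)//; ring.
Qed.

(** * The closing argument, for an abstract family of errors *)

Section Bootstrap.
Context {R : realType} (b : R) (N : nat) (r : nat -> R).
Hypothesis hm : is_mesh b N r.
Context (n : nat) (T : R) (hT : 0 < T) (d dd : R -> nat -> {poly R}) (V : R -> R) (C1 e1 e2 : R).

Let nq (q : nat -> {poly R}) := nn 0 b (glob N r q).

(** In the four constants, [gronwall_cst] is the growth rate of [|d|] in units of [e1], [source_cst]
    the source in the inequality for time differences in units of [tau e2], [rate_cst] the bound on
    [|d_t|] in units of [e2], and [smallness_cst] what [e2] must compensate for the bound on [V] to
    improve to 1/2. *)
Definition gronwall_cst : R := C1 * expR (C1 * T).
Definition source_cst : R := C1 * (1 + 3 * C1 + C1 * (gronwall_cst * T) + gronwall_cst * T).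
Definition rate_cst : R := (gronwall_cst + source_cst * T) * expR ((C1 + C1 ^+ 2) * T) + 1.
Definition smallness_cst : R := C1 * (rate_cst + gronwall_cst * T + 2) + gronwall_cst * T + 1.

Hypotheses (C10 : 0 <= C1) (e10 : 0 <= e1) (e12 : e1 <= e2) (e20 : 0 < e2).
Hypothesis sd : forall t i, 0 <= t <= T -> (i < N)%N -> (size (d t i) <= n)%N.
Hypothesis sdd : forall t i, 0 < t < T -> (i < N)%N -> (size (dd t i) <= n)%N.
Hypothesis cd : forall i j, (i < N)%N -> {within `[0, T], continuous (fun s => (d s i)`_j)}.
Hypothesis hd : forall t i j, 0 < t < T -> (i < N)%N -> is_derive t 1 (fun s => (d s i)`_j) (dd t i)`_j.
Hypothesis udd : forall e, 0 < e -> exists2 h, 0 < h & forall s t, 0 < s -> s <= t -> t < T ->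
  t - s <= h -> nq (fun i => dd t i - dd s i) <= e.
Hypothesis d0 : nq (d 0) = 0.
Hypothesis cV : {within `[0, T], continuous V}.
Hypothesis V0 : V 0 <= 2^-1.
Hypothesis hM : forall t, 0 < t < T -> V t <= 1 ->
  ip N r (dd t) (d t) <= C1 * nq (d t) ^+ 2 + C1 * e1 * nq (d t).
Hypothesis hV : forall t, 0 < t < T -> V t <= 1 -> V t <= C1 * (nq (dd t) + nq (d t) + e1 + e2).
Hypothesis hD : forall s t, 0 < s -> s <= t -> t < T -> V s <= 1 -> V t <= 1 -> nq (d s) + e2 <= 1 ->
  ip N r (fun i => dd t i - dd s i) (fun i => d t i - d s i) <=
  C1 * nq (fun i => d t i - d s i) ^+ 2 +
  C1 * ((t - s) * (e2 + V s + nq (d s))) * nq (fun i => d t i - d s i).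
Hypothesis small : smallness_cst * e2 <= 2^-1.

Let C40 : 0 <= gronwall_cst. Proof. by rewrite mulr_ge0// expR_ge0. Qed.
Let C4T : 0 <= gronwall_cst * T. Proof. by rewrite mulr_ge0// ltW. Qed.
Let C70 : 0 <= source_cst.
Proof. by apply: mulr_ge0 => //; rewrite !addr_ge0// mulr_ge0. Qed.
Let C80 : 0 <= rate_cst.
Proof. by rewrite addr_ge0// mulr_ge0 ?expR_ge0// addr_ge0// mulr_ge0// ltW. Qed.

Let expT K t : 0 <= K -> t <= T -> expR (K * t) <= expR (K * T).
Proof. by move=> K0 tT; rewrite ler_expR; apply: ler_wpM2l. Qed.

Lemma boot_error t1 : 0 <= t1 <= T -> (forall s, 0 < s < t1 -> V s <= 1) ->
  nq (d t1) <= gronwall_cst * e1 * t1.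
Proof.
move=> tI hs; have C1e : 0 <= C1 * e1 by exact: mulr_ge0.
have t10 : 0 <= t1 by case/andP: tI. have t1T : t1 <= T by case/andP: tI.
have := @ip_gronwall _ b N r hm n d dd C1 (C1 * e1) t1 t10 C10 C1e.
rewrite -!/(nq _) d0 add0r => h; apply: le_trans (h _ _ _ _ _) _.
- by move=> t i sI iN; apply: sd => //; lra.
- by move=> t i sI iN; apply: sdd => //; lra.
- by move=> i j iN; apply: within_sub (lexx _) t1T _; exact: cd.
- by move=> t i j sI iN; apply: hd => //; lra.
- by move=> t sI; apply: hM; [lra|exact: hs].
have -> : gronwall_cst * e1 * t1 = C1 * e1 * t1 * expR (C1 * T) by rewrite /gronwall_cst; ring.
by apply: ler_wpM2l; [exact: mulr_ge0|exact: expT].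
Qed.

Let boot_n s t1 : 0 < s < t1 -> t1 <= T -> (forall s, 0 < s < t1 -> V s <= 1) ->
  nq (d s) <= gronwall_cst * T * e2.
Proof.
move=> sI tT hs; apply: le_trans (boot_error _ _) _; [lra| |].
  by move=> s' s'I; apply: hs; lra.
have h1 : gronwall_cst * e1 * s <= gronwall_cst * e1 * T.
  by apply: ler_wpM2l; [exact: mulr_ge0|lra].
have h2 : gronwall_cst * T * e1 <= gronwall_cst * T * e2 by exact: ler_wpM2l.
lra.
Qed.

(* The mean value inequality, from Gronwall's with a zero constant. *)
Let boot_mv s tau e : 0 < s -> 0 < tau -> s + tau < T -> 0 <= e ->
  (forall t, s <= t -> t <= s + tau -> nq (fun i => dd t i - dd s i) <= e) ->
  tau * nq (dd s) <= nq (fun i => d (tau + s) i - d s i) + e * tau.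
Proof.
move=> s0 tau0 sT e0 he.
pose q v i := d (s + v) i - d s i - v *: dd s i.
pose dq v i := dd (s + v) i - dd s i.
have h : nq (q tau) <= e * tau.
  have := @ip_gronwall _ b N r hm n q dq 0 e tau (ltW tau0) (lexx _) e0.
  have q0 : nq (q 0) = 0.
    rewrite /nq (@eq_nn _ 0 b _ (fun x => 0 * x)) ?nnZ ?normr0 ?mul0r//; first exact: bm_id.
    move=> x _; rewrite mul0r /glob /pw big1// => i _.
    by rewrite /q addr0 subrr scale0r subr0 horner0 mulr0.
  rewrite -!/(nq _) q0 add0r mul0r expR0 mulr1; apply.
  - move=> t i tI iN; apply: leq_trans (size_polyD _ _) _; rewrite geq_max size_polyN.
    apply/andP; split; last by apply: leq_trans (size_scale_leq _ _) _; apply: sdd => //; lra.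
    apply: leq_trans (size_polyD _ _) _; rewrite geq_max size_polyN !sd//; lra.
  - move=> t i tI iN; apply: leq_trans (size_polyD _ _) _; rewrite geq_max size_polyN !sdd//; lra.
  - move=> i j iN; rewrite (_ : (fun v => _) = (fun v => ((d (s + v) i)`_j - (d s i)`_j) - v * (dd s i)`_j)).
      apply: withinB; last by apply/lip_cont/lipM; [exact: lip_id|exact: lip_cst].
      apply: withinB; last exact/lip_cont/lip_cst.
      apply: (@within_shift _ T _ _ (fun v => (d v i)`_j)); [lra|lra|exact: cd].
    by apply/funext => v; rewrite /q !coefB coefZ.
  - move=> t i j tI iN.
    have d1 : is_derive t 1 (fun v => (d (s + v) i)`_j) (dd (s + t) i)`_j.
      have tI' : 0 < s + t < T by lra.
      exact: drv_shift (hd j tI' iN).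
    have d2 := drvM (drv_id t) (drv_cst t (dd s i)`_j).
    have -> : (fun v => (q v i)`_j) = (fun v => (d (s + v) i)`_j - (d s i)`_j - v * (dd s i)`_j).
      by apply/funext => v; rewrite /q !coefB coefZ.
    by apply: drv_eq (drvB (drvB d1 (drv_cst t (d s i)`_j)) d2) _; rewrite /dq coefB; ring.
  - move=> t tI; rewrite mul0r add0r; apply: le_trans (ler_norm _) _.
    apply: le_trans (ip_le hm _ _) _; apply: ler_wpM2r; first exact: nn_ge0.
    by apply: he; lra.
rewrite [tau + s]addrC; have -> : tau * nq (dd s) = nq (fun i => (d (s + tau) i - d s i) + - q tau i).
  have -> : tau = `|tau| by rewrite gtr0_norm.
  rewrite /nq -nnZ; last exact: bm_glob.
  apply: eq_nn => x _; rewrite /glob /pw mulr_sumr; apply: eq_bigr => i _.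
  by rewrite /q gtr0_norm// !(hornerD, hornerN, hornerZ); ring.
apply: le_trans (nn_globD _ _ _ _ _) _; rewrite -!/(nq _) lerD2l.
suff -> : nq (fun i => - q tau i) = nq (q tau) by [].
rewrite /nq (@eq_nn _ 0 b _ (fun x => -1 * glob N r (q tau) x)).
  by rewrite nnZ ?normrN1 ?mul1r//; exact: bm_glob.
by move=> x _; rewrite /glob /pw mulr_sumr; apply: eq_bigr => i _; rewrite hornerN; ring.
Qed.

(** Gronwall's inequality is applied to [d (tau + v) - d v], for fixed [tau]. It starts at
    O([tau e2]) because [d] vanishes at time 0, so dividing by [tau] leaves a bound independent of
    [tau], and the mean value inequality turns it into a bound on [d_t]. *)
Lemma boot_dd s t1 : 0 < s < t1 -> t1 <= T -> (forall s, 0 < s < t1 -> V s <= 1) ->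
  nq (dd s) <= rate_cst * e2.
Proof.
move=> sI tT hs; have [h h0 uh] := udd e20.
(* Over a time [tau] the derivative [d_t] varies by at most [e2], so difference quotients stand for
   derivatives up to [e2]. *)
have [tau [tau0 tauh taut]] : exists tau, [/\ 0 < tau, tau <= h & s + tau < t1].
  exists (Num.min h ((t1 - s) / 2)).
  rewrite lt_min ge_min lexx h0; split => //; first by lra.
  have : Num.min h ((t1 - s) / 2) <= (t1 - s) / 2 by rewrite ge_min lexx orbT.
  lra.
have mv v : 0 < v <= s -> nq (dd v) <= nq (fun i => d (tau + v) i - d v i) / tau + e2.
  move=> vI; rewrite -(ler_pM2l tau0) mulrDr mulrCA mulfV ?gt_eqF// mulr1 [tau * e2]mulrC.
  apply: boot_mv; [lra|by []|lra|exact: ltW|].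
  by move=> t h1 h2; apply: uh; lra.
pose q v i := d (tau + v) i - d v i; pose dq v i := dd (tau + v) i - dd v i.
have C72 : 0 <= source_cst * tau * e2 by apply: mulr_ge0; [exact: mulr_ge0 (ltW _)|exact: ltW].
have K0 : 0 <= C1 + C1 ^+ 2 by rewrite addr_ge0// sqr_ge0.
have s0 : 0 <= s by lra.
have q0 : nq (q 0) <= gronwall_cst * e2 * tau.
  apply: le_trans (nn_globB _ _ _ _ _) _; rewrite -!/(nq _) d0 !addr0.
  apply: le_trans (boot_error _ _) _; [lra|by move=> v vI; apply: hs; lra|].
  by apply: ler_wpM2r; [exact: ltW|exact: ler_wpM2l].
have h1 : nq (q s) <= (nq (q 0) + source_cst * tau * e2 * s) * expR ((C1 + C1 ^+ 2) * s).
  apply: (@ip_gronwall _ b N r hm n q dq) => //.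
  - move=> t i tI iN; apply: leq_trans (size_polyD _ _) _; rewrite geq_max size_polyN !sd//; lra.
  - move=> t i tI iN; apply: leq_trans (size_polyD _ _) _; rewrite geq_max size_polyN !sdd//; lra.
  - move=> i j iN; rewrite (_ : (fun v => _) = (fun v => (d (tau + v) i)`_j - (d v i)`_j)).
      apply: withinB.
        apply: (@within_shift _ T _ _ (fun v => (d v i)`_j)); [lra|lra|exact: cd].
      apply: (@within_sub _ 0 T); [lra|lra|exact: cd].
    by apply/funext => v; rewrite /q !coefB.
  - move=> t i j tI iN.
    have d1 : is_derive t 1 (fun v => (d (tau + v) i)`_j) (dd (tau + t) i)`_j.
      have tI' : 0 < tau + t < T by lra.
      exact: drv_shift (hd j tI' iN).
    have d2 : is_derive t 1 (fun v => (d v i)`_j) (dd t i)`_j by apply: hd => //; lra.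
    have -> : (fun v => (q v i)`_j) = (fun v => (d (tau + v) i)`_j - (d v i)`_j).
      by apply/funext => v; rewrite /q coefB.
    by apply: drv_eq (drvB d1 d2) _; rewrite /dq coefB.
  - move=> t tI; have n1 : nq (d t) <= gronwall_cst * T * e2 by apply: (boot_n (t1 := t1)) => //; lra.
    have Vt : V t <= 1 by apply: hs; lra.
    have Vt' : V (tau + t) <= 1 by apply: hs; lra.
    have n2 : nq (d t) + e2 <= 1.
      have h2 : 0 <= C1 * (rate_cst + gronwall_cst * T + 2) * e2.
        apply: mulr_ge0; last exact: ltW.
        by apply: mulr_ge0 => //; apply: addr_ge0 => //; exact: addr_ge0.
      by move: small; rewrite /smallness_cst; lra.
    have := hD (ltac:(lra) : 0 < t) (ltac:(lra) : t <= tau + t) (ltac:(lra) : tau + t < T) Vt Vt' n2.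
    rewrite addrK -!/(nq _) -/(q t) -/(dq t) => /le_trans; apply.
    (* The loop closes here: [V] is bounded by [|d_t|], and [|d_t|] by [Q / tau + e2]. As [V]
       carries the factor [tau], the quotient becomes a term in [Q], which Gronwall absorbs with the
       coefficient [C1^2]. *)
    have V1 := hV (ltac:(lra) : 0 < t < T) Vt.
    have m1 := mv t (ltac:(lra)); rewrite -/(q t) in m1.
    set Q := nq (q t) in m1 *; have Q0 : 0 <= Q by exact: nn_ge0.
    set D := nq (dd t) in m1 V1; set n0 := nq (d t) in n1 n2 V1 *.
    have C2 : C1 * (D + n0 + e1 + e2) <= C1 * (Q / tau + e2 + gronwall_cst * T * e2 + e2 + e2).
      by apply: ler_wpM2l => //; have := e12; lra.
    set X := C1 * _ in V1 C2.
    have tQ : 0 <= tau * Q by apply: mulr_ge0 => //; exact: ltW.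
    have step : (tau * Q) * (C1 * (e2 + V t + n0)) <= (tau * Q) * (C1 * (e2 +
      C1 * (Q / tau + e2 + gronwall_cst * T * e2 + e2 + e2) + gronwall_cst * T * e2)).
      by apply: ler_wpM2l => //; apply: ler_wpM2l => //; lra.
    rewrite [X in _ + X](_ : _ = (tau * Q) * (C1 * (e2 + V t + n0))); last by ring.
    rewrite [leRHS](_ : _ = C1 * Q ^+ 2 + (tau * Q) * (C1 * (e2 +
      C1 * (Q / tau + e2 + gronwall_cst * T * e2 + e2 + e2) + gronwall_cst * T * e2))); first by rewrite lerD2l.
    by rewrite /source_cst; field; rewrite gt_eqF.
have m2 := mv s (ltac:(lra)); apply: le_trans m2 _; rewrite -/(q s).
have h2 : nq (q s) <= tau * ((gronwall_cst + source_cst * T) * expR ((C1 + C1 ^+ 2) * T) * e2).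
  apply: le_trans h1 _.
  rewrite [leRHS](_ : _ = (gronwall_cst * e2 * tau + source_cst * tau * e2 * T) * expR ((C1 + C1 ^+ 2) * T)); last by ring.
  apply: ler_pM; rewrite ?expR_ge0//.
  - by apply: addr_ge0; [exact: nn_ge0|exact: mulr_ge0].
  - by apply: lerD => //; apply: ler_wpM2l => //; lra.
  - by apply: expT => //; lra.
have : nq (q s) / tau <= (gronwall_cst + source_cst * T) * expR ((C1 + C1 ^+ 2) * T) * e2.
  by rewrite ler_pdivrMr// [leRHS]mulrC.
by rewrite /rate_cst; lra.
Qed.

(** The parameter [e2] only serves to establish [V <= 1]; once this holds on the whole interval, the
    bound on [d] involves [e1] alone. *)
Lemma bootstrap t : 0 <= t <= T -> nq (d t) <= gronwall_cst * T * e1.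
Proof.
move=> tI; have V1 : forall s, 0 <= s <= T -> V s <= 1.
  apply: continuation cV V0 _ => [|t1 t1I hs s sI]; first exact: ltW.
  have t1T : t1 <= T by lra.
  have n1 := boot_n sI t1T hs; have n2 := boot_dd sI t1T hs.
  have h1 := hV (ltac:(lra) : 0 < s < T) (hs s sI).
  have h2 : C1 * (nq (dd s) + nq (d s) + e1 + e2) <= C1 * (rate_cst * e2 + gronwall_cst * T * e2 + e2 + e2).
    by apply: ler_wpM2l => //; have := e12; lra.
  have h3 : 0 <= gronwall_cst * T * e2 by apply: mulr_ge0 => //; exact: ltW.
  by move: small e20; rewrite /smallness_cst; lra.
apply: le_trans (boot_error tI _) _; first by move=> s sI; apply: V1; lra.
rewrite mulrAC; apply: ler_wpM2r => //; apply: ler_wpM2l => //; lra.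
Qed.

End Bootstrap.

Lemma finite_delta {R : realType} (P : nat -> R -> Prop) (n : nat) :
  (forall i d d', 0 < d' -> d' <= d -> P i d -> P i d') ->
  (forall i, (i < n)%N -> exists2 d, 0 < d & P i d) ->
  exists2 d, 0 < d & forall i, (i < n)%N -> P i d.
Proof.
move=> mono; elim: n => [|n ih] h; first by exists 1.
have [|d d0 hd] := ih; first by move=> i iN; apply: h; exact: ltnW.
have [d' d'0 hd'] := h n (ltnSn n).
have m0 : 0 < Num.min d d' by rewrite lt_min d0.
exists (Num.min d d') => // i; rewrite ltnS leq_eqVlt => /predU1P[->|iN].
  by apply: mono hd'; rewrite // ge_min lexx orbT.
by apply: mono (hd i iN); rewrite // ge_min lexx.
Qed.

(** * Qualitative bounds on a fixed mesh *)

Section BrokenBound.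
Context {R : realType} (b : R) (hb : 0 < b) (N : nat) (r : nat -> R).
Hypothesis hm : is_mesh b N r.
Context (n : nat).

Lemma horner_le (p : {poly R}) m B x : (size p <= m)%N -> 0 <= B -> 0 <= x <= b ->
  (forall j, (j < m)%N -> `|p`_j| <= B) -> `|p.[x]| <= B * \sum_(j < m) b ^+ j.
Proof.
move=> sp B0 xI hB; rewrite (horner_coef_wide _ sp) mulr_sumr.
apply: le_trans (ler_norm_sum _ _ _) _; apply: ler_sum => j _.
rewrite normrM; apply: ler_pM => //; first exact: hB.
by rewrite normrX ger0_norm; [apply: lerXn2r; rewrite ?nnegrE; lra|lra].
Qed.

(** The constant contains the inverse lengths of the cells and so depends on the mesh; it is used to
    transfer continuity from the coefficients to the norms. *)
Lemma broken_bound : exists2 L : R, 0 < L & forall (q : nat -> {poly R}) B, 0 <= B ->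
  (forall i, (i < N)%N -> (size (q i) <= n)%N) ->
  (forall i j, (i < N)%N -> (j < n)%N -> `|(q i)`_j| <= B) ->
  nn 0 b (glob N r q) <= L * B /\ pvr b N r q <= L * B.
Proof.
pose S := \sum_(j < n) b ^+ j; have S0 : 0 <= S by apply: sumr_ge0 => j _; rewrite exprn_ge0// ltW.
pose H := \sum_(i < N) (r i.+1 - r i)^-1.
have Hi i : (i < N)%N -> 0 < (r i.+1 - r i)^-1 by move=> /(mesh_lt hm) h; rewrite invr_gt0; slim_lra.
have H0 : 0 <= H by apply: sumr_ge0 => i _; exact/ltW/Hi.
have Hle i : (i < N)%N -> (r i.+1 - r i)^-1 <= H.
  move=> iN; rewrite /H (bigD1 (Ordinal iN))//= lerDl; apply: sumr_ge0 => j _; exact/ltW/Hi.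
pose A := S + n%:R * S + 2 * S * H.
have nS : 0 <= n%:R * S by rewrite mulr_ge0.
have SH : 0 <= 2 * S * H by rewrite !mulr_ge0.
have A0 : 0 <= A by rewrite /A; slim_lra.
have sb : 0 <= Num.sqrt b by exact: sqrtr_ge0.
exists (A * Num.sqrt b + 1); first by rewrite ltr_wpDl// mulr_ge0.
move=> q B B0 sq hq.
have AB : 0 <= B * A by exact: mulr_ge0.
have up f : nn 0 b f <= (B * A) * Num.sqrt b -> nn 0 b f <= (A * Num.sqrt b + 1) * B.
  by move=> hf; rewrite (_ : (_ + 1) * B = B * A * Num.sqrt b + B); [slim_lra|ring].
have xb i x : (i < N)%N -> r i <= x <= r i.+1 -> 0 <= x <= b by exact: (mesh_in hm).
have qle i x : (i < N)%N -> 0 <= x <= b -> `|(q i).[x]| <= B * S.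
  by move=> iN xI; apply: horner_le => //; [exact: sq|move=> j jn; exact: hq].
have BS : 0 <= B * S by exact: mulr_ge0.
have rle i : (i < N)%N -> 0 <= r i.+1 <= b.
  by move=> iN; apply: (xb i) => //; have := mesh_lt hm iN; slim_lra.
split; apply: up.
  apply: (nn_le_cells hb hm (bm_glob _ _ _ _) AB) => i x iN xI.
  rewrite (globE hm _ iN xI); apply: le_trans (qle i x iN _) _; first by apply: (xb i) => //; slim_lra.
  by apply: ler_wpM2l => //; rewrite /A; slim_lra.
apply: (nn_le_cells hb hm _ AB); first by apply: bm_pw => i; apply: bm_vard => j; exact: bm_poly.
move=> i x iN xI; rewrite (pwE hm _ iN xI) /vard ger0_norm ?addr_ge0//.
have xI' : 0 <= x <= b by apply: (xb i) => //; slim_lra.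
have h1 : `|(deriv (q i)).[x]| <= B * n%:R * S.
  apply: horner_le; rewrite ?mulr_ge0//.
    by apply: leq_trans (size_poly _ _) _; apply: leq_trans (leq_pred _) (sq i iN).
  move=> j jn; rewrite coef_deriv normrMn.
  have [jn'|jn'] := ltnP j.+1 n; last first.
    rewrite nth_default ?normr0 ?mul0rn ?mulr_ge0//.
    exact: leq_trans (sq i iN) _.
  rewrite -[leLHS]mulr_natr; apply: ler_pM => //; first exact: hq.
  by rewrite ler_nat ltnW.
have h2 : `|jmp N r (fun i x => (q i).[x]) i| <= 2 * (B * S).
  rewrite /jmp; apply: le_trans (ler_normB _ _) _; rewrite mulrDl !mul1r; apply: lerD.
    by case: ifP => iN'; [apply: qle => //; exact: rle|rewrite normr0].
  by apply: qle => //; exact: rle.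
have h3 : `|jmp N r (fun i x => (q i).[x]) i / (r i.+1 - r i)| <= 2 * (B * S) * H.
  rewrite normrM [X in _ * X]gtr0_norm ?Hi//.
  by apply: ler_pM => //; [exact/ltW/Hi|exact: Hle].
rewrite /A; slim_lra.
Qed.

Lemma broken_unif (q : R -> nat -> {poly R}) (D : R -> R -> Prop) :
  (forall s t i, D s t -> (i < N)%N -> (size (q s i) <= n)%N /\ (size (q t i) <= n)%N) ->
  (forall i j e, (i < N)%N -> 0 < e -> exists2 h, 0 < h & forall s t, D s t -> `|t - s| <= h ->
    `|(q t i)`_j - (q s i)`_j| <= e) ->
  forall e, 0 < e -> exists2 h, 0 < h & forall s t, D s t -> `|t - s| <= h ->
    nn 0 b (glob N r (fun i => q t i - q s i)) <= e /\ pvr b N r (fun i => q t i - q s i) <= e.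
Proof.
move=> sq hq e e0; have [L L0 hL] := broken_bound.
have eL : 0 < e / L by rewrite divr_gt0.
pose P i h := forall j, (j < n)%N -> forall s t, D s t -> `|t - s| <= h ->
  `|(q t i)`_j - (q s i)`_j| <= e / L.
have [|i iN|h h0 hh] := @finite_delta R P N.
- by move=> i d d' _ dd' hP j jn s t st ts; apply: hP => //; lra.
- apply: (@finite_delta R (fun j h => forall s t, D s t -> `|t - s| <= h -> _)) => [j d d' _ dd' hP|j jn].
    by move=> s t st ts; apply: hP => //; lra.
  exact: hq.
exists h => // s t st ts.
have -> : e = L * (e / L) by rewrite mulrCA mulfV ?mulr1// gt_eqF.
apply: hL; first exact: ltW.
- move=> i iN; apply: leq_trans (size_polyD _ _) _; rewrite geq_max size_polyN.
  by have [-> ->] := sq s t i st iN.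
- by move=> i j iN jn; rewrite coefB; exact: hh.
Qed.

End BrokenBound.

Lemma eq_vr {R : realType} (b : R) (N : nat) (r : nat -> R) v dv v' dv' :
  (forall i x, (i < N)%N -> v i x = v' i x) -> (forall i x, (i < N)%N -> dv i x = dv' i x) ->
  vr b N r v dv = vr b N r v' dv'.
Proof.
move=> hv hdv; apply: eq_nn => x _; apply: eq_bigr => i _.
rewrite /vard /jmp (hdv _ _ (ltn_ord i)) (hv _ _ (ltn_ord i)).
by case: ifP => // iN; rewrite hv.
Qed.

Lemma eq_glob {R : realType} (N : nat) (r : nat -> R) (p q : nat -> {poly R}) x :
  (forall i, (i < N)%N -> p i = q i) -> glob N r p x = glob N r q x.
Proof. by move=> pq; apply: eq_bigr => i _; rewrite pq. Qed.

(** * Application to the exact solution and the scheme *)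

Section Snapshots.
Context {R : realType} (k : nat) (hk : (1 <= k)%N) (b T C : R) (hb : 0 < b) (hT : 0 < T).
Context (u ur ut : R -> R -> R).
Hypothesis rs : regular_solution k b T C u ur ut.

Let C0 : 0 <= C := reg_C rs.

Lemma reg_aa_le t x : 0 < t < T -> 0 <= x <= b -> `|aa (u t) x| <= C.
Proof.
move=> tI xI; apply: (@aa_lip _ b) => //; first by apply/cb_bm/(reg_cb_u rs); lra.
move=> y z yI zI; have [yz|zy] := leP y z.
  by rewrite distrC [`|y - z|]distrC (ger0_norm (_ : 0 <= z - y)); [apply: (reg_lip rs)|]; lra.
by rewrite (ger0_norm (_ : 0 <= y - z)); [apply: (reg_lip rs)|]; lra.
Qed.

Lemma reg_adm t : 0 < t < T -> adm b (u t).
Proof.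
move=> tI; apply: (@adm_bounded _ _ _ C) => //; first by apply/cb_bm/(reg_cb_u rs); lra.
by move=> x xI; apply: reg_aa_le => //; lra.
Qed.

Definition snap (p dp : R -> nat -> {poly R}) (tr : R -> traces R) (Ub : R -> R) (t : R) : snapshot :=
  Snapshot (u t) (ur t) (ut t) (p t) (dp t) (tr t) (Ub t).

(** The time increment of a projection error is the projection error of the increment, whose
    derivative has a Hoelder constant proportional to [t - s]. Values are of order [h^(k+1)];
    variations and increments in time are bounded at the order [sqrt h], the modulus over a cell. *)
Lemma projection_bounds : exists2 A : R, 0 < A & forall (N : nat) (r : nat -> R) p dp tr Ub,
  is_mesh b N r -> let S := snap p dp tr Ub in let h := mesh_size N r in
  [/\ forall t, 0 <= t <= T -> nn 0 b (s_E k N r (S t)) <= A * h ^+ k.+1,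
      forall t, 0 < t < T -> nn 0 b (s_Et k N r (S t)) <= A * h ^+ k.+1 /\
        vr b N r (s_err k r (S t)) (s_derr k r (S t)) <= A * Num.sqrt h &
      forall s t, 0 < s -> s <= t -> t < T ->
        [/\ vr b N r (fun i x => s_err k r (S t) i x - s_err k r (S s) i x)
              (fun i x => s_derr k r (S t) i x - s_derr k r (S s) i x) <= A * Num.sqrt h * (t - s),
            nn 0 b (fun x => s_E k N r (S t) x - s_E k N r (S s) x) <= A * Num.sqrt h * (t - s) &
            nn 0 b (fun x => s_Et k N r (S t) x - s_Et k N r (S s) x) <= A * Num.sqrt h * (t - s)]].
Proof.
have [A1 A10 h1] := proj_error hk hb hT rs; have [A2 A20 h2] := proj_error_t hk hb hT rs.
have [A3 A30 h3] := vr_proj hk hb; have [A4 A40 h4] := @nn_proj_osc R k b hb.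
have sb : 0 <= Num.sqrt b by exact: sqrtr_ge0.
have A1b : 0 <= A1 * Num.sqrt b by rewrite mulr_ge0// ltW.
have A3C : 0 <= A3 * C by rewrite mulr_ge0// ltW.
have A4C : 0 <= A4 * C by rewrite mulr_ge0// ltW.
exists (A1 * Num.sqrt b + A2 + A3 * C + A4 * C); first by slim_lra.
move=> N r p dp tr Ub hm S h; set A := _ + _ * C.
have h0 : 0 <= h by exact: mesh_size_ge0.
have hk0 : 0 <= h ^+ k.+1 by exact: exprn_ge0.
have sh : 0 <= Num.sqrt h by exact: sqrtr_ge0.
have cu t : 0 <= t <= T -> cb 0 b (u t) by exact: (reg_cb_u rs).
have lin s t x : 0 < s -> s <= t -> t < T ->
    s_E k N r (S t) x - s_E k N r (S s) x =
    (u t x - u s x) - glob N r (gproj k r (fun y => u t y - u s y)) x /\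
    s_Et k N r (S t) x - s_Et k N r (S s) x =
    (ut t x - ut s x) - glob N r (gproj k r (fun y => ut t y - ut s y)) x.
  move=> s0 st tT; rewrite /s_E /s_Et /s_q /s_qt /=.
  split.
    rewrite (@eq_glob _ N r (gproj k r (fun y => u t y - u s y)) (fun i => gproj k r (u t) i - gproj k r (u s) i)).
      by rewrite globB; ring.
    by move=> i iN; apply: (proj_sub k hm) => //; apply: cu; slim_lra.
  rewrite (@eq_glob _ N r (gproj k r (fun y => ut t y - ut s y)) (fun i => gproj k r (ut t) i - gproj k r (ut s) i)).
    by rewrite globB; ring.
  by move=> i iN; apply: (proj_sub k hm) => //; apply: (reg_cb_ut rs); slim_lra.
split.
- move=> t tI; apply: (@le_trans _ _ (A1 * h ^+ k.+1 * Num.sqrt b)).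
    have Ah : 0 <= A1 * h ^+ k.+1 by rewrite mulr_ge0// ltW.
    have bE : bm 0 b (s_E k N r (S t)) by apply: bmB; [exact/cb_bm/cu|exact: bm_glob].
    apply: (nn_le_cells hb hm bE Ah) => i x iN xI.
    rewrite /s_E (globE hm _ iN xI); apply: le_trans (h1 N r hm t tI i x iN _) _; first by slim_lra.
    apply: ler_wpM2l; first exact: ltW.
    have ri := mesh_lt hm iN.
    by apply: lerXn2r; rewrite ?nnegrE; [slim_lra|slim_lra|exact: mesh_size_ge].
  by rewrite mulrAC; apply: ler_wpM2r => //; rewrite /A; slim_lra.
- move=> t tI; split.
    apply: le_trans (h2 N r hm t tI) _; apply: ler_wpM2r => //; rewrite /A; slim_lra.
  have [[_ hh _ _] _] := reg_gd0 rs tI.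
  have [hv _] := h3 N r (u t) (ur t) C hm C0 (cu t (ltac:(slim_lra))) (reg_prim rs tI) hh.
  by apply: le_trans hv _; apply: ler_wpM2r => //; rewrite /A; slim_lra.
move=> s t s0 st tT; have [[_ _ _ hh] [_ _ _ hh']] := reg_gd rs s0 st tT.
have Cts : 0 <= C * (t - s) by rewrite mulr_ge0//; slim_lra.
have cts : cb 0 b (fun x => u t x - u s x) by apply: cbB; apply: cu; slim_lra.
have pts : prim 0 b (fun x => u t x - u s x) (fun x => ur t x - ur s x).
  by apply: primB; apply: (reg_prim rs); slim_lra.
have [hv hn] := h3 N r _ _ _ hm Cts cts pts hh.
have fin a X : a <= A -> X <= a * (t - s) * Num.sqrt h -> X <= A * Num.sqrt h * (t - s).
  move=> aA /le_trans; apply; rewrite mulrAC.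
  by apply: ler_wpM2r; [slim_lra|exact: ler_wpM2r].
split.
- apply: (fin (A3 * C)); first by rewrite /A; slim_lra.
  rewrite -(mulrA A3); apply: le_trans hv; rewrite le_eqVlt; apply/orP; left; apply/eqP.
  have E i : (i < N)%N -> gproj k r (fun y => u t y - u s y) i = gproj k r (u t) i - gproj k r (u s) i.
    by move=> iN; apply: (proj_sub k hm) => //; apply: cu; slim_lra.
  apply: eq_vr => i x iN.
    by rewrite /s_err /err E// hornerD hornerN /=; ring.
  by rewrite /s_derr /derr E// derivB hornerD hornerN /=; ring.
- apply: (fin (A3 * C)); first by rewrite /A; slim_lra.
  rewrite -(mulrA A3); apply: le_trans hn; rewrite le_eqVlt; apply/orP; left; apply/eqP.
  by apply: eq_nn => x _; have [] := lin s t x s0 st tT.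
- apply: (fin (A4 * C)); first by rewrite /A; slim_lra.
  rewrite -(mulrA A4); apply: le_trans (h4 N r _ _ hm Cts hh'); rewrite le_eqVlt; apply/orP; left; apply/eqP.
  by apply: eq_nn => x _; have [] := lin s t x s0 st tT.
Qed.

End Snapshots.

Section Scheme.
Context {R : realType} (k : nat) (hk : (1 <= k)%N) (b T C : R) (hb : 0 < b) (hT : 0 < T).
Context (u ur ut : R -> R -> R).
Hypothesis rs : regular_solution k b T C u ur ut.
Context (N : nat) (r : nat -> R).
Hypothesis hm : is_mesh b N r.
Context (p dp : R -> nat -> {poly R}) (tr : R -> traces R) (Ub : R -> R).
Hypothesis hC1 : C1_broken_poly T k N p dp.
Hypothesis hs : forall t, t \in `[0, T] ->
  [/\ forall i, (i < N)%N -> local_equation k r (p t) (dp t) (tr t) i,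
      forall i, (i.+1 < N)%N -> transmission r (p t) (tr t) i,
      u_hat (tr t) N = Ub t /\ g_hat (tr t) N = 1 &
      w_hat (tr t) 0%N = 0 /\ z_hat (tr t) 0%N = 0].
Hypothesis hUb : forall t, 0 <= t <= T -> u t b = Ub t.
Hypothesis h0 : forall i, (i < N)%N -> Gauss_Radau k (r i) (r i.+1) (u 0) (p 0 i).

Let C0 : 0 <= C := reg_C rs.
Let S := snap u ur ut p dp tr Ub.
Let d t := s_d k r (S t).
Let dd t := s_dd k r (S t).

Let sp t i : 0 <= t <= T -> (i < N)%N -> (size (p t i) <= k.+1)%N /\ (size (dp t i) <= k.+1)%N.
Proof. by move=> tI iN; have [|h1 h2] := C1_poly hC1 (t := t); [rewrite in_itv|split; [exact: h1|exact: h2]]. Qed.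

Lemma wf_snap M t : C <= M -> 0 < t < T -> wf_snapshot k b N r M (S t).
Proof.
move=> CM tI; have tI' : 0 <= t <= T by lra.
have [h1 h2 [h3 h4] [h5 h6]] : [/\ forall i, (i < N)%N -> local_equation k r (p t) (dp t) (tr t) i,
      forall i, (i.+1 < N)%N -> transmission r (p t) (tr t) i,
      u_hat (tr t) N = Ub t /\ g_hat (tr t) N = 1 &
      w_hat (tr t) 0%N = 0 /\ z_hat (tr t) 0%N = 0] by apply: hs; rewrite in_itv.
split => //=.
- exact: (reg_adm hb rs).
- exact: (reg_cb_u rs).
- exact: (reg_prim rs).
- exact: (reg_cb_ut rs).
- by move=> x xI; have [[h _ _ _] _] := reg_gd0 rs tI; have [h7 _ _] := h x xI; exact: le_trans CM.
- by move=> x xI; apply: le_trans CM; exact: (reg_aa_le hb rs).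
- exact: (reg_rhs rs).
- exact: hUb.
- by move=> i iN; exact: sp.
Qed.

(** By uniqueness of the projection, so that the discrete error starts from exactly 0; the estimate
    of the first time difference relies on this. *)
Lemma initial_error i : (i < N)%N -> d 0 i = 0.
Proof.
move=> iN; have [s0 o0 l0] := h0 iN; have ri := mesh_lt hm iN.
have tI : (0 : R) <= 0 <= T by rewrite lexx ltW.
have c0 : cb (r i) (r i.+1) (u 0) by apply: (cell_cb hm iN); exact: (reg_cb_u rs).
rewrite /d /s_d /s_q /gproj /= (_ : p 0 i = grp k (r i) (r i.+1) (u 0)) ?subrr//.
apply: grp_uniq => // v sv; rewrite -itg_oo; first exact: o0.
apply/bm_ig/bmM; last exact: bm_poly.
by apply: bmB; [exact: bm_poly|exact: cb_bm].
Qed.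

Lemma d_size t i : 0 <= t <= T -> (i < N)%N -> (size (d t i) <= k.+1)%N.
Proof.
move=> tI iN; have [h1 _] := sp tI iN.
by apply: leq_trans (size_polyD _ _) _; rewrite geq_max size_polyN size_grp h1.
Qed.

Lemma dd_size t i : 0 <= t <= T -> (i < N)%N -> (size (dd t i) <= k.+1)%N.
Proof.
move=> tI iN; have [_ h1] := sp tI iN.
by apply: leq_trans (size_polyD _ _) _; rewrite geq_max size_polyN size_grp h1.
Qed.

Lemma d_cont i j : (i < N)%N -> {within `[0, T], continuous (fun t => (d t i)`_j)}.
Proof.
move=> iN; have [h1 _] := C1_cont hC1 j iN.
have [L L0 hL] := proj_coef_lip rs hm iN; have [l1 _] := hL j.
rewrite (_ : (fun t => _) = fun t => (p t i)`_j - (gproj k r (u t) i)`_j); last first.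
  by apply/funext => t; rewrite /d /s_d coefB.
by apply: withinB => //; exact: (lip_within_time L0).
Qed.

Lemma d_derive i j t : (i < N)%N -> 0 < t < T -> is_derive t 1 (fun s => (d s i)`_j) (dd t i)`_j.
Proof.
move=> iN tI; have h1 : is_derive t 1 (fun s => (p s i)`_j) (dp t i)`_j.
  by apply: (C1_derive hC1) => //; rewrite in_itv.
have h2 := proj_coef_derive rs hm j iN tI.
rewrite (_ : (fun t => _) = fun t => (p t i)`_j - (gproj k r (u t) i)`_j); last first.
  by apply/funext => s; rewrite /d /s_d coefB.
by apply: drv_eq (drvB h1 h2) _; rewrite /dd /s_dd coefB.
Qed.

(** The modulus depends on the mesh, which is harmless: it only limits the step of the difference
    quotients, and no bound depends on that step. *)
Lemma dd_unif e : 0 < e -> exists2 h, 0 < h & forall s t, 0 < s -> s <= t -> t < T ->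
  t - s <= h -> nn 0 b (glob N r (fun i => dd t i - dd s i)) <= e.
Proof.
move=> e0; have [||h hh0 hh] := @broken_unif _ b hb N r hm k.+1 dd (fun s t => [/\ 0 < s, s <= t & t < T]) _ _ e e0.
- by move=> s t i [s0 st tT] iN; split; apply: dd_size => //; lra.
- move=> i j e' iN e'0; have [_ h1] := C1_cont hC1 j iN.
  have e2 : 0 < e' / 2 by rewrite divr_gt0.
  have [h hh0 hu] := uniform_cts (ltW hT) h1 e2.
  have [L L0 hL] := proj_coef_lip rs hm iN; have [_ l2] := hL j.
  have L1 : 0 < L + 1 by lra.
  have q0 : 0 < e' / 2 / (L + 1) by rewrite divr_gt0.
  exists (Num.min h (e' / 2 / (L + 1))); first by rewrite lt_min hh0.
  move=> s t [s0 st tT]; rewrite ger0_norm ?subr_ge0// le_min => /andP[ts1 ts2].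
  have a1 := hu s t (ltW s0) st (ltW tT) ts1.
  have a2 : `|(gproj k r (ut t) i)`_j - (gproj k r (ut s) i)`_j| <= e' / 2.
    apply: le_trans (l2 s t s0 st tT) _.
    apply: (@le_trans _ _ ((L + 1) * (e' / 2 / (L + 1)))); last by rewrite mulrCA mulfV ?mulr1// gt_eqF.
    by apply: ler_pM => //; [rewrite subr_ge0|rewrite lerDl].
  rewrite /dd /s_dd !coefB /s_qt /=.
  by move: a1 a2; rewrite !ler_norml; lra.
- by exists h => // s t s0 st tT ts; have [] := hh s t (And3 s0 st tT) (ltac:(rewrite ger0_norm ?subr_ge0)).
Qed.

Lemma pvr_cont : {within `[0, T], continuous (fun t => pvr b N r (d t))}.
Proof.
apply: eps_within => t e tI e0.
have [||h hh0 hh] := @broken_unif _ b hb N r hm k.+1 d (fun s t => 0 <= s <= T /\ 0 <= t <= T) _ _ e e0.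
- by move=> s t' i [sI t'I] iN; split; apply: d_size.
- move=> i j e' iN e'0; have [h hh0 hu] := uniform_cts (ltW hT) (@d_cont i j iN) e'0.
  exists h => // s t' [sI t'I]; have [st|ts] := leP s t'.
    by rewrite ger0_norm ?subr_ge0//; apply: hu; lra.
  move=> th; rewrite distrC; apply: hu; [lra|exact: ltW|lra|].
  by move: th; rewrite distrC gtr0_norm ?subr_gt0.
have sub (z z' : nat -> {poly R}) : pvr b N r z <= pvr b N r z' + pvr b N r (fun i => z' i - z i).
  apply: le_trans (vr_sub _ _ hm _ _); [|by move=> i; exact: bm_poly|by move=> i; exact: bm_poly].
  rewrite le_eqVlt; apply/orP; left; apply/eqP; apply: eq_vr => i w _.
    by rewrite hornerD hornerN; ring.
  by rewrite derivB hornerD hornerN; ring.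
exists h => // s sI st; have st' : `|s - t| <= h by exact: ltW.
have [_ h1] := hh t s (conj tI sI) st'.
have st2 : `|t - s| <= h by rewrite distrC.
have [_ h2] := hh s t (conj sI tI) st2.
have := sub (d s) (d t); have := sub (d t) (d s); rewrite ler_norml; lra.
Qed.

End Scheme.

(** All constants, and with them the threshold on [h], are fixed before the mesh is introduced. *)
Theorem semidiscrete_error {R : realType} (k : nat) (b T C : R) (u ur ut : R -> R -> R) :
  (1 <= k)%N -> 0 < b -> 0 < T -> regular_solution k b T C u ur ut ->
  exists h0 A : R, [/\ 0 < h0, 0 < A & forall (N : nat) (r : nat -> R) p dp tr Ub,
  is_mesh b N r -> mesh_size N r <= h0 -> C1_broken_poly T k N p dp ->
  (forall t, t \in `[0, T] ->
    [/\ forall i, (i < N)%N -> local_equation k r (p t) (dp t) (tr t) i,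
        forall i, (i.+1 < N)%N -> transmission r (p t) (tr t) i,
        u_hat (tr t) N = Ub t /\ g_hat (tr t) N = 1 &
        w_hat (tr t) 0%N = 0 /\ z_hat (tr t) 0%N = 0]) ->
  (forall t, 0 <= t <= T -> u t b = Ub t) ->
  (forall i, (i < N)%N -> Gauss_Radau k (r i) (r i.+1) (u 0) (p 0 i)) ->
  forall t, 0 <= t <= T ->
    nn 0 b (fun x => u t x - glob N r (p t) x) <= A * mesh_size N r ^+ k.+1].
Proof.
move=> hk hb hT rs; have C0 : 0 <= C := reg_C rs.
have [A A0 hA] := projection_bounds hk hb hT rs.
have sb : 0 <= Num.sqrt b by exact: sqrtr_ge0.
have Cb : 0 <= C * Num.sqrt b by exact: mulr_ge0.
(* [nn 0 b (aa (P - u))] is at most 5 times the sum of the energy norms of [d] and of the projection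
   error, each at most 1; the other summand accounts for [u]. *)
pose K := 10 + C * Num.sqrt b; pose M := C + C * Num.sqrt b.
have K0 : 0 <= K by rewrite /K; slim_lra.
have M0 : 0 <= M by rewrite /M; slim_lra.
have CM : C <= M by rewrite /M; slim_lra.
have CbM : C * Num.sqrt b <= M by rewrite /M; slim_lra.
have CbK : C * Num.sqrt b <= K by rewrite /K; slim_lra.
have [Ci Ci0 hi] := @inverse_ineq R k.+1.
have hCi : inverse_cst k Ci by split.
have [CH CH0 hH] := nn_HH hb K0 M0.
have [Cd Cd0 hd] := delta_estimate k hb K0 M0 Ci0.
pose Cg := 16 * (Ci + 1) * expR (b * K ^+ 2) ^+ 2.
have Cg0 : 0 <= Cg by apply: mulr_ge0; [apply: mulr_ge0; slim_lra|exact: sqr_ge0].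
have KC : 0 <= K ^+ 2 * (1 + Ci) by apply: mulr_ge0; [exact: sqr_ge0|slim_lra].
have CgH : 0 <= Cg * CH by apply: mulr_ge0 => //; exact: ltW.
(* A single constant dominating those of the main estimate, of the bound on the energy norm and of
   the estimate of time differences; in the last one, the factor 2 absorbs the L2 norm of the
   projection error into [e2]. *)
pose C1 := 1 + CH + K ^+ 2 * (1 + Ci) + (Cg + Cg * CH) + 2 * Cd.
have C10 : 0 <= C1 by rewrite /C1; slim_lra.
have C1a : CH <= C1 by rewrite /C1; slim_lra.
have C1b : 1 + (CH + K ^+ 2 * (1 + Ci)) <= C1 by rewrite /C1; slim_lra.
have C1c : Cg * (1 + CH) <= C1 by rewrite /C1; slim_lra.
have C1d : 2 * Cd <= C1 by rewrite /C1; slim_lra.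
have C1e : Cd <= C1 by slim_lra.
have CHK : 0 <= CH + K ^+ 2 * (1 + Ci) by slim_lra.
(* With [sqrt h <= q], both [A sqrt h <= 1] and the smallness condition hold. *)
pose q := (2 * ((`|smallness_cst T C1| + 1) * A + A))^-1.
have n9 : 0 <= `|smallness_cst T C1| by [].
have nA : 0 <= `|smallness_cst T C1| * A by apply: mulr_ge0 => //; exact: ltW.
have q0 : 0 < q by rewrite invr_gt0; slim_lra.
exists (Num.min 1 (q ^+ 2)), (gronwall_cst T C1 * T * A + A).
have C40 : 0 <= gronwall_cst T C1 * T by rewrite !mulr_ge0 ?expR_ge0// ltW.
split; first by rewrite lt_min ltr01 exprn_gt0.
  by have := mulr_ge0 C40 (ltW A0); slim_lra.
move=> N r p dp tr Ub hm hh hC1 hs hUb hini.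
have N0 : (0 < N)%N by case: hm => r0 rN _; case: (N) rN => // r0'; move: hb; rewrite -r0' r0 ltxx.
set h := mesh_size N r in hh *.
have hp : 0 < h by have := mesh_lt_h hm N0; rewrite -/h; slim_lra.
move: hh; rewrite le_min => /andP[h1 hq].
have sq : Num.sqrt h <= q by have := ler_wsqrtr hq; rewrite sqrtr_sqr (ger0_norm (ltW q0)).
have s0 : 0 < Num.sqrt h by rewrite sqrtr_gt0.
have hs2 : Num.sqrt h * Num.sqrt h = h by rewrite -expr2 sqr_sqrtr// ltW.
have s1 : Num.sqrt h <= 1 by rewrite -sqrtr1; exact: ler_wsqrtr.
have hk1 : h ^+ k.+1 <= Num.sqrt h.
  apply: (@le_trans _ _ h).
    by rewrite exprS ler_piMr ?exprn_ile1// ltW.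
  by rewrite -{1}hs2 ler_piMr// ltW.
(* The two scales: [e1] gives the rate, and [e2] is the small parameter of the continuity
   argument. *)
pose e1 := A * h ^+ k.+1; pose e2 := A * Num.sqrt h.
have e10 : 0 <= e1 by rewrite mulr_ge0 ?exprn_ge0// ltW.
have e20 : 0 < e2 by exact: mulr_gt0.
have e12 : e1 <= e2 by apply: ler_wpM2l => //; exact: ltW.
have e2q : ((`|smallness_cst T C1| + 1) * A + A) * Num.sqrt h <= 2^-1.
  apply: (@le_trans _ _ (((`|smallness_cst T C1| + 1) * A + A) * q)); first by apply: ler_wpM2l => //; slim_lra.
  by rewrite /q invfM mulrCA mulfV ?mulr1// gt_eqF//; slim_lra.
have nAs : 0 <= `|smallness_cst T C1| * A * Num.sqrt h by apply: mulr_ge0 => //; exact: ltW.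
have As : 0 <= A * Num.sqrt h by exact: ltW.
have e21 : e2 <= 1 by rewrite /e2; slim_lra.
have small : smallness_cst T C1 * e2 <= 2^-1.
  apply: (@le_trans _ _ (`|smallness_cst T C1| * e2)); first by apply: ler_wpM2r (ler_norm _); exact: ltW.
  rewrite /e2; slim_lra.
pose S := snap u ur ut p dp tr Ub.
have [hE hEt hinc] := hA N r p dp tr Ub hm; rewrite -/S -/h -/e1 -/e2 in hE hEt hinc.
have ws t : 0 < t < T -> wf_snapshot k b N r M (S t) by exact: (wf_snap hb rs hC1 hs hUb).
have sup f m : 0 <= m -> bm 0 b f -> (forall x, 0 <= x <= b -> `|f x| <= m) -> nn 0 b f <= m * Num.sqrt b.
  move=> m0 bf fm; rewrite -[X in Num.sqrt X]subr0; apply: nn_sup => //; first exact: ltW.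
  by move=> x /andP[/ltW x0 /ltW xb]; apply: fm; rewrite x0.
have Ku t : 0 < t < T -> nn 0 b (aa (s_u (S t))) <= K.
  move=> tI; apply: le_trans CbK; apply: sup => //; first by case: (reg_adm hb rs tI).
  by move=> x xI; exact: (reg_aa_le hb rs).
have KP t : 0 < t < T -> pvr b N r (s_d k r (S t)) <= 1 -> nn 0 b (aa (s_P N r (S t))) <= K.
  move=> tI V1; have [_ ve] := hEt t tI.
  have aP : adm b (s_P N r (S t)) := adm_glob hb hm _.
  have au : adm b (s_u (S t)) by exact: (reg_adm hb rs).
  have aPu := admB aP au.
  rewrite (@eq_nn _ 0 b _ (fun x => aa (fun y => s_P N r (S t) y - s_u (S t) y) x + aa (s_u (S t)) x)).
    apply: le_trans (nnD (proj2 aPu) (proj2 au)) _.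
    have := nn_aa_sub hb hm (ws t tI).
    have : nn 0 b (aa (s_u (S t))) <= C * Num.sqrt b.
      apply: sup => //; first by case: au.
      by move=> x xI; exact: (reg_aa_le hb rs).
    by move: V1 ve e21; rewrite /K; clear; lra.
  by move=> x xI; rewrite (aaB (proj1 aP) (proj1 au) xI); ring.
have HHt t : 0 < t < T -> pvr b N r (s_d k r (S t)) <= 1 ->
    nn 0 b (HH b (s_P N r (S t)) (s_u (S t)) (s_ur (S t))) <= CH * nn 0 b (fun x => s_P N r (S t) x - s_u (S t) x).
  move=> tI V1; have [_ bur _ _ _] := s_bm (ws t tI).
  apply: hH => //; [exact: adm_glob|exact: (reg_adm hb rs)|exact: KP|exact: Ku| |].
    by move=> x /andP[/ltW x0 /ltW xb]; apply: (w_ur (ws t tI)); rewrite x0.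
  by move=> x /andP[/ltW x0 /ltW xb]; apply: (w_aa (ws t tI)); rewrite x0.
have tI0 t : 0 < t < T -> 0 <= t <= T by clear; lra.
pose n t := nn 0 b (glob N r (s_d k r (S t))).
have n0 t : 0 <= n t by exact: nn_ge0.
have d0 : nn 0 b (glob N r (s_d k r (S 0))) = 0.
  rewrite (@eq_nn _ 0 b _ (fun x => 0 * x)) ?nnZ ?normr0 ?mul0r//; first exact: bm_id.
  move=> x _; rewrite mul0r /glob /pw big1// => i _.
  by rewrite (initial_error hT rs hm dp tr Ub hini (ltn_ord i)) horner0 mulr0.
have V0 : pvr b N r (s_d k r (S 0)) <= 2^-1.
  apply: (@le_trans _ _ 0); last by [].
  rewrite /pvr (@eq_vr _ b N r _ _ (fun _ _ => 0) (fun _ _ => 0)).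
  - rewrite /vr (@eq_nn _ 0 b _ (fun x => 0 * x)) ?nnZ ?normr0 ?mul0r//; first exact: bm_id.
    move=> x _; rewrite mul0r /pw big1// => i _.
    by rewrite /vard /jmp; case: ifP => _; rewrite subrr mul0r normr0 addr0 mulr0.
  - by move=> i x iN; rewrite (initial_error hT rs hm dp tr Ub hini iN) horner0.
  - by move=> i x iN; rewrite (initial_error hT rs hm dp tr Ub hini iN) deriv0 horner0.
have main t : 0 <= t <= T -> n t <= gronwall_cst T C1 * T * e1.
  apply: (@bootstrap _ b N r hm k.+1 T hT (fun t => s_d k r (S t)) (fun t => s_dd k r (S t))
    (fun t => pvr b N r (s_d k r (S t))) C1 e1 e2 C10 e10 e12 e20) => //.
  - by move=> t' i t'I iN; exact: (d_size u ur ut r tr Ub hC1).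
  - by move=> t' i t'I iN; exact: (dd_size u ur ut r tr Ub hC1 (tI0 _ t'I)).
  - by move=> i j iN; exact: (d_cont rs hm hC1).
  - by move=> t' i j t'I iN; exact: (d_derive rs hm tr Ub hC1).
  - by move=> e e0; exact: (dd_unif hb hT rs hm tr Ub hC1).
  - exact: (pvr_cont hb hT rs hm hC1).
  - move=> s sI V1; have := s_main hb hm (ws s sI) K0 (KP s sI V1) CH0 (HHt s sI V1) hCi.
    rewrite /s_n -/(n s) => /le_trans; apply.
    have [hEt1 _] := hEt s sI; have hE1 := hE s (tI0 _ sI).
    have a1 : (CH + K ^+ 2 * (1 + Ci)) * nn 0 b (s_E k N r (S s)) <= (CH + K ^+ 2 * (1 + Ci)) * e1.
      exact: ler_wpM2l.
    apply: lerD; first by apply: ler_wpM2r; [exact: sqr_ge0|].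
    apply: ler_wpM2r => //.
    have a2 : (1 + (CH + K ^+ 2 * (1 + Ci))) * e1 <= C1 * e1 by apply: ler_wpM2r.
    by apply: le_trans a2; rewrite [leRHS]mulrDl mul1r; exact: lerD.
  - move=> s sI V1; have := s_vr hb hm (ws s sI) K0 (KP s sI V1) CH0 (HHt s sI V1) hCi.
    rewrite /s_n -/(n s) -/Cg => /le_trans; apply.
    have [hEt1 hv] := hEt s sI; have hE1 := hE s (tI0 _ sI).
    set D := nn 0 b (glob N r (s_dd k r (S s))); have D0 : 0 <= D by exact: nn_ge0.
    have a1 : CH * (n s + nn 0 b (s_E k N r (S s))) <= CH * (n s + e1) by apply: ler_wpM2l; [exact: ltW|rewrite lerD2l].
    have HD : 0 <= CH * D by apply: mulr_ge0 => //; exact: ltW.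
    have He : 0 <= CH * e2 by apply: mulr_ge0; exact: ltW.
    have ns := n0 s.
    apply: (@le_trans _ _ (Cg * ((1 + CH) * (D + n s + e1 + e2)))).
      apply: ler_wpM2l => //.
      by move: a1 hEt1 hv HD He ns D0 (ltW CH0); clear; lra.
    rewrite mulrA; apply: ler_wpM2r => //.
    by move: D0 ns e10 (ltW e20); clear; lra.
  - move=> s t' s0' st tT V1 V2 ne.
    have sI : 0 < s < T by rewrite s0' (le_lt_trans st tT).
    have tI : 0 < t' < T by rewrite (lt_le_trans s0' st).
    have hE1 := hE s (tI0 _ sI); have [_ hv] := hEt s sI.
    have [i1 i2 i3] := hinc s t' s0' st tT.
    have [g1 _] := reg_gd rs s0' st tT.
    have E0 := nn_ge0 0 b (s_E k N r (S s)).
    have [bu bur but _ _] := s_bm (ws s sI); have [bu' bur' but' _ _] := s_bm (ws t' tI).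
    have ts0 : 0 <= t' - s by rewrite subr_ge0.
    have Cts : 0 <= C * (t' - s) by exact: mulr_ge0.
    have supts f : bm 0 b f -> (forall x, 0 <= x <= b -> `|f x| <= C * (t' - s)) ->
        nn 0 b f <= M * (t' - s).
      move=> bf fC; apply: le_trans (sup f _ Cts bf fC) _.
      by rewrite mulrAC; apply: ler_wpM2r.
    have j1 : nn 0 b (fun x => s_u (S t') x - s_u (S s) x) <= M * (t' - s).
      apply: supts; first exact: bmB.
      by move=> x xI; apply: (reg_time rs) => //; exact: ltW.
    have j2 : nn 0 b (aa (fun x => s_u (S t') x - s_u (S s) x)) <= M * (t' - s).
      apply: supts; first by case: (admB (reg_adm hb rs tI) (reg_adm hb rs sI)).
      by move=> x xI; rewrite (aaB bu' bu xI); apply: (reg_aa rs).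
    have j3 : nn 0 b (fun x => s_ur (S t') x - s_ur (S s) x) <= M * (t' - s).
      apply: supts; first exact: bmB.
      by case: g1 => g1 _ _ _ x xI; have [_ _] := g1 x xI.
    have nE : s_n k b N r (S s) + nn 0 b (s_E k N r (S s)) <= 1.
      rewrite /s_n -/(n s); apply: le_trans ne; rewrite lerD2l; exact: le_trans hE1 e12.
    have e2I : 0 <= e2 <= 1 by rewrite e21 ltW.
    have := hd N r (S s) (S t') (t' - s) e2 hm hCi (ws s sI) (ws t' tI) ts0 e2I (KP s sI V1) (KP t' tI V2)
      (Ku s sI) (Ku t' tI) j1 j2 j3 i1 i2 i3 hv V1 nE.
    rewrite /s_n -/(n s); set nd := nn 0 b (glob N r (s_delta k r (S s) (S t'))).
    have nd0 : 0 <= nd by exact: nn_ge0.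
    move=> /le_trans; apply; apply: lerD.
      by apply: ler_wpM2r; [exact: sqr_ge0|].
    apply: ler_wpM2r => //; set V := pvr b N r _.
    have v0 : 0 <= V by exact: vr_ge0.
    have ns := n0 s.
    apply: (@le_trans _ _ (Cd * ((t' - s) * (2 * (e2 + V + n s))))).
      apply: ler_wpM2l; first exact: ltW.
      by apply: ler_wpM2l => //; move: v0 ns hE1 e12; clear; lra.
    rewrite (_ : Cd * _ = (2 * Cd) * ((t' - s) * (e2 + V + n s))); last by ring.
    by apply: ler_wpM2r => //; apply: mulr_ge0 => //; move: v0 ns (ltW e20); clear; lra.
move=> t tI.
have bu : bm 0 b (u t) by apply: cb_bm; exact: (reg_cb_u rs).
have bE : bm 0 b (s_E k N r (S t)) by apply: bmB => //; exact: bm_glob.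
rewrite (@eq_nn _ 0 b _ (fun x => s_E k N r (S t) x - glob N r (s_d k r (S t)) x)).
  apply: le_trans (nnB bE (bm_glob _ _ _ _)) _.
  by move: (main t tI) (hE t tI); rewrite /n /e1; clear; lra.
by move=> x _; have := s_Pu k N r (S t) x; rewrite /s_P /=; move: (s_E _ _ _ _ _) (glob _ _ _ _) => y z; clear; lra.
Qed.

Lemma broken_errorE {R : realType} (b : R) (N : nat) (r : nat -> R) f p : is_mesh b N r ->
  bm 0 b f -> broken_error N r f p = nn 0 b (fun x => f x - glob N r p x).
Proof.
move=> hm bf; have bd : bm 0 b (fun x => f x - glob N r p x) by apply: bmB => //; exact: bm_glob.
rewrite -[RHS]ger0_norm ?nn_ge0// -sqrtr_sqr (nn_cells hm bd); congr Num.sqrt.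
apply: eq_bigr => -[i iN] _ /=; rewrite nn_sqr.
have bq : bm 0 b (fun x => (f x - (p i).[x]) ^+ 2) by apply/bmX/bmB => //; exact: bm_poly.
rewrite itg_oo; last exact/bm_ig/(bm_cell hm iN).
apply: eq_itg_oo; [exact/bm_ig/(bm_cell hm iN)|exact/bm_ig/(bm_cell hm iN)/bmX|].
by move=> x xI; rewrite (globE hm _ iN)//; lra.
Qed.

Theorem theorem4p4 (R : realType) (k : nat) (hk : (1 <= k)%N)
  (b T : R) (hb : 0 < b) (hT : 0 < T)
  (Ub : R -> R) (u w g z : R -> R -> R)
  (hexact : exact_solution b T Ub u w g z)
  (hu : Linfty_Bochner T (W_norm 0 b k.+1 +oo%E) u)
  (hut : Linfty_Bochner T (W_norm 0 b k.+1 2%:E) (time_derivative u)) :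
  exists h0 C : R, [/\ 0 < h0, 0 < C &
    forall (N : nat) (r : nat -> R) (u_h : R -> nat -> {poly R})
      (tr : R -> traces R),
      is_mesh b N r -> mesh_size N r <= h0 ->
      hdg_solution k T Ub N r u_h tr ->
      (forall i, (i < N)%N -> Gauss_Radau k (r i) (r i.+1) (u 0) (u_h 0 i)) ->
      (ereal_sup [set (broken_error N r (u t) (u_h t))%:E | t in `[0%R, T]]
        <= (C * mesh_size N r ^+ k.+1)%:E)%E].
Proof.
have [C rs] := exact_regular hk hb hT hexact hu hut.
have [h0 [A [h00 A0 hA]]] := semidiscrete_error hk hb hT rs.
exists h0, A; split=> // N r u_h tr hm hh [du_h [hC1 hs]] hini.
apply: ge_ereal_sup => _ [t /= tI <-]; rewrite lee_fin.
have tI' : 0 <= t <= T by move: tI; rewrite in_itv.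
have bu : bm 0 b (u t) by apply: cb_bm; exact: (reg_cb_u rs).
rewrite (broken_errorE _ hm bu).
apply: (hA N r u_h du_h tr Ub) => // s sI.
by have [|->] := exact_outer hexact (t := s); rewrite ?in_itv.
Qed.
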